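(* Let $1\leq q_1,q_2\leq \infty$ and $0<r<\infty$ with $\frac{1}r =\frac 1 {q_1}+\frac 1 {q_2}$. Suppose that $a\in S^{m}_{\varrho,\delta}(n,2)$ with $0<\varrho,\delta\leq 1$, $\delta<1$, and \[ m<n(\varrho-1)\left[\max\left(\left|\frac{1}{2}-\frac{1}{q_1}\right|,\left|\frac{1}{2}-\frac{1}{q_2}\right|\right)+\frac{1}{\min(2,q_1,q_2)}\right]+\frac{n\min(\varrho-\delta,0)}{2}. \] Then the bilinear pseudodifferential operator $T_{a} (f,g)(x)= \iint a(x,\xi,\eta)\, e^{ i \langle x,\xi+\eta\rangle} \widehat{ f}(\xi) \widehat{g}(\eta)\,d \xi\, d\eta$ satisfies $\|T_a(f,g)\|_{L^r}\lesssim \|f\|_{L^{q_1}}\|g\|_{L^{q_2}}$ for $f,g\in\mathcal{S}$.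
   Context: $S^m_{\varrho,\delta}(n,2)$: functions $a\in C^\infty(\mathbb{R}^n\times\mathbb{R}^{2n})$ with $|\partial_x^\beta\partial_{\xi}^{\alpha_1}\partial_{\eta}^{\alpha_2}a(x,\xi,\eta)|\le C_{\alpha_1,\alpha_2,\beta}(1+|\xi|+|\eta|)^{m-\varrho(|\alpha_1|+|\alpha_2|)+\delta|\beta|}$ for all multi-indices. *)

(* Defs.v *)
From HB Require Import structures.
From mathcomp Require Import all_boot all_order all_algebra.
From mathcomp Require Import all_classical all_reals all_analysis.
From mathcomp Require Import complex.

Set Implicit Arguments.
Unset Strict Implicit.
Unset Printing Implicit Defensive.
Import Order.TTheory GRing.Theory Num.Theory.
Import numFieldNormedType.Exports.
Local Open Scope ring_scope.
Local Open Scope complex_scope.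

Section Defs.
Variable R : realType.

Local Notation C := (R[i]).
Local Notation V n := ('rV[R]_n).
Local Notation Re := (@complex.Re R).
Local Notation Im := (@complex.Im R).

Definition cmod (z : C) : R := Num.sqrt (Re z ^+ 2 + Im z ^+ 2).

Definition dotp n (x y : V n) : R := \sum_(i < n) x 0 i * y 0 i.
Definition enorm n (x : V n) : R := Num.sqrt (dotp x x).

Definition cD (W : normedModType R) (v : W) (f : W -> C) : W -> C :=
  fun x => ('D_v (fun y => Re (f y)) x) +i* ('D_v (fun y => Im (f y)) x).

Fixpoint cDs (W : normedModType R) (vs : seq W) (f : W -> C) : W -> C :=
  match vs with
  | [::] => f
  | v :: vs' => cD v (cDs vs' f)
  end.

Definition smooth (W : normedModType R) (f : W -> C) : Prop :=
  forall vs : seq W,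
    continuous (fun y => Re (cDs vs f y)) /\
    continuous (fun y => Im (cDs vs f y)) /\
    forall (v x : W), derivable (fun y => Re (cDs vs f y)) x v /\
                      derivable (fun y => Im (cDs vs f y)) x v.

Definition mindex n := 'I_n -> nat.
Definition mabs n (al : mindex n) : nat := (\sum_(i < n) al i)%N.
(* list of directions realising  d^alpha  (e_i repeated alpha_i times),
   with e_i embedded into W by emb *)
Definition mdirs (W : Type) n (emb : 'I_n -> W) (al : mindex n) : seq W :=
  flatten [seq nseq (al i) (emb i) | i <- enum 'I_n].
Definition ebasis n (i : 'I_n) : V n := delta_mx 0 i.
Definition mpow n (x : V n) (al : mindex n) : R := \prod_(i < n) x 0 i ^+ al i.

Definition Wx n (i : 'I_n) : V n * V n * V n := (ebasis i, 0, 0).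
Definition Wxi n (i : 'I_n) : V n * V n * V n := (0, ebasis i, 0).
Definition Weta n (i : 'I_n) : V n * V n * V n := (0, 0, ebasis i).

Definition bilinear_symbol n (m rho delta : R) (a : V n * V n * V n -> C) : Prop :=
  smooth a /\
  forall (al1 al2 be : mindex n), exists Cst : R,
    forall (x xi eta : V n),
      cmod (cDs (mdirs (@Wx n) be ++ mdirs (@Wxi n) al1 ++ mdirs (@Weta n) al2) a
              (x, xi, eta))
      <= Cst * (1 + enorm xi + enorm eta) `^
               (m - rho * (mabs al1 + mabs al2)%:R + delta * (mabs be)%:R).

Definition schwartz n (f : V n -> C) : Prop :=
  smooth f /\
  forall al be : mindex n, exists Cst : R, forall x : V n,
    cmod ((mpow x al)%:C * cDs (mdirs (@ebasis n) be) f x) <= Cst.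

(* Integral with respect to Lebesgue measure on R^n, computed as the iterated
   one-dimensional Lebesgue integral over the coordinates (Tonelli/Fubini).
   A point of R^(n+1) is written  row_mx [t] v  with t : R, v : R^n. *)
Fixpoint iint (n : nat) : (V n -> \bar R) -> \bar R :=
  match n return (V n -> \bar R) -> \bar R with
  | 0 => fun f => f 0
  | n'.+1 => fun f =>
      (\int[@lebesgue_measure R]_t iint (fun v : V n' => f (row_mx (\row_(_ < 1) t) v)))%E
  end.

Definition rint n (h : V n -> R) : R := fine (iint (fun x => (h x)%:E)).
Definition cint n (h : V n -> C) : C :=
  rint (fun x => Re (h x)) +i* rint (fun x => Im (h x)).

Definition cexpi (t : R) : C := cos t +i* sin t.

Definition fourier n (f : V n -> C) : V n -> C :=
  fun xi => cint (fun x => cexpi (- dotp x xi) * f x).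

Definition bipsido n (a : V n * V n * V n -> C) (f g : V n -> C) : V n -> C :=
  fun x => cint (fun eta => cint (fun xi =>
     a (x, xi, eta) * cexpi (dotp x (xi + eta)) * fourier f xi * fourier g eta)).

Definition lebn n (A : set (V n)) : \bar R := iint (fun x => (\1_A x)%:E).

Definition esssup_norm n (h : V n -> C) : \bar R :=
  ereal_inf [set M : \bar R | (0 <= M)%E /\
                              lebn [set x | (M < (cmod (h x))%:E)%E] = 0%E].

Definition Lpnorm n (p : \bar R) (h : V n -> C) : \bar R :=
  match p with
  | +oo%E => esssup_norm h
  | (p'%:E)%E => ((iint (fun x => ((cmod (h x)) `^ p')%:E)) `^ p'^-1)%E
  | -oo%E => 0%E
  end.

Definition qinv (q : \bar R) : R :=
  match q with
  | +oo%E => 0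
  | (q'%:E)%E => q'^-1
  | -oo%E => 0
  end.

End Defs.

(* Main.v *)
Require Import Defs.
From HB Require Import structures.
From mathcomp Require Import all_boot all_order all_algebra.
From mathcomp Require Import all_classical all_reals all_analysis.
From mathcomp Require Import measurable_realfun complex ring lra.
Set Implicit Arguments.
Unset Strict Implicit.
Unset Printing Implicit Defensive.
Import Order.TTheory GRing.Theory Num.Theory.
Import numFieldNormedType.Exports.
Local Open Scope classical_set_scope.
Local Open Scope ring_scope.

(** Idea of the proof.  Cut the symbol into pieces a_j living at frequency
    |xi| + |eta| ~ s = 2^j and localise each of them in x to a ball of radius
    s^(-delta) about a centre u (after replacing delta by max(rho, delta)).  For
    such a piece, a T T* argument in (x, xi), integration by parts in x and the
    Schur test bound the L^2 norm of the bilinear operator by the product of the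
    L^2 norms of f^ and g^ on |xi| <~ s, with constant s^(m + n/2); the sup norm is
    bounded in the same way with s^(m + n).  Integrations by parts in xi and eta
    localise f and g to balls of radius s^(-rho) about u; by a threshold argument
    the frequency-localised L^2 norm of a localised function is then controlled by
    its L^q norm.  Interpolating between the L^2 and the sup bounds gives an L^r
    bound over the ball, and averaging over u gives one over R^n with constant
    s^(-epsilon), where the hypothesis on m yields epsilon > 0.  The pieces are
    summed geometrically and Fatou's lemma removes the truncation.  All integrals
    are taken of continuous functions dominated by omega(x) = prod (1 + x_i^2)^(-1),
    for which iterated integration, Fubini and differentiation need no measure
    theory on R^n. *)

(** * Integration on the line *)

(** Enlarging [delta] to [d = max(rho, delta)] is forced by the localisation of the inputs:
    integrating by parts in frequency multiplies the symbol by coordinates of x at scale [s^rho],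
    and these respect the class only if [s^rho <= s^d]. The input balls then have volume
    [s^(-rho n)] and the output balls [s^(-d n)]; this mismatch is the origin of the term
    [min(rho - delta, 0)] in the hypothesis. The L^r bounds are drawn from L^2 and sup bounds by
    numerical inequalities at a well chosen threshold, and they control the r-th power by a sum, not
    a product, of powers of the inputs: a sum can be averaged over the centre by Fubini alone. The
    product of norms is recovered at the end by homogeneity. Only finitely many derivatives are ever
    taken, two per coordinate of x, xi and eta. The cutoffs can therefore be rational functions with
    polynomial tails, and a calculus of weights takes the place of support conditions. *)

Section LineIntegral.
Context {R : realType}.
Local Notation mu := (@lebesgue_measure R).

(** The integral of a nonnegative function is a supremum over the simple functions below it, which
    is monotone for arbitrary functions. *)
Lemma integral_ge0_mono (f g : R -> \bar R) :
  (forall x, (0 <= f x)%E) -> (forall x, (f x <= g x)%E) ->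
  (\int[mu]_x f x <= \int[mu]_x g x)%E.
Proof.
move=> f0 fg; rewrite !ge0_integralTE//; last by move=> x; exact: le_trans (fg x).
apply: le_ereal_sup => _ [h hf <-]; exists h => //= x.
exact: le_trans (hf x) (fg x).
Qed.

(** Its primitive is [atan], so its integral is explicit, and as the inverse of a polynomial it is
    handled by the product and quotient rules. *)
Definition lweight (t : R) : R := (1 + t ^+ 2)^-1.

Lemma lweight_gt0 t : 0 < lweight t.
Proof. by rewrite invr_gt0 ltr_wpDr ?sqr_ge0. Qed.

Lemma lweight_le1 t : lweight t <= 1.
Proof. by rewrite invf_le1 ?lerDl ?sqr_ge0// ltr_wpDr ?sqr_ge0. Qed.

Lemma continuous_inv (T : topologicalType) (f : T -> R) :
  (forall x, f x != 0) -> continuous f -> continuous (fun x => (f x)^-1).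
Proof. by move=> f0 cf x; apply: cvgV => //; exact: cf. Qed.

Lemma continuous_lweight : continuous lweight.
Proof.
apply: continuous_inv; first by move=> x; rewrite gt_eqF// ltr_wpDr ?sqr_ge0.
by move=> x; apply: cvgD; [exact: cvg_cst|exact: exprn_continuous].
Qed.

Lemma derivable_continuous (F : R -> R) :
  (forall x : R, derivable F x 1) -> continuous F.
Proof.
by move=> dF x; apply: differentiable_continuous; apply/derivable1_diffP.
Qed.

Lemma FTC_sym (F f : R -> R) (n : R) : 0 < n ->
  (forall x : R, is_derive x 1 F (f x)) -> continuous f ->
  (\int[mu]_(x in `[(- n)%R, n%R]) (f x)%:E = (F n - F (- n))%:E)%E.
Proof.
move=> n0 dF cf.
have dF' x : derivable F x 1 by case: (dF x).
have cF := derivable_continuous dF'.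
rewrite (@continuous_FTC2 _ f F) ?EFinB//.
- by rewrite gtrN.
- exact/continuous_subspaceT.
- split=> [x _ //||]; [apply: cvg_at_right_filter|apply: cvg_at_left_filter]; exact: cF.
- by move=> x _; rewrite derive1E; case: (dF x).
Qed.

Definition truncE (f : R -> R) (n : R) : R -> \bar R :=
  (EFin \o f) \_ `[- n, n].

Lemma cvg_restrict_sym (f : R -> R) x :
  truncE f n.+1%:R x @[n --> \oo] --> (f x)%:E.
Proof.
apply: cvg_near_cst; near=> n; rewrite /truncE patchE mem_set//= in_itv/=.
rewrite -ler_norml.
have : `|x| <= n%:R by near: n; exact: nbhs_infty_ger.
by move=> /le_trans; apply; rewrite ler_nat.
Unshelve. all: by end_near. Qed.

Lemma measurable_restrict_sym (f : R -> R) (n : R) : continuous f ->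
  measurable_fun setT (truncE f n).
Proof.
move=> cf; apply/(measurable_restrictT _ _).1 => //.
apply: measurable_funTS; apply/measurable_EFinP.
exact: continuous_measurable_fun.
Qed.

(** On a symmetric interval the fundamental theorem of calculus bounds the integral by [2 * B];
    Fatou's lemma passes to the line, so that integrability is a conclusion. *)
Lemma integral_derivative_le (F f : R -> R) (B : R) :
  (forall x : R, is_derive x 1 F (f x)) -> continuous f ->
  (forall x, 0 <= f x) -> (forall x, `|F x| <= B) ->
  (\int[mu]_x (f x)%:E <= (2 * B)%:E)%E.
Proof.
move=> dF cf f0 FB.
pose g n : R -> \bar R := truncE f n.+1%:R.
have g0 n x : (0 <= g n x)%E by apply: erestrict_ge0 => y _; rewrite lee_fin.
have mg n : measurable_fun setT (g n) by exact: measurable_restrict_sym.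
have gE : (fun x => (f x)%:E) = (fun x => limn_einf (g^~ x)).
  apply/funext => x; have h := @cvg_restrict_sym f x.
  by rewrite is_cvg_limn_einfE ?(cvg_lim _ h)//; apply/cvg_ex; eexists; exact: h.
rewrite gE (le_trans (fatou mu measurableT mg (fun n x _ => g0 n x)))//.
rewrite limn_einf_lim.
apply: lime_le; first exact: is_cvg_einfs.
near=> n; rewrite /einfs; apply: ereal_inf_le => /=.
exists (\int[mu]_x g n x)%E; first by exists n => //=.
rewrite /g /truncE -integral_mkcond (FTC_sym _ dF)// lee_fin.
rewrite mulrDl mul1r lerD//; first exact: le_trans (ler_norm _) (FB _).
by rewrite (le_trans (ler_norm _))// normrN.
Unshelve. all: by end_near. Qed.

Lemma integral_lweight_le : (\int[mu]_x (lweight x)%:E <= pi%:E)%E.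
Proof.
have -> : pi = 2 * (pi / 2) :> R by rewrite mulrC divfK.
apply: (@integral_derivative_le atan).
- exact: continuous_lweight.
- by move=> x; exact: ltW (lweight_gt0 x).
- by move=> x; rewrite ler_norml (ltW (atan_gtNpi2 x)) (ltW (atan_ltpi2 x)).
Qed.

Lemma continuous_measurable_EFin (h : R -> R) :
  continuous h -> measurable_fun setT (EFin \o h).
Proof. by move=> ch; apply/measurable_EFinP; exact: continuous_measurable_fun. Qed.

Lemma integrable_lweight : mu.-integrable setT (EFin \o lweight).
Proof.
apply/integrableP; split.
  by apply: continuous_measurable_EFin; exact: continuous_lweight.
under eq_integral => x _ do
  rewrite /= ger0_norm ?(ltW (lweight_gt0 x))//.
by rewrite (le_lt_trans integral_lweight_le)// ltry.
Qed.

Lemma integrable_dom (h : R -> R) C : continuous h ->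
  (forall t, `|h t| <= C * lweight t) -> mu.-integrable setT (EFin \o h).
Proof.
move=> ch hC.
have := integrableZl measurableT C integrable_lweight.
apply: le_integrable => //; first exact: continuous_measurable_EFin.
move=> x _; rewrite -EFinM !abse_EFin lee_fin (le_trans (hC x))//.
by rewrite ler_norm.
Qed.

Lemma cvg_lweight : lweight n.+1%:R @[n --> \oo] --> (0 : R).
Proof.
apply: (@squeeze_cvgr _ _ _ _ (fun=> 0) harmonic).
- near=> n; rewrite (ltW (lweight_gt0 _))/= lef_pV2 ?posrE ?ltr0n//.
    rewrite (@le_trans _ _ (n.+1%:R ^+ 2))// ?lerDr//.
    by rewrite expr2 ler_peMr// ler1n.
- exact: cvg_cst.
- exact: cvg_harmonic.
Unshelve. all: by end_near. Qed.

(** The truncated integrals converge by domination, and they equal boundary terms that decay like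
    [lweight n.+1%:R]. *)
Lemma integral_derivative_eq0 (F f : R -> R) (C : R) :
  (forall x : R, is_derive x 1 F (f x)) -> continuous f ->
  (forall x, `|f x| <= C * lweight x) -> (forall x, `|F x| <= C * lweight x) ->
  (\int[mu]_x (f x)%:E = 0)%E.
Proof.
move=> dF cf fC FC.
have lim1 : (\int[mu]_x truncE f n.+1%:R x)%E @[n --> \oo] --> (\int[mu]_x (f x)%:E)%E.
  have iC := integrableZl measurableT C integrable_lweight.
  apply: (dominated_cvg measurableT _ _ _ iC) => //.
  - by move=> n; exact: measurable_restrict_sym.
  - by move=> x _; exact: cvg_restrict_sym.
  - move=> n x _; rewrite /truncE patchE; case: ifPn => _ /=.
      by rewrite -EFinM lee_fin.
    by rewrite normr0 -EFinM lee_fin (le_trans _ (fC x)).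
suff lim2 : (\int[mu]_x truncE f n.+1%:R x)%E @[n --> \oo] --> (0%:E : \bar R).
  by apply: cvg_unique lim1 lim2; exact: ereal_hausdorff.
apply: cvg_EFin.
  near=> n; rewrite /truncE -integral_mkcond (FTC_sym _ dF)//.
apply/cvgr0Pnorm_le => e e0; near=> n.
rewrite /= /truncE -integral_mkcond (FTC_sym _ dF)//=.
rewrite (le_trans (ler_normB _ _))// (le_trans (lerD (FC _) (FC _)))//.
rewrite /lweight sqrrN -/(lweight _) -mulrDl.
rewrite (le_trans (ler_norm _))//; near: n.
have /cvgr0Pnorm_le : (C + C) * lweight n.+1%:R @[n --> \oo] --> (0 : R).
  by rewrite -[X in _ --> X](mulr0 (C + C)); apply: cvgM; [exact: cvg_cst|exact: cvg_lweight].
by move=> /(_ _ e0).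
Unshelve. all: by end_near. Qed.

(** Dominated convergence speaks of sequences, so continuity of parameter integrals is tested on
    them: a failure at [x] provides a bad point in each ball of radius [1 / (n + 1)]. *)
Lemma seq_continuous_at (T : pseudoMetricType R) (f : T -> R) (x : T) :
  (forall u : nat -> T, u n @[n --> \oo] --> x -> f (u n) @[n --> \oo] --> f x) ->
  {for x, continuous f}.
Proof.
move=> H; apply: contrapT => nc.
have [e e0 He] : exists2 e : R, 0 < e &
    forall n : nat, exists y, ball x n.+1%:R^-1 y /\ e <= `|f x - f y|.
  apply: contrapT => ne; apply: nc; apply/cvgrPdist_lt => e e0.
  have /existsNP[n hn] : ~ forall n : nat, exists y, ball x n.+1%:R^-1 y /\ e <= `|f x - f y|.
    by move=> h; apply: ne; exists e.
  apply/nbhs_ballP; exists n.+1%:R^-1 => /=; first by rewrite invr_gt0.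
  move=> y xy; rewrite ltNge; apply/negP => ey; apply: hn; by exists y.
have [u hu] := choice He.
have ux : u n @[n --> \oo] --> x.
  apply/cvg_ballP => d d0; near=> n.
  have := (hu n).1; apply: le_ball.
  rewrite -[leRHS]invrK lef_pV2 ?posrE ?invr_gt0//.
  rewrite (@le_trans _ _ n%:R) ?ler_nat//.
  by near: n; exact: nbhs_infty_ger.
have /cvgrPdist_lt/(_ _ e0)[N _ /(_ N (leqnn N))] := H u ux.
by rewrite ltNge => /negP; apply; exact: (hu N).2.
Unshelve. all: by end_near. Qed.

Lemma continuous_pairing (T A B U : topologicalType) (f : T -> A) (g : T -> B)
    (h : A * B -> U) :
  continuous f -> continuous g -> continuous h -> continuous (fun t => h (f t, g t)).
Proof.
move=> cf cg ch t; apply: (cvg_comp (fun t => (f t, g t)) h _ (ch (f t, g t))).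
by apply: cvg_pair; [exact: cf|exact: cg].
Qed.

Lemma continuous_idT (T : topologicalType) : continuous (fun x : T => x).
Proof. by move=> x; exact: cvg_id. Qed.

Lemma continuous_cstT (T U : topologicalType) (c : U) : continuous (fun _ : T => c).
Proof. by move=> x; exact: cvg_cst. Qed.

Lemma continuous_pair (T A B : topologicalType) (f : T -> A) (g : T -> B) :
  continuous f -> continuous g -> continuous (fun t => (f t, g t)).
Proof.
by move=> cf cg; apply: (continuous_pairing (h := fun z => z) cf cg) => z; exact: cvg_id.
Qed.

Lemma continuous_fstT (T A B : topologicalType) (f : T -> A * B) :
  continuous f -> continuous (fun t => (f t).1).
Proof. by move=> cf t; apply: (cvg_comp f fst (cf t)); exact: cvg_fst. Qed.

Lemma continuous_sndT (T A B : topologicalType) (f : T -> A * B) :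
  continuous f -> continuous (fun t => (f t).2).
Proof. by move=> cf t; apply: (cvg_comp f snd (cf t)); exact: cvg_snd. Qed.

Lemma continuous_param_integral (T : pseudoMetricType R) (h : T -> R -> R) C :
  continuous (fun p : T * R => h p.1 p.2) ->
  (forall t x, `|h t x| <= C * lweight x) ->
  continuous (fun t => \int[mu]_x h t x).
Proof.
move=> ch hC t.
have chx s : continuous (h s).
  exact: (continuous_pairing (fun=> cvg_cst _) (fun=> cvg_id) ch).
apply: seq_continuous_at => u ut.
apply: fine_cvg; rewrite fineK; last first.
  by apply: integrable_fin_num => //; exact: (integrable_dom _ (hC t)).
have iC := integrableZl measurableT C integrable_lweight.
apply: (dominated_cvg measurableT _ _ _ iC) => //.
- by move=> n; exact: continuous_measurable_EFin.
- move=> x _; apply: cvg_EFin; first by near=> n.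
  have cx : continuous (fun s => h s (x : R)).
    exact: (continuous_pairing (fun=> cvg_id) (fun=> cvg_cst _) ch).
  exact: (cvg_comp u (h^~ x) ut (cx t)).
- by move=> n x _; rewrite /= -EFinM lee_fin.
Unshelve. all: by end_near. Qed.

(** The sigma-algebra on the plane is the product one, so an open set has to be written as a
    countable union of measurable rectangles, here squares with rational centre and radius. *)
Lemma measurable_continuous2 (h : R * R -> R) :
  continuous h -> measurable_fun setT h.
Proof.
move=> ch; apply: (measurability _ (RGenOpens.measurableE R)).
move=> _ [_ [a [b ->] <-]]; rewrite setTI.
have oU : open (h @^-1` `]a, b[).
  by move/continuousP: ch; apply; exact: interval_open.
set U := h @^-1` _ in oU *.
(* Squares that are not contained in [U] are replaced by the empty set, so that the union may range
   over all rational triples. *)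
pose Q (p q e : rat) : set (R * R) :=
  if `[< ball (ratr p : R) (ratr e) `*` ball (ratr q : R) (ratr e) `<=` U >]
  then ball (ratr p : R) (ratr e) `*` ball (ratr q : R) (ratr e) else set0.
have -> : U = \bigcup_p \bigcup_q \bigcup_e Q p q e.
  apply/seteqP; split; last first.
    by move=> z [p _ [q _ [e _]]]; rewrite /Q; case: asboolP => // + ?; exact.
  move=> [x y] Uxy.
  have /nbhs_ballP[d /= d0 dU] := open_nbhs_nbhs (conj oU Uxy).
  (* A square of radius [ratr e < d / 4] that contains the point has all its points within
     [2 * ratr e < d] of it. *)
  have d40 : 0 < d / 4 by rewrite divr_gt0.
  have [e] := rat_in_itvoo d40; rewrite in_itv/= => /andP[e0 ed].
  have approx (z : R) : exists p : rat, `|ratr p - z| < ratr e.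
    have [|p] := @rat_in_itvoo R (z - ratr e) (z + ratr e); first by lra.
    by rewrite in_itv/= => zp; exists p; rewrite ltr_distl.
  have [p px] := approx x; have [q qy] := approx y.
  exists p => //; exists q => //; exists e => //; rewrite /Q.
  case: asboolP => [_|]; first by split.
  case=> -[x' y'] [/= px' qy']; apply: dU; split => /=; rewrite /ball/= in px' qy' *.
    by move: px px'; rewrite -[x - x'](subrKA (ratr p)) => px px'; rewrite (le_lt_trans (ler_normD _ _))// distrC; lra.
  by move: qy qy'; rewrite -[y - y'](subrKA (ratr q)) => qy qy'; rewrite (le_lt_trans (ler_normD _ _))// distrC; lra.
do 3 apply: bigcupT_measurable_rat => ?; rewrite /Q; case: ifPn => // _.
by apply: measurableX; exact: measurable_ball.
Qed.

Lemma Rintegral_ext (f g : R -> R) : f =1 g -> \int[mu]_x f x = \int[mu]_x g x.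
Proof. by move=> fg; congr fine; apply: eq_integral => x _; rewrite fg. Qed.

Lemma integral_dom_EFin (h : R -> R) C : continuous h ->
  (forall t, `|h t| <= C * lweight t) ->
  (\int[mu]_x (h x)%:E = (\int[mu]_x h x)%:E)%E.
Proof.
move=> ch hC; rewrite /Rintegral fineK//.
by apply: integrable_fin_num => //; exact: integrable_dom hC.
Qed.

Lemma Rintegral_normr_le (h : R -> R) C : continuous h ->
  (forall t, `|h t| <= C * lweight t) -> `|\int[mu]_x h x| <= C * pi.
Proof.
move=> ch hC; have C0 : 0 <= C.
  by have := le_trans (normr_ge0 _) (hC 0); rewrite pmulr_lge0// lweight_gt0.
have ih := integrable_dom ch hC.
rewrite (le_trans (le_normr_Rintegral _ ih))//.
rewrite -lee_fin EFinM fineK; last first.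
  apply: integrable_fin_num => //; apply: (@integrable_dom _ C).
    by move=> x; apply: continuous_comp; [exact: ch|exact: norm_continuous].
  by move=> x; rewrite normr_id.
rewrite (@le_trans _ _ (\int[mu]_x (C%:E * (lweight x)%:E))%E)//.
  by apply: integral_ge0_mono => x; rewrite ?lee_fin// -EFinM lee_fin.
rewrite ge0_integralZl//=; last 2 first.
- by apply: continuous_measurable_EFin; exact: continuous_lweight.
- by move=> x _; rewrite lee_fin ltW ?lweight_gt0.
by rewrite lee_wpmul2l ?lee_fin//; exact: integral_lweight_le.
Qed.

Lemma Fubini_line (h : R -> R -> R) C :
  continuous (fun p : R * R => h p.1 p.2) ->
  (forall x y, `|h x y| <= C * lweight x * lweight y) ->
  \int[mu]_x \int[mu]_y h x y = \int[mu]_y \int[mu]_x h x y.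
Proof.
move=> ch hC.
have C0 : 0 <= C.
  have := le_trans (normr_ge0 _) (hC 0 0).
  by rewrite -mulrA pmulr_lge0// mulr_gt0// lweight_gt0.
have cx x : continuous (h x).
  exact: (continuous_pairing (fun=> cvg_cst _) (fun=> cvg_id) ch).
have cy y : continuous (h^~ y).
  exact: (continuous_pairing (fun=> cvg_id) (fun=> cvg_cst _) ch).
have FX x : (\int[mu]_y (h x y)%:E)%E = (\int[mu]_y h x y)%:E.
  exact: (integral_dom_EFin _ (hC x)).
have FY y : (\int[mu]_x (h x y)%:E)%E = (\int[mu]_x h x y)%:E.
  by apply: (@integral_dom_EFin _ (C * lweight y)) => // x; rewrite mulrAC.
congr fine.
under eq_integral do rewrite -FX.
under [RHS]eq_integral do rewrite -FY.
apply: (@Fubini _ _ _ _ _ mu mu (fun p => (h p.1 p.2)%:E)).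
have mh : measurable_fun setT (fun p : R * R => (h p.1 p.2)%:E).
  by apply/measurable_EFinP; exact: measurable_continuous2.
apply/(integrable12ltyP mu mu mh).
apply: (@le_lt_trans _ _ (\int[mu]_x (C * pi * lweight x)%:E)%E).
  apply: integral_ge0_mono => x; first exact: integral_ge0.
  have cn : continuous (fun y => `|h x y|).
    by move=> y; apply: continuous_comp; [exact: cx|exact: norm_continuous].
  have hn y : `| `|h x y| | <= C * lweight x * lweight y by rewrite normr_id.
  rewrite (integral_dom_EFin cn hn) lee_fin (le_trans (ler_norm _))//.
  by rewrite (le_trans (Rintegral_normr_le cn hn))// mulrAC.
under eq_integral do rewrite EFinM.
have := integrableZl measurableT (C * pi) integrable_lweight.
by move=> /integrable_fin_num; rewrite fin_numE ltey => /(_ measurableT)/andP[].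
Qed.

End LineIntegral.

Ltac cont_proj := repeat lazymatch goal with
  | |- continuous (fun t => t) => exact: continuous_idT
  | |- continuous (fun t => (@?a t, @?b t)) => apply: continuous_pair
  | |- continuous (fun t => (@?a t).1) => apply: continuous_fstT
  | |- continuous (fun t => (@?a t).2) => apply: continuous_sndT
  | |- continuous fst => apply: (continuous_fstT (f := fun t => t))
  | |- continuous snd => apply: (continuous_sndT (f := fun t => t))
  | |- continuous (fun t => _) => exact: continuous_cstT
  end.

(** * Iterated integrals of functions dominated by [omega] *)

Section SpaceIntegral.
Context {R : realType}.
Local Notation mu := (@lebesgue_measure R).
Local Notation V n := ('rV[R]_n).

(** A tensor product and not a radial weight: setting one coordinate apart factors it, so domination
    by [omega] passes to slices and to partial integrals. *)
Definition omega n (x : V n) : R := \prod_(i < n) lweight (x 0 i).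

Lemma omega_gt0 n (x : V n) : 0 < omega x.
Proof. by apply: prodr_gt0 => i _; exact: lweight_gt0. Qed.

Lemma omega_le1 n (x : V n) : omega x <= 1.
Proof.
have -> : 1 = \prod_(i < n) (1 : R) by rewrite big1.
by apply: ler_prod => i _; rewrite lweight_le1 ltW// lweight_gt0.
Qed.

(** [t] takes the index [ord0]: it is the variable of the outermost integral in [iint]. *)
Definition rcons_mx n (t : R) (v : V n) : V n.+1 := row_mx (\row_(_ < 1) t) v.

Lemma rcons_mx0 n t (v : V n) : rcons_mx t v 0 ord0 = t.
Proof.
by rewrite mxE; case: splitP => // j _; rewrite mxE.
Qed.

Lemma rcons_mxS n t (v : V n) i : rcons_mx t v 0 (lift ord0 i) = v 0 i.
Proof.
rewrite mxE; case: splitP => [j|k /= [ik]]; first by rewrite ord1.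
by congr (v 0 _); apply: val_inj.
Qed.

Lemma omega_rcons n t (v : V n) : omega (rcons_mx t v) = lweight t * omega v.
Proof.
by rewrite /omega big_ord_recl rcons_mx0; congr *%R; apply: eq_bigr => i _; rewrite rcons_mxS.
Qed.

Lemma continuous_rV (T : topologicalType) n (f : T -> V n) :
  (forall i, continuous (fun t => f t 0 i)) -> continuous f.
Proof.
move=> cf t A [P hP PA]; rewrite /nbhs/=.
have : \forall s \near t, forall i : 'I_n, P 0 i (f s 0 i).
  by apply: filter_forall => i; apply: cf; exact: hP.
by apply: filterS => s hs; apply: PA => i j; rewrite ord1.
Qed.

Lemma continuous_rcons (T : topologicalType) n (f : T -> R) (g : T -> V n) :
  continuous f -> continuous g -> continuous (fun t => rcons_mx (f t) (g t)).
Proof.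
move=> cf cg; apply: continuous_rV => i; case: (unliftP ord0 i) => [j|] ->.
  rewrite [X in continuous X](_ : _ = (fun t => g t 0 j)); last first.
    by apply/funext => t; rewrite rcons_mxS.
  by move=> t; apply: (cvg_comp g (fun v : V n => v 0 j) (cg t)); exact: coord_continuous.
rewrite [X in continuous X](_ : _ = f)//.
by apply/funext => t; rewrite rcons_mx0.
Qed.

Lemma rintS_iint n (h : V n.+1 -> R) :
  (forall t, iint (fun v => (h (rcons_mx t v))%:E) = (rint (fun v => h (rcons_mx t v)))%:E) ->
  rint h = \int[mu]_t rint (fun v => h (rcons_mx t v)).
Proof.
by move=> H; congr fine => /=; apply: eq_integral => t _; rewrite H.
Qed.

(** Finiteness, continuity and boundedness are proved together and for every parameter space: in the
    induction the first coordinate joins the parameter, and continuity in it makes the remaining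
    one-dimensional integral tractable. *)
Lemma rint_param n (T : pseudoMetricType R) (h : T -> V n -> R) C :
  continuous (fun p : T * V n => h p.1 p.2) ->
  (forall t v, `|h t v| <= C * omega v) ->
  [/\ forall t, iint (fun v => (h t v)%:E) = (rint (h t))%:E,
      continuous (fun t => rint (h t)) &
      forall t, `|rint (h t)| <= C * pi ^+ n].
Proof.
elim: n T h C => [|n IH] T h C ch hC.
  split=> [//||t]; last first.
    by rewrite expr0; have := hC t 0; rewrite /omega big_ord0.
  exact: (continuous_pairing (fun=> cvg_id) (fun=> cvg_cst _) ch).
pose g (p : T * R) (v : V n) := h p.1 (rcons_mx p.2 v).
have cg : continuous (fun p : (T * R) * V n => g p.1 p.2).
  apply: (continuous_pairing (f := fun p => p.1.1)
    (g := fun p => rcons_mx p.1.2 p.2) (h := fun p => h p.1 p.2)) => //.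
    by move=> p; apply: (cvg_comp fst fst); exact: cvg_fst.
  apply: continuous_rcons.
    by move=> p; apply: (cvg_comp fst snd); [exact: cvg_fst|exact: cvg_snd].
  by move=> p; exact: cvg_snd.
have gC p v : `|g p v| <= C * lweight p.2 * omega v.
  by rewrite -mulrA -omega_rcons; exact: hC.
have C0 (t : T) : 0 <= C.
  by have := le_trans (normr_ge0 _) (hC t 0); rewrite pmulr_lge0// omega_gt0.
have gC' p v : `|g p v| <= C * omega v.
  rewrite (le_trans (gC p v))// ler_wpM2r ?(ltW (omega_gt0 _))//.
  by rewrite ler_piMr ?lweight_le1// (C0 p.1).
have [gE cig _] := IH _ g C cg gC'.
(* The induction hypothesis is used again on a constant family: with [p] frozen, [lweight p.2] can
   be part of the constant, and this yields decay in the new variable. *)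
have igC p : `|rint (g p)| <= C * pi ^+ n * lweight p.2.
  have cgp : continuous (fun q : R * V n => g p q.2).
    apply: (continuous_pairing (f := fun=> p) (g := snd) (h := fun p => g p.1 p.2)) => //.
      by move=> q; exact: cvg_cst.
    by move=> q; exact: cvg_snd.
  have [_ _ /(_ 0)] := IH R (fun=> g p) _ cgp (fun=> gC p).
  by rewrite mulrAC.
have hE t : rint (h t) = \int[mu]_s rint (g (t, s)).
  by apply: rintS_iint => s; exact: gE (t, s).
have cgt t : continuous (fun s => rint (g (t, s))).
  exact: (continuous_pairing (fun=> cvg_cst _) (fun=> cvg_id) cig).
split.
- move=> t; rewrite hE -(integral_dom_EFin (cgt t) (fun s => igC (t, s)))/=.
  by apply: eq_integral => s _; exact: gE (t, s).
- under eq_fun do rewrite hE.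
  apply: (@continuous_param_integral _ _ (fun t s => rint (g (t, s))) _ _ (fun t s => igC (t, s))).
  by under eq_fun do rewrite -surjective_pairing.
- move=> t; rewrite hE exprSr mulrA.
  exact: Rintegral_normr_le (cgt t) (fun s => igC (t, s)).
Qed.

Lemma continuous_add (T : topologicalType) (f g : T -> R) :
  continuous f -> continuous g -> continuous (fun t => f t + g t).
Proof. by move=> cf cg x; exact: (cvgD (cf x) (cg x)). Qed.

Lemma continuous_mul (T : topologicalType) (f g : T -> R) :
  continuous f -> continuous g -> continuous (fun t => f t * g t).
Proof. by move=> cf cg x; exact: (cvgM (cf x) (cg x)). Qed.

Lemma continuous_cst (T : topologicalType) (c : R) : continuous (fun _ : T => c).
Proof. by move=> x; exact: cvg_cst. Qed.

Lemma continuous_opp (T : topologicalType) (f : T -> R) :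
  continuous f -> continuous (fun t => - f t).
Proof. by move=> cf x; exact: (cvgN (cf x)). Qed.

Lemma continuous_normr (T : topologicalType) (f : T -> R) :
  continuous f -> continuous (fun t => `|f t|).
Proof. by move=> cf x; apply: continuous_comp; [exact: cf|exact: norm_continuous]. Qed.

Definition Kfun n (h : V n -> R) :=
  continuous h /\ exists C, forall v, `|h v| <= C * omega v.

Lemma Kfun_cst_param n (h : V n -> R) : continuous h ->
  continuous (fun p : R * V n => h p.2).
Proof. by move=> ch p; apply: (cvg_comp snd h _ (ch p.2)); exact: cvg_snd. Qed.

Lemma iint_EFin n (h : V n -> R) : Kfun h ->
  iint (fun v => (h v)%:E) = (rint h)%:E.
Proof.
move=> [ch [C hC]].
by have [/(_ 0)] := rint_param (Kfun_cst_param ch) (fun=> hC).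
Qed.

Lemma Kfun_slices n (h : V n.+1 -> R) : Kfun h ->
  [/\ forall t, Kfun (fun v => h (rcons_mx t v)),
      rint h = \int[mu]_t rint (fun v => h (rcons_mx t v)),
      continuous (fun t => rint (fun v => h (rcons_mx t v))) &
      exists C, forall t, `|rint (fun v => h (rcons_mx t v))| <= C * lweight t].
Proof.
move=> [ch [C hC]].
have cg : continuous (fun p : R * V n => h (rcons_mx p.1 p.2)).
  move=> p; apply: (cvg_comp (fun p : R * V n => rcons_mx p.1 p.2) h _ (ch _)).
  by apply: continuous_rcons => q; [exact: cvg_fst|exact: cvg_snd].
have K t : Kfun (fun v => h (rcons_mx t v)).
  split; first exact: (continuous_pairing (fun=> cvg_cst _) (fun=> cvg_id) cg).
  by exists (C * lweight t) => v; rewrite -mulrA -omega_rcons.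
have C0 : 0 <= C.
  by have := le_trans (normr_ge0 _) (hC 0); rewrite pmulr_lge0// omega_gt0.
have gC t v : `|h (rcons_mx t v)| <= C * omega v.
  rewrite (le_trans (hC _))// omega_rcons ler_wpM2l//.
  by rewrite ler_piMl ?lweight_le1// ltW// omega_gt0.
have [_ cr _] := @rint_param n R (fun t v => h (rcons_mx t v)) C cg gC.
split => //.
- by apply: rintS_iint => t; exact: iint_EFin.
- exists (C * pi ^+ n) => t.
  have [ct _] := K t.
  have hC' v : `|h (rcons_mx t v)| <= C * lweight t * omega v.
    by rewrite -mulrA -omega_rcons.
  have [_ _ /(_ 0)] := rint_param (Kfun_cst_param ct) (fun=> hC').
  by rewrite mulrAC.
Qed.

Lemma Kfun_rintS n (h : V n.+1 -> R) : Kfun h ->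
  rint h = \int[mu]_t rint (fun v => h (rcons_mx t v)).
Proof. by case/Kfun_slices. Qed.

Lemma KfunD n (f g : V n -> R) : Kfun f -> Kfun g -> Kfun (fun v => f v + g v).
Proof.
move=> [cf [C fC]] [cg [D gD]]; split.
  exact: continuous_add.
by exists (C + D) => v; rewrite mulrDl (le_trans (ler_normD _ _))// lerD.
Qed.

Lemma KfunM n (f g : V n -> R) B : continuous f -> (forall x, `|f x| <= B) ->
  Kfun g -> Kfun (fun v => f v * g v).
Proof.
move=> cf fB [cg [D gD]]; split.
  exact: continuous_mul.
by exists (B * D) => v; rewrite normrM -mulrA ler_pM.
Qed.

Lemma KfunZ n (a : R) (f : V n -> R) : Kfun f -> Kfun (fun v => a * f v).
Proof. by apply: (@KfunM _ (fun=> a) f `|a|) => //; exact: continuous_cst. Qed.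

Lemma KfunN n (f : V n -> R) : Kfun f -> Kfun (fun v => - f v).
Proof. by move=> /(KfunZ (-1)); under eq_fun do rewrite mulN1r. Qed.

Lemma Kfun_norm n (f : V n -> R) : Kfun f -> Kfun (fun v => `|f v|).
Proof.
move=> [cf [C fC]]; split.
  exact: continuous_normr.
by exists C => v; rewrite normr_id.
Qed.

Lemma Kfun_le n (f g : V n -> R) : continuous f -> Kfun g ->
  (forall x, `|f x| <= g x) -> Kfun f.
Proof.
by move=> cf [_ [C gC]] fg; split => //; exists C => v;
  rewrite (le_trans (fg v))// (le_trans (ler_norm _)).
Qed.

Lemma eq_rint n (f g : V n -> R) : f =1 g -> rint f = rint g.
Proof. by move=> /funext ->. Qed.

Lemma rint_linear n (a : R) (f g : V n -> R) : Kfun f -> Kfun g ->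
  rint (fun v => a * f v + g v) = a * rint f + rint g.
Proof.
elim: n f g => [//|n IH] f g Kf Kg.
have [Kfs -> cf [C fC]] := Kfun_slices Kf; have [Kgs -> cg [D gD]] := Kfun_slices Kg.
have [_ -> _ _] := Kfun_slices (KfunD (KfunZ a Kf) Kg).
under Rintegral_ext do rewrite IH//.
rewrite RintegralD//.
- by rewrite RintegralZl//; exact: integrable_dom fC.
- apply: (@integrable_dom _ _ (`|a| * C)).
    by move=> t; apply: cvgM; [exact: cvg_cst|exact: cf].
  by move=> t; rewrite normrM -mulrA ler_wpM2l.
- exact: integrable_dom gD.
Qed.

Lemma Kfun0 n : Kfun (fun _ : V n => 0).
Proof.
split; first exact: continuous_cst.
by exists 0 => v; rewrite normr0 mul0r.
Qed.

Lemma rint0 n : rint (fun _ : V n => 0 : R) = 0.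
Proof.
have := rint_linear (-1) (@Kfun0 n) (@Kfun0 n).
by under eq_rint do rewrite mulr0 addr0; move=> ->; rewrite mulN1r addNr.
Qed.

Lemma rintD n (f g : V n -> R) : Kfun f -> Kfun g ->
  rint (fun v => f v + g v) = rint f + rint g.
Proof.
by move=> Kf Kg; have := rint_linear 1 Kf Kg; under eq_rint do rewrite mul1r; rewrite mul1r.
Qed.

Lemma rintZ n (a : R) (f : V n -> R) : Kfun f ->
  rint (fun v => a * f v) = a * rint f.
Proof.
move=> Kf; have := rint_linear a Kf (@Kfun0 n).
by under eq_rint do rewrite addr0; rewrite rint0 addr0.
Qed.

Lemma rintN n (f : V n -> R) : Kfun f -> rint (fun v => - f v) = - rint f.
Proof. by move=> /(rintZ (-1)); under eq_rint do rewrite mulN1r; rewrite mulN1r. Qed.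

Lemma iint_ge0 n (f : V n -> \bar R) : (forall v, (0 <= f v)%E) -> (0 <= iint f)%E.
Proof.
elim: n f => [|n IH] f f0 /=; first exact: f0.
by apply: integral_ge0 => t _; exact: IH.
Qed.

Lemma rint_ge0 n (f : V n -> R) : (forall v, 0 <= f v) -> 0 <= rint f.
Proof. by move=> f0; apply: fine_ge0; apply: iint_ge0 => v; rewrite lee_fin. Qed.

Lemma le_rint n (f g : V n -> R) : Kfun f -> Kfun g ->
  (forall v, f v <= g v) -> rint f <= rint g.
Proof.
move=> Kf Kg fg; rewrite -subr_ge0 addrC -rintN// -rintD//; last exact: KfunN.
by apply: rint_ge0 => v; rewrite addrC subr_ge0.
Qed.

Lemma ler_norm_rint n (f : V n -> R) : Kfun f -> `|rint f| <= rint (fun v => `|f v|).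
Proof.
move=> Kf; rewrite ler_norml lerNl -rintN//.
rewrite !le_rint ?ler_norm//; try exact: Kfun_norm; try exact: KfunN.
- by move=> v; exact: ler_norm.
- by move=> v; rewrite -normrN ler_norm.
Qed.

Lemma Kfun_sum n (I : Type) (r : seq I) (f : I -> V n -> R) :
  (forall i, Kfun (f i)) -> Kfun (fun v => \sum_(i <- r) f i v).
Proof.
move=> Kf; elim: r => [|i r IH].
  by under eq_fun do rewrite big_nil; exact: Kfun0.
by under eq_fun do rewrite big_cons; exact: KfunD.
Qed.

Lemma rint_sum n (I : Type) (r : seq I) (f : I -> V n -> R) :
  (forall i, Kfun (f i)) ->
  rint (fun v => \sum_(i <- r) f i v) = \sum_(i <- r) rint (f i).
Proof.
move=> Kf; elim: r => [|i r IH].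
  by under eq_rint do rewrite big_nil; rewrite rint0 big_nil.
under eq_rint do rewrite big_cons; rewrite rintD ?IH ?big_cons//.
exact: Kfun_sum.
Qed.

(** The induction runs over the coordinates of the inner integral; each is exchanged with [t] by the
    Fubini theorem of the plane. *)
Lemma rintS_param k (h : R -> V k -> R) C :
  continuous (fun p : R * V k => h p.1 p.2) ->
  (forall t v, `|h t v| <= C * lweight t * omega v) ->
  \int[mu]_t rint (h t) = rint (fun v => \int[mu]_t h t v).
Proof.
elim: k h C => [|k IH] h C ch hC //.
pose g (p : R * R) (v : V k) := h p.1 (rcons_mx p.2 v).
have C0 : 0 <= C.
  have := le_trans (normr_ge0 _) (hC 0 0).
  by rewrite -mulrA pmulr_lge0// mulr_gt0// ?lweight_gt0// omega_gt0.
have cg : continuous (fun p : (R * R) * V k => g p.1 p.2).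
  apply: (continuous_pairing (f := fun p => p.1.1)
    (g := fun p => rcons_mx p.1.2 p.2) (h := fun p => h p.1 p.2)) => //.
    by move=> p; apply: (cvg_comp fst fst); exact: cvg_fst.
  apply: continuous_rcons.
    by move=> p; apply: (cvg_comp fst snd); [exact: cvg_fst|exact: cvg_snd].
  by move=> p; exact: cvg_snd.
have gC p v : `|g p v| <= C * lweight p.1 * lweight p.2 * omega v.
  by rewrite -[leRHS]mulrA -omega_rcons; exact: hC.
have gC' p v : `|g p v| <= C * omega v.
  rewrite (le_trans (gC p v))// ler_wpM2r ?(ltW (omega_gt0 _))//.
  by rewrite -mulrA ler_piMr// mulr_ile1 ?lweight_le1// ltW// lweight_gt0.
have [gE cig _] := rint_param cg gC'.
have Kh t : Kfun (h t).
  split; first exact: (continuous_pairing (fun=> cvg_cst _) (fun=> cvg_id) ch).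
  by exists (C * lweight t) => v.
transitivity (\int[mu]_t \int[mu]_s rint (g (t, s))).
  by apply: Rintegral_ext => t; have [_ -> _ _] := Kfun_slices (Kh t).
have igC t s : `|rint (g (t, s))| <= C * pi ^+ k * lweight t * lweight s.
  have cgp : continuous (fun q : R * V k => g (t, s) q.2).
    apply: (continuous_pairing (f := fun=> (t, s)) (g := snd) (h := fun p => g p.1 p.2)) => //.
      by move=> q; exact: cvg_cst.
    by move=> q; exact: cvg_snd.
  have [_ _ /(_ 0)] := @rint_param k R (fun=> g (t, s)) _ cgp (fun=> gC (t, s)).
  by rewrite mulrC !mulrA => /le_trans; apply; rewrite le_eqVlt; apply/orP; left; apply/eqP => /=; ring.
rewrite (@Fubini_line _ _ (C * pi ^+ k))//.
have KI : Kfun (fun v => \int[mu]_t h t v).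
  split.
    apply: (@continuous_param_integral _ (V k.+1) (fun v t => h t v) C).
      by apply: (continuous_pairing (f := snd) (g := fst) (h := fun p => h p.1 p.2)) => // p;
        [exact: cvg_snd|exact: cvg_fst].
    by move=> v t; rewrite (le_trans (hC t v))// ler_piMr ?omega_le1// mulr_ge0// ltW// lweight_gt0.
  exists (C * pi) => v; rewrite mulrAC; apply: Rintegral_normr_le.
    exact: (continuous_pairing (fun=> cvg_id) (fun=> cvg_cst _) ch).
  by move=> t; rewrite mulrAC.
have [_ -> _ _] := Kfun_slices KI.
apply: Rintegral_ext => s.
apply: (IH (fun t v => h t (rcons_mx s v)) (C * lweight s)).
  apply: (continuous_pairing (f := fst)
    (g := fun p => rcons_mx s p.2) (h := fun p => h p.1 p.2)) => //.
    by move=> p; exact: cvg_fst.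
  by apply: continuous_rcons; [exact: continuous_cst|move=> p; exact: cvg_snd].
by move=> t v; rewrite (mulrAC C); exact: gC (t, s) v.
Qed.

Lemma Fubini_rint n k (h : V n -> V k -> R) C :
  continuous (fun p : V n * V k => h p.1 p.2) ->
  (forall x y, `|h x y| <= C * omega x * omega y) ->
  rint (fun x => rint (h x)) = rint (fun y => rint (fun x => h x y)).
Proof.
elim: n h C => [|n IH] h C ch hC //.
have C0 : 0 <= C.
  have := le_trans (normr_ge0 _) (hC 0 0).
  by rewrite -mulrA pmulr_lge0// mulr_gt0// omega_gt0.
have hC' x y : `|h x y| <= C * omega y.
  rewrite (le_trans (hC x y))// ler_wpM2r ?(ltW (omega_gt0 _))//.
  by rewrite ler_piMr// omega_le1.
have [_ ci _] := rint_param ch hC'.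
have KI : Kfun (fun x => rint (h x)).
  split => //; exists (C * pi ^+ k) => x.
  have cx : continuous (h x).
    exact: (continuous_pairing (fun=> cvg_cst _) (fun=> cvg_id) ch).
  have [_ _ /(_ 0)] := rint_param (Kfun_cst_param cx) (fun=> hC x).
  by rewrite mulrAC.
have [_ -> _ _] := Kfun_slices KI.
have Ky y : Kfun (fun x => h x y).
  split; first exact: (continuous_pairing (fun=> cvg_id) (fun=> cvg_cst _) ch).
  by exists (C * omega y) => x; rewrite mulrAC.
under [RHS]eq_rint => y do rewrite (Kfun_rintS (Ky y)).
pose g (p : R * V k) (v : V n) := h (rcons_mx p.1 v) p.2.
have cg : continuous (fun p : (R * V k) * V n => g p.1 p.2).
  apply: (continuous_pairing (f := fun p : (R * V k) * V n => rcons_mx p.1.1 p.2)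
    (g := fun p => p.1.2) (h := fun p => h p.1 p.2)) => //.
    apply: continuous_rcons.
      by move=> p; apply: (cvg_comp fst fst); exact: cvg_fst.
    by move=> p; exact: cvg_snd.
  by move=> p; apply: (cvg_comp fst snd); [exact: cvg_fst|exact: cvg_snd].
have gC p v : `|g p v| <= C * lweight p.1 * omega p.2 * omega v.
  by rewrite (le_trans (hC _ _))// omega_rcons le_eqVlt; apply/orP; left; apply/eqP; ring.
have gC' p v : `|g p v| <= C * omega v.
  rewrite (le_trans (gC p v))// ler_wpM2r ?(ltW (omega_gt0 _))//.
  rewrite -mulrA ler_piMr// mulr_ile1 ?lweight_le1 ?omega_le1// ltW// ?lweight_gt0//.
  exact: omega_gt0.
have [_ cig _] := rint_param cg gC'.
transitivity (\int[mu]_t rint (fun y => rint (g (t, y)))).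
  apply: Rintegral_ext => t; apply: (IH _ (C * lweight t)).
    apply: (continuous_pairing (f := fun p : V n * V k => rcons_mx t p.1)
      (g := fun p => p.2) (h := fun p => h p.1 p.2)) => //.
      by apply: continuous_rcons; [exact: continuous_cst|move=> p; exact: cvg_fst].
    by move=> p; exact: cvg_snd.
  by move=> x y; rewrite (le_trans (hC _ _))// omega_rcons !mulrA.
apply: (@rintS_param _ (fun t y => rint (g (t, y))) (C * pi ^+ n)).
  by under eq_fun do rewrite -surjective_pairing.
move=> t y.
have cgp : continuous (g (t, y)).
  exact: (continuous_pairing (fun=> cvg_cst _) (fun=> cvg_id) cg).
have [_ _ /(_ 0)] := rint_param (Kfun_cst_param cgp) (fun=> gC (t, y)).
by move=> /le_trans; apply; rewrite le_eqVlt; apply/orP; left; apply/eqP => /=; ring.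
Qed.

End SpaceIntegral.

(** * Integrals of derivatives, product weights, Cauchy-Schwarz and Fatou on [R^n] *)

Section SpaceIntegralTheory.
Context {R : realType}.
Local Notation mu := (@lebesgue_measure R).
Local Notation V n := ('rV[R]_n).

Lemma Rintegral0 : \int[mu]_(t in setT) 0 = 0 :> R.
Proof. by rewrite /Rintegral integral0. Qed.

Lemma rV_ext n (u v : V n) : (forall k, u 0 k = v 0 k) -> u = v.
Proof. by move=> uv; apply/rowP. Qed.

Lemma rVD n (u v : V n) k : (u + v) 0 k = u 0 k + v 0 k.
Proof. by rewrite mxE. Qed.

Lemma rVB n (u v : V n) k : (u - v) 0 k = u 0 k - v 0 k.
Proof. by rewrite !mxE. Qed.

Lemma rVZ n (a : R) (v : V n) k : (a *: v) 0 k = a * v 0 k.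
Proof. by rewrite mxE. Qed.

Lemma ebasisE n (i k : 'I_n) : ebasis R i 0 k = (k == i)%:R.
Proof. by rewrite mxE. Qed.

(** [A] carries the line through [x] in direction [v] to a line in direction [w], so the two
    difference quotients coincide and the directional derivative transfers as it is. *)
Lemma is_derive_along (W1 W2 : normedModType R) (A : W1 -> W2) (f : W2 -> R)
    (x v : W1) (w : W2) (d : R) :
  (forall s : R, A (s *: v + x) = s *: w + A x) ->
  is_derive (A x) w f d -> is_derive x v (f \o A) d.
Proof.
move=> Ax [df dfE].
have E : (fun h : R => h^-1 *: (((f \o A) \o shift x) (h *: v) - (f \o A) x)) =
         (fun h : R => h^-1 *: ((f \o shift (A x)) (h *: w) - f (A x))).
  by apply/funext => h /=; rewrite Ax.
by split; [rewrite /derivable E|rewrite /derive E].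
Qed.

(** For the first coordinate, [rintS_param] moves its integral inside, where the one-dimensional
    statement applies; any other direction is a direction of the slices, to which the induction
    applies. *)
Lemma rint_derive_eq0 n (i : 'I_n) (h h' : V n -> R) :
  (forall x, is_derive x (ebasis R i) h (h' x)) -> Kfun h -> Kfun h' -> rint h' = 0.
Proof.
elim: n i h h' => [[]//|n IH] i h h' dh Kh Kh'.
have [Ksl hE _ _] := Kfun_slices Kh'.
case: (unliftP ord0 i) => [j|] iE.
  have [Ksl0 _ _ _] := Kfun_slices Kh.
  rewrite hE -[RHS]Rintegral0; apply: Rintegral_ext => t.
  apply: (IH j (fun v => h (rcons_mx t v))) => //.
  move=> v; apply: (@is_derive_along _ _ (rcons_mx t) h _ _ (ebasis R i)) (dh _).
  move=> s; apply: rV_ext => k; rewrite rVD rVZ ebasisE iE.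
  case: (unliftP ord0 k) => [l|] ->.
    by rewrite !rcons_mxS rVD rVZ ebasisE (inj_eq lift_inj).
  by rewrite !rcons_mx0 eq_liftF mulr0 add0r.
have [ch' [C' hC']] := Kh'; have [ch [C hC]] := Kh.
have cg : continuous (fun p : R * V n => h' (rcons_mx p.1 p.2)).
  move=> p; apply: (cvg_comp (fun p : R * V n => rcons_mx p.1 p.2) h' _ (ch' _)).
  by apply: continuous_rcons => q; [exact: cvg_fst|exact: cvg_snd].
rewrite hE (@rintS_param _ _ (fun t v => h' (rcons_mx t v)) C')//; last first.
  by move=> t v; rewrite -mulrA -omega_rcons.
rewrite (_ : (fun v => _) = (fun=> 0)) ?rint0//; apply/funext => v.
have Cle (D : R) : D <= Num.max C C' -> forall t, D * omega (rcons_mx t v) <= Num.max C C' * omega v * lweight t.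
  by move=> DC t; rewrite omega_rcons -mulrA (mulrC (omega v)) ler_wpM2r// mulr_ge0// ltW// ?lweight_gt0// omega_gt0.
have dF t : is_derive t (1 : R) (fun t => h (rcons_mx t v)) (h' (rcons_mx t v)).
  apply: (@is_derive_along _ _ (fun t => rcons_mx t v) h _ _ (ebasis R i)) (dh _).
  move=> s; apply: rV_ext => k; rewrite rVD rVZ ebasisE iE.
  case: (unliftP ord0 k) => [l|] ->.
    by rewrite !rcons_mxS eq_sym eq_liftF mulr0 add0r.
  by rewrite !rcons_mx0 eqxx mulr1 [s *: _]mulr1.
rewrite /Rintegral (@integral_derivative_eq0 _ _ _ (Num.max C C' * omega v) dF)//.
- exact: (continuous_pairing (fun=> cvg_id) (fun=> cvg_cst _) cg).
- by move=> t; rewrite (le_trans (hC' _))// Cle// le_max lexx orbT.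
- by move=> t; rewrite (le_trans (hC _))// Cle// le_max lexx.
Qed.

Lemma continuous_coord (T : topologicalType) n (f : T -> V n) i :
  continuous f -> continuous (fun t => f t 0 i).
Proof.
by move=> cf t; apply: (cvg_comp f (fun v : V n => v 0 i) (cf t)); exact: coord_continuous.
Qed.

Lemma continuous_prod (T : topologicalType) (I : Type) (r : seq I) (f : I -> T -> R) :
  (forall i, continuous (f i)) -> continuous (fun t => \prod_(i <- r) f i t).
Proof.
move=> cf; elim: r => [|i r IH].
  by under eq_fun do rewrite big_nil; exact: continuous_cst.
by under eq_fun do rewrite big_cons; apply: continuous_mul.
Qed.

Lemma continuous_sum (T : topologicalType) (I : Type) (r : seq I) (f : I -> T -> R) :
  (forall i, continuous (f i)) -> continuous (fun t => \sum_(i <- r) f i t).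
Proof.
move=> cf; elim: r => [|i r IH].
  by under eq_fun do rewrite big_nil; exact: continuous_cst.
by under eq_fun do rewrite big_cons; apply: continuous_add.
Qed.

Lemma Kfun_prod n (phi : 'I_n -> R -> R) (C : R) :
  (forall i, continuous (phi i)) -> (forall i t, `|phi i t| <= C * lweight t) ->
  Kfun (fun x : V n => \prod_i phi i (x 0 i)).
Proof.
move=> cphi phiC; split.
  apply: continuous_prod => i x.
  by apply: (cvg_comp (fun x : V n => x 0 i) (phi i) _ (cphi i _)); exact: coord_continuous.
exists (C ^+ n) => x; have -> : C ^+ n = \prod_(i < n) C by rewrite prodr_const card_ord.
rewrite normr_prod /omega -big_split/=.
by apply: ler_prod => i _; rewrite normr_ge0 phiC.
Qed.

Lemma rint_prod n (phi : 'I_n -> R -> R) (C : R) :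
  (forall i, continuous (phi i)) -> (forall i t, `|phi i t| <= C * lweight t) ->
  rint (fun x : V n => \prod_i phi i (x 0 i)) = \prod_i \int[mu]_t phi i t.
Proof.
elim: n phi => [|n IH] phi cphi phiC; first by rewrite big_ord0 /rint/= big_ord0.
rewrite (Kfun_rintS (Kfun_prod cphi phiC)) big_ord_recl.
rewrite -(IH (fun i => phi (lift ord0 i)))//.
rewrite mulrC -RintegralZl//; last exact: integrable_dom (phiC _).
apply: Rintegral_ext => t.
rewrite mulrC -rintZ; last exact: (@Kfun_prod _ (fun i => phi (lift ord0 i)) C).
apply: eq_rint => v; rewrite big_ord_recl rcons_mx0.
by congr *%R; apply: eq_bigr => i _; rewrite rcons_mxS.
Qed.

Lemma continuous_lweight_affine (m t0 : R) : continuous (fun t : R => lweight (m * (t - t0))).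
Proof.
have ca : continuous (fun t : R => m * (t - t0)).
  apply: continuous_mul; first exact: continuous_cst.
  by apply: continuous_add; [move=> ?; exact: cvg_id|exact: continuous_cst].
by move=> t; exact: (cvg_comp _ lweight (ca t) (@continuous_lweight R _)).
Qed.

Lemma lweight_affine_le (m t0 : R) : 0 < m -> exists C : R,
  forall t, lweight (m * (t - t0)) <= C * lweight t.
Proof.
(* The constant comes from [t ^+ 2 <= 2 * (t - t0) ^+ 2 + 2 * t0 ^+ 2]. *)
move=> m0; exists (1 + 2 * t0 ^+ 2 + 2 / m ^+ 2) => t.
have h1 : 0 < 1 + (m * (t - t0)) ^+ 2 by rewrite ltr_wpDr ?sqr_ge0.
have h2 : 0 < 1 + t ^+ 2 by rewrite ltr_wpDr ?sqr_ge0.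
rewrite /lweight -[leLHS]mul1r ler_pdivrMr// mulrAC ler_pdivlMr// mul1r.
have mV : 0 < 2 / m ^+ 2 by rewrite divr_gt0 ?exprn_gt0.
have E : 2 / m ^+ 2 * (m * (t - t0)) ^+ 2 = 2 * (t - t0) ^+ 2.
  by field; rewrite gt_eqF.
have : 0 <= (1 + 2 * t0 ^+ 2) * (m * (t - t0)) ^+ 2.
  by rewrite mulr_ge0 ?sqr_ge0// addr_ge0 ?ler01// mulr_ge0 ?sqr_ge0.
have E2 : 2 / m ^+ 2 * (1 + (m * (t - t0)) ^+ 2) = 2 / m ^+ 2 + 2 * (t - t0) ^+ 2.
  by rewrite mulrDr mulr1 E.
move=> h3; rewrite [leRHS]mulrDl E2.
have := sqr_ge0 (t - 2 * t0); nra.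
Qed.

Lemma Rintegral_lweight_affine_le (m t0 : R) : 0 < m ->
  \int[mu]_t lweight (m * (t - t0)) <= pi / m.
Proof.
move=> m0; rewrite -lee_fin.
have [C hC] := lweight_affine_le t0 m0.
rewrite -(@integral_dom_EFin _ _ C); last 2 first.
- exact: continuous_lweight_affine.
- by move=> t; rewrite ger0_norm// ltW// lweight_gt0.
have -> : pi / m = 2 * (pi / 2 / m) by field; rewrite gt_eqF.
apply: (@integral_derivative_le _ (fun t => m^-1 * atan (m * (t - t0)))).
- move=> t.
  have h : is_derive t (1 : R) (fun t => m * (t - t0)) m.
    rewrite -[X in is_derive _ _ _ X]mulr1; apply: is_deriveZ => /=.
    rewrite -[X in is_derive _ _ _ X]subr0; apply: is_deriveB.
  have := @is_derive1_comp _ atan (fun t : R => m * (t - t0)) _ _ _ (is_derive1_atan (m * (t - t0))) h.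
  move=> h2; have -> : lweight (m * (t - t0)) = m^-1 *: ((1 + (m * (t - t0)) ^+ 2)^-1 * m).
    by rewrite [_ *: _]mulrC mulfK// gt_eqF.
  exact: is_deriveZ.
- exact: continuous_lweight_affine.
- by move=> t; rewrite ltW// lweight_gt0.
- move=> t; rewrite normrM gtr0_norm ?invr_gt0// mulrC ler_wpM2r ?invr_ge0 ?(ltW m0)//.
  by rewrite ler_norml (ltW (atan_gtNpi2 _)) (ltW (atan_ltpi2 _)).
Qed.

(** On the interval [|t - t0| <= 1 / m], of length [2 / m], the weight is at least one half. Such a
    lower bound allows an average over centres to be divided out. *)
Lemma Rintegral_lweight_affine_ge (L : nat) (m t0 : R) : 0 < m ->
  2 ^- L.+1 * (2 / m) <= \int[mu]_t lweight (m * (t - t0)) ^+ L.+1.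
Proof.
move=> m0; rewrite -lee_fin.
have [C hC] := lweight_affine_le t0 m0.
have ch : continuous (fun t : R => lweight (m * (t - t0)) ^+ L.+1).
  move=> t; apply: (cvg_comp _ (fun x : R => x ^+ L.+1) (continuous_lweight_affine (x:=t))).
  exact: exprn_continuous.
rewrite -(@integral_dom_EFin _ _ C)//; last first.
  move=> t; rewrite ger0_norm; last by rewrite exprn_ge0// ltW// lweight_gt0.
  apply: le_trans (hC t).
  by rewrite exprS ler_piMr ?exprn_ile1 ?lweight_le1// ltW// lweight_gt0.
pose D := `[t0 - m^-1, t0 + m^-1]%classic : set R.
apply: (@le_trans _ _ (\int[mu]_(t in D) (2 ^- L.+1)%:E)%E).
  have muD : mu D = (2 / m)%:E.
    rewrite /D lebesgue_measure_itv/= lte_fin ltrD2l gtrN ?invr_gt0//.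
    by rewrite -EFinB; congr EFin; ring.
  by rewrite integral_cst; [rewrite [X in (_ * X)%E]muD -EFinM|exact: measurable_itv].
apply: (@le_trans _ _ (\int[mu]_(t in D) (lweight (m * (t - t0)) ^+ L.+1)%:E)%E).
  apply: ge0_le_integral => //.
  - exact: measurable_itv.
  - by apply: measurable_funTS; exact: continuous_measurable_EFin.
  - move=> t; rewrite /D/= in_itv/= => /andP[h1 h2]; rewrite lee_fin -exprVn lerXn2r ?nnegrE ?invr_ge0//.
      by rewrite addr_ge0 ?sqr_ge0.
    rewrite lef_pV2 ?posrE//; last by rewrite ltr_wpDr ?sqr_ge0.
    have h3 : `|m * (t - t0)| <= 1.
      rewrite normrM gtr0_norm// -ler_pdivlMl// mulr1 ler_distl; apply/andP; split; lra.
    by rewrite -[2]/(1 + 1) lerD2l -real_normK ?num_real// expr_le1.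
apply: ge0_subset_integral => //.
- exact: measurable_itv.
- exact: continuous_measurable_EFin.
- by move=> t _; rewrite lee_fin exprn_ge0// ltW// lweight_gt0.
Qed.

Lemma continuous_scale (T : topologicalType) n (f : T -> R) (g : T -> V n) :
  continuous f -> continuous g -> continuous (fun t => f t *: g t).
Proof. by move=> cf cg x; exact: (cvgZ (cf x) (cg x)). Qed.

Lemma continuous_addV (T : topologicalType) (W : normedModType R) (f g : T -> W) :
  continuous f -> continuous g -> continuous (fun t => f t + g t).
Proof. by move=> cf cg x; exact: (cvgD (cf x) (cg x)). Qed.

Lemma continuous_subV (T : topologicalType) (W : normedModType R) (f g : T -> W) :
  continuous f -> continuous g -> continuous (fun t => f t - g t).
Proof. by move=> cf cg x; exact: (cvgB (cf x) (cg x)). Qed.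

Lemma continuous_comp' (T U W : topologicalType) (f : T -> U) (g : U -> W) :
  continuous f -> continuous g -> continuous (fun t => g (f t)).
Proof. by move=> cf cg x; exact: (cvg_comp f g (cf x) (cg (f x))). Qed.

Lemma continuous_omega n : continuous (@omega R n).
Proof.
apply: continuous_prod => i; apply: continuous_comp' (@continuous_lweight R).
by apply: continuous_coord => x; exact: cvg_id.
Qed.

Lemma omega_affineE n (m : R) (x x0 : V n) :
  omega (m *: (x - x0)) = \prod_i lweight (m * (x 0 i - x0 0 i)).
Proof. by apply: eq_bigr => i _; rewrite rVZ rVB. Qed.

Lemma lweight_affine_unif n (m : R) (x0 : V n) : 0 < m -> exists C : R,
  forall i t, lweight (m * (t - x0 0 i)) <= C * lweight t.
Proof.
move=> m0; have [c hc] := choice (fun i => lweight_affine_le (x0 0 i) m0).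
exists (\big[Num.max/0]_i c i) => i t; rewrite (le_trans (hc i t))//.
by rewrite ler_wpM2r ?(ltW (lweight_gt0 _))// le_bigmax_cond.
Qed.

Lemma Kfun_omega_affine n (m : R) (x0 : V n) : 0 < m ->
  Kfun (fun x => omega (m *: (x - x0))).
Proof.
move=> m0; have [C hC] := lweight_affine_unif x0 m0.
under eq_fun do rewrite omega_affineE.
apply: (@Kfun_prod _ (fun i t => lweight (m * (t - x0 0 i))) C).
  by move=> i; exact: continuous_lweight_affine.
by move=> i t; rewrite ger0_norm// ltW// lweight_gt0.
Qed.

Lemma rint_omega_affine_le n (m : R) (x0 : V n) : 0 < m ->
  rint (fun x => omega (m *: (x - x0))) <= (pi / m) ^+ n.
Proof.
move=> m0; have [C hC] := lweight_affine_unif x0 m0.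
under eq_rint do rewrite omega_affineE.
rewrite (@rint_prod _ (fun i t => lweight (m * (t - x0 0 i))) C).
- have -> : (pi / m) ^+ n = \prod_(i < n) (pi / m) by rewrite prodr_const card_ord.
  apply: ler_prod => i _; rewrite Rintegral_lweight_affine_le// andbT.
  by apply: fine_ge0; apply: integral_ge0 => t _; rewrite lee_fin ltW// lweight_gt0.
- by move=> i; exact: continuous_lweight_affine.
- by move=> i t; rewrite ger0_norm// ltW// lweight_gt0.
Qed.

Lemma rint_omega_exp_affine_ge n (L : nat) (m : R) (x0 : V n) : 0 < m ->
  (2 ^- L.+1 * (2 / m)) ^+ n <= rint (fun x => omega (m *: (x - x0)) ^+ L.+1).
Proof.
move=> m0; have [C hC] := lweight_affine_unif x0 m0.
under eq_rint do rewrite omega_affineE -prodrXl.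
rewrite (@rint_prod _ (fun i t => lweight (m * (t - x0 0 i)) ^+ L.+1) C).
- have -> : (2 ^- L.+1 * (2 / m)) ^+ n = \prod_(i < n) (2 ^- L.+1 * (2 / m)).
    by rewrite prodr_const card_ord.
  apply: ler_prod => i _; rewrite Rintegral_lweight_affine_ge// andbT.
  by rewrite mulr_ge0// ?invr_ge0 ?exprn_ge0// divr_ge0// ltW.
- move=> i; apply: (continuous_comp' (g := fun x : R => x ^+ L.+1)).
    exact: continuous_lweight_affine.
  exact: exprn_continuous.
- move=> i t; rewrite ger0_norm; last by rewrite exprn_ge0// ltW// lweight_gt0.
  apply: le_trans (hC i t).
  by rewrite exprS ler_piMr ?exprn_ile1 ?lweight_le1// ltW// lweight_gt0.
Qed.

(** The hypotheses bear on the squares and the product because the factors themselves may decay too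
    slowly for [Kfun], as [Num.sqrt (psi p xi)] does below. *)
Lemma rint_Cauchy_Schwarz n (f g : V n -> R) :
  Kfun (fun x => f x ^+ 2) -> Kfun (fun x => g x ^+ 2) -> Kfun (fun x => f x * g x) ->
  rint (fun x => f x * g x) ^+ 2 <= rint (fun x => f x ^+ 2) * rint (fun x => g x ^+ 2).
Proof.
move=> Kf Kg Kfg.
set A := rint (fun x => f x ^+ 2); set B := rint (fun x => g x ^+ 2).
set P := rint _.
have H t : 0 <= t ^+ 2 * A + (2 * t * P + B).
  rewrite -(rintZ _ Kf) -(rintZ _ Kfg) -rintD//; last exact: KfunZ.
  rewrite -rintD; [|exact: KfunZ|by apply: KfunD => //; exact: KfunZ].
  apply: rint_ge0 => v.
  rewrite (_ : _ + _ = (t * f v + g v) ^+ 2) ?sqr_ge0//; ring.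
have [A0|A0] := eqVneq A 0.
  have [->|P0] := eqVneq P 0; first by rewrite A0 expr0n mul0r.
  (* When [A = 0] the quadratic is affine in [t], and at this point its value would be -1. *)
  have := H (- (B + 1) / (2 * P)); rewrite A0 mulr0 add0r.
  rewrite (_ : 2 * (- (B + 1) / (2 * P)) * P = - (B + 1)); last by field.
  by move=> ?; exfalso; lra.
have A1 : 0 < A by rewrite lt_def A0 rint_ge0// => v; exact: sqr_ge0.
have := H (- P / A).
rewrite (_ : _ + _ = B - P ^+ 2 / A); last by field.
by rewrite subr_ge0 ler_pdivrMr// mulrC.
Qed.

(** Fatou's lemma of the line is applied one coordinate at a time; [H] enters through monotonicity
    of the integral. *)
Lemma iint_fatou n (h : nat -> V n -> R) (H : V n -> \bar R) :
  (forall k, Kfun (h k)) -> (forall k v, 0 <= h k v) ->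
  (forall v, (0 <= H v)%E) -> (forall v, (H v <= limn_einf (fun k => (h k v)%:E))%E) ->
  (iint H <= limn_einf (fun k => (rint (h k))%:E))%E.
Proof.
elim: n h H => [|n IH] h H Kh h0 H0 hH /=; first exact: (le_trans (hH 0)).
apply: (@le_trans _ _ (\int[mu]_t limn_einf (fun k => (rint (fun v => h k (rcons_mx t v)))%:E))%E).
  apply: integral_ge0_mono => t; first by apply: iint_ge0 => v.
  apply: IH => // k; by have [] := Kfun_slices (Kh k).
apply: le_trans (fatou _ measurableT _ _) _.
- move=> k; have [_ _ ck _] := Kfun_slices (Kh k).
  exact: continuous_measurable_EFin.
- by move=> k t _; rewrite lee_fin rint_ge0.
rewrite le_eqVlt; apply/orP; left; apply/eqP; congr limn_einf; apply/funext => k.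
have [_ -> ck [C hC]] := Kfun_slices (Kh k).
exact: integral_dom_EFin hC.
Qed.

(** The limit [H] may lie outside [Kfun]: this is the case of the r-th power of the bilinear
    operator, whose decay is not known beforehand. *)
Lemma iint_le_of_cvg n (h : nat -> V n -> R) (H : V n -> R) (B : R) :
  (forall k, Kfun (h k)) -> (forall k v, 0 <= h k v) ->
  (forall v, h k v @[k --> \oo] --> H v) -> (forall k, rint (h k) <= B) ->
  (iint (fun v => (H v)%:E) <= B%:E)%E.
Proof.
move=> Kh h0 hH hB.
have H0 v : 0 <= H v.
  rewrite -(cvg_lim _ (hH v))//; apply: limr_ge; first by apply/cvg_ex; exists (H v).
  exact: nearW.
have := @iint_fatou _ h (fun v => (H v)%:E) Kh h0.
move=> /(_ (fun v => _)) /= F; apply: (le_trans (F _ _)).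
- by move=> v; rewrite lee_fin.
- move=> v; rewrite is_cvg_limn_einfE; last first.
    by apply/cvg_ex; exists (H v)%:E; apply: cvg_EFin (hH v); exact: nearW.
  rewrite (cvg_lim _ (cvg_EFin _ (hH v)))//; exact: nearW.
rewrite limn_einf_lim; apply: lime_le; first exact: is_cvg_einfs.
apply: nearW => k; apply: ereal_inf_le => /=.
by exists (rint (h k))%:E; [exists k => //=|rewrite lee_fin].
Qed.

End SpaceIntegralTheory.

(** * Complex integrals and integration by parts *)

Section ComplexIntegral.
Context {R : realType}.
Local Notation C := (R[i]).
Local Notation V n := ('rV[R]_n).
Local Notation Re := (@complex.Re R).
Local Notation Im := (@complex.Im R).
Local Open Scope complex_scope.

Lemma ReD (z w : C) : Re (z + w) = Re z + Re w. Proof. by case: z; case: w. Qed.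
Lemma ImD (z w : C) : Im (z + w) = Im z + Im w. Proof. by case: z; case: w. Qed.
Lemma ReM (z w : C) : Re (z * w) = Re z * Re w - Im z * Im w.
Proof. by case: z; case: w. Qed.
Lemma ImM (z w : C) : Im (z * w) = Re z * Im w + Im z * Re w.
Proof. by case: z; case: w. Qed.
Lemma ReN (z : C) : Re (- z) = - Re z. Proof. by case: z. Qed.
Lemma ImN (z : C) : Im (- z) = - Im z. Proof. by case: z. Qed.
Lemma complex_ext (z w : C) : Re z = Re w -> Im z = Im w -> z = w.
Proof. by case: z => a b; case: w => c d /= -> ->. Qed.
Definition conjc' (z : C) : C := Re z -i* Im z.

Lemma cmod_ge0 (z : C) : 0 <= cmod z. Proof. exact: sqrtr_ge0. Qed.

Lemma sqr_cmod (z : C) : cmod z ^+ 2 = Re z ^+ 2 + Im z ^+ 2.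
Proof. by rewrite sqr_sqrtr// addr_ge0 ?sqr_ge0. Qed.

Lemma cmodM (z w : C) : cmod (z * w) = cmod z * cmod w.
Proof.
rewrite /cmod -sqrtrM ?addr_ge0 ?sqr_ge0// ReM ImM; congr Num.sqrt; ring.
Qed.

Lemma cmodR (a : R) : cmod a%:C = `|a|.
Proof. by rewrite /cmod /= expr0n/= addr0 sqrtr_sqr. Qed.

Lemma cmodN (z : C) : cmod (- z) = cmod z.
Proof. by rewrite /cmod ReN ImN !sqrrN. Qed.

Lemma Re_le_cmod (z : C) : `|Re z| <= cmod z.
Proof. by rewrite -sqrtr_sqr ler_wsqrtr// lerDl sqr_ge0. Qed.

Lemma Im_le_cmod (z : C) : `|Im z| <= cmod z.
Proof. by rewrite -sqrtr_sqr ler_wsqrtr// lerDr sqr_ge0. Qed.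

Lemma cmod_conj (z : C) : cmod (conjc' z) = cmod z.
Proof. by rewrite /cmod /= sqrrN. Qed.

Lemma cmodD (z w : C) : cmod (z + w) <= cmod z + cmod w.
Proof.
rewrite -(@ler_pXn2r _ 2)// ?nnegrE ?addr_ge0 ?cmod_ge0// sqrrD !sqr_cmod ReD ImD.
have H : Re z * Re w + Im z * Im w <= cmod z * cmod w.
  have := Re_le_cmod (conjc' z * w); rewrite cmodM cmod_conj ReM /=.
  by move=> /(le_trans (ler_norm _)); rewrite mulNr opprK.
rewrite -subr_ge0 (_ : _ - _ = (cmod z * cmod w - (Re z * Re w + Im z * Im w)) *+ 2); last by ring.
by rewrite mulrn_wge0// subr_ge0.
Qed.

Lemma cmod_le_ReIm (z : C) : cmod z <= `|Re z| + `|Im z|.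
Proof.
rewrite -(@ler_pXn2r _ 2)// ?nnegrE ?addr_ge0 ?cmod_ge0// sqr_cmod sqrrD.
by rewrite !real_normK ?num_real// -addrA addrCA lerDr// mulrn_wge0// mulr_ge0.
Qed.

Lemma cmod_cexpi t : cmod (cexpi t : C) = 1.
Proof. by rewrite /cmod /= cos2Dsin2 sqrtr1. Qed.

Lemma cexpiD (s t : R) : cexpi (s + t) = cexpi s * cexpi t :> C.
Proof. by apply: complex_ext; rewrite ?ReM ?ImM /= ?cosD ?sinD//; ring. Qed.

Lemma conj_cexpi (s : R) : conjc' (cexpi s) = cexpi (- s) :> C.
Proof. by rewrite /conjc' /cexpi/= cosN sinN. Qed.

Lemma conjM (z w : C) : conjc' (z * w) = conjc' z * conjc' w.
Proof. by apply: complex_ext; rewrite ?ReM ?ImM /= ?ReM ?ImM /=; ring. Qed.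

Lemma cmod_sqrE (z : C) : cmod z ^+ 2 = Re (z * conjc' z).
Proof. by rewrite sqr_cmod ReM/=; ring. Qed.

Definition ccont (T : topologicalType) (f : T -> C) :=
  continuous (fun t => Re (f t)) /\ continuous (fun t => Im (f t)).

Section ccont.
Variable T : topologicalType.
Implicit Types f g : T -> C.

Lemma ccontD f g : ccont f -> ccont g -> ccont (fun t => f t + g t).
Proof.
move=> [f1 f2] [g1 g2]; split.
  by under eq_fun do rewrite ReD; exact: continuous_add.
by under eq_fun do rewrite ImD; exact: continuous_add.
Qed.

Lemma ccontM f g : ccont f -> ccont g -> ccont (fun t => f t * g t).
Proof.
move=> [f1 f2] [g1 g2]; split.
  under eq_fun do rewrite ReM.
  by apply: continuous_add; [|apply: continuous_opp]; exact: continuous_mul.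
by under eq_fun do rewrite ImM; apply: continuous_add; exact: continuous_mul.
Qed.

Lemma ccont_cst (c : C) : ccont (fun _ : T => c).
Proof. by split; exact: continuous_cst. Qed.

Lemma ccontR (f : T -> R) : continuous f -> ccont (fun t => (f t)%:C).
Proof. by split => //; exact: continuous_cst. Qed.

Lemma ccont_conj f : ccont f -> ccont (fun t => conjc' (f t)).
Proof. by move=> [f1 f2]; split => //; exact: continuous_opp. Qed.

Lemma ccont_cexpi (f : T -> R) : continuous f -> ccont (fun t => cexpi (f t) : C).
Proof.
move=> cf; split; apply: continuous_comp' cf _.
  exact: continuous_cos.
exact: continuous_sin.
Qed.

Lemma ccont_cmod f : ccont f -> continuous (fun t => cmod (f t)).
Proof.
move=> [f1 f2].
apply: (continuous_comp' (f := fun t => Re (f t) ^+ 2 + Im (f t) ^+ 2) (g := Num.sqrt)).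
  by apply: continuous_add; under eq_fun do rewrite expr2; exact: continuous_mul.
exact: sqrt_continuous.
Qed.

End ccont.

Lemma ccont_comp (T U : topologicalType) (f : T -> U) (g : U -> C) :
  continuous f -> ccont g -> ccont (fun t => g (f t)).
Proof.
move=> cf [g1 g2]; split.
  exact: (continuous_comp' (g := fun u => Re (g u)) cf g1).
exact: (continuous_comp' (g := fun u => Im (g u)) cf g2).
Qed.

Definition Kc n (h : V n -> C) := Kfun (fun x => Re (h x)) /\ Kfun (fun x => Im (h x)).

Lemma KcI n (h : V n -> C) B : ccont h -> (forall x, cmod (h x) <= B * omega x) -> Kc h.
Proof.
move=> [h1 h2] hB; split; split => //; exists B => x.
  exact: le_trans (Re_le_cmod _) (hB x).
exact: le_trans (Im_le_cmod _) (hB x).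
Qed.

Lemma Kc_cont n (h : V n -> C) : Kc h -> ccont h.
Proof. by move=> [[? _] [? _]]. Qed.

Lemma KcE n (h : V n -> C) : Kc h -> exists2 B, 0 <= B & forall x, cmod (h x) <= B * omega x.
Proof.
move=> [[_ [A hA]] [_ [B hB]]]; exists (A + B).
  have := lerD (hA 0) (hB 0); rewrite -mulrDl => /(le_trans (addr_ge0 (normr_ge0 _) (normr_ge0 _))).
  by rewrite pmulr_lge0// omega_gt0.
by move=> x; rewrite (le_trans (cmod_le_ReIm _))// mulrDl lerD.
Qed.

Lemma Kfun_cmod n (h : V n -> C) : Kc h -> Kfun (fun x => cmod (h x)).
Proof.
move=> Kh; split; first exact: ccont_cmod (Kc_cont Kh).
by have [B B0 hB] := KcE Kh; exists B => x; rewrite ger0_norm ?cmod_ge0.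
Qed.

Lemma KcD n (f g : V n -> C) : Kc f -> Kc g -> Kc (fun x => f x + g x).
Proof.
move=> [f1 f2] [g1 g2]; split.
  by under eq_fun do rewrite ReD; exact: KfunD.
by under eq_fun do rewrite ImD; exact: KfunD.
Qed.

Lemma KcM n (f g : V n -> C) B : ccont f -> (forall x, cmod (f x) <= B) ->
  Kc g -> Kc (fun x => f x * g x).
Proof.
move=> cf fB Kg; have [D D0 gD] := KcE Kg.
apply: (@KcI _ _ (B * D)); first exact: ccontM (Kc_cont Kg).
by move=> x; rewrite cmodM -mulrA ler_pM ?cmod_ge0.
Qed.

Lemma KcZ n (a : C) (f : V n -> C) : Kc f -> Kc (fun x => a * f x).
Proof. by apply: KcM; [exact: ccont_cst|]. Qed.

Lemma KcR n (f : V n -> R) : Kfun f -> Kc (fun x => (f x)%:C).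
Proof. by move=> Kf; split => //; exact: Kfun0. Qed.

Lemma KcMr n (f g : V n -> C) B : ccont f -> (forall x, cmod (f x) <= B) ->
  Kc g -> Kc (fun x => g x * f x).
Proof. by move=> cf fB Kg; under eq_fun do rewrite mulrC; exact: KcM fB Kg. Qed.

Lemma eq_cint n (f g : V n -> C) : f =1 g -> cint f = cint g.
Proof. by move=> /funext ->. Qed.

Lemma cintD n (f g : V n -> C) : Kc f -> Kc g ->
  cint (fun x => f x + g x) = cint f + cint g.
Proof.
move=> [f1 f2] [g1 g2]; apply: complex_ext; rewrite ?ReD ?ImD /= -rintD//.
  by apply: eq_rint => x; rewrite ReD.
by apply: eq_rint => x; rewrite ImD.
Qed.

Lemma cintZ n (a : C) (f : V n -> C) : Kc f -> cint (fun x => a * f x) = a * cint f.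
Proof.
move=> [f1 f2]; apply: complex_ext; rewrite ?ReM ?ImM /=.
  rewrite -!rintZ// -rintN; last exact: KfunZ.
  rewrite -rintD; [|exact: KfunZ|by apply: KfunN; exact: KfunZ].
  by apply: eq_rint => x; rewrite ReM.
rewrite -!rintZ// -rintD; [|exact: KfunZ|exact: KfunZ].
by apply: eq_rint => x; rewrite ImM.
Qed.

Lemma cintR n (f : V n -> R) : cint (fun x => (f x)%:C) = (rint f)%:C.
Proof. by apply: complex_ext => //=; exact: rint0. Qed.

Lemma cint_conj n (f : V n -> C) : Kc f -> cint (fun x => conjc' (f x)) = conjc' (cint f).
Proof. by move=> [f1 f2]; apply: complex_ext => //=; rewrite rintN. Qed.

Lemma cint0 n : cint (fun _ : V n => 0) = 0 :> C.
Proof. by have := cintR (fun _ : V n => 0 : R); rewrite rint0. Qed.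

Lemma cmod_cint_le n (f : V n -> C) : Kc f -> cmod (cint f) <= rint (fun x => cmod (f x)).
Proof.
move=> Kf; set z := cint f.
have Kn := Kfun_cmod Kf.
have [z0|z0] := eqVneq (cmod z) 0; first by rewrite z0 rint_ge0// => x; exact: cmod_ge0.
have z1 : 0 < cmod z by rewrite lt_def z0 cmod_ge0.
(* Multiplication by the conjugate of the integral turns its squared modulus into the real part of
   an integral, to which monotonicity applies. *)
rewrite -(ler_pM2l z1) -expr2 cmod_sqrE mulrC /z -cintZ// -rintZ//=.
have [K1 _] := KcZ (conjc' z) Kf.
apply: le_rint => //; first exact: KfunZ.
move=> x; rewrite (le_trans (ler_norm _))// (le_trans (Re_le_cmod _))//.
by rewrite cmodM cmod_conj.
Qed.

Lemma cint_param n (T : pseudoMetricType R) (h : T -> V n -> C) B :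
  ccont (fun p : T * V n => h p.1 p.2) ->
  (forall t v, cmod (h t v) <= B * omega v) ->
  ccont (fun t => cint (h t)).
Proof.
move=> [c1 c2] hB; split => /=.
  have hB' t v : `|Re (h t v)| <= B * omega v by exact: le_trans (Re_le_cmod _) (hB t v).
  by have [_ c _] := rint_param c1 hB'; exact: c.
have hB' t v : `|Im (h t v)| <= B * omega v by exact: le_trans (Im_le_cmod _) (hB t v).
by have [_ c _] := rint_param c2 hB'; exact: c.
Qed.

Lemma Fubini_cint n k (h : V n -> V k -> C) B :
  ccont (fun p : V n * V k => h p.1 p.2) ->
  (forall x y, cmod (h x y) <= B * omega x * omega y) ->
  cint (fun x => cint (h x)) = cint (fun y => cint (fun x => h x y)).
Proof.
move=> [c1 c2] hB; apply: complex_ext => /=.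
  apply: (Fubini_rint (h := fun x y => Re (h x y)) c1 (C := B)) => x y.
  exact: le_trans (Re_le_cmod _) (hB x y).
apply: (Fubini_rint (h := fun x y => Im (h x y)) c2 (C := B)) => x y.
exact: le_trans (Im_le_cmod _) (hB x y).
Qed.

Lemma dotpC n (x y : V n) : dotp x y = dotp y x.
Proof. by apply: eq_bigr => i _; rewrite mulrC. Qed.
Lemma dotpDl n (x y z : V n) : dotp (x + y) z = dotp x z + dotp y z.
Proof. by rewrite /dotp -big_split/=; apply: eq_bigr => i _; rewrite rVD mulrDl. Qed.
Lemma dotpDr n (x y z : V n) : dotp x (y + z) = dotp x y + dotp x z.
Proof. by rewrite dotpC dotpDl !(dotpC x). Qed.
Lemma dotpZl n a (x y : V n) : dotp (a *: x) y = a * dotp x y.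
Proof. by rewrite /dotp mulr_sumr; apply: eq_bigr => i _; rewrite rVZ mulrA. Qed.
Lemma dotpNl n (x y : V n) : dotp (- x) y = - dotp x y.
Proof. by rewrite -scaleN1r dotpZl mulN1r. Qed.
Lemma dotpNr n (x y : V n) : dotp x (- y) = - dotp x y.
Proof. by rewrite dotpC dotpNl dotpC. Qed.
Lemma dotp_ebasis n i (y : V n) : dotp (ebasis R i) y = y 0 i.
Proof.
rewrite /dotp (bigD1 i)//= ebasisE eqxx mul1r big1 ?addr0// => j ji.
by rewrite ebasisE (negbTE ji) mul0r.
Qed.

Lemma continuous_dotp (T : topologicalType) n (f g : T -> V n) :
  continuous f -> continuous g -> continuous (fun t => dotp (f t) (g t)).
Proof.
by move=> cf cg; apply: continuous_sum => i; apply: continuous_mul; exact: continuous_coord.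
Qed.

Lemma is_derive_dir (f : R -> R) (t w d : R) :
  is_derive t (1 : R) f d -> is_derive t w f (w * d).
Proof.
move=> [df <-]; have dif : differentiable f t by apply/derivable1_diffP.
split; first exact: diff_derivable.
by rewrite !deriveE// -[w in LHS]mulr1 -[w * 1]/(w *: (1 : R)) linearZ.
Qed.

Lemma is_derive_ext (W : normedModType R) (x v : W) (f g : W -> R) (d e : R) :
  is_derive x v f d -> f =1 g -> d = e -> is_derive x v g e.
Proof. by move=> df /funext <- <-. Qed.

Section IntegrationByParts.
Variables (n : nat) (i : 'I_n) (z : V n).

Lemma is_derive_cos_dotp (x : V n) :
  is_derive x (ebasis R i) (fun x => cos (dotp x z)) (- (z 0 i * sin (dotp x z))).
Proof.
rewrite -mulrN.
apply: (@is_derive_along _ _ _ (fun x => dotp x z) cos _ _ (z 0 i)).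
  by move=> s; rewrite dotpDl dotpZl dotp_ebasis.
exact: is_derive_dir.
Qed.

Lemma is_derive_sin_dotp (x : V n) :
  is_derive x (ebasis R i) (fun x => sin (dotp x z)) (z 0 i * cos (dotp x z)).
Proof.
apply: (@is_derive_along _ _ _ (fun x => dotp x z) sin _ _ (z 0 i)).
  by move=> s; rewrite dotpDl dotpZl dotp_ebasis.
exact: is_derive_dir.
Qed.

Lemma continuous_trig_dotp : continuous (fun x : V n => cos (dotp x z)) /\
  continuous (fun x : V n => sin (dotp x z)).
Proof.
have cd : continuous (fun x : V n => dotp x z).
  by apply: continuous_dotp; [exact: continuous_idT|exact: continuous_cstT].
split; apply: continuous_comp' cd _; [exact: continuous_cos|exact: continuous_sin].
Qed.

Lemma KcM_cexpi (h : V n -> R) : Kfun h ->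
  Kc (fun x => (h x)%:C * cexpi (dotp x z)).
Proof.
move=> Kh; have [c1 c2] := continuous_trig_dotp.
apply: (@KcMr _ (fun x => cexpi (dotp x z)) (fun x => (h x)%:C) 1).
- by split.
- by move=> x; rewrite cmod_cexpi.
- exact: KcR.
Qed.

(** The derivatives of [h] times [cos] and of [h] times [sin] have integral zero; these are the real
    and imaginary parts of the identity. *)
Lemma cint_by_parts (h h' : V n -> R) :
  (forall x, is_derive x (ebasis R i) h (h' x)) -> Kfun h -> Kfun h' ->
  cint (fun x => (h' x)%:C * cexpi (dotp x z)) =
  - ('i * (z 0 i)%:C) * cint (fun x => (h x)%:C * cexpi (dotp x z)).
Proof.
move=> dh Kh Kh'; have [c1 c2] := continuous_trig_dotp.
have ReE g x : Re (g%:C * cexpi (dotp x z)) = g * cos (dotp x z).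
  by rewrite ReM /= mul0r subr0.
have ImE g x : Im (g%:C * cexpi (dotp x z)) = g * sin (dotp x z).
  by rewrite ImM /= mul0r addr0.
have Kcs g : Kfun g ->
    Kfun (fun x => g x * cos (dotp x z)) /\ Kfun (fun x => g x * sin (dotp x z)).
  move=> /KcM_cexpi[K1 K2]; split.
    by move: K1; under eq_fun do rewrite ReE.
  by move: K2; under eq_fun do rewrite ImE.
have [K1 K2] := Kcs h Kh; have [K1' K2'] := Kcs h' Kh'.
have E1 : rint (fun x => h' x * cos (dotp x z) + - z 0 i * (h x * sin (dotp x z))) = 0.
  apply: (@rint_derive_eq0 _ _ i (fun x => h x * cos (dotp x z))) => //.
    move=> x; apply: is_derive_ext (is_deriveM (dh x) (is_derive_cos_dotp x)) _ _ => //.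
    by rewrite /GRing.scale/=; ring.
  by apply: KfunD => //; exact: KfunZ.
have E2 : rint (fun x => h' x * sin (dotp x z) + z 0 i * (h x * cos (dotp x z))) = 0.
  apply: (@rint_derive_eq0 _ _ i (fun x => h x * sin (dotp x z))) => //.
    move=> x; apply: is_derive_ext (is_deriveM (dh x) (is_derive_sin_dotp x)) _ _ => //.
    by rewrite /GRing.scale/=; ring.
  by apply: KfunD => //; exact: KfunZ.
move: E1 E2; rewrite !rintD//; try exact: KfunZ.
rewrite !rintZ// => E1 E2.
have cE g : cint (fun x => (g x)%:C * cexpi (dotp x z)) =
    rint (fun x => g x * cos (dotp x z)) +i* rint (fun x => g x * sin (dotp x z)).
  by rewrite /cint; congr (_ +i* _); apply: eq_rint => x; [exact: ReE|exact: ImE].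
rewrite !cE; apply: complex_ext; rewrite ?ReM ?ImM ?ReN ?ImN ?ReM ?ImM /=; lra.
Qed.

End IntegrationByParts.

End ComplexIntegral.

(** * Symbol classes *)

Section SymbolClass.
Context {R : realType} {X : normedModType R} {P : Type}.
(** A derivative along [vec v] may cost a factor [sc p v]. The constants of the class do not depend
    on the parameter [p], so bounds derived from membership are uniform in frequency and centre. *)
Variables (vec : nat -> X) (sc : P -> nat -> X -> R).
Implicit Types (W b : P -> X -> R).

Definition Dv (v : nat) (b : P -> X -> R) : P -> X -> R :=
  fun p x => 'D_(vec v) (b p) x.

(* Derivatives are only controlled when taken along non-increasing directions
   [v < i], which is the order in which [mdirs] lists them. *)
Fixpoint sclass (k i : nat) W b : Prop :=
  (forall p, continuous (b p)) /\
  (exists C, forall p x, `|b p x| <= C * W p x) /\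
  match k with
  | 0 => True
  | k'.+1 => forall v, (v < i)%N ->
      (forall p x, derivable (b p) x (vec v)) /\
      sclass k' v.+1 (fun p x => W p x * sc p v x) (Dv v b)
  end.

Lemma sclass_cont k i W b : sclass k i W b -> forall p, continuous (b p).
Proof. by case: k => [|k] []. Qed.

Lemma sclass_bound k i W b : sclass k i W b ->
  exists C, forall p x, `|b p x| <= C * W p x.
Proof. by case: k => [|k] [_ []]. Qed.

Lemma sclass_der k i W b v : sclass k.+1 i W b -> (v < i)%N ->
  (forall p x, derivable (b p) x (vec v)) /\
  sclass k v.+1 (fun p x => W p x * sc p v x) (Dv v b).
Proof. by move=> [_ [_]]; exact. Qed.

Lemma sclass_lek k' k i W b : (k' <= k)%N -> sclass k i W b -> sclass k' i W b.
Proof.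
elim: k k' i W b => [|k IH] [|k'] i W b //= kk [c [B H]]; split=> //; split => // v vi.
by have [d S] := H v vi; split => //; exact: IH S.
Qed.

Lemma sclass_lei i' k i W b : (i' <= i)%N -> sclass k i W b -> sclass k i' W b.
Proof.
case: k => [//|k] ii [c [B H]]; split => //; split => // v vi.
by apply: H; exact: leq_trans ii.
Qed.

Hypothesis sc_ge0 : forall p v x, 0 <= sc p v x.

Lemma sclass_leW D k i W W' b : (forall p x, 0 <= W p x) ->
  (forall p x, W p x <= D * W' p x) -> sclass k i W b -> sclass k i W' b.
Proof.
elim: k i W W' b => [|k IH] i W W' b W0 WW [c [[C HC] H]]; split=> //; split.
- exists (`|C| * D) => p x; rewrite (le_trans (HC p x))// -mulrA.
  by rewrite (le_trans (ler_wpM2r (W0 p x) (ler_norm C)))// ler_wpM2l.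
- by [].
- exists (`|C| * D) => p x; rewrite (le_trans (HC p x))// -mulrA.
  by rewrite (le_trans (ler_wpM2r (W0 p x) (ler_norm C)))// ler_wpM2l.
- move=> v vi; have [d S] := H v vi; split => //; apply: IH S.
    by move=> p x; rewrite mulr_ge0.
  by move=> p x; rewrite mulrA ler_wpM2r.
Qed.

Lemma eq_sclass k i W b b' : (forall p x, b p x = b' p x) -> sclass k i W b -> sclass k i W b'.
Proof. by move=> E; have -> : b = b' by apply/funext => p; apply/funext. Qed.

Lemma eq_sclassW k i W W' b : (forall p x, W p x = W' p x) -> sclass k i W b -> sclass k i W' b.
Proof. by move=> E; have -> : W = W' by apply/funext => p; apply/funext. Qed.

Lemma sclassD k i W b1 b2 : sclass k i W b1 -> sclass k i W b2 ->
  sclass k i W (fun p x => b1 p x + b2 p x).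
Proof.
elim: k i W b1 b2 => [|k IH] i W b1 b2 [c1 [[C1 H1] D1]] [c2 [[C2 H2] D2]].
  split; [by move=> p; exact: continuous_add|split=> //].
  by exists (C1 + C2) => p x; rewrite mulrDl (le_trans (ler_normD _ _))// lerD.
split; [by move=> p; exact: continuous_add|split].
  by exists (C1 + C2) => p x; rewrite mulrDl (le_trans (ler_normD _ _))// lerD.
move=> v vi; have [d1 S1] := D1 v vi; have [d2 S2] := D2 v vi; split.
  by move=> p x; exact: derivableD.
apply: eq_sclass (IH _ _ _ _ S1 S2) => p x.
by rewrite /Dv -[RHS]/('D_(vec v) (b1 p + b2 p) x) deriveD.
Qed.

Lemma sclassM k i W1 W2 b1 b2 : sclass k i W1 b1 -> sclass k i W2 b2 ->
  sclass k i (fun p x => W1 p x * W2 p x) (fun p x => b1 p x * b2 p x).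
Proof.
elim: k i W1 W2 b1 b2 => [|k IH] i W1 W2 b1 b2 S1 S2; have [c1 [[C1 H1] D1]] := S1;
  have [c2 [[C2 H2] D2]] := S2; split; try (by move=> p; exact: continuous_mul); split => //.
- by exists (C1 * C2) => p x; rewrite normrM mulrACA ler_pM.
- by exists (C1 * C2) => p x; rewrite normrM mulrACA ler_pM.
move=> v vi; have [d1 T1] := D1 v vi; have [d2 T2] := D2 v vi; split.
  by move=> p x; exact: derivableM.
(* In each term of the Leibniz rule the factor that is not differentiated is demoted to order [k]
   and to directions up to [v], to match the other one. *)
have S1' := sclass_lei vi (sclass_lek (leqnSn k) S1).
have S2' := sclass_lei vi (sclass_lek (leqnSn k) S2).
apply: (@eq_sclass _ _ _ (fun p x => b1 p x * Dv v b2 p x + Dv v b1 p x * b2 p x)).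
  move=> p x; rewrite /Dv -[RHS]/('D_(vec v) (b1 p * b2 p) x) deriveM//.
  by rewrite [X in _ = _ + X]mulrC.
apply: sclassD.
  by apply: eq_sclassW (IH _ _ _ _ _ S1' T2) => p x; rewrite mulrA.
by apply: eq_sclassW (IH _ _ _ _ _ T1 S2') => p x; rewrite mulrAC.
Qed.

Lemma sclass0 k i W : sclass k i W (fun _ _ => 0).
Proof.
elim: k i W => [|k IH] i W; split; try (by move=> p; exact: continuous_cst); split => //.
- by exists 0 => p x; rewrite normr0 mul0r.
- by exists 0 => p x; rewrite normr0 mul0r.
move=> v vi; split; first by move=> p x; exact: derivable_cst.
by apply: eq_sclass (IH _ _) => p x; rewrite /Dv derive_cst.
Qed.

Lemma sclass_cst k i W (c : P -> R) C : (forall p x, `|c p| <= C * W p x) ->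
  sclass k i W (fun p _ => c p).
Proof.
move=> cW; case: k => [|k]; split; try (by move=> p; exact: continuous_cst); split => //.
- by exists C.
- by exists C.
move=> v vi; split; first by move=> p x; exact: derivable_cst.
by apply: eq_sclass (sclass0 _ _ _) => p x; rewrite /Dv derive_cst.
Qed.

Lemma sclassN k i W b : sclass k i W b -> sclass k i W (fun p x => - b p x).
Proof.
move=> S; have S1 : sclass k i (fun _ _ => 1) (fun _ _ => -1).
  by apply: (@sclass_cst _ _ _ (fun=> -1) 1) => _ _; rewrite normrN normr1 mulr1.
have := sclassM S1 S.
move=> /(eq_sclassW (fun p x => mul1r _)); apply: eq_sclass => p x; exact: mulN1r.
Qed.

Lemma sclass_exp k i W b N : sclass k i W b ->
  sclass k i (fun p x => W p x ^+ N) (fun p x => b p x ^+ N).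
Proof.
move=> S; elim: N => [|N IH].
  by apply: (@sclass_cst _ _ _ (fun=> 1) 1) => p x; rewrite normr1 expr0 mulr1.
apply: eq_sclassW (eq_sclass _ (sclassM S IH)) => p x /=; by rewrite exprS.
Qed.

Lemma sclass_prod k i (I : Type) (r : seq I) (W b : I -> P -> X -> R) :
  (forall j, sclass k i (W j) (b j)) ->
  sclass k i (fun p x => \prod_(j <- r) W j p x) (fun p x => \prod_(j <- r) b j p x).
Proof.
move=> S; elim: r => [|j r IH].
  apply: (@eq_sclass _ _ _ (fun _ _ => 1)) => [p x|]; first by rewrite big_nil.
  by apply: (@sclass_cst _ _ _ (fun=> 1) 1) => p x; rewrite !big_nil normr1 mulr1.
apply: eq_sclassW (eq_sclass _ (sclassM (S j) IH)) => p x /=; by rewrite big_cons.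
Qed.

Lemma sclass_sum k i W (I : Type) (r : seq I) (b : I -> P -> X -> R) :
  (forall j, sclass k i W (b j)) ->
  sclass k i W (fun p x => \sum_(j <- r) b j p x).
Proof.
move=> S; elim: r => [|j r IH].
  by apply: eq_sclass (sclass0 _ _ _) => p x; rewrite big_nil.
by apply: eq_sclass (sclassD (S j) IH) => p x /=; rewrite big_cons.
Qed.

(** With [y = 1 / (1 + phi)] one has [y' = - phi' y^2], and [phi'] is of size [sc / y], so a
    derivative of [y] is again of size [y] times [sc]. The induction feeds the class of [y], one
    order lower, into the product rule. *)
Lemma sclass_inv k i (phi : P -> X -> R) : (forall p x, 0 <= phi p x) ->
  sclass k i (fun p x => 1 + phi p x) phi ->
  sclass k i (fun p x => (1 + phi p x)^-1) (fun p x => (1 + phi p x)^-1).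
Proof.
move=> phi0.
have h p x : 1 + phi p x != 0 by rewrite gt_eqF// ltr_wpDr.
elim: k i => [|k IH] i [c [B H]].
  split; [|split => //]; last first.
    by exists 1 => p x; rewrite mul1r ger0_norm// invr_ge0 ltW// ltr_wpDr.
  by move=> p; apply: continuous_inv => //; apply: continuous_add => //; exact: continuous_cst.
split; [|split].
- by move=> p; apply: continuous_inv => //; apply: continuous_add => //; exact: continuous_cst.
- by exists 1 => p x; rewrite mul1r ger0_norm// invr_ge0 ltW// ltr_wpDr.
move=> v vi; have [d S] := H v vi.
have d1 p x : derivable (fun y => 1 + phi p y) x (vec v).
  exact: (derivableD (derivable_cst (1 : R) x (vec v)) (d p x)).
split; first by move=> p x; apply: derivableV.
have Sy : sclass k v.+1 (fun p x => (1 + phi p x)^-1) (fun p x => (1 + phi p x)^-1).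
  by apply: IH; apply: sclass_lei vi _; apply: sclass_lek (leqnSn k) _; split.
have := sclassN (sclassM S (sclassM Sy Sy)).
move=> /(@eq_sclassW _ _ _ (fun p x => (1 + phi p x)^-1 * sc p v x)) => /(_ _)E.
apply: eq_sclass (E _).
  move=> p x; have E1 := deriveV (f := fun y => 1 + phi p y) (h p x) (d1 p x).
  have E2 : 'D_(vec v) (fun y => 1 + phi p y) x = 'D_(vec v) (phi p) x.
    have := deriveD (derivable_cst (1 : R) x (vec v)) (d p x).
    by rewrite derive_cst add0r.
  rewrite /Dv; transitivity (- (1 + phi p x) ^- 2 * 'D_(vec v) (phi p) x).
    by rewrite -exprVn; ring.
  by rewrite -E2; symmetry; exact: E1.
by move=> p x; field; exact: h.
Qed.

(** The derivatives of [q] are constants, so bounds on its size and its slopes settle all orders. *)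
Lemma sclass_affine k i W (q : P -> X -> R) (c : P -> nat -> R) D :
  (forall p, continuous (q p)) ->
  (forall p x v, is_derive x (vec v) (q p) (c p v)) ->
  (forall p x, `|q p x| <= D * W p x) ->
  (forall p v x, `|c p v| <= D * (W p x * sc p v x)) ->
  sclass k i W q.
Proof.
move=> cq dq qW cW; case: k => [|k]; split=> //; split => //; [by exists D|by exists D|].
move=> v _; split; first by move=> p x; case: (dq p x v).
apply: (@eq_sclass _ _ _ (fun p _ => c p v)).
  by move=> p x; case: (dq p x v) => _ <-.
exact: (@sclass_cst _ _ _ (fun p => c p v) D).
Qed.

(* [sqrt (1 + q ^ 2)] is the natural majorant of an affine [q]: the class then
   gives [1 + q ^ 2] for the square. *)
Lemma sclass_affine_sqr k i (q : P -> X -> R) (c : P -> nat -> R) D :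
  (forall p, continuous (q p)) ->
  (forall p x v, is_derive x (vec v) (q p) (c p v)) ->
  (forall p v x, `|c p v| <= D * sc p v x) ->
  sclass k i (fun p x => 1 + q p x ^+ 2) (fun p x => q p x ^+ 2).
Proof.
move=> cq dq cs.
have s1 p x : 0 <= 1 + q p x ^+ 2 by rewrite addr_ge0 ?sqr_ge0.
have S : sclass k i (fun p x => Num.sqrt (1 + q p x ^+ 2)) q.
  apply: (@sclass_affine _ _ _ _ c (1 + `|D|) cq dq) => [p x|p v x].
    rewrite -[leLHS]mul1r; apply: ler_pM => //; first by rewrite lerDl.
    by rewrite -sqrtr_sqr ler_wsqrtr// lerDr.
  apply: (le_trans (cs p v x)); apply: (@le_trans _ _ (`|D| * sc p v x)).
    by rewrite ler_wpM2r// ler_norm.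
  apply: ler_pM => //; first by rewrite lerDr.
  rewrite ler_peMl//; rewrite -[leLHS]sqrtr1 ler_wsqrtr// lerDl; exact: sqr_ge0.
apply: eq_sclassW (eq_sclass _ (sclass_exp 2 S)) => p x //.
by rewrite sqr_sqrtr.
Qed.

Lemma sclass_lweight k i (q : P -> X -> R) (c : P -> nat -> R) D :
  (forall p, continuous (q p)) ->
  (forall p x v, is_derive x (vec v) (q p) (c p v)) ->
  (forall p v x, `|c p v| <= D * sc p v x) ->
  sclass k i (fun p x => lweight (q p x)) (fun p x => lweight (q p x)).
Proof.
move=> cq dq cs; apply: (@sclass_inv _ _ (fun p x => q p x ^+ 2)); first by move=> p x; exact: sqr_ge0.
exact: sclass_affine_sqr dq cs.
Qed.

End SymbolClass.

(* Each derivative costs one power of [1 / g], hence the bounded order [k]. *)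
Lemma sclass_rescale {R : realType} {X : normedModType R} {P : Type}
    (vec : nat -> X) (sc sc' : P -> nat -> X -> R) (g : P -> X -> R) k i (W b : P -> X -> R) :
  (forall p x, 0 < g p x) -> (forall p x, 0 <= W p x) -> (forall p v x, 0 <= sc p v x) ->
  (forall p v x, sc p v x * g p x <= sc' p v x) -> (forall p x, g p x <= 1) ->
  sclass vec sc k i W b -> sclass vec sc' k i (fun p x => W p x / g p x ^+ k) b.
Proof.
move=> g0 + sc0 gs g1; elim: k i W b => [|k IH] i W b W0 [c [[D hD] H]].
  by split=> //; split => //; exists D => p x; rewrite expr0 divr1.
split => //; split.
  exists `|D| => p x; rewrite (le_trans (hD p x))//.
  rewrite (le_trans (ler_wpM2r (W0 p x) (ler_norm D)))//; apply: ler_wpM2l => //.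
  by rewrite ler_pdivlMr ?exprn_gt0// ler_piMr// exprn_ile1// ltW.
move=> v vi; have [d S] := H v vi; split => //.
have sc'0 p u x : 0 <= sc' p u x by rewrite (le_trans _ (gs p u x))// mulr_ge0// ltW.
have W1 p x : 0 <= W p x * sc p v x by exact: mulr_ge0.
apply: (sclass_leW sc'0 (D := 1) _ _ (IH _ _ _ W1 S)) => p x.
  by rewrite divr_ge0// exprn_ge0// ltW.
have gk : g p x ^+ k != 0 by rewrite expf_neq0// gt_eqF.
have -> : W p x * sc p v x / g p x ^+ k = W p x / g p x ^+ k.+1 * (sc p v x * g p x).
  by rewrite exprS; field; rewrite gk gt_eqF.
rewrite mul1r; apply: ler_wpM2l => //.
by rewrite divr_ge0// exprn_ge0// ltW.
Qed.

Lemma sclass_reparam {R : realType} {X : normedModType R} {P Q : Type} (g : Q -> P)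
    (vec : nat -> X) (sc : P -> nat -> X -> R) k i (W b : P -> X -> R) :
  sclass vec sc k i W b ->
  sclass vec (fun q => sc (g q)) k i (fun q => W (g q)) (fun q => b (g q)).
Proof.
elim: k i W b => [|k IH] i W b [c [[D hD] H]]; split; try (by move=> q; exact: c);
  split; try (by exists D => q x; exact: hD); first by [].
move=> v vi; have [d S] := H v vi; split; first by move=> q x; exact: d.
exact: IH S.
Qed.

Arguments sclass_cont {R X P vec sc k i W b} _ p.

(** * Decay of oscillatory integrals *)

Section OscillatoryIntegrals.
Context {R : realType}.
Local Notation C := (R[i]).
Local Notation V n := ('rV[R]_n).
Local Notation Re := (@complex.Re R).
Local Notation Im := (@complex.Im R).
Local Open Scope complex_scope.

(** Indexing by [nat] lets several blocks of variables be numbered consecutively; the vector is zero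
    when [v >= n]. *)
Definition evec n (v : nat) : V n := \row_j (j == v :> nat)%:R.

Lemma evecE n (i : 'I_n) : evec n i = ebasis R i.
Proof. by apply: rV_ext => k; rewrite ebasisE mxE. Qed.

Lemma evec_coord n v (i : 'I_n) : evec n v 0 i = (i == v :> nat)%:R.
Proof. by rewrite mxE. Qed.

Lemma omega_ge0 n (x : V n) : 0 <= omega x.
Proof. exact: ltW (omega_gt0 x). Qed.

Lemma Kfun_omega n : Kfun (@omega R n).
Proof.
split; first exact: continuous_omega.
by exists 1 => x; rewrite mul1r ger0_norm// omega_ge0.
Qed.

(** Directions have to be used in non-increasing order, so the coordinates are treated from the last
    to the first. *)
Lemma path_rev_iota n k : (n <= k)%N -> path geq k (rev (iota 1 n)).
Proof.
elim: n k => [//|n IH] k nk.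
by rewrite -(addn1 n) iotaD cats1 rev_rcons /= add1n nk IH.
Qed.

Section Decay.
Variables (n : nat) (P : Type) (m : P -> R).
Hypothesis m_gt0 : forall p, 0 < m p.
Local Notation scm := (fun (p : P) (_ : nat) (_ : V n) => m p).

(** Two integrations by parts: [b'] is [b - m^(-2) d_i^2 b], and the power of [m] pays for the two
    derivatives, so that the weight [W] is unchanged. *)
Lemma cint_second_order (b : P -> V n -> R) (W : P -> V n -> R) k (i : 'I_n) I :
  (forall p, Kfun (W p)) -> (i < I)%N ->
  sclass (evec n) scm k.+2 I W b ->
  exists b', [/\ sclass (evec n) scm k i.+1 W b' &
   forall p (z : V n), (1 + (z 0 i / m p) ^+ 2)%:C * cint (fun x => (b p x)%:C * cexpi (dotp x z)) =
               cint (fun x => (b' p x)%:C * cexpi (dotp x z))].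
Proof.
move=> KW iI S; have [d1 S1] := sclass_der S iI.
have [d2 S2] := sclass_der S1 (ltnSn i).
exists (fun p x => b p x + (- (m p ^- 2)) * Dv (evec n) i (Dv (evec n) i b) p x); split.
  apply: sclassD => //.
    by apply: sclass_lei (leq_trans _ iI) _ => //; apply: sclass_lek S; rewrite -addn2 leq_addr.
  have Sc : sclass (evec n) scm k i.+1 (fun p _ => m p ^- 2) (fun p _ => - (m p ^- 2)).
    apply: (@sclass_cst _ _ _ _ _ _ _ _ (fun p => - (m p ^- 2)) 1) => p x.
    by rewrite normrN mul1r ger0_norm// invr_ge0 exprn_ge0// ltW.
  apply: eq_sclassW (sclassM Sc S2) => p x.
  by field; rewrite gt_eqF.
move=> p z.
have Kb W' b0 k' I' : sclass (evec n) scm k' I' W' b0 -> (forall p, Kfun (W' p)) -> Kfun (b0 p).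
  move=> S0 K0; have [D hD] := sclass_bound S0.
  apply: (Kfun_le (g := fun x => D * W' p x)).
    exact: (sclass_cont S0 p).
    exact: KfunZ (K0 p).
    exact: (hD p).
have Kb0 := Kb _ _ _ _ S KW.
have KW1 q : Kfun (fun x => W q x * m q).
  by under eq_fun do rewrite mulrC; exact: KfunZ.
have KW2 q : Kfun (fun x => W q x * m q * m q).
  by under eq_fun do rewrite mulrC; exact: KfunZ.
have Kb1 := Kb _ _ _ _ S1 KW1; have Kb2 := Kb _ _ _ _ S2 KW2.
have D1 x : is_derive x (ebasis R i) (b p) (Dv (evec n) i b p x).
  by rewrite -evecE; apply: DeriveDef.
have D2 x : is_derive x (ebasis R i) (Dv (evec n) i b p) (Dv (evec n) i (Dv (evec n) i b) p x).
  by rewrite -evecE; apply: DeriveDef.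
have E1 := cint_by_parts z D1 Kb0 Kb1; have E2 := cint_by_parts z D2 Kb1 Kb2.
transitivity (cint (fun x => (b p x)%:C * cexpi (dotp x z)
   + (- (m p ^- 2))%:C * ((Dv (evec n) i (Dv (evec n) i b) p x)%:C * cexpi (dotp x z)))).
  rewrite cintD; [|exact: KcM_cexpi|by apply: KcZ; exact: KcM_cexpi].
  rewrite cintZ; last exact: KcM_cexpi.
  rewrite E2 E1.
  rewrite (_ : (1 + _)%:C = 1 + (- (m p ^- 2))%:C * (- ('i * (z 0 i)%:C) * - ('i * (z 0 i)%:C))).
    by rewrite mulrDl mul1r !mulrA.
  apply: complex_ext; rewrite ?(ReD, ImD, ReM, ImM, ReN, ImN) /=; last by ring.
  rewrite -exprVn; ring.
apply: eq_cint => x; rewrite mulrA -mulrDl; congr (_ * _).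
by apply: complex_ext; rewrite ?(ReD, ImD, ReM, ImM) /=; ring.
Qed.

Lemma cint_decay (l : seq 'I_n) (b : P -> V n -> R) (W : P -> V n -> R) I :
  (forall p, Kfun (W p)) ->
  path geq I [seq i.+1 | i : 'I_n <- l] ->
  sclass (evec n) scm (size l).*2 I W b ->
  exists D, forall p (z : V n),
    cmod (cint (fun x => (b p x)%:C * cexpi (dotp x z))) *
      \prod_(i <- l) (1 + (z 0 i / m p) ^+ 2) <= D * rint (W p).
Proof.
move=> KW; elim: l I b => [|i l IH] I b hl S.
  have [D hD] := sclass_bound S; exists D => p z; rewrite big_nil mulr1.
  have Kb : Kfun (b p).
    exact: (Kfun_le (g := fun x => D * W p x) (sclass_cont S p) (KfunZ D (KW p)) (hD p)).
  rewrite (le_trans (cmod_cint_le (KcM_cexpi z Kb)))// -rintZ//.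
  apply: le_rint; [exact: Kfun_cmod (KcM_cexpi z Kb)|exact: KfunZ|].
  by move=> x; rewrite cmodM cmod_cexpi mulr1 cmodR.
have /andP[iI pl] := hl.
have [b' [S' E]] := cint_second_order KW iI S.
have [D hD] := IH _ _ pl S'.
exists D => p z; rewrite big_cons mulrA (mulrC (cmod _)).
rewrite -[X in X * cmod _]ger0_norm; last by rewrite addr_ge0 ?sqr_ge0.
by rewrite -cmodR -cmodM E.
Qed.

(** One pair of integrations by parts per coordinate, hence the order [n.*2]; the product of the
    factors gained is the inverse of the [omega] on the right. *)
Lemma cint_omega_decay (b : P -> V n -> R) (W : P -> V n -> R) :
  (forall p, Kfun (W p)) -> sclass (evec n) scm n.*2 n W b ->
  exists D, forall p (z : V n),
    cmod (cint (fun x => (b p x)%:C * cexpi (dotp x z))) <=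
      D * rint (W p) * omega ((m p)^-1 *: z).
Proof.
move=> KW S.
have sz : size (rev (enum 'I_n)) = n by rewrite size_rev size_enum_ord.
have [||D hD] := @cint_decay (rev (enum 'I_n)) b W n KW.
- rewrite map_rev; have -> : [seq i.+1 | i : 'I_n <- enum 'I_n] = iota 1 n.
    by rewrite (map_comp succn val) val_enum_ord -(iotaDl 1 0).
  exact: path_rev_iota.
- by rewrite sz.
exists D => p z; have := hD p z.
rewrite (perm_big (enum 'I_n)) ?perm_rev//= big_enum/=.
rewrite -ler_pdivlMr; last by apply: prodr_gt0 => i _; rewrite ltr_wpDr ?sqr_ge0.
move=> /le_trans; apply; rewrite /omega prodfV le_eqVlt; apply/orP; left; apply/eqP.
by congr (_ / _); apply: eq_big => // i _; rewrite rVZ mulrC.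
Qed.

End Decay.

(** * Two-variable integrands and the Schur test *)

Lemma lweight_conv (c : R) : 0 < c -> exists D : R, 0 <= D /\
  forall x y, lweight y * lweight (c * (x - y)) <= D * lweight x.
Proof.
(* The constant comes from [1 + x ^+ 2 <= 2 * (1 + y ^+ 2) + 2 * (x - y) ^+ 2]. *)
move=> c0; exists (2 + 2 / c ^+ 2); split; first by rewrite addr_ge0// divr_ge0// exprn_ge0// ltW.
move=> x y.
have h1 : 0 < 1 + (c * (x - y)) ^+ 2 by rewrite ltr_wpDr ?sqr_ge0.
have h2 : 0 < 1 + y ^+ 2 by rewrite ltr_wpDr ?sqr_ge0.
have h3 : 0 < 1 + x ^+ 2 by rewrite ltr_wpDr ?sqr_ge0.
rewrite /lweight -invfM -[leLHS]mul1r ler_pdivrMr ?mulr_gt0// mulrAC ler_pdivlMr// mul1r.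
have c2 : 0 <= 2 / c ^+ 2 by rewrite divr_ge0// exprn_ge0// ltW.
have E : 2 / c ^+ 2 * (c * (x - y)) ^+ 2 = 2 * (x - y) ^+ 2 by field; rewrite gt_eqF.
apply: (@le_trans _ _ ((2 * (1 + y ^+ 2) + 2 * (x - y) ^+ 2))).
  have := sqr_ge0 (x - 2 * y); nra.
have -> : (2 + 2 / c ^+ 2) * ((1 + y ^+ 2) * (1 + (c * (x - y)) ^+ 2)) =
  (1 + y ^+ 2) * (2 + 2 * (c * (x - y)) ^+ 2 + 2 / c ^+ 2 + 2 / c ^+ 2 * (c * (x - y)) ^+ 2) by ring.
rewrite E; have := sqr_ge0 (c * (x - y)); have := sqr_ge0 (x - y); have := sqr_ge0 y; nra.
Qed.

Lemma omega_conv n (c : R) : 0 < c -> exists D : R, 0 <= D /\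
  forall x y : V n, omega y * omega (c *: (x - y)) <= D * omega x.
Proof.
move=> c0; have [D [D0 hD]] := lweight_conv c0; exists (D ^+ n); split; first exact: exprn_ge0.
move=> x y; rewrite omega_affineE /omega -big_split/=.
have -> : D ^+ n = \prod_(i < n) D by rewrite prodr_const card_ord.
rewrite -big_split/=; apply: ler_prod => i _; rewrite hD andbT.
by rewrite mulr_ge0// ltW// lweight_gt0.
Qed.

Lemma omegaN n (x : V n) : omega (- x) = omega x.
Proof. by apply: eq_bigr => i _; rewrite mxE /lweight sqrrN. Qed.

Lemma omega_subC n (c : R) (x y : V n) : omega (c *: (x - y)) = omega (c *: (y - x)).
Proof. by rewrite -omegaN -scalerN opprB. Qed.

Lemma continuous_omega_sub n (c : R) :
  continuous (fun p : V n * V n => omega (c *: (p.1 - p.2))).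
Proof.
apply: continuous_comp' (@continuous_omega R n).
apply: continuous_scale; first exact: continuous_cst.
by apply: continuous_subV => p; [exact: cvg_fst|exact: cvg_snd].
Qed.

Lemma KfunE n (h : V n -> R) : Kfun h -> exists2 B, 0 <= B & forall x, `|h x| <= B * omega x.
Proof.
move=> [_ [B hB]]; exists B => //.
by have := le_trans (normr_ge0 _) (hB 0); rewrite pmulr_lge0// omega_gt0.
Qed.

Definition K2 n k (h : V n -> V k -> R) :=
  continuous (fun p : V n * V k => h p.1 p.2) /\
  exists B, forall x y, `|h x y| <= B * omega x * omega y.

Section K2.
Variables (n k : nat).
Implicit Types h : V n -> V k -> R.

Lemma K2_l h x : K2 h -> Kfun (h x).
Proof.
move=> [ch [B hB]]; split; last by exists (B * omega x).
exact: (continuous_pairing (fun=> cvg_cst _) (fun=> cvg_id) ch).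
Qed.

Lemma K2_rint h : K2 h -> Kfun (fun x => rint (h x)).
Proof.
move=> Kh; have [ch [B hB]] := Kh.
have B0 : 0 <= B.
  have := le_trans (normr_ge0 _) (hB 0 0).
  by rewrite -mulrA pmulr_lge0// mulr_gt0// omega_gt0.
have hB' x y : `|h x y| <= B * omega y.
  by rewrite (le_trans (hB x y))// ler_wpM2r ?omega_ge0// ler_piMr// omega_le1.
have [_ ci _] := rint_param ch hB'; split; first exact: ci.
exists (B * rint (@omega R k)) => x.
rewrite (le_trans (ler_norm_rint (K2_l x Kh)))// mulrAC -rintZ; last exact: Kfun_omega.
apply: le_rint; [exact: Kfun_norm (K2_l x Kh)|exact: KfunZ (Kfun_omega k)|].
exact: hB.
Qed.

Lemma K2_swap h : K2 h -> K2 (fun y x => h x y).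
Proof.
move=> [ch [B hB]]; split; last by exists B => y x; rewrite mulrAC.
apply: (continuous_pairing (f := snd) (g := fst) (h := fun p => h p.1 p.2)) ch => p.
  exact: cvg_snd.
exact: cvg_fst.
Qed.

Lemma K2_Fubini h : K2 h -> rint (fun x => rint (h x)) = rint (fun y => rint (h^~ y)).
Proof. by move=> [ch [B hB]]; exact: Fubini_rint hB. Qed.

Lemma K2D h1 h2 : K2 h1 -> K2 h2 -> K2 (fun x y => h1 x y + h2 x y).
Proof.
move=> [c1 [B1 H1]] [c2 [B2 H2]]; split; first exact: continuous_add.
by exists (B1 + B2) => x y; rewrite !mulrDl (le_trans (ler_normD _ _))// lerD.
Qed.

Lemma K2Z (a : R) h : K2 h -> K2 (fun x y => a * h x y).
Proof.
move=> [c1 [B1 H1]]; split; first by apply: continuous_mul => //; exact: continuous_cst.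
by exists (`|a| * B1) => x y; rewrite normrM -!mulrA ler_wpM2l// mulrA.
Qed.

Lemma K2_le h g : continuous (fun p : V n * V k => h p.1 p.2) -> K2 g ->
  (forall x y, `|h x y| <= g x y) -> K2 h.
Proof.
move=> ch [_ [B gB]] hg; split => //; exists B => x y.
by rewrite (le_trans (hg x y))// (le_trans (ler_norm _)).
Qed.

Lemma le_rint2 h1 h2 : K2 h1 -> K2 h2 -> (forall x y, h1 x y <= h2 x y) ->
  rint (fun x => rint (h1 x)) <= rint (fun x => rint (h2 x)).
Proof.
move=> K1 K2' h12; apply: le_rint; [exact: K2_rint|exact: K2_rint|] => x.
by apply: le_rint => //; exact: K2_l.
Qed.

End K2.

(** Two powers of [omega x] are spent: one remains as decay in [x], the other is traded, together
    with the kernel, for decay in [y]. *)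
Lemma K2_omega_sub n (c : R) (Phi : V n -> R) : 0 < c -> continuous Phi ->
  (exists B, forall x, `|Phi x| <= B * omega x ^+ 2) ->
  K2 (fun x y => Phi x * omega (c *: (x - y))).
Proof.
move=> c0 cP [B hB]; split.
  apply: continuous_mul; last exact: continuous_omega_sub.
  by apply: continuous_comp' cP => p; exact: cvg_fst.
have B0 : 0 <= B.
  by have := le_trans (normr_ge0 _) (hB 0); rewrite pmulr_lge0// exprn_gt0// omega_gt0.
have [D [D0 hD]] := omega_conv n c0; exists (B * D) => x y.
rewrite normrM [X in _ * X]ger0_norm ?omega_ge0//.
rewrite (le_trans (ler_wpM2r (omega_ge0 _) (hB x)))//.
rewrite (_ : B * omega x ^+ 2 * _ = B * omega x * (omega x * omega (c *: (x - y)))); last by ring.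
rewrite (_ : B * D * _ * _ = B * omega x * (D * omega y)); last by ring.
by rewrite ler_wpM2l ?mulr_ge0 ?omega_ge0// omega_subC.
Qed.

(** As the kernel is symmetric, [Phi x * Phi y <= (Phi x ^+ 2 + Phi y ^+ 2) / 2] suffices: each half
    is integrated in its free variable, where the kernel has mass at most [(pi / c) ^+ n]. *)
Lemma Schur_bound n (c : R) (Phi : V n -> R) : 0 < c -> Kfun Phi ->
  rint (fun x => rint (fun y => Phi x * Phi y * omega (c *: (x - y)))) <=
  (pi / c) ^+ n * rint (fun x => Phi x ^+ 2).
Proof.
move=> c0 KP; have [cP _] := KP; have [B B0 hB] := KfunE KP.
have c2 : continuous (fun x => Phi x ^+ 2).
  by under eq_fun do rewrite expr2; exact: continuous_mul.
have h2 x : `|Phi x ^+ 2| <= B ^+ 2 * omega x ^+ 2.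
  by rewrite normrX -exprMn lerXn2r ?nnegrE ?mulr_ge0 ?omega_ge0.
have KP2 : Kfun (fun x => Phi x ^+ 2).
  split => //; exists (B ^+ 2) => x; rewrite (le_trans (h2 x))// ler_wpM2l ?sqr_ge0//.
  by rewrite expr2 ler_piMr ?omega_ge0 ?omega_le1.
have K1 : K2 (fun x y => Phi x ^+ 2 * omega (c *: (x - y))).
  by apply: K2_omega_sub => //; exists (B ^+ 2).
have K1' : K2 (fun x y => Phi y ^+ 2 * omega (c *: (x - y))).
  by have := K2_swap K1; under eq_fun do under eq_fun do rewrite omega_subC.
have Kc : K2 (fun x y => Phi x * Phi y * omega (c *: (x - y))).
  apply: K2_le (K2D K1 K1') _.
    apply: continuous_mul; last exact: continuous_omega_sub.
    apply: continuous_mul; apply: continuous_comp' cP => p; [exact: cvg_fst|exact: cvg_snd].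
  move=> x y; rewrite normrM -mulrDl [X in _ * X]ger0_norm ?omega_ge0//.
  rewrite ler_wpM2r ?omega_ge0// normrM.
  have := sqr_ge0 (`|Phi x| - `|Phi y|); have := sqr_ge0 (Phi x); have := sqr_ge0 (Phi y).
  rewrite -[Phi x ^+ 2]real_normK ?num_real// -[Phi y ^+ 2]real_normK ?num_real//; nra.
have E (f1 f2 : V n -> V n -> R) : K2 f1 -> K2 f2 ->
    rint (fun x => rint (fun y => 2^-1 * f1 x y + 2^-1 * f2 x y)) =
    2^-1 * rint (fun x => rint (f1 x)) + 2^-1 * rint (fun x => rint (f2 x)).
  move=> k1 k2; have k1' := K2Z 2^-1 k1; have k2' := K2Z 2^-1 k2.
  transitivity (rint (fun x => 2^-1 * rint (f1 x) + 2^-1 * rint (f2 x))).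
    apply: eq_rint => x; rewrite -(rintZ _ (K2_l x k1)) -(rintZ _ (K2_l x k2)).
    by rewrite rintD//; [exact: (K2_l x k1')|exact: (K2_l x k2')].
  by rewrite rintD ?rintZ//; try apply: KfunZ; exact: K2_rint.
rewrite (@le_trans _ _ (rint (fun x => rint (fun y =>
    2^-1 * (Phi x ^+ 2 * omega (c *: (x - y))) + 2^-1 * (Phi y ^+ 2 * omega (c *: (x - y)))))))//.
  apply: le_rint2 => //; first by apply: K2D; exact: K2Z.
  move=> x y; rewrite -mulrDr -mulrDl mulrA ler_wpM2r ?omega_ge0//.
  have := sqr_ge0 (Phi x - Phi y); nra.
rewrite E// (K2_Fubini K1').
have H : rint (fun x => rint (fun y => Phi x ^+ 2 * omega (c *: (x - y)))) <=
    (pi / c) ^+ n * rint (fun x => Phi x ^+ 2).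
  rewrite -rintZ//; apply: le_rint; [exact: K2_rint|exact: KfunZ|] => x.
  rewrite rintZ; last first.
    by under eq_fun do rewrite omega_subC; exact: Kfun_omega_affine.
  rewrite mulrC ler_wpM2r ?sqr_ge0//.
  by under eq_rint do rewrite omega_subC; exact: rint_omega_affine_le.
under [X in _ + _ * X]eq_rint do under eq_rint do rewrite omega_subC.
by rewrite -mulrDr; lra.
Qed.

End OscillatoryIntegrals.

(** * Estimates for a localised bilinear operator *)

Section TTstar.
Context {R : realType}.
Local Notation C := (R[i]).
Local Notation V n := ('rV[R]_n).
Local Notation Re := (@complex.Re R).
Local Notation Im := (@complex.Im R).
Local Open Scope complex_scope.

Definition K2c n k (h : V n -> V k -> C) :=
  ccont (fun p : V n * V k => h p.1 p.2) /\
  exists B, forall x y, cmod (h x y) <= B * omega x * omega y.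

Section K2c.
Variables (n k : nat).
Implicit Types h : V n -> V k -> C.

Lemma K2c_ge0 h : K2c h -> exists2 B, 0 <= B & forall x y, cmod (h x y) <= B * omega x * omega y.
Proof.
move=> [_ [B hB]]; exists B => //.
have := le_trans (cmod_ge0 _) (hB 0 0).
by rewrite -mulrA pmulr_lge0// mulr_gt0// omega_gt0.
Qed.

Lemma K2c_l h x : K2c h -> Kc (h x).
Proof.
move=> [ch [B hB]]; apply: (@KcI _ _ _ (B * omega x)) => //.
by apply: (ccont_comp (f := fun y => (x, y)) _ ch); cont_proj.
Qed.

Lemma K2c_cint h : K2c h -> Kc (fun x => cint (h x)).
Proof.
move=> Kh; have [ch _] := Kh; have [B B0 hB] := K2c_ge0 Kh.
have hB' x y : cmod (h x y) <= B * omega y.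
  by rewrite (le_trans (hB x y))// ler_wpM2r ?omega_ge0// ler_piMr// omega_le1.
apply: (@KcI _ _ _ (B * rint (@omega R k))); first exact: cint_param ch hB'.
move=> x; rewrite (le_trans (cmod_cint_le (K2c_l x Kh)))// mulrAC -rintZ; last exact: Kfun_omega.
apply: le_rint; [exact: Kfun_cmod (K2c_l x Kh)|exact: KfunZ (Kfun_omega k)|].
exact: hB.
Qed.

Lemma K2c_swap h : K2c h -> K2c (fun y x => h x y).
Proof.
move=> [ch [B hB]]; split; last by exists B => y x; rewrite mulrAC.
by apply: (ccont_comp (f := fun p => (p.2, p.1)) _ ch); cont_proj.
Qed.

Lemma K2c_Fubini h : K2c h -> cint (fun x => cint (h x)) = cint (fun y => cint (h^~ y)).
Proof. by move=> [ch [B hB]]; exact: Fubini_cint hB. Qed.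

End K2c.

Lemma Kfun_sqr n (f : V n -> R) : Kfun f -> Kfun (fun x => f x ^+ 2).
Proof.
move=> Kf; have [cf _] := Kf; have [B B0 hB] := KfunE Kf.
under eq_fun do rewrite expr2; apply: (@KfunM _ _ _ _ B) => // x.
by rewrite (le_trans (hB x))// ler_piMr// omega_le1.
Qed.

(** The square of the inner integral is expanded and the integral in [x] moved inside, where [Q]
    controls it. The weight [beta] may decay only like the square root of [omega]: one kernel is
    then not dominated by [omega] in [x], but the product of two is. *)
Lemma TTstar_weighted n k (B : V n -> V k -> C) (Q : V k -> V k -> R) (beta : V n -> R) D E :
  ccont (fun p : V n * V k => B p.1 p.2) ->
  0 <= D -> 0 <= E -> (forall x y, cmod (B x y) <= D * beta x * omega y) ->
  (forall x, 0 <= beta x <= 1) -> (forall x, beta x ^+ 2 <= E * omega x) -> K2 Q ->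
  (forall y y', cmod (cint (fun x => B x y * conjc' (B x y'))) <= Q y y') ->
  rint (fun x => cmod (cint (B x)) ^+ 2) <= rint (fun y => rint (Q y)).
Proof.
move=> cB D0 E0 hD hb hb2 KQ hQ.
have b0 x : 0 <= beta x by have /andP[] := hb x.
have D2 x y : cmod (B x y) <= D * omega y.
  rewrite (le_trans (hD x y))// ler_wpM2r ?omega_ge0// ler_piMr//.
  by have /andP[] := hb x.
have KBx x : Kc (B x).
  apply: (@KcI _ _ _ (D * beta x)) => //.
  by apply: (ccont_comp (f := fun y => (x, y)) _ cB); cont_proj.
have cBy y : ccont (fun x => B x y).
  by apply: (ccont_comp (f := fun x => (x, y)) _ cB); cont_proj.
have cH : ccont (fun x => cint (B x)) by exact: cint_param cB D2.
set O := rint (@omega R k).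
have O0 : 0 <= O by apply: rint_ge0 => y; exact: omega_ge0.
have hH x : cmod (cint (B x)) <= D * O * beta x.
  rewrite (le_trans (cmod_cint_le (KBx x)))// mulrAC -rintZ; last exact: Kfun_omega.
  by apply: le_rint; [exact: Kfun_cmod|exact: KfunZ (Kfun_omega k)|exact: hD].
have KG : K2c (fun x y => B x y * conjc' (cint (B x))).
  split.
    apply: ccontM => //; apply: ccont_conj.
    by apply: (ccont_comp (f := fst) (g := fun x => cint (B x))) => // p; exact: cvg_fst.
  exists (D * (D * O) * E) => x y; rewrite cmodM cmod_conj.
  apply: (@le_trans _ _ ((D * beta x * omega y) * (D * O * beta x))).
    by rewrite ler_pM ?cmod_ge0.
  rewrite (_ : _ * (D * O * beta x) = (D * (D * O) * omega y) * beta x ^+ 2); last by ring.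
  rewrite (_ : _ * E * _ * _ = (D * (D * O) * omega y) * (E * omega x)); last by ring.
  by rewrite ler_wpM2l// !mulr_ge0// omega_ge0.
have -> : rint (fun x => cmod (cint (B x)) ^+ 2) =
    Re (cint (fun x => cint (fun y => B x y * conjc' (cint (B x))))).
  apply: eq_rint => x; rewrite cmod_sqrE; congr Re.
  rewrite mulrC -cintZ//; by apply: eq_cint => y; rewrite mulrC.
rewrite (K2c_Fubini KG) (le_trans (ler_norm _))// (le_trans (Re_le_cmod _))//.
have KG' := K2c_cint (K2c_swap KG).
rewrite (le_trans (cmod_cint_le KG'))//.
apply: le_rint; [exact: Kfun_cmod|exact: K2_rint|] => y /=.
have KBy : K2c (fun x y' => B x y * conjc' (B x y')).
  split.
    apply: ccontM; last exact: ccont_conj.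
    by apply: (ccont_comp (f := fst) (g := fun x => B x y)) => // p; exact: cvg_fst.
  exists (D * D * E) => x y'; rewrite cmodM cmod_conj.
  apply: (@le_trans _ _ ((D * beta x * 1) * (D * beta x * omega y'))).
    apply: ler_pM; rewrite ?cmod_ge0// (le_trans (hD x y))// ler_wpM2l ?omega_le1//.
    exact: mulr_ge0.
  rewrite (_ : _ * (D * beta x * omega y') = (D * D * omega y') * beta x ^+ 2); last by ring.
  rewrite (_ : _ * E * _ * _ = (D * D * omega y') * (E * omega x)); last by ring.
  by rewrite ler_wpM2l// !mulr_ge0// omega_ge0.
have -> : cint (fun x => B x y * conjc' (cint (B x))) =
    cint (fun x => cint (fun y' => B x y * conjc' (B x y'))).
  apply: eq_cint => x; rewrite -cint_conj ?cintZ//.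
  have [B0 B0' hB0] := KcE (KBx x).
  apply: (@KcI _ _ _ B0); last by move=> y'; rewrite cmod_conj.
  by apply: ccont_conj; exact: Kc_cont.
rewrite (K2c_Fubini KBy) (le_trans (cmod_cint_le (K2c_cint (K2c_swap KBy))))//.
apply: le_rint; [exact: Kfun_cmod (K2c_cint (K2c_swap KBy))|exact: K2_l KQ|].
exact: hQ.
Qed.

Lemma TTstar n k (B : V n -> V k -> C) (Q : V k -> V k -> R) :
  K2c B -> K2 Q ->
  (forall y y', cmod (cint (fun x => B x y * conjc' (B x y'))) <= Q y y') ->
  rint (fun x => cmod (cint (B x)) ^+ 2) <= rint (fun y => rint (Q y)).
Proof.
move=> KB; have [cB _] := KB; have [D D0 hD] := K2c_ge0 KB.
apply: (TTstar_weighted (beta := @omega R n) cB D0 ler01 hD).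
  by move=> x; rewrite omega_ge0 omega_le1.
by move=> x; rewrite mul1r expr2 ler_piMr ?omega_ge0 ?omega_le1.
Qed.

Lemma omega_exp_le n (x : V n) L : omega x ^+ L.+1 <= omega x.
Proof. by rewrite exprS ler_piMr ?omega_ge0// exprn_ile1 ?omega_ge0 ?omega_le1. Qed.

Lemma continuous_exprn (T : topologicalType) (f : T -> R) k :
  continuous f -> continuous (fun t => f t ^+ k).
Proof.
by move=> cf; apply: (continuous_comp' (g := fun x : R => x ^+ k) cf); exact: exprn_continuous.
Qed.

Lemma continuous_omega_affine n (c : R) (x0 : V n) :
  continuous (fun x : V n => omega (c *: (x - x0))).
Proof.
apply: continuous_comp' (@continuous_omega R n).
apply: continuous_scale; first exact: continuous_cst.
by apply: continuous_subV; cont_proj.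
Qed.

Lemma Kfun_omega_exp n (c : R) (x0 : V n) L : 0 < c ->
  Kfun (fun x => omega (c *: (x - x0)) ^+ L.+1).
Proof.
move=> c0; apply: Kfun_le (Kfun_omega_affine x0 c0) _.
  by apply: continuous_exprn; exact: continuous_omega_affine.
by move=> x; rewrite ger0_norm ?exprn_ge0 ?omega_ge0// omega_exp_le.
Qed.

Lemma rint_omega_exp_le n (c : R) (x0 : V n) L : 0 < c ->
  rint (fun x => omega (c *: (x - x0)) ^+ L.+1) <= (pi / c) ^+ n.
Proof.
move=> c0; rewrite (le_trans _ (rint_omega_affine_le x0 c0))//.
apply: le_rint; [exact: Kfun_omega_exp|exact: Kfun_omega_affine|].
by move=> x; exact: omega_exp_le.
Qed.

End TTstar.

(** * Symbols at one dyadic frequency and their bilinear operators *)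

Section CoreEstimate.
Context {R : realType} (n : nat).
Local Notation C := (R[i]).
Local Notation V := ('rV[R]_n).
Local Notation X3 := (V * V * V)%type.
Local Notation Re := (@complex.Re R).
Local Notation Im := (@complex.Im R).
Local Open Scope complex_scope.
Variables m rho delta : R.
Hypothesis rho_gt0 : 0 < rho.
Hypothesis rho_delta : rho <= delta.
(* A parameter [(j, u)] carries the dyadic frequency [2 ^ j] and the centre [u]
   of the spatial localisation. *)
Local Notation P := (nat * V)%type.

(* Directions [0 <= v < n] are the [x_i], then come the [xi_i], then the [eta_i],
   in the order in which [mdirs] lists them. *)
Definition vec3 (v : nat) : X3 :=
  if (v < n)%N then (evec n v, 0, 0)
  else if (v < n + n)%N then (0, evec n (v - n), 0) else (0, 0, evec n (v - (n + n))).

Definition dy (p : P) : R := 2 ^+ p.1.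

Lemma dy_ge1 p : 1 <= dy p. Proof. by rewrite exprn_ege1// ler1n. Qed.
Lemma dy_gt0 p : 0 < dy p. Proof. exact: lt_le_trans (dy_ge1 p). Qed.

Definition dyX (e : R) (p : P) : R := dy p `^ e.
Lemma dyX_gt0 e p : 0 < dyX e p. Proof. by rewrite powR_gt0 ?dy_gt0. Qed.
Hint Resolve dyX_gt0 dy_gt0 : core.

(** The scales of the symbol class, with the size of the frequency replaced by [2 ^ j]. *)
Definition sc3 (p : P) (v : nat) (X : X3) : R :=
  if (v < n)%N then dyX delta p else (dyX rho p)^-1.

Definition psi (p : P) (xi : V) : R := omega ((dy p)^-1 *: xi).
Definition kappa (e : R) (p : P) (x : V) : R := omega (dyX e p *: (x - p.2)).

(** The size of a symbol of order [m] at frequency [2 ^ j]. Polynomial tails stand for compact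
    support, with [N] powers in space and [M] in frequency; later steps spend these powers. *)
Definition W3 (N M : nat) (p : P) (X : X3) : R :=
  dyX m p * kappa delta p X.1.1 ^+ N * (psi p X.1.2 * psi p X.2) ^+ M.

Lemma psi_ge0 p xi : 0 <= psi p xi. Proof. exact: omega_ge0. Qed.
Lemma psi_gt0 p xi : 0 < psi p xi. Proof. exact: omega_gt0. Qed.
Lemma psi_le1 p xi : psi p xi <= 1. Proof. exact: omega_le1. Qed.
Lemma kappa_ge0 e p xi : 0 <= kappa e p xi. Proof. exact: omega_ge0. Qed.
Lemma kappa_gt0 e p xi : 0 < kappa e p xi. Proof. exact: omega_gt0. Qed.
Lemma kappa_le1 e p xi : kappa e p xi <= 1. Proof. exact: omega_le1. Qed.

Ltac nng := repeat first
  [ assumption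
  | lazymatch goal with
    | |- is_true (0 <= _ * _) => apply: mulr_ge0
    | |- is_true (0 <= _ + _) => apply: addr_ge0
    | |- is_true (0 <= _ ^+ _) => apply: exprn_ge0
    | |- is_true (0 <= _^-1) => rewrite invr_ge0
    | |- is_true (0 <= cmod _) => exact: cmod_ge0
    | |- is_true (0 <= `|_|) => exact: normr_ge0
    | |- is_true (0 <= omega _) => exact: omega_ge0
    | |- is_true (0 <= psi _ _) => exact: psi_ge0
    | |- is_true (0 <= kappa _ _ _) => exact: kappa_ge0
    | |- is_true (0 <= dyX _ _) => exact: (ltW (dyX_gt0 _ _))
    | |- is_true (0 <= dy _) => exact: (ltW (dy_gt0 _))
    | |- is_true (0 <= pi) => exact: pi_ge0
    | |- is_true (0 <= _%:R) => exact: ler0n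
    | |- is_true (0 <= 1) => exact: ler01
    end ].

Lemma psiE p xi : psi p xi = omega ((dy p)^-1 *: (xi - 0)).
Proof. by rewrite subr0. Qed.

Lemma continuous_psi p : continuous (psi p).
Proof.
have -> : psi p = (fun xi => omega ((dy p)^-1 *: (xi - 0))) by apply/funext => xi; exact: psiE.
exact: continuous_omega_affine.
Qed.

Lemma Kfun_psiX p L : Kfun (fun xi => psi p xi ^+ L.+1).
Proof. by under eq_fun do rewrite psiE; apply: Kfun_omega_exp; rewrite invr_gt0. Qed.

Lemma Kfun_psi p : Kfun (psi p).
Proof. by have := Kfun_psiX p 0; under eq_fun do rewrite expr1. Qed.

Lemma rint_psiX_le p L : rint (fun xi => psi p xi ^+ L.+1) <= (pi * dy p) ^+ n.
Proof.
under eq_rint do rewrite psiE; rewrite (le_trans (rint_omega_exp_le _ _ _)) ?invr_gt0//.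
by rewrite invrK.
Qed.

Lemma rint_psi_le p : rint (psi p) <= (pi * dy p) ^+ n.
Proof. by have := rint_psiX_le p 0; under eq_rint do rewrite expr1. Qed.

Lemma W3_ge0 N M p X : 0 <= W3 N M p X.
Proof. by rewrite !mulr_ge0 ?exprn_ge0 ?kappa_ge0 ?mulr_ge0 ?psi_ge0// ltW. Qed.

Lemma sc3_ge0 p v X : 0 <= sc3 p v X.
Proof. by rewrite /sc3; case: ifP => _; rewrite ?invr_ge0 ltW. Qed.

(** Along the directions of [x] the frequencies are spectators: they join the parameter, which makes
    the constants uniform in them. *)
Lemma sclass_slice k i (W b : P -> X3 -> R) : (i <= n)%N ->
  sclass vec3 sc3 k i W b ->
  sclass (evec n) (fun (q : P * V * V) (_ : nat) (_ : V) => dyX delta q.1.1) k i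
    (fun q x => W q.1.1 (x, q.1.2, q.2)) (fun q x => b q.1.1 (x, q.1.2, q.2)).
Proof.
elim: k i W b => [|k IH] i W b ii [c [[D hD] H]].
  split; [|split => //]; last by exists D => q x; exact: hD.
  move=> q; apply: continuous_comp' (c q.1.1).
  by cont_proj.
split; [|split]; last 2 first.
- by exists D => q x; exact: hD.
- move=> v vi; have [d S] := H v vi.
  have vn : (v < n)%N by exact: leq_trans ii.
  have dE q x : is_derive x (evec n v) (fun x => b q.1.1 (x, q.1.2, q.2))
      (Dv vec3 v b q.1.1 (x, q.1.2, q.2)).
    apply: (@is_derive_along _ _ _ (fun x => (x, q.1.2, q.2)) (b q.1.1) _ _ (vec3 v)).
      by move=> s; rewrite /vec3 vn; congr (_, _, _); rewrite /= scaler0 add0r.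
    by apply: DeriveDef.
  split; first by move=> q x; case: (dE q x).
  apply: (eq_sclass (b := fun q x => Dv vec3 v b q.1.1 (x, q.1.2, q.2))).
    by move=> q x; case: (dE q x) => _ <-.
  apply: eq_sclassW (IH _ _ _ vn S) => q x.
  by rewrite /sc3 vn.
move=> q; apply: continuous_comp' (c q.1.1).
by cont_proj.
Qed.

Definition bdc (Phi : V -> C) := ccont Phi /\ exists B, forall xi, cmod (Phi xi) <= B.

(* The frequency-localised energy through which both inputs are measured. *)
Definition NN (p : P) (Phi : V -> C) : R := rint (fun xi => psi p xi * cmod (Phi xi) ^+ 2).

Lemma bdc_ge0 Phi : bdc Phi -> exists2 B, 0 <= B & forall xi, cmod (Phi xi) <= B.
Proof. by move=> [_ [B hB]]; exists B => //; exact: le_trans (cmod_ge0 _) (hB 0). Qed.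

Lemma bdc_sqr_cont Phi : bdc Phi -> continuous (fun xi => cmod (Phi xi) ^+ 2).
Proof. by move=> [cP _]; apply: continuous_exprn; exact: ccont_cmod. Qed.

Lemma Kfun_NN p Phi : bdc Phi -> Kfun (fun xi => psi p xi * cmod (Phi xi) ^+ 2).
Proof.
move=> bP; have [B B0 hB] := bdc_ge0 bP.
have : Kfun (fun xi => cmod (Phi xi) ^+ 2 * psi p xi).
  apply: (@KfunM _ _ _ _ (B ^+ 2)); [exact: bdc_sqr_cont| |exact: Kfun_psi].
  by move=> x; rewrite normrX ger0_norm ?cmod_ge0// lerXn2r ?nnegrE ?cmod_ge0.
by under eq_fun do rewrite mulrC.
Qed.

Lemma NN_ge0 p Phi : 0 <= NN p Phi.
Proof. by apply: rint_ge0 => xi; rewrite mulr_ge0 ?psi_ge0 ?sqr_ge0. Qed.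

Section FixedSymbol.
Variables (N M : nat) (b : P -> X3 -> R).
Hypothesis Sb : sclass vec3 sc3 n.*2 n (W3 N.+1 M.+2) b.

Definition Bker (p : P) (Phi : V -> C) (eta x xi : V) : C :=
  (b p (x, xi, eta))%:C * cexpi (dotp x xi) * Phi xi.

Lemma symbol_bound : exists2 D, 0 <= D & forall p X, `|b p X| <= D * W3 N.+1 M.+2 p X.
Proof.
have [D hD] := sclass_bound Sb; exists `|D| => // p X.
by rewrite (le_trans (hD p X))// ler_wpM2r ?W3_ge0// ler_norm.
Qed.

Lemma kappa_le_omega e p : exists2 D, 0 <= D & forall x, kappa e p x <= D * omega x.
Proof.
have [B B0 hB] := KfunE (Kfun_omega_affine p.2 (dyX_gt0 e p)); exists B => // x.
by rewrite (le_trans _ (hB x))// ler_norm.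
Qed.

Lemma psi_le_omega p : exists2 D, 0 <= D & forall x, psi p x <= D * omega x.
Proof.
by have [B B0 hB] := KfunE (Kfun_psi p); exists B => // x; rewrite (le_trans _ (hB x))// ler_norm.
Qed.

Lemma W3_le p x xi eta : W3 N.+1 M.+2 p (x, xi, eta) <=
  dyX m p * kappa delta p x * psi p xi ^+ M.+2 * psi p eta ^+ M.+2.
Proof.
rewrite /W3/= exprMn mulrA; do 2 (apply: ler_wpM2r; first by nng).
by apply: ler_wpM2l; [nng|exact: omega_exp_le].
Qed.

Lemma K2c_Bker p Phi eta : bdc Phi -> K2c (Bker p Phi eta).
Proof.
move=> bP; have [cP _] := bP; have [B B0 hB] := bdc_ge0 bP.
have [D D0 hD] := symbol_bound; split.
  apply: ccontM; last by apply: (ccont_comp _ cP); cont_proj.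
  apply: ccontM.
    apply: ccontR; apply: continuous_comp' (sclass_cont Sb p); cont_proj.
  by apply: ccont_cexpi; apply: continuous_dotp; cont_proj.
have [E E0 hE] := kappa_le_omega delta p; have [F F0 hF] := psi_le_omega p.
exists (D * (dyX m p * E * F) * B) => x xi.
rewrite !cmodM cmod_cexpi mulr1 cmodR.
rewrite (_ : _ * B * _ * _ = D * (dyX m p * (E * omega x) * (F * omega xi)) * B); last by ring.
rewrite ler_pM ?cmod_ge0 ?hB// (le_trans (hD _ _))// ler_wpM2l// (le_trans (W3_le _ _ _ _))//.
rewrite -[leRHS]mulr1; apply: ler_pM; [by nng|by nng| |]; last first.
  by rewrite exprn_ile1 ?psi_ge0 ?psi_le1.
apply: ler_pM; [by nng|by nng| |exact: le_trans (omega_exp_le _ _) (hF xi)].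
by apply: ler_wpM2l; [nng|exact: hE].
Qed.

(* For fixed [eta], T T* in [xi]: integrating by parts in [x] makes the kernel
   decay in [xi - xi'] at scale [2 ^ (delta j)], and the Schur test applies. *)
Lemma slice_L2 : exists2 D, 0 <= D & forall p eta Phi, bdc Phi ->
  rint (fun x => cmod (cint (Bker p Phi eta x)) ^+ 2) <=
    D * (dyX m p ^+ 2 * psi p eta ^+ M.+2) * NN p Phi.
Proof.
(* A parameter is [(p, xi, xi', eta)]; the two factors of the T T* kernel share [eta]. *)
pose Q := (P * V * V * V)%type.
have S1 : sclass (evec n) (fun (q : Q) (_ : nat) (_ : V) => dyX delta q.1.1.1) n.*2 n
    (fun q x => W3 N.+1 M.+2 q.1.1.1 (x, q.1.1.2, q.2)) (fun q x => b q.1.1.1 (x, q.1.1.2, q.2)).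
  exact: (sclass_reparam (fun q : Q => (q.1.1, q.2)) (sclass_slice (leqnn n) Sb)).
have S2 : sclass (evec n) (fun (q : Q) (_ : nat) (_ : V) => dyX delta q.1.1.1) n.*2 n
    (fun q x => W3 N.+1 M.+2 q.1.1.1 (x, q.1.2, q.2)) (fun q x => b q.1.1.1 (x, q.1.2, q.2)).
  exact: (sclass_reparam (fun q : Q => (q.1.1.1, q.1.2, q.2)) (sclass_slice (leqnn n) Sb)).
have S12 := sclassM S1 S2.
pose c (q : Q) : R := dyX m q.1.1.1 ^+ 2 *
  ((psi q.1.1.1 q.1.1.2 * psi q.1.1.1 q.2) ^+ M.+2 * (psi q.1.1.1 q.1.2 * psi q.1.1.1 q.2) ^+ M.+2).
have c0 q : 0 <= c q.
  by rewrite /c; nng.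
have WE q x : W3 N.+1 M.+2 q.1.1.1 (x, q.1.1.2, q.2) * W3 N.+1 M.+2 q.1.1.1 (x, q.1.2, q.2) =
    c q * kappa delta q.1.1.1 x ^+ (N + N.+1).+1.
  by rewrite /W3/c/= -addSn exprD; ring.
have {}S12 := eq_sclassW WE S12.
have KW (q : Q) : Kfun (fun x => c q * kappa delta q.1.1.1 x ^+ (N + N.+1).+1).
  by apply: KfunZ; exact: Kfun_omega_exp.
have [D hD] := cint_omega_decay (fun q : Q => dyX_gt0 delta q.1.1.1) KW S12.
exists (`|D| * (pi ^+ n * pi ^+ n)); first by nng.
move=> p eta Phi bP; have [cP _] := bP; have [B B0 hB] := bdc_ge0 bP.
set A := `|D| * (dyX m p ^+ 2 * psi p eta ^+ M.+2 ^+ 2) * (pi / dyX delta p) ^+ n.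
have A0 : 0 <= A.
  by rewrite /A; nng.
pose Ph xi := psi p xi ^+ M.+2 * cmod (Phi xi).
have KPh : Kfun Ph.
  rewrite /Ph; under eq_fun do rewrite mulrC.
  apply: (@KfunM _ _ _ _ B); [exact: ccont_cmod| |exact: Kfun_psiX].
  by move=> x; rewrite ger0_norm ?cmod_ge0.
have d0 : 0 < (dyX delta p)^-1 by rewrite invr_gt0.
have KQ : K2 (fun xi xi' => A * (Ph xi * Ph xi' * omega ((dyX delta p)^-1 *: (xi - xi')))).
  apply: K2Z; have [cPh _] := KPh; have [E E0 hE] := KfunE KPh; split.
    apply: continuous_mul; last exact: continuous_omega_sub.
    by apply: continuous_mul; apply: continuous_comp' cPh; cont_proj.
  exists (E * E) => x y; rewrite normrM [X in _ * X]ger0_norm ?omega_ge0//.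
  rewrite (_ : E * E * _ * _ = (E * omega x) * (E * omega y) * 1); last by ring.
  by rewrite ler_pM ?omega_le1 ?omega_ge0// normrM ler_pM.
apply: le_trans (TTstar (K2c_Bker p eta bP) KQ _) _.
  move=> xi xi'.
  have -> : cint (fun x => Bker p Phi eta x xi * conjc' (Bker p Phi eta x xi')) =
      (Phi xi * conjc' (Phi xi')) *
      cint (fun x => (b p (x, xi, eta) * b p (x, xi', eta))%:C * cexpi (dotp x (xi - xi'))).
    rewrite -cintZ; last first.
      apply: KcM_cexpi.
      have [D' hD'] := sclass_bound S12.
      apply: (Kfun_le (g := fun x => D' * (c (p, xi, xi', eta) * kappa delta p x ^+ (N + N.+1).+1))).
      - exact: (sclass_cont S12 (p, xi, xi', eta)).
      - exact: KfunZ (KW (p, xi, xi', eta)).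
      - by move=> x; exact: (hD' (p, xi, xi', eta) x).
    apply: eq_cint => x; rewrite /Bker !conjM dotpDr dotpNr cexpiD conj_cexpi.
    have -> : conjc' (b p (x, xi', eta))%:C = (b p (x, xi', eta))%:C.
      by rewrite /conjc' /= oppr0.
    by rewrite rmorphM/=; ring.
  rewrite cmodM cmodM cmod_conj.
  have := hD (p, xi, xi', eta) (xi - xi') => /=.
  rewrite rintZ; last exact: Kfun_omega_exp.
  set I := rint _ => hD1.
  have hI : I <= (pi / dyX delta p) ^+ n by exact: rint_omega_exp_le.
  have I0 : 0 <= I by apply: rint_ge0 => x; rewrite exprn_ge0 ?kappa_ge0.
  rewrite (le_trans (ler_wpM2l _ hD1)) ?mulr_ge0 ?cmod_ge0//.
  rewrite (_ : A * _ = cmod (Phi xi) * cmod (Phi xi') *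
      (`|D| * (c (p, xi, xi', eta) * (pi / dyX delta p) ^+ n) * omega ((dyX delta p)^-1 *: (xi - xi')))); last first.
    rewrite /A /c /Ph /= ![(psi _ _ * psi _ _) ^+ _]exprMn.
    set e1 := psi p xi ^+ _; set e2 := psi p xi' ^+ _; set e3 := psi p eta ^+ _.
    by set e4 := (pi / _) ^+ n; ring.
  rewrite ler_wpM2l ?mulr_ge0 ?cmod_ge0// ler_wpM2r ?omega_ge0//.
  apply: (le_trans (ler_wpM2r (mulr_ge0 (c0 _) I0) (ler_norm D))).
  by apply: ler_wpM2l => //; exact: ler_wpM2l.
have KS : K2 (fun xi xi' => Ph xi * Ph xi' * omega ((dyX delta p)^-1 *: (xi - xi'))).
  have [cPh _] := KPh; have [E E0 hE] := KfunE KPh; split.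
    apply: continuous_mul; last exact: continuous_omega_sub.
    by apply: continuous_mul; apply: continuous_comp' cPh; cont_proj.
  exists (E * E) => x y; rewrite normrM [X in _ * X]ger0_norm ?omega_ge0//.
  rewrite (_ : E * E * _ * _ = (E * omega x) * (E * omega y) * 1); last by ring.
  by rewrite ler_pM ?omega_le1 ?omega_ge0// normrM ler_pM.
rewrite (_ : rint _ = A * rint (fun xi => rint (fun xi' =>
    Ph xi * Ph xi' * omega ((dyX delta p)^-1 *: (xi - xi'))))); last first.
  rewrite -rintZ; last exact: K2_rint KS.
  by apply: eq_rint => xi; rewrite rintZ//; exact: K2_l KS.
rewrite (le_trans (ler_wpM2l A0 (Schur_bound d0 KPh)))// invrK.
(* The volume of the spatial ball, from the integral in [x], cancels the mass of the kernel in the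
   Schur test: no power of [2 ^ j] is left beyond the order [m]. *)
have -> : A * ((pi * dyX delta p) ^+ n * rint (fun x => Ph x ^+ 2)) =
    `|D| * (pi ^+ n * pi ^+ n) * (dyX m p ^+ 2 * psi p eta ^+ M.+2 ^+ 2) * rint (fun x => Ph x ^+ 2).
  rewrite /A !expr_div_n [(pi * dyX delta p) ^+ n]exprMn.
  by field; rewrite expf_neq0// gt_eqF.
apply: ler_pM; [by nng| |apply: ler_wpM2l; first by nng|].
- by apply: rint_ge0 => x; exact: sqr_ge0.
- apply: ler_wpM2l; first by nng.
  rewrite expr2 ler_piMr ?exprn_ge0 ?psi_ge0// exprn_ile1 ?psi_ge0 ?psi_le1//.
- apply: le_rint; [exact: Kfun_sqr|exact: Kfun_NN|] => x.
  rewrite /Ph exprMn; apply: ler_wpM2r; first by nng.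
  rewrite -exprM mulnC -[leRHS]expr1.
  by rewrite ler_wiXn2l// ?psi_ge0 ?psi_le1.
Qed.

Definition Tbil (p : P) (Phi Gam : V -> C) (x : V) : C :=
  cint (fun eta => cint (fun xi =>
    (b p (x, xi, eta))%:C * cexpi (dotp x (xi + eta)) * Phi xi * Gam eta)).

Lemma TbilE p Phi Gam x : bdc Phi ->
  Tbil p Phi Gam x =
  cint (fun eta => cexpi (dotp x eta) * Gam eta * cint (Bker p Phi eta x)).
Proof.
move=> bP; apply: eq_cint => eta; rewrite -cintZ; last exact: K2c_l (K2c_Bker p eta bP).
by apply: eq_cint => xi; rewrite /Bker dotpDr cexpiD; ring.
Qed.

(** The bound involves the sup of [Phi], so it serves to place integrands in the classes where
    Fubini and Cauchy-Schwarz hold, not to produce constants. *)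
Lemma H_bound : exists2 D, 0 <= D & forall p Phi B eta x, bdc Phi -> 0 <= B ->
  (forall xi, cmod (Phi xi) <= B) ->
  cmod (cint (Bker p Phi eta x)) <=
    D * dyX m p * kappa delta p x * psi p eta ^+ M.+2 * (B * rint (fun xi => psi p xi ^+ M.+2)).
Proof.
have [D D0 hD] := symbol_bound; exists D => // p Phi B eta x bP B0 hB.
have KB := K2c_l x (K2c_Bker p eta bP).
rewrite (le_trans (cmod_cint_le KB))// mulrA -rintZ; last exact: Kfun_psiX.
apply: le_rint; [exact: Kfun_cmod|apply: KfunZ; exact: Kfun_psiX|] => xi.
rewrite !cmodM cmod_cexpi mulr1 cmodR.
rewrite (_ : _ * B * _ = D * (dyX m p * kappa delta p x * psi p xi ^+ M.+2 * psi p eta ^+ M.+2) * B); last by ring.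
apply: ler_pM; [by nng|by nng| |exact: hB].
by rewrite (le_trans (hD _ _))// ler_wpM2l// W3_le.
Qed.

Lemma ccont_H p Phi : bdc Phi ->
  ccont (fun z : V * V => cint (Bker p Phi z.2 z.1)).
Proof.
move=> bP; have [cP _] := bP; have [B B0 hB] := bdc_ge0 bP.
have [D D0 hD] := symbol_bound; have [F F0 hF] := psi_le_omega p.
apply: (@cint_param _ _ _ (fun z xi => Bker p Phi z.2 z.1 xi) (D * dyX m p * F * B)).
  apply: ccontM; last by apply: (ccont_comp _ cP); cont_proj.
  apply: ccontM.
    apply: ccontR; apply: continuous_comp' (sclass_cont Sb p); cont_proj.
  by apply: ccont_cexpi; apply: continuous_dotp; cont_proj.
move=> [x eta] xi /=; rewrite !cmodM cmod_cexpi mulr1 cmodR.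
rewrite (_ : _ * B * _ = D * (dyX m p * (F * omega xi)) * B); last by ring.
apply: ler_pM; [by nng|by nng| |exact: hB].
rewrite (le_trans (hD _ _))// ler_wpM2l// (le_trans (W3_le _ _ _ _))//.
rewrite -[leRHS]mulr1; apply: ler_pM; [by nng|by nng| |by rewrite exprn_ile1 ?psi_ge0 ?psi_le1].
apply: ler_pM; [by nng|by nng| |exact: le_trans (omega_exp_le _ _) (hF xi)].
by rewrite ler_piMr ?kappa_le1//; nng.
Qed.

Lemma K2c_T p Phi Gam : bdc Phi -> bdc Gam ->
  K2c (fun x eta => cexpi (dotp x eta) * Gam eta * cint (Bker p Phi eta x)).
Proof.
move=> bP bG; have [cG _] := bG; have [B B0 hB] := bdc_ge0 bP; have [B' B0' hB'] := bdc_ge0 bG.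
split.
  apply: ccontM; last by apply: (ccont_comp _ (ccont_H p bP)); cont_proj.
  apply: ccontM; last by apply: (ccont_comp _ cG); cont_proj.
  by apply: ccont_cexpi; apply: continuous_dotp; cont_proj.
have [D D0 hD] := H_bound.
have [E E0 hE] := kappa_le_omega delta p; have [F F0 hF] := psi_le_omega p.
set I := rint (fun xi => psi p xi ^+ M.+2).
have I0 : 0 <= I by apply: rint_ge0 => xi; nng.
exists (B' * (D * dyX m p * E * F * (B * I))) => x eta.
rewrite !cmodM cmod_cexpi mul1r.
rewrite (_ : _ * omega x * _ = B' * (D * dyX m p * (E * omega x) * (F * omega eta) * (B * I))); last by ring.
apply: ler_pM; [by nng|by nng|exact: hB'|].
rewrite (le_trans (hD p Phi B eta x bP B0 hB))//.
apply: ler_wpM2r; first by nng.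
apply: ler_pM; [by nng|by nng| |exact: le_trans (omega_exp_le _ _) (hF eta)].
by apply: ler_wpM2l; [nng|exact: hE].
Qed.

Lemma Kc_Tbil p Phi Gam : bdc Phi -> bdc Gam -> Kc (Tbil p Phi Gam).
Proof.
move=> bP bG; have := K2c_cint (K2c_T p bP bG).
by have -> : Tbil p Phi Gam = (fun x => cint (fun eta => cexpi (dotp x eta) * Gam eta *
  cint (Bker p Phi eta x))) by apply/funext => x; exact: TbilE.
Qed.

(** Absolute values are taken inside, then Cauchy-Schwarz in [xi] and in [eta]; each variable costs
    the mass [(pi * dy p) ^+ n] of [psi]. *)
Lemma Tbil_sup : exists2 D, 0 <= D & forall p Phi Gam, bdc Phi -> bdc Gam ->
  forall x, cmod (Tbil p Phi Gam x) ^+ 2 <=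
    D * (dyX m p ^+ 2 * (dy p ^+ n) ^+ 2) * (NN p Phi * NN p Gam).
Proof.
have [D D0 hD] := symbol_bound; exists (D ^+ 2 * (pi ^+ n) ^+ 2); first by nng.
move=> p Phi Gam bP bG x.
have L1 Ph : bdc Ph -> Kfun (fun xi => psi p xi ^+ M.+2 * cmod (Ph xi)).
  move=> [cP [B hB]]; under eq_fun do rewrite mulrC.
  apply: (@KfunM _ _ _ _ B); [exact: ccont_cmod| |exact: Kfun_psiX].
  by move=> y; rewrite ger0_norm ?cmod_ge0.
have CS Ph : bdc Ph -> rint (fun xi => psi p xi ^+ M.+2 * cmod (Ph xi)) ^+ 2 <=
    (pi * dy p) ^+ n * NN p Ph.
  move=> bPh; pose f xi := Num.sqrt (psi p xi) ; pose g xi := Num.sqrt (psi p xi) * cmod (Ph xi).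
  have fE xi : f xi ^+ 2 = psi p xi by rewrite sqr_sqrtr ?psi_ge0.
  have gE xi : g xi ^+ 2 = psi p xi * cmod (Ph xi) ^+ 2 by rewrite exprMn sqr_sqrtr ?psi_ge0.
  have fgE xi : f xi * g xi = psi p xi * cmod (Ph xi) by rewrite mulrA -expr2 sqr_sqrtr ?psi_ge0.
  have Kfg : Kfun (fun xi => psi p xi * cmod (Ph xi)).
    have [cP [B hB]] := bPh; under eq_fun do rewrite mulrC.
    apply: (@KfunM _ _ _ _ B); [exact: ccont_cmod| |exact: Kfun_psi].
    by move=> y; rewrite ger0_norm ?cmod_ge0.
  have := @rint_Cauchy_Schwarz _ _ f g.
  rewrite (_ : (fun x => f x ^+ 2) = psi p); last by apply/funext.
  rewrite (_ : (fun x => g x ^+ 2) = (fun xi => psi p xi * cmod (Ph xi) ^+ 2)); last by apply/funext.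
  rewrite (_ : (fun x => f x * g x) = (fun xi => psi p xi * cmod (Ph xi))); last by apply/funext.
  move=> /(_ (Kfun_psi p) (Kfun_NN p bPh) Kfg) h.
  apply: (@le_trans _ _ (rint (fun xi => psi p xi * cmod (Ph xi)) ^+ 2)).
    rewrite lerXn2r ?nnegrE//; try by apply: rint_ge0 => xi; nng.
    apply: le_rint => //; first exact: L1.
    by move=> xi; apply: ler_wpM2r; [nng|exact: omega_exp_le].
  rewrite (le_trans h)// ler_wpM2r ?NN_ge0//; exact: rint_psi_le.
have T1 : cmod (Tbil p Phi Gam x) <= D * dyX m p *
    (rint (fun xi => psi p xi ^+ M.+2 * cmod (Phi xi)) * rint (fun xi => psi p xi ^+ M.+2 * cmod (Gam xi))).
  rewrite TbilE// (le_trans (cmod_cint_le (K2c_l x (K2c_T p bP bG))))//.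
  rewrite mulrA -rintZ; last exact: L1.
  apply: le_rint; [exact: Kfun_cmod (K2c_l x (K2c_T p bP bG))|apply: KfunZ; exact: L1|] => eta.
  rewrite !cmodM cmod_cexpi mul1r.
  have KB := K2c_l x (K2c_Bker p eta bP).
  set I := rint _.
  rewrite (_ : _ * (_ * cmod _) = cmod (Gam eta) * (D * dyX m p * psi p eta ^+ M.+2 * I)); last by ring.
  apply: ler_wpM2l; first by nng.
  rewrite (le_trans (cmod_cint_le KB))// -rintZ; last exact: L1.
  apply: le_rint; [exact: Kfun_cmod|apply: KfunZ; exact: L1|] => xi.
  rewrite !cmodM cmod_cexpi mulr1 cmodR mulrA; apply: ler_wpM2r; first by nng.
  rewrite (_ : _ * dyX m p * _ * _ = D * (dyX m p * 1 * psi p xi ^+ M.+2 * psi p eta ^+ M.+2)).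
    rewrite (le_trans (hD _ _))// ler_wpM2l// (le_trans (W3_le _ _ _ _))//.
    do 2 (apply: ler_wpM2r; first by nng).
    by apply: ler_wpM2l; [nng|exact: kappa_le1].
  by ring.
apply: (le_trans (_ : _ <= (D * dyX m p *
    (rint (fun xi => psi p xi ^+ M.+2 * cmod (Phi xi)) * rint (fun xi => psi p xi ^+ M.+2 * cmod (Gam xi)))) ^+ 2)).
  rewrite lerXn2r ?nnegrE ?cmod_ge0//; apply: mulr_ge0; first by nng.
  by apply: mulr_ge0; apply: rint_ge0 => xi; nng.
rewrite !exprMn (_ : _ * (dyX m p ^+ 2 * _) * _ =
  (D ^+ 2 * dyX m p ^+ 2) * (((pi * dy p) ^+ n * NN p Phi) * ((pi * dy p) ^+ n * NN p Gam))); last first.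
  by rewrite !exprMn; ring.
by apply: ler_wpM2l; [nng|apply: ler_pM; [exact: sqr_ge0|exact: sqr_ge0|exact: CS|exact: CS]].
Qed.

(** Cauchy-Schwarz in [eta] alone, with weights [psi] and its inverse, then [slice_L2] for each
    [eta]. One frequency variable instead of two costs the mass of [psi], whence the gain of [n / 2]
    over the sup bound. *)
Lemma Tbil_L2 : exists2 D, 0 <= D & forall p Phi Gam, bdc Phi -> bdc Gam ->
  rint (fun x => cmod (Tbil p Phi Gam x) ^+ 2) <=
    D * (dyX m p ^+ 2 * dy p ^+ n) * (NN p Phi * NN p Gam).
Proof.
have [D D0 hD] := slice_L2; exists (D * pi ^+ n); first by nng.
move=> p Phi Gam bP bG.
have [B B0 hB] := bdc_ge0 bP; have [B' B0' hB'] := bdc_ge0 bG; have [cG _] := bG.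
have [E E0 hE] := H_bound.
pose H x eta := cint (Bker p Phi eta x).
pose I := rint (fun xi => psi p xi ^+ M.+2).
have I0 : 0 <= I by apply: rint_ge0 => xi; nng.
pose A := E * dyX m p * (B * I).
have A0 : 0 <= A by rewrite /A; nng.
have HA x eta : cmod (H x eta) <= A * kappa delta p x * psi p eta ^+ M.+2.
  by rewrite (le_trans (hE p Phi B eta x bP B0 hB))// le_eqVlt /A/I; apply/orP; left; apply/eqP; ring.
have cH : ccont (fun z : V * V => H z.1 z.2).
  by have := ccont_H p bP.
have psV xi : psi p xi != 0 by rewrite gt_eqF ?psi_gt0.
have cpV : continuous (fun z : V * V => (psi p z.2)^-1).
  apply: (continuous_inv (f := fun z : V * V => psi p z.2)) => //.
  apply: (continuous_comp' (f := fun z : V * V => z.2) (g := psi p)); first by cont_proj.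
  exact: continuous_psi.
have [Ek Ek0 hk] := kappa_le_omega delta p; have [F F0 hF] := psi_le_omega p.
(* Dividing by [psi] is harmless because [H] carries the factor [psi p eta ^+ M.+2]. *)
pose h x eta := (psi p eta)^-1 * cmod (H x eta) ^+ 2.
have hle x eta : h x eta <= A ^+ 2 * kappa delta p x * psi p eta.
  rewrite /h mulrC ler_pdivrMr ?psi_gt0//.
  apply: (le_trans (_ : _ <= (A * kappa delta p x * psi p eta ^+ M.+2) ^+ 2)).
    by rewrite lerXn2r ?nnegrE ?cmod_ge0//; nng.
  rewrite (_ : (A * _ * _) ^+ 2 = A ^+ 2 * (kappa delta p x ^+ 2 * (psi p eta ^+ M.+2) ^+ 2)); last first.
    by move: (psi p eta ^+ M.+2) (kappa delta p x) (A) => e1 e2 e3; ring.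
  rewrite (_ : A ^+ 2 * _ * _ * _ = A ^+ 2 * (kappa delta p x * (psi p eta * psi p eta))); last by ring.
  apply: ler_wpM2l; first by nng.
  apply: ler_pM; [by nng|by nng|exact: (omega_exp_le _ 1)|].
  rewrite -expr2 -exprM; apply: ler_wiXn2l; rewrite ?psi_ge0 ?psi_le1//.
have h0 x eta : 0 <= h x eta by rewrite /h; apply: mulr_ge0; [rewrite invr_ge0; nng|nng].
have Kh : K2 h.
  split; first by apply: continuous_mul => //; apply: continuous_exprn; exact: ccont_cmod.
  exists (A ^+ 2 * Ek * F) => x eta; rewrite ger0_norm// (le_trans (hle x eta))//.
  rewrite (_ : _ * omega x * _ = A ^+ 2 * (Ek * omega x) * (F * omega eta)); last by ring.
  apply: ler_pM; [by nng|by nng| |exact: hF].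
  by apply: ler_wpM2l; [nng|exact: hk].
have KT := K2c_T p bP bG.
have step x : cmod (Tbil p Phi Gam x) ^+ 2 <= NN p Gam * rint (h x).
  pose f eta := Num.sqrt (psi p eta) * cmod (Gam eta).
  pose g eta := (Num.sqrt (psi p eta))^-1 * cmod (H x eta).
  have fE : (fun eta => f eta ^+ 2) = (fun eta => psi p eta * cmod (Gam eta) ^+ 2).
    by apply/funext => eta; rewrite exprMn sqr_sqrtr ?psi_ge0.
  have gE : (fun eta => g eta ^+ 2) = h x.
    by apply/funext => eta; rewrite /g /h exprMn exprVn sqr_sqrtr ?psi_ge0.
  have fgE : (fun eta => f eta * g eta) =
      (fun eta => cmod (cexpi (dotp x eta) * Gam eta * cint (Bker p Phi eta x))).
    apply/funext => eta; rewrite /f /g !cmodM cmod_cexpi mul1r mulrACA -[RHS]mul1r; congr (_ * _).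
    by rewrite mulfV// gt_eqF// sqrtr_gt0 psi_gt0.
  have := @rint_Cauchy_Schwarz _ _ f g; rewrite fE gE fgE.
  move=> /(_ (Kfun_NN p bG) (K2_l x Kh) (Kfun_cmod (K2c_l x KT))); apply: le_trans.
  rewrite lerXn2r ?nnegrE ?cmod_ge0//; first by apply: rint_ge0 => y; nng.
  by rewrite TbilE//; exact: cmod_cint_le (K2c_l x KT).
have KTb := Kfun_sqr (Kfun_cmod (Kc_Tbil p bP bG)).
apply: (@le_trans _ _ (NN p Gam * rint (fun x => rint (h x)))).
  rewrite -rintZ; last exact: K2_rint.
  by apply: le_rint => //; apply: KfunZ; exact: K2_rint.
rewrite (K2_Fubini Kh) mulrC (_ : D * _ * _ * _ =
  (D * dyX m p ^+ 2 * NN p Phi * (pi * dy p) ^+ n) * NN p Gam); last by rewrite exprMn; ring.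
apply: ler_wpM2r; first exact: NN_ge0.
apply: (@le_trans _ _ (D * dyX m p ^+ 2 * NN p Phi * rint (psi p))); last first.
  by apply: ler_wpM2l; [apply: mulr_ge0; [nng|exact: NN_ge0]|exact: rint_psi_le].
rewrite -rintZ; last exact: Kfun_psi.
apply: le_rint; [exact: K2_rint (K2_swap Kh)|apply: KfunZ; exact: Kfun_psi|] => eta.
have KHe : Kfun (fun x => cmod (H x eta) ^+ 2).
  exact: Kfun_sqr (Kfun_cmod (K2c_cint (K2c_Bker p eta bP))).
rewrite /h rintZ// mulrC ler_pdivrMr ?psi_gt0//.
apply: (le_trans (hD p eta Phi bP)).
rewrite (_ : D * _ * NN p Phi * _ * _ = D * (dyX m p ^+ 2 * (psi p eta * psi p eta)) * NN p Phi); last by ring.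
apply: ler_wpM2r; first exact: NN_ge0.
do 2 (apply: ler_wpM2l; first by nng).
by rewrite -expr2; apply: ler_wiXn2l; rewrite ?psi_ge0 ?psi_le1.
Qed.

End FixedSymbol.

(** * Peeling off spatial weights *)

Lemma fourier_bdc (F : V -> C) : Kc F -> bdc (fourier F).
Proof.
move=> KF; have [B B0 hB] := KcE KF; have cF := Kc_cont KF.
have h xi y : cmod (cexpi (- dotp y xi) * F y) <= B * omega y by rewrite cmodM cmod_cexpi mul1r.
split.
  apply: (@cint_param _ _ _ (fun xi y => cexpi (- dotp y xi) * F y) B) => //.
  apply: ccontM; last by apply: (ccont_comp _ cF); cont_proj.
  by apply: ccont_cexpi; apply: continuous_opp; apply: continuous_dotp; cont_proj.
exists (B * rint (@omega R n)) => xi.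
have K1 : Kc (fun y => cexpi (- dotp y xi) * F y).
  apply: (@KcM _ _ _ _ 1) => //; last by move=> y; rewrite cmod_cexpi.
  by apply: ccont_cexpi; apply: continuous_opp; apply: continuous_dotp; cont_proj.
rewrite (le_trans (cmod_cint_le K1))// -rintZ; last exact: Kfun_omega.
by apply: le_rint; [exact: Kfun_cmod|exact: KfunZ (Kfun_omega n)|exact: h].
Qed.

(** The Fourier multiplier with symbol [beta], up to the normalising power of [2 * pi]. *)
Definition Umul (beta : V -> R) (F : V -> C) (x : V) : C :=
  cint (fun xi => (beta xi)%:C * cexpi (dotp x xi) * fourier F xi).

Lemma Kc_fourier_int (beta : V -> R) (F : V -> C) x : Kfun beta -> Kc F ->
  Kc (fun xi => (beta xi)%:C * cexpi (dotp x xi) * fourier F xi).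
Proof.
move=> Kb KF; have [cF [B hB]] := fourier_bdc KF.
apply: (@KcMr _ _ (fourier F) (fun xi => (beta xi)%:C * cexpi (dotp x xi)) B) => //.
by have := KcM_cexpi x Kb; under eq_fun do rewrite dotpC.
Qed.

(** In convolution form a coordinate factor becomes a derivative of [beta] through integration by
    parts in the kernel, so [fourier F] never has to be differentiated. *)
Lemma Umul_kernel (beta : V -> R) (F : V -> C) x : Kfun beta -> Kc F ->
  Kc (fun y => F y * cint (fun xi => (beta xi)%:C * cexpi (dotp xi (x - y)))) /\
  Umul beta F x = cint (fun y => F y * cint (fun xi => (beta xi)%:C * cexpi (dotp xi (x - y)))).
Proof.
move=> Kb KF; have [B B0 hB] := KcE KF; have cF := Kc_cont KF.
have [cb _] := Kb; have [E E0 hE] := KfunE Kb.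
have KK : K2c (fun xi y => (beta xi)%:C * cexpi (dotp xi (x - y)) * F y).
  split.
    apply: ccontM; last by apply: (ccont_comp _ cF); cont_proj.
    apply: ccontM; first by apply: ccontR; apply: continuous_comp' cb; cont_proj.
    apply: ccont_cexpi; apply: continuous_dotp; first by cont_proj.
    by apply: continuous_subV; cont_proj.
  exists (E * B) => xi y; rewrite !cmodM cmod_cexpi mulr1 cmodR.
  rewrite (_ : E * B * _ * _ = (E * omega xi) * (B * omega y)); last by ring.
  by apply: ler_pM; [nng|nng| |].
have e1 y : F y * cint (fun xi => (beta xi)%:C * cexpi (dotp xi (x - y))) =
    cint (fun xi => (beta xi)%:C * cexpi (dotp xi (x - y)) * F y).
  by rewrite -cintZ; [apply: eq_cint => xi; rewrite mulrC|exact: KcM_cexpi].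
have -> : (fun y => F y * cint (fun xi => (beta xi)%:C * cexpi (dotp xi (x - y)))) =
    (fun y => cint (fun xi => (beta xi)%:C * cexpi (dotp xi (x - y)) * F y)).
  by apply/funext.
split; first exact: (K2c_cint (K2c_swap KK)).
rewrite -(K2c_Fubini KK); apply: eq_cint => xi.
rewrite /fourier -cintZ; last first.
  apply: (@KcM _ _ _ _ 1) => //; last by move=> y; rewrite cmod_cexpi.
  by apply: ccont_cexpi; apply: continuous_opp; apply: continuous_dotp; cont_proj.
apply: eq_cint => y; rewrite dotpDr dotpNr cexpiD (dotpC y) (dotpC x); ring.
Qed.

(* Multiplying the input by [y_i - c] costs multiplication of the output by
   [x_i - c] and one derivative of the multiplier. *)
Lemma Umul_coord (beta beta' : V -> R) (F F1 : V -> C) (i : 'I_n) (c : R) x :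
  (forall xi, is_derive xi (ebasis R i) beta (beta' xi)) ->
  Kfun beta -> Kfun beta' -> Kc F -> Kc F1 ->
  (forall y, F1 y = (y 0 i - c)%:C * F y) ->
  Umul beta F1 x = (x 0 i - c)%:C * Umul beta F x - 'i * Umul beta' F x.
Proof.
move=> db Kb Kb' KF KF1 F1E.
have [K1 ->] := Umul_kernel x Kb KF1.
have [K2 ->] := Umul_kernel x Kb KF; have [K3 ->] := Umul_kernel x Kb' KF.
rewrite -mulNr -!cintZ// -cintD; [|exact: KcZ|exact: KcZ].
apply: eq_cint => y; rewrite F1E (cint_by_parts (x - y) db Kb Kb') rVB.
set A := cint _.
have i2 : 'i * 'i = -1 :> C by rewrite -expr2 sqr_i.
rewrite (_ : - 'i * (F y * (- ('i * (x 0 i - y 0 i)%:C) * A)) =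
  ('i * 'i) * ((x 0 i - y 0 i)%:C * (F y * A))); last by ring.
by rewrite i2 !rmorphB/=; ring.
Qed.

Lemma Umul_linear (beta : V -> R) (F G : V -> C) (a : C) x : Kfun beta -> Kc F -> Kc G ->
  Umul beta (fun y => F y + a * G y) x = Umul beta F x + a * Umul beta G x.
Proof.
move=> Kb KF KG.
have [_ ->] := Umul_kernel x Kb (KcD KF (KcZ a KG)).
have [K2 ->] := Umul_kernel x Kb KF; have [K3 ->] := Umul_kernel x Kb KG.
rewrite -cintZ// -cintD//; last exact: KcZ.
by apply: eq_cint => y; ring.
Qed.

(** Multiplying twice by the coordinate gives one term in [b2] and twice the mixed term, whence the
    factor [2 * 'i]. *)
Lemma Umul_peel (b0 b1 b2 : V -> R) (F F2 : V -> C) (i : 'I_n) (c l : R) x : 0 < l ->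
  (forall xi, is_derive xi (ebasis R i) b0 (b1 xi)) ->
  (forall xi, is_derive xi (ebasis R i) b1 (b2 xi)) ->
  Kfun b0 -> Kfun b1 -> Kfun b2 -> Kc F -> Kc F2 ->
  (forall y, F2 y = (1 + (l * (y 0 i - c)) ^+ 2)%:C * F y) ->
  Umul b0 F2 x = (1 + (l * (x 0 i - c)) ^+ 2)%:C * Umul b0 F x
     + (- (2 * 'i)) * ((l * (x 0 i - c) * l)%:C * Umul b1 F x)
     + (-1) * ((l * l)%:C * Umul b2 F x).
Proof.
move=> l0 d0 d1 K0 K1 K2 KF KF2 F2E.
have cF := Kc_cont KF; have [B B0 hB] := KcE KF2.
have ccoord : continuous (fun y : V => y 0 i - c).
  by apply: continuous_add; [apply: continuous_coord; cont_proj|exact: continuous_cst].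
pose F1 (y : V) := (y 0 i - c)%:C * F y; pose F11 (y : V) := (y 0 i - c)%:C * F1 y.
(* The bound on [F2] controls [F] times the first and second powers of the coordinate, which puts
   [F1] and [F11] in the class. *)
have le2 (y : V) : (1 + (l * (y 0 i - c)) ^+ 2) * cmod (F y) <= B * omega y.
  have := hB y; rewrite F2E cmodM cmodR ger0_norm//.
  by rewrite addr_ge0 ?sqr_ge0.
have KF1 : Kc F1.
  apply: (@KcI _ _ _ (l^-1 * B)); first by apply: ccontM => //; exact: ccontR.
  move=> y; rewrite cmodM cmodR -mulrA ler_pdivlMl//.
  rewrite (le_trans _ (le2 y))// mulrA; apply: ler_wpM2r; first by nng.
  rewrite -{1}(gtr0_norm l0) -normrM.
  have := sqr_ge0 (`|l * (y 0 i - c)| - 1); rewrite -[X in 1 + X]real_normK ?num_real//.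
  by have := normr_ge0 (l * (y 0 i - c)); nra.
have KF11 : Kc F11.
  apply: (@KcI _ _ _ ((l ^+ 2)^-1 * B)).
    by apply: ccontM; [exact: ccontR|exact: Kc_cont].
  move=> y; rewrite !cmodM !cmodR -mulrA ler_pdivlMl ?exprn_gt0//.
  rewrite (le_trans _ (le2 y))// !mulrA; apply: ler_wpM2r; first by nng.
  rewrite -mulrA -normrM -expr2 ger0_norm ?sqr_ge0// -exprMn.
  by rewrite ler_wpDl.
have E1 := Umul_coord x d0 K0 K1 KF1 KF11 (fun y => erefl).
have E2 := Umul_coord x d0 K0 K1 KF KF1 (fun y => erefl).
have E3 := Umul_coord x d1 K1 K2 KF KF1 (fun y => erefl).
have -> : F2 = (fun y => F y + (l ^+ 2)%:C * F11 y).
  apply/funext => y; rewrite F2E /F11 /F1 exprMn rmorphD rmorphM/= !rmorphXn/=.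
  by rewrite rmorph1 rmorphB/=; ring.
rewrite Umul_linear// E1 E2 E3.
have i2 : 'i * 'i = -1 :> C by rewrite -expr2 sqr_i.
move: (x 0 i - c) => t; rewrite !expr2 !rmorphD/= !rmorphM/= rmorph1.
set X := t%:C; set L := l%:C; set U0 := Umul b0 F x; set U1 := Umul b1 F x.
set U2 := Umul b2 F x.
rewrite (_ : U0 + L * L * (X * (X * U0 - 'i * U1) - 'i * (X * U1 - 'i * U2)) =
  U0 + L * L * (X * X * U0 - 2 * 'i * X * U1 + 'i * 'i * U2)); last by ring.
by rewrite i2; ring.
Qed.

Lemma kappaV_ge e p (x : V) (i : 'I_n) : 1 + (dyX e p * (x 0 i - p.2 0 i)) ^+ 2 <= (kappa e p x)^-1.
Proof.
rewrite /kappa omega_affineE (bigD1 i)//= invfM -[leLHS]mulr1.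
have h : 0 < \prod_(j | j != i) lweight (dyX e p * (x 0 j - p.2 0 j)).
  by apply: prodr_gt0 => j _; exact: lweight_gt0.
apply: ler_pM => //; [by rewrite addr_ge0 ?sqr_ge0|by rewrite /lweight invrK|].
rewrite invf_ge1// -[leRHS](@big1 R 1 *%R _ (index_enum 'I_n) (fun j => j != i) (fun=> 1))//.
by apply: ler_prod => j _; rewrite lweight_le1 ltW// lweight_gt0.
Qed.

Lemma dyX_le e e' p : e <= e' -> dyX e p <= dyX e' p.
Proof. by move=> ee; rewrite ler_powR ?dy_ge1. Qed.

(** The scale [2 ^ (rho j)] matches the gain of a frequency derivative, although the symbol itself
    is localised in [x] at scale [2 ^ (- delta j)]. *)
Definition xcoord (i : 'I_n) (p : P) (X : X3) : R := dyX rho p * (X.1.1 0 i - p.2 0 i).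

(** This is where [rho <= delta] enters: a derivative in [x] produces [2 ^ (rho j)], which must be
    at most [2 ^ (delta j)]. The size of the coordinate is paid for with one power of [kappa]. *)
Lemma sclass_xcoord k I (i : 'I_n) :
  sclass vec3 sc3 k I (fun p X => (kappa delta p X.1.1)^-1) (xcoord i).
Proof.
have bnd p X : `|xcoord i p X| <= 1 * (kappa delta p X.1.1)^-1.
  rewrite mul1r (le_trans _ (kappaV_ge delta p X.1.1 i))// /xcoord normrM.
  rewrite gtr0_norm//; set t := X.1.1 0 i - _.
  apply: (@le_trans _ _ `|dyX delta p * t|).
    by rewrite normrM (gtr0_norm (dyX_gt0 delta p)); apply: ler_wpM2r => //; exact: dyX_le.
  set s := dyX delta p * t; rewrite -[s ^+ 2]real_normK ?num_real//.
  by have := sqr_ge0 (`|s| - 1); have := normr_ge0 s; nra.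
have cx p : continuous (xcoord i p).
  apply: continuous_mul; first exact: continuous_cst.
  apply: continuous_add; last exact: continuous_cst.
  by apply: continuous_coord; cont_proj.
have dE p X v : is_derive X (vec3 v) (xcoord i p) (if (i == v :> nat) then dyX rho p else 0).
  apply: (@is_derive_along _ _ _ (xcoord i p) (fun t : R => t) _ _ (if (i == v :> nat) then dyX rho p else 0)).
    move=> s; rewrite /xcoord /vec3; case: ifPn => vn /=.
      by rewrite rVD rVZ evec_coord; case: eqP => _; rewrite ?scaler0 ?add0r /GRing.scale/=; ring.
    rewrite [in RHS]ifF; last by apply/negbTE; apply: contra vn => /eqP <-.
    by case: ifP => _ /=; rewrite !scaler0 !add0r.
have K1 p X : 1 <= (kappa delta p X.1.1)^-1 by rewrite invf_ge1 ?kappa_gt0 ?kappa_le1.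
case: k => [|k]; split=> //; split => //; [by exists 1|by exists 1|].
move=> v vI; split; first by move=> p X; case: (dE p X v).
apply: (@eq_sclass _ _ _ _ _ _ _ _ (fun p _ => if (i == v :> nat) then dyX rho p else 0)).
  by move=> p X; case: (dE p X v) => _ <-.
apply: (@sclass_cst _ _ _ _ _ _ _ _ (fun p => if (i == v :> nat) then dyX rho p else 0) 1) => p X.
rewrite mul1r; case: ifPn => [/eqP iv|_]; last by rewrite normr0 mulr_ge0 ?invr_ge0 ?sc3_ge0 ?kappa_ge0.
rewrite /sc3 -iv ltn_ord gtr0_norm// (le_trans (dyX_le p rho_delta))//.
by rewrite ler_peMl// ltW.
Qed.

Lemma W3_leN N M p X : W3 N.+1 M p X <= W3 N M p X.
Proof.
rewrite /W3; apply: ler_wpM2r; first by nng.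
by apply: ler_wpM2l; [nng|rewrite exprS ler_piMl ?kappa_le1//; nng].
Qed.

Lemma sclass_W3N k I N M b : sclass vec3 sc3 k I (W3 N.+1 M) b -> sclass vec3 sc3 k I (W3 N M) b.
Proof.
apply: (@sclass_leW _ _ _ _ _ sc3_ge0 1) => p X; first exact: W3_ge0.
by rewrite mul1r W3_leN.
Qed.

Lemma sclass_xcoordM k I N M b i : sclass vec3 sc3 k I (W3 N.+1 M) b ->
  sclass vec3 sc3 k I (W3 N M) (fun p X => xcoord i p X * b p X).
Proof.
move=> S; apply: eq_sclassW (sclassM (sclass_xcoord k I i) S) => p X.
by rewrite /W3 exprS; field; rewrite gt_eqF ?kappa_gt0.
Qed.

Definition xquad (i : 'I_n) (b : P -> X3 -> R) p X := (1 + xcoord i p X ^+ 2) * b p X.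

Lemma sclass_xquad k I N M b i : sclass vec3 sc3 k I (W3 N.+2 M) b ->
  sclass vec3 sc3 k I (W3 N M) (xquad i b).
Proof.
move=> S; apply: (@eq_sclass _ _ _ _ _ _ _ _
    (fun p X => b p X + xcoord i p X * (xcoord i p X * b p X))).
  by move=> p X; rewrite /xquad; ring.
apply: sclassD; first by do 2 apply: sclass_W3N.
by do 2 apply: sclass_xcoordM.
Qed.

Lemma Kfun_slice N M b p (x eta : V) : sclass vec3 sc3 n.*2 n (W3 N.+1 M.+2) b ->
  Kfun (fun xi => b p (x, xi, eta)).
Proof.
move=> S; have [D D0 hD] := symbol_bound S.
apply: (Kfun_le (g := fun xi => D * dyX m p * psi p xi)); last 1 first.
- move=> xi; rewrite (le_trans (hD _ _))// -mulrA ler_wpM2l// (le_trans (W3_le _ _ _ _ _ _))//.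
  rewrite -[leRHS]mulr1; apply: ler_pM; [by nng|by nng| |by rewrite exprn_ile1 ?psi_ge0 ?psi_le1].
  apply: ler_pM; [by nng|by nng| |exact: omega_exp_le].
  by rewrite ler_piMr ?kappa_le1//; nng.
- apply: (continuous_comp' (f := fun xi : V => ((x, xi, eta) : X3)) _ (sclass_cont S p)).
  apply: continuous_pair; last exact: continuous_cstT.
  by apply: continuous_pair; [exact: continuous_cstT|exact: continuous_idT].
- exact: KfunZ (Kfun_psi p).
Qed.

Lemma Kc_TbilE N M b p x Phi Gam : sclass vec3 sc3 n.*2 n (W3 N.+1 M.+2) b ->
  bdc Phi -> bdc Gam ->
  Kc (fun eta => cexpi (dotp x eta) * Gam eta * cint (Bker b p Phi eta x)).
Proof. by move=> S bP bG; exact: (K2c_l x (K2c_T S p bP bG)). Qed.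

(** For fixed [eta] the operator in [xi] is a multiplier, so [Umul_peel] applies. The three symbols
    on the right are of the original type, at the price of two powers of [kappa] and two frequency
    derivatives. *)
Lemma Tbil_peel N M (b e1 e2 : P -> X3 -> R) (i : 'I_n) p (F F2 Gam : V -> C) x :
  sclass vec3 sc3 n.*2 n (W3 N.+3 M.+2) b ->
  sclass vec3 sc3 n.*2 n (W3 N.+3 M.+2) e1 ->
  sclass vec3 sc3 n.*2 n (W3 N.+3 M.+2) e2 ->
  (forall X, is_derive X ((0, ebasis R i, 0) : X3) (b p) ((dyX rho p)^-1 * e1 p X)) ->
  (forall X, is_derive X ((0, ebasis R i, 0) : X3) (e1 p) ((dyX rho p)^-1 * e2 p X)) ->
  Kc F -> Kc F2 -> bdc Gam ->
  (forall y, F2 y = (1 + (dyX rho p * (y 0 i - p.2 0 i)) ^+ 2)%:C * F y) ->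
  Tbil b p (fourier F2) Gam x =
  Tbil (xquad i b) p (fourier F) Gam x
  + (- (2 * 'i)) * Tbil (fun p X => xcoord i p X * e1 p X) p (fourier F) Gam x
  + (-1) * Tbil e2 p (fourier F) Gam x.
Proof.
move=> Sb S1 S2 d1 d2 KF KF2 bG F2E.
have Sb0 : sclass vec3 sc3 n.*2 n (W3 N.+1 M.+2) (xquad i b) by exact: sclass_xquad.
have Sb1 : sclass vec3 sc3 n.*2 n (W3 N.+1 M.+2) (fun p X => xcoord i p X * e1 p X).
  by apply: sclass_xcoordM; exact: sclass_W3N.
have bF := fourier_bdc KF.
rewrite (TbilE Sb p Gam x (fourier_bdc KF2)) (TbilE Sb0 p Gam x bF) (TbilE Sb1 p Gam x bF)
  (TbilE S2 p Gam x bF).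
have K0 := Kc_TbilE p x Sb0 bF bG; have K1 := Kc_TbilE p x Sb1 bF bG.
have K2 := Kc_TbilE p x S2 bF bG.
rewrite -(cintZ _ K1) -(cintZ _ K2) -(cintD K0 (KcZ _ K1)) -(cintD (KcD K0 (KcZ _ K1)) (KcZ _ K2)).
apply: eq_cint => eta.
have sl (f g : X3 -> R) : (forall X, is_derive X ((0, ebasis R i, 0) : X3) f ((dyX rho p)^-1 * g X)) ->
    forall xi, is_derive xi (ebasis R i) (fun xi : V => f (x, xi, eta)) ((dyX rho p)^-1 * g (x, xi, eta)).
  move=> h xi; apply: (@is_derive_along _ _ _ (fun xi => (x, xi, eta)) f _ _ ((0, ebasis R i, 0) : X3)) => //.
  by move=> s; congr (_, _, _); rewrite /= scaler0 add0r.
have Kb := Kfun_slice p x eta Sb; have K1' := Kfun_slice p x eta S1; have K2' := Kfun_slice p x eta S2.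
have l0 := dyX_gt0 rho p.
have d1' := sl _ _ (d1); have d2' xi : is_derive xi (ebasis R i)
    (fun xi : V => (dyX rho p)^-1 * e1 p (x, xi, eta)) ((dyX rho p)^-1 * ((dyX rho p)^-1 * e2 p (x, xi, eta))).
  have := sl _ _ d2 xi => h; exact: is_deriveZ.
have := Umul_peel x l0 d1' d2' Kb (KfunZ _ K1') (KfunZ _ (KfunZ _ K2')) KF KF2 F2E.
rewrite -[cint (Bker b p (fourier F2) eta x)]/(Umul (fun xi => b p (x, xi, eta)) F2 x) => ->.
have UZ (a : R) (f : V -> R) : Kfun f -> Umul (fun xi => a * f xi) F x = a%:C * Umul f F x.
  move=> Kf; rewrite /Umul -cintZ; last exact: Kc_fourier_int.
  by apply: eq_cint => xi; rewrite rmorphM/= !mulrA.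
rewrite -[cint (Bker (xquad i b) _ _ _ _)]/(Umul (fun xi => (1 + (dyX rho p * (x 0 i - p.2 0 i)) ^+ 2) * b p (x, xi, eta)) F x).
rewrite -[cint (Bker (fun p X => xcoord _ _ _ * _) _ _ _ _)]/(Umul (fun xi => (dyX rho p * (x 0 i - p.2 0 i)) * e1 p (x, xi, eta)) F x).
rewrite -[cint (Bker e2 _ _ _ _)]/(Umul (fun xi => e2 p (x, xi, eta)) F x).
rewrite !UZ//; last exact: KfunZ.
have lV : (dyX rho p)%:C * ((dyX rho p)^-1)%:C = 1 :> C by rewrite -rmorphM/= divff ?rmorph1// gt_eqF.
move: (1 + _) (Umul (fun xi => b p _) _ _) (Umul (fun xi => e1 p _) _ _) (Umul (fun xi => e2 p _) _ _).
move: (x 0 i - _) => t a0 u0 u1 u2; rewrite !(rmorphM (real_complex R))/=.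
move: (cexpi _) (Gam eta) lV; set l := (dyX rho p)%:C; set l' := (_^-1)%:C => c g lV.
transitivity (c * g * (a0%:C * u0) + - (2 * 'i) * (c * g * (l * t%:C * (l * l') * u1)) + -1 * (c * g * ((l * l') * (l * l') * u2))).
  by ring.
by rewrite lV; ring.
Qed.

(** Exchanging [xi] and [eta] disturbs the order of their directions, so the class keeps those of
    [x]; besides explicit derivatives, [Tbil_peel] asks for these alone. *)
Lemma sclass_swap k N M b : sclass vec3 sc3 k n (W3 N M) b ->
  sclass vec3 sc3 k n (W3 N M) (fun p X => b p (X.1.1, X.2, X.1.2)).
Proof.
have : forall W i b, (i <= n)%N -> sclass vec3 sc3 k i W b ->
    sclass vec3 sc3 k i (fun p X => W p (X.1.1, X.2, X.1.2)) (fun p X => b p (X.1.1, X.2, X.1.2)).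
  elim: k => [|k IH] W i {}b ii [c [[D hD] H]].
    split; [|split => //]; last by exists D => p X; exact: hD.
    by move=> p; apply: continuous_comp' (c p); cont_proj.
  split; [|split]; last 2 first.
  - by exists D => p X; exact: hD.
  - move=> v vi; have [d S] := H v vi; have vn : (v < n)%N by exact: leq_trans ii.
    have dE p X : is_derive X (vec3 v) (fun X => b p (X.1.1, X.2, X.1.2))
        (Dv vec3 v b p (X.1.1, X.2, X.1.2)).
      apply: (@is_derive_along _ _ _ (fun X : X3 => (X.1.1, X.2, X.1.2)) (b p) _ _ (vec3 v)).
        by move=> s; rewrite /vec3 vn.
      by apply: DeriveDef.
    split; first by move=> p X; case: (dE p X).
    apply: (eq_sclass (b := fun p X => Dv vec3 v b p (X.1.1, X.2, X.1.2))).
      by move=> p X; case: (dE p X) => _ <-.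
    by apply: eq_sclassW (IH _ _ _ vn S) => p X; rewrite /sc3 vn.
  by move=> p; apply: continuous_comp' (c p); cont_proj.
move=> H S; apply: eq_sclassW (H _ _ _ (leqnn n) S) => p X.
by rewrite /W3/= (mulrC (psi p X.2)).
Qed.

Lemma K2c_Tbil N M b p Phi Gam x : sclass vec3 sc3 n.*2 n (W3 N.+1 M.+2) b ->
  bdc Phi -> bdc Gam ->
  K2c (fun eta xi => (b p (x, xi, eta))%:C * cexpi (dotp x (xi + eta)) * Phi xi * Gam eta).
Proof.
move=> S bP bG; have [cP _] := bP; have [cG _] := bG.
have [B B0 hB] := bdc_ge0 bP; have [B' B0' hB'] := bdc_ge0 bG.
have [D D0 hD] := symbol_bound S; have [E E0 hE] := psi_le_omega p.
split.
  apply: ccontM; last by apply: (ccont_comp _ cG); cont_proj.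
  apply: ccontM; last by apply: (ccont_comp _ cP); cont_proj.
  apply: ccontM.
    by apply: ccontR; apply: continuous_comp' (sclass_cont S p); cont_proj.
  by apply: ccont_cexpi; apply: continuous_dotp; [cont_proj|apply: continuous_addV; cont_proj].
exists (D * dyX m p * E * E * B * B') => eta xi; rewrite !cmodM cmod_cexpi mulr1 cmodR.
rewrite (_ : _ * omega eta * _ = (D * (dyX m p * (E * omega xi) * (E * omega eta))) * B * B'); last by ring.
apply: ler_pM; [by nng|by nng| |exact: hB']; apply: ler_pM; [by nng|by nng| |exact: hB].
rewrite (le_trans (hD _ _))// ler_wpM2l// (le_trans (W3_le _ _ _ _ _ _))//.
apply: ler_pM; [by nng|by nng| |exact: le_trans (omega_exp_le _ _) (hE _)].
apply: ler_pM; [by nng|by nng| |exact: le_trans (omega_exp_le _ _) (hE _)].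
by rewrite ler_piMr ?kappa_le1//; nng.
Qed.

Lemma Tbil_swap N M b p Phi Gam x : sclass vec3 sc3 n.*2 n (W3 N.+1 M.+2) b ->
  bdc Phi -> bdc Gam ->
  Tbil b p Phi Gam x = Tbil (fun p X => b p (X.1.1, X.2, X.1.2)) p Gam Phi x.
Proof.
move=> S bP bG; rewrite /Tbil (K2c_Fubini (K2c_Tbil p x S bP bG)).
by apply: eq_cint => xi; apply: eq_cint => eta /=; rewrite (addrC xi); ring.
Qed.

Lemma rho_delta_sc p v X : (n <= v)%N -> sc3 p v X = (dyX rho p)^-1.
Proof. by move=> nv; rewrite /sc3 ltnNge nv. Qed.

(** Multiplication by [2 ^ (rho j)] undoes the gain of a frequency derivative, so [e1] and [e2] have
    the same weight as [b]. *)
Lemma peel_family k I N M b v : (n <= v < I)%N -> sclass vec3 sc3 k.+2 I (W3 N M) b ->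
  exists e1 e2, [/\ sclass vec3 sc3 k v.+1 (W3 N M) e1, sclass vec3 sc3 k v.+1 (W3 N M) e2,
    (forall p X, is_derive X (vec3 v) (b p) ((dyX rho p)^-1 * e1 p X)) &
    (forall p X, is_derive X (vec3 v) (e1 p) ((dyX rho p)^-1 * e2 p X))].
Proof.
move=> /andP[nv vI] S.
have [d1 S1] := sclass_der S vI; have [d2 S2] := sclass_der S1 (ltnSn v).
have cst k' i (c : R -> R) (c_gt0 : forall t, 0 < t -> 0 < c t) :
    sclass vec3 sc3 k' i (fun p _ => c (dyX rho p)) (fun p _ => c (dyX rho p)).
  apply: (@sclass_cst _ _ _ _ _ _ _ _ (fun p => c (dyX rho p)) 1) => p X.
  by rewrite mul1r gtr0_norm// c_gt0.
have lV p : dyX rho p != 0 by rewrite gt_eqF.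
exists (fun p X => dyX rho p * Dv vec3 v b p X).
exists (fun p X => dyX rho p * (dyX rho p * Dv vec3 v (Dv vec3 v b) p X)); split.
- apply: sclass_lek (leqnSn k) _.
  apply: eq_sclassW (sclassM (cst _ _ id (fun t h => h)) S1) => p X.
  by rewrite rho_delta_sc//; field.
- apply: eq_sclassW (sclassM (cst _ _ id (fun t h => h)) (sclassM (cst _ _ id (fun t h => h)) S2)) => p X.
  by rewrite rho_delta_sc//; field.
- by move=> p X; rewrite mulKf//; apply: DeriveDef.
- move=> p X; rewrite mulKf//.
  have h : is_derive X (vec3 v) (Dv vec3 v b p) (Dv vec3 v (Dv vec3 v b) p X) by apply: DeriveDef.
  exact: is_deriveZ.
Qed.

(* The weights of the coordinates [i < l] have already been peeled off. *)
Definition wt (l : nat) (p : P) (y : V) : R :=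
  \prod_(i < n | (l <= i)%N) lweight (dyX rho p * (y 0 i - p.2 0 i)).

Definition wmul (l : nat) (p : P) (f : V -> C) (y : V) : C := (wt l p y)%:C * f y.

Lemma wt0 p y : wt 0 p y = kappa rho p y.
Proof. by rewrite /wt /kappa omega_affineE. Qed.

Lemma wt_n p y : wt n p y = 1.
Proof. by rewrite /wt big_pred0// => i; rewrite leqNgt ltn_ord. Qed.

Lemma wmul_n p f : wmul n p f = f.
Proof. by apply/funext => y; rewrite /wmul wt_n rmorph1 mul1r. Qed.

Lemma wt_step (i : 'I_n) p y :
  wt i.+1 p y = (1 + (dyX rho p * (y 0 i - p.2 0 i)) ^+ 2) * wt i p y.
Proof.
rewrite /wt [in RHS](bigD1 i)//= mulrA /lweight mulfV ?mul1r; last first.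
  by rewrite gt_eqF// ltr_wpDr ?sqr_ge0.
by apply: eq_bigl => j; rewrite ltn_neqAle andbC eq_sym.
Qed.

Lemma wt_ge0 l p y : 0 <= wt l p y.
Proof. by apply: prodr_ge0 => i _; rewrite ltW// lweight_gt0. Qed.

Lemma wt_le1 l p y : wt l p y <= 1.
Proof.
rewrite /wt -[leRHS](@big1 R 1 *%R _ (index_enum 'I_n) (fun j => (l <= j)%N) (fun=> 1))//.
by apply: ler_prod => j _; rewrite lweight_le1 ltW// lweight_gt0.
Qed.

Lemma continuous_wt l p : continuous (wt l p).
Proof.
have -> : wt l p = fun y => \prod_(i <- [seq i : 'I_n <- enum 'I_n | (l <= i)%N])
    lweight (dyX rho p * (y 0 i - p.2 0 i)).
  by apply/funext => y; rewrite /wt big_filter big_enum_cond.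
apply: continuous_prod => i.
apply: (continuous_comp' (g := fun t : R => lweight (dyX rho p * (t - p.2 0 i)))).
  by apply: continuous_coord; cont_proj.
exact: continuous_lweight_affine.
Qed.

Lemma Kc_wmul l p f : Kc f -> Kc (wmul l p f).
Proof.
move=> Kf; apply: (@KcM _ _ _ _ 1) => //; first by apply: ccontR; exact: continuous_wt.
by move=> y; rewrite cmodR ger0_norm ?wt_ge0 ?wt_le1.
Qed.

(** [wmul 0] multiplies by [kappa rho p]: this is the energy of the part of [f] within distance
    about [2 ^ (- rho j)] of the centre. *)
Definition NK p f := NN p (fourier (wmul 0 p f)).

Lemma NK_ge0 p f : 0 <= NK p f. Proof. exact: NN_ge0. Qed.

Definition bilest (D : R) p f g (Z : V -> C) :=
  [/\ Kc Z, rint (fun x => cmod (Z x) ^+ 2) <= D * ((dyX m p ^+ 2 * dy p ^+ n) * (NK p f * NK p g)) &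
    forall x, cmod (Z x) ^+ 2 <= D * ((dyX m p ^+ 2 * (dy p ^+ n) ^+ 2) * (NK p f * NK p g))].

Lemma bilest_comb D0 D1 D2 p f g Z0 Z1 Z2 :
  bilest D0 p f g Z0 -> bilest D1 p f g Z1 -> bilest D2 p f g Z2 ->
  bilest (3 * D0 + 12 * D1 + 3 * D2) p f g (fun x => Z0 x + (- (2 * 'i)) * Z1 x + (-1) * Z2 x).
Proof.
move=> [K0 L0 S0] [K1 L1 S1] [K2 L2 S2].
have c2 : cmod (- (2 * 'i) : C) = 2.
  rewrite cmodN cmodM (_ : 2 = (2 : R)%:C) ?cmodR; last by rewrite rmorph_nat.
  by rewrite gtr0_norm// /cmod/= expr0n/= expr1n add0r sqrtr1 mulr1.
have KZ : Kc (fun x => Z0 x + (- (2 * 'i)) * Z1 x + (-1) * Z2 x).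
  by apply: KcD; [apply: KcD => //|]; apply: KcZ.
(* From [(a + 2 b + c)^2 <= 3 (a^2 + 4 b^2 + c^2)]. *)
have H x : cmod (Z0 x + (- (2 * 'i)) * Z1 x + (-1) * Z2 x) ^+ 2 <=
    3 * cmod (Z0 x) ^+ 2 + (12 * cmod (Z1 x) ^+ 2 + 3 * cmod (Z2 x) ^+ 2).
  apply: (@le_trans _ _ ((cmod (Z0 x) + 2 * cmod (Z1 x) + cmod (Z2 x)) ^+ 2)).
    rewrite lerXn2r ?nnegrE//; try nng.
    rewrite (le_trans (cmodD _ _))// mulN1r cmodN lerD2r (le_trans (cmodD _ _))// lerD2l.
    by rewrite cmodM c2.
  set a := cmod (Z0 x); set b := cmod (Z1 x); set c := cmod (Z2 x).
  have := sqr_ge0 (a - 2 * b); have := sqr_ge0 (a - c); have := sqr_ge0 (2 * b - c); nra.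
have KS (Z : V -> C) : Kc Z -> Kfun (fun x => cmod (Z x) ^+ 2) by move=> KZ'; exact: Kfun_sqr (Kfun_cmod KZ').
split => //; last first.
  move=> x; rewrite (le_trans (H x))//; move: (S0 x) (S1 x) (S2 x); nra.
apply: (@le_trans _ _ (3 * rint (fun x => cmod (Z0 x) ^+ 2) +
   (12 * rint (fun x => cmod (Z1 x) ^+ 2) + 3 * rint (fun x => cmod (Z2 x) ^+ 2)))); last first.
  move: L0 L1 L2; nra.
rewrite -(rintZ _ (KS _ K0)) -(rintZ _ (KS _ K1)) -(rintZ _ (KS _ K2)).
have k0 := KfunZ 3 (KS _ K0); have k1 := KfunZ 12 (KS _ K1); have k2 := KfunZ 3 (KS _ K2).
rewrite -(rintD k1 k2) -(rintD k0 (KfunD k1 k2)).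
by apply: le_rint => //; [exact: KS|exact: KfunD k0 (KfunD k1 k2)].
Qed.

(** [l1] and [l2] count the coordinates whose weights have been removed from the inputs, while the
    energies in the bound keep all weights. [k], [I] and [N] form a budget: a removal costs two
    derivatives, one direction and two powers of [kappa]. *)
Definition Est k I N l1 l2 := forall M b, sclass vec3 sc3 k I (W3 N M.+2) b ->
  exists2 D, 0 <= D & forall p f g, Kc f -> Kc g ->
    bilest D p f g (Tbil b p (fourier (wmul l1 p f)) (fourier (wmul l2 p g))).

Lemma sclass_x k I W b : (n.*2 <= k)%N -> (n <= I)%N ->
  sclass vec3 sc3 k I W b -> sclass vec3 sc3 n.*2 n W b.
Proof. by move=> hk hI S; apply: sclass_lek hk _; exact: sclass_lei hI S. Qed.

Lemma Est_base : Est n.*2 n 1 0 0.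
Proof.
move=> M b S; have [D D0 hD] := Tbil_L2 S; have [E E0 hE] := Tbil_sup S.
exists (D + E); first by nng.
move=> p f g Kf Kg; have bf := fourier_bdc (Kc_wmul 0 p Kf); have bg := fourier_bdc (Kc_wmul 0 p Kg).
have NN0 := mulr_ge0 (NK_ge0 p f) (NK_ge0 p g).
have KT := Kc_Tbil S p bf bg.
split; first exact: KT.
  rewrite (le_trans (hD _ _ _ bf bg))// -mulrA; apply: ler_wpM2r; first by nng.
  by rewrite ler_wpDr.
move=> x; rewrite (le_trans (hE _ _ _ bf bg x))// -mulrA; apply: ler_wpM2r; first by nng.
by rewrite ler_wpDl.
Qed.

(** The symbol is differentiated along its highest direction first, and the lower ones are left to
    the hypothesis, as the ordered class demands. *)
Lemma Est_xi k N (i : 'I_n) l2 : (n.*2 <= k)%N ->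
  Est k (n + i) N.+1 i l2 -> Est k.+2 (n + i.+1) N.+3 i.+1 l2.
Proof.
move=> nk IH M b S.
have vI : (n <= n + i < n + i.+1)%N by rewrite leq_addr addnS ltnSn.
have [e1 [e2 [S1 S2 d1 d2]]] := peel_family vI S.
have S0 : sclass vec3 sc3 k (n + i) (W3 N.+3 M.+2) b.
  apply: sclass_lek (leq_trans (leqnSn _) (leqnSn _)) _.
  by apply: sclass_lei S; rewrite addnS.
have {}S1 := sclass_lei (leqnSn _) S1; have {}S2 := sclass_lei (leqnSn _) S2.
have [D0 D0' h0] := IH _ _ (sclass_xquad i S0).
have [D1 D1' h1] := IH _ _ (sclass_xcoordM i (sclass_W3N S1)).
have [D2 D2' h2] := IH _ _ (sclass_W3N (sclass_W3N S2)).
exists (3 * D0 + 12 * D1 + 3 * D2); first by nng.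
move=> p f g Kf Kg.
have := bilest_comb (h0 p f g Kf Kg) (h1 p f g Kf Kg) (h2 p f g Kf Kg).
congr (bilest _ _ _ _ _); apply/funext => x.
have nn : (n <= n + i)%N by rewrite leq_addr.
symmetry; apply: (Tbil_peel (N := N) (M := M) (e2 := e2) (i := i)).
- exact: sclass_x nk nn S0.
- exact: sclass_x nk nn S1.
- exact: sclass_x nk nn S2.
- move=> X; have := d1 p X; rewrite /vec3 ltnNge leq_addr/= ltn_add2l ltn_ord.
  by rewrite addKn evecE.
- move=> X; have := d2 p X; rewrite /vec3 ltnNge leq_addr/= ltn_add2l ltn_ord.
  by rewrite addKn evecE.
- exact: Kc_wmul.
- exact: Kc_wmul.
- exact: fourier_bdc (Kc_wmul l2 p Kg).
- by move=> y; rewrite /wmul wt_step rmorphM/= mulrA.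
Qed.

(** The roles of [xi] and [eta] are exchanged, so that [Tbil_peel] serves again. *)
Lemma Est_eta k N (i : 'I_n) l1 : (n.*2 <= k)%N ->
  Est k (n + n + i) N.+1 l1 i -> Est k.+2 (n + n + i.+1) N.+3 l1 i.+1.
Proof.
move=> nk IH M b S.
have vI : (n <= n + n + i < n + n + i.+1)%N by apply/andP; split; [rewrite -addnA leq_addr|rewrite !addnS].
have [e1 [e2 [S1 S2 d1 d2]]] := peel_family vI S.
have S0 : sclass vec3 sc3 k (n + n + i) (W3 N.+3 M.+2) b.
  apply: sclass_lek (leq_trans (leqnSn _) (leqnSn _)) _.
  by apply: sclass_lei S; rewrite !addnS.
have {}S1 := sclass_lei (leqnSn _) S1; have {}S2 := sclass_lei (leqnSn _) S2.
have SQ := sclass_xquad i S0; have SX := sclass_xcoordM i (sclass_W3N S1).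
have SW := sclass_W3N (sclass_W3N S2).
have [D0 D0' h0] := IH _ _ SQ; have [D1 D1' h1] := IH _ _ SX; have [D2 D2' h2] := IH _ _ SW.
exists (3 * D0 + 12 * D1 + 3 * D2); first by nng.
move=> p f g Kf Kg.
have := bilest_comb (h0 p f g Kf Kg) (h1 p f g Kf Kg) (h2 p f g Kf Kg).
congr (bilest _ _ _ _ _); apply/funext => x; symmetry.
have nn : (n <= n + n + i)%N by rewrite -addnA leq_addr.
have bf := fourier_bdc (Kc_wmul l1 p Kf).
have bg := fourier_bdc (Kc_wmul i p Kg); have bg' := fourier_bdc (Kc_wmul i.+1 p Kg).
rewrite (Tbil_swap p x (sclass_x nk nn (sclass_W3N (sclass_W3N S0))) bf bg').
rewrite (Tbil_swap p x (sclass_x nk nn SQ) bf bg) (Tbil_swap p x (sclass_x nk nn SX) bf bg).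
rewrite (Tbil_swap p x (sclass_x nk nn SW) bf bg).
have vE : vec3 (n + n + i) = ((0, 0, ebasis R i) : X3).
  by rewrite /vec3 ltnNge -addnA leq_addr/= ltn_add2l ltnNge leq_addr/= addnA addKn evecE.
have der (h h' : X3 -> R) : (forall X, is_derive X ((0, 0, ebasis R i) : X3) h (h' X)) ->
    forall X, is_derive X ((0, ebasis R i, 0) : X3) (fun X => h (X.1.1, X.2, X.1.2)) (h' (X.1.1, X.2, X.1.2)).
  move=> dh X.
  by apply: (@is_derive_along _ _ _ (fun X : X3 => (X.1.1, X.2, X.1.2)) h _ _ ((0, 0, ebasis R i) : X3)).
apply: (Tbil_peel (N := N) (M := M) (i := i) (e1 := fun p X => e1 p (X.1.1, X.2, X.1.2))
   (e2 := fun p X => e2 p (X.1.1, X.2, X.1.2))).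
- exact: sclass_swap (sclass_x nk nn S0).
- exact: sclass_swap (sclass_x nk nn S1).
- exact: sclass_swap (sclass_x nk nn S2).
- by apply: (der _ (fun X => (dyX rho p)^-1 * e1 p X)) => X; rewrite -vE; exact: d1.
- by apply: (der _ (fun X => (dyX rho p)^-1 * e2 p X)) => X; rewrite -vE; exact: d2.
- exact: Kc_wmul.
- exact: Kc_wmul.
- exact: bf.
- by move=> y; rewrite /wmul wt_step rmorphM/= mulrA.
Qed.

(** The budget adds up to two derivatives per coordinate of [x], [xi] and [eta], and to [4 n + 1]
    powers of [kappa], one of them for [Est_base]. The weights in [eta] come outermost because their
    directions are the highest. *)
Lemma Est_full : Est (n.*2 + n.*2 + n.*2) (n + n + n) (n.*2 + n.*2).+1 n n.
Proof.
have E1 i : (i <= n)%N -> Est (n.*2 + i.*2) (n + i) i.*2.+1 i 0.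
  elim: i => [_|i IH ii]; first by rewrite !addn0; exact: Est_base.
  rewrite doubleS !(addnS n.*2); apply: (@Est_xi _ _ (Ordinal ii) 0 _ (IH (ltnW ii))).
  exact: leq_addr.
have E2 i : (i <= n)%N -> Est (n.*2 + n.*2 + i.*2) (n + n + i) (n.*2 + i.*2).+1 n i.
  elim: i => [_|i IH ii]; first by rewrite !addn0; exact: E1.
  rewrite doubleS !(addnS n.*2) !(addnS (n.*2 + n.*2)); apply: (@Est_eta _ _ (Ordinal ii) n _ (IH (ltnW ii))).
  by rewrite -addnA leq_addr.
exact: E2.
Qed.

Lemma bilinear_core M b :
  sclass vec3 sc3 (n.*2 + n.*2 + n.*2) (n + n + n) (W3 (n.*2 + n.*2).+1 M.+2) b ->
  exists2 D, 0 <= D & forall p f g, Kc f -> Kc g ->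
    bilest D p f g (Tbil b p (fourier f) (fourier g)).
Proof.
move=> S; have [D D0 hD] := Est_full S; exists D => // p f g Kf Kg.
by have := hD p f g Kf Kg; rewrite !wmul_n.
Qed.

(** * Energies of localised inputs *)

Lemma is_derive_coord_evec (i : 'I_n) (a c : R) (x : V) v :
  is_derive x (evec n v) (fun x : V => a * (x 0 i - c)) (if (i == v :> nat) then a else 0).
Proof.
apply: (@is_derive_along _ _ _ (fun x : V => a * (x 0 i - c)) (fun t : R => t) _ _ (if (i == v :> nat) then a else 0)).
by move=> s /=; rewrite rVD rVZ evec_coord; case: eqP => _; rewrite ?scaler0 ?add0r /GRing.scale/=; ring.
Qed.

Lemma continuous_affine_coord (i : 'I_n) (a c : R) : continuous (fun x : V => a * (x 0 i - c)).
Proof.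
apply: continuous_mul; first exact: continuous_cst.
apply: continuous_add; last exact: continuous_cst.
by apply: continuous_coord; cont_proj.
Qed.

Lemma sclass_psi k I :
  sclass (evec n) (fun (p : P) (_ : nat) (_ : V) => (dy p)^-1) k I psi psi.
Proof.
have E p x : psi p x = \prod_(i <- index_enum 'I_n) lweight ((dy p)^-1 * (x 0 i - 0)).
  by rewrite psiE omega_affineE; apply: eq_bigr => i _; rewrite mxE.
apply: (@eq_sclassW _ _ _ _ _ _ _ _ _ _ (fun p x => esym (E p x))).
apply: (@eq_sclass _ _ _ _ _ _ _ _ _ _ (fun p x => esym (E p x))).
have sc0 (p : P) (v : nat) (x : V) : 0 <= (dy p)^-1 by rewrite invr_ge0; nng.
apply: sclass_prod => // i.
apply: (sclass_lweight sc0 k I (q := fun (p : P) (x : V) => (dy p)^-1 * (x 0 i - 0))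
  (c := fun (p : P) (v : nat) => if (i == v :> nat) then (dy p)^-1 else 0) (D := 1)) => //.
- by move=> p; exact: continuous_affine_coord.
- by move=> p x v; exact: is_derive_coord_evec.
- move=> p v x; rewrite mul1r; have := sc0 p v x => h.
  by case: ifP => _; rewrite ?normr0// ger0_norm.
Qed.

Lemma Kfun_K2 (h : V -> V -> R) (a b : V -> R) :
  continuous (fun z : V * V => h z.1 z.2) -> Kfun a -> Kfun b ->
  (forall x y, `|h x y| <= a x * b y) -> K2 h.
Proof.
move=> ch Ka Kb hab; have [A A0 hA] := KfunE Ka; have [B B0 hB] := KfunE Kb.
split => //; exists (A * B) => x y; rewrite (le_trans (hab x y))// (le_trans (ler_norm _))//.
by rewrite normrM (_ : A * B * _ * _ = (A * omega x) * (B * omega y)) ?ler_pM//; ring.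
Qed.

(** When the square is expanded, the integral of [psi] against the exponential is a bump in [y - y']
    of height [2 ^ (j n)] and width [2 ^ (- j)]. Each kernel receives a square root of [psi], to fit
    the T T* scheme. *)
Lemma NN_kernel : exists2 D, 0 <= D & forall p F, Kc F ->
  NN p (fourier F) <= D * (dy p ^+ n *
    rint (fun y => rint (fun y' => cmod (F y) * cmod (F y') * omega (dy p *: (y - y'))))).
Proof.
have m0 (p : P) : 0 < (dy p)^-1 by rewrite invr_gt0.
have [D hD] := cint_omega_decay m0 Kfun_psi (sclass_psi n.*2 n).
exists (`|D| * pi ^+ n); first by nng.
move=> p F KF; have [B B0 hB] := KcE KF; have cF := Kc_cont KF.
pose sp (xi : V) := Num.sqrt (psi p xi).
have sp2 xi : sp xi ^+ 2 = psi p xi by rewrite sqr_sqrtr ?psi_ge0.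
have sp0 xi : 0 <= sp xi by exact: sqrtr_ge0.
have csp : continuous sp by apply: (continuous_comp' (continuous_psi (p := p))); exact: sqrt_continuous.
pose Bk (xi y : V) : C := (sp xi)%:C * (cexpi (- dotp y xi) * F y).
pose A := `|D| * (pi ^+ n * dy p ^+ n).
have A0 : 0 <= A by rewrite /A; nng.
have KcF := Kfun_cmod KF.
have KQ : K2 (fun y y' => cmod (F y) * cmod (F y') * omega (dy p *: (y - y'))).
  apply: (Kfun_K2 _ KcF KcF).
    apply: continuous_mul; last exact: continuous_omega_sub.
    by apply: continuous_mul; apply: (continuous_comp' _ (ccont_cmod cF)); cont_proj.
  move=> y y'; rewrite normrM [X in _ * X]ger0_norm ?omega_ge0// ger0_norm; last by nng.
  by rewrite ler_piMr ?omega_le1//; nng.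
have KQA := K2Z A KQ.
have Kex xi : Kc (fun y => cexpi (- dotp y xi) * F y).
  apply: (@KcM _ _ _ _ 1) => //; last by move=> y; rewrite cmod_cexpi.
  by apply: ccont_cexpi; apply: continuous_opp; apply: continuous_dotp; cont_proj.
rewrite (_ : NN p (fourier F) = rint (fun xi => cmod (cint (Bk xi)) ^+ 2)); last first.
  apply: eq_rint => xi; rewrite /Bk cintZ// cmodM cmodR ger0_norm// exprMn sp2.
  by [].
rewrite (_ : `|D| * pi ^+ n * _ = rint (fun y => rint (fun y' => A * (cmod (F y) * cmod (F y') * omega (dy p *: (y - y')))))); last first.
  rewrite mulrA -(mulrA `|D|) -/A -rintZ; last exact: K2_rint KQ.
  by apply: eq_rint => y; rewrite rintZ//; exact: K2_l KQ.
have [E E0 hE] := psi_le_omega p.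
apply: (TTstar_weighted (beta := sp) (D := B) (E := E)) => //.
- apply: ccontM; first by apply: ccontR; apply: (continuous_comp' _ csp); cont_proj.
  apply: ccontM; last by apply: (ccont_comp _ cF); cont_proj.
  by apply: ccont_cexpi; apply: continuous_opp; apply: continuous_dotp; cont_proj.
- move=> xi y; rewrite /Bk !cmodM cmod_cexpi mul1r cmodR ger0_norm// mulrC (mulrAC B).
  by apply: ler_wpM2r.
- by move=> xi; rewrite sp0/= -[leRHS]sqrtr1 ler_wsqrtr// psi_le1.
- by move=> xi; rewrite sp2.
move=> y y'.
have -> : cint (fun xi => Bk xi y * conjc' (Bk xi y')) =
    (F y * conjc' (F y')) * cint (fun xi => (psi p xi)%:C * cexpi (dotp xi (y' - y))).
  rewrite -cintZ; last by apply: KcM_cexpi; exact: Kfun_psi.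
  apply: eq_cint => xi; rewrite /Bk !conjM conj_cexpi opprK.
  have -> : conjc' (sp xi)%:C = (sp xi)%:C by rewrite /conjc' /= oppr0.
  rewrite -sp2 expr2 rmorphM/= dotpDr dotpNr cexpiD (dotpC xi) (dotpC xi y); ring.
rewrite !cmodM cmod_conj.
have := hD p (y' - y); rewrite invrK => h.
rewrite [leRHS]mulrCA; apply: ler_wpM2l; first by nng.
rewrite (le_trans h)// omega_subC; apply: ler_wpM2r; first exact: omega_ge0.
have I0 : 0 <= rint (psi p) by apply: rint_ge0 => z; exact: psi_ge0.
rewrite (le_trans (ler_wpM2r I0 (ler_norm D)))// /A -exprMn; apply: ler_wpM2l; first by nng.
exact: rint_psi_le.
Qed.

(** The Schur test takes the place of Plancherel's theorem: the height of the bump times its volume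
    is bounded. *)
Lemma NN_L2 : exists2 D, 0 <= D & forall p F, Kc F ->
  NN p (fourier F) <= D * rint (fun y => cmod (F y) ^+ 2).
Proof.
have [D D0 hD] := NN_kernel; exists (D * pi ^+ n); first by nng.
move=> p F KF; rewrite (le_trans (hD p F KF))// -mulrA; apply: ler_wpM2l => //.
have h := Schur_bound (dy_gt0 p) (Kfun_cmod KF).
apply: (le_trans (ler_wpM2l _ h)); first by nng.
by rewrite mulrA expr_div_n mulrCA divff ?mulr1// expf_neq0// gt_eqF.
Qed.

Lemma continuous_norm_powR (q : R) : 0 < q -> continuous (fun t : R => `|t| `^ q).
Proof.
move=> q0 t; have [->|t0] := eqVneq t 0.
  apply/cvgrPdist_lt => e e0; rewrite normr0 powR0 ?gt_eqF//.
  have d0 : 0 < e `^ q^-1 by rewrite powR_gt0.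
  exists (e `^ q^-1) => // s /=; rewrite sub0r normrN => hs; rewrite sub0r normrN ger0_norm ?powR_ge0//.
  have -> : e = (e `^ q^-1) `^ q by rewrite -powRrM mulVf ?gt_eqF// powRr1// ltW.
  by apply: gt0_ltr_powR => //; rewrite ?nnegrE ?powR_ge0.
apply: (@continuous_comp _ _ _ (fun t : R => `|t|) (fun a : R => a `^ q)).
  exact: norm_continuous.
apply: differentiable_continuous; apply/derivable1_diffP; apply: derivable_powR.
by rewrite in_itv/= andbT normr_gt0.
Qed.

Lemma continuous_cmod_powR (T : topologicalType) (f : T -> C) (q : R) : 0 < q -> ccont f ->
  continuous (fun t => cmod (f t) `^ q).
Proof.
move=> q0 cf.
have -> : (fun t => cmod (f t) `^ q) = (fun t => `|cmod (f t)| `^ q).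
  by apply/funext => t; rewrite ger0_norm ?cmod_ge0.
apply: (continuous_comp' (g := fun t : R => `|t| `^ q) (ccont_cmod cf)).
exact: continuous_norm_powR.
Qed.

Lemma Kfun_powR (f : V -> C) (q : R) : 1 <= q -> Kc f -> Kfun (fun y => cmod (f y) `^ q).
Proof.
move=> q1 Kf; have [B B0 hB] := KcE Kf; have q0 : 0 < q by exact: lt_le_trans q1.
split; first by apply: continuous_cmod_powR => //; exact: Kc_cont.
exists (B `^ q) => y; rewrite ger0_norm ?powR_ge0//.
apply: (@le_trans _ _ ((B * omega y) `^ q)).
  apply: ge0_ler_powR => //; rewrite ?nnegrE; try nng; exact: ltW.
rewrite powRM//; last by nng.
apply: ler_wpM2l; first exact: powR_ge0.
by apply: ge1r_powR => //; rewrite omega_gt0 omega_le1.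
Qed.

(** Two numbers below 1 are compared through their squares, which are at most their q-th powers
    since [q <= 2]; a number above 1 is at most its q-th power. It is applied to values measured in
    units of a threshold. *)
Lemma powR_split (q a b : R) : 1 <= q <= 2 -> 0 <= a -> 0 <= b ->
  a * b <= a `^ q + b `^ q + a `^ q * b `^ q.
Proof.
move=> /andP[q1 q2] a0 b0.
have pa : 0 <= a `^ q by exact: powR_ge0. have pb : 0 <= b `^ q by exact: powR_ge0.
have pab := mulr_ge0 pa pb.
have small (c : R) : 0 <= c -> c <= 1 -> c ^+ 2 <= c `^ q.
  rewrite le_eqVlt => /orP[/eqP <- _|c0 c1]; first by rewrite expr0n/= powR_ge0.
  have h : 0 < c <= 1 by rewrite c0.
  apply: (@le_trans _ _ (c `^ 2%:R)); first by rewrite powR_mulrn// ltW.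
  exact: (ger_powR h).
have big (c : R) : 1 <= c -> c <= c `^ q by move=> c1; exact: le1r_powR.
have [a1|a1] := leP a 1; have [b1|b1] := leP b 1.
- have := small a a0 a1; have := small b b0 b1; have := sqr_ge0 (a - b); nra.
- by have := big b (ltW b1); nra.
- by have := big a (ltW a1); nra.
- have := big b (ltW b1); have := big a (ltW a1) => ha hb.
  have := ler_pM a0 b0 ha hb; lra.
Qed.

Lemma powR_split2 (q a : R) : 2 <= q -> 0 <= a -> a ^+ 2 <= a `^ q + 1.
Proof.
move=> q2 a0; have [a1|a1] := leP a 1.
  by apply: (@le_trans _ _ 1); [exact: exprn_ile1|rewrite lerDr powR_ge0].
by rewrite -powR_mulrn// ler_wpDr// ler_powR// ltW.
Qed.

Lemma powR_div (Q a q : R) : 0 < q -> 0 < Q -> 0 <= a -> (a / Q `^ q^-1) `^ q = a `^ q / Q.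
Proof.
move=> q0 Q0 a0; rewrite powRM// ?invr_ge0 ?powR_ge0//; congr (_ * _).
rewrite -powR_inv1 ?powR_ge0// -!powRrM mulN1r mulrN mulVf ?gt_eqF// powR_inv1//; exact: ltW.
Qed.

Lemma dyX_expn e p k : dyX e p ^+ k = dyX (e * k%:R) p.
Proof. by rewrite -powR_mulrn ?powR_ge0// -powRrM. Qed.

Lemma dy_expn p k : dy p ^+ k = dyX k%:R p.
Proof. by rewrite -powR_mulrn// ltW. Qed.

Lemma dyX_powR e c p : dyX e p `^ c = dyX (e * c) p.
Proof. by rewrite /dyX powRrM. Qed.

Lemma dyXD e e' p : dyX (e + e') p = dyX e p * dyX e' p.
Proof. by rewrite /dyX powRD// (gt_eqF (dy_gt0 p)) implybT. Qed.

Lemma dyXN e p : dyX (- e) p = (dyX e p)^-1.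
Proof. by rewrite /dyX powRN. Qed.

(* The free term [tau > 0] keeps the quantity positive, so that it may serve as a
   threshold; for [q = +oo] it is the whole quantity, raised to the power [0]. *)
Definition Tq (q : \bar R) (p : P) (f : V -> C) (tau : R) : R :=
  (match q with EFin q' => rint (fun y => kappa rho p y * cmod (f y) `^ q') | _ => 0 end) + tau.

Lemma Tq_gt0 q p f tau : 0 < tau -> 0 < Tq q p f tau.
Proof.
move=> t0; rewrite /Tq ltr_wpDl//; case: q => [q||] //.
by apply: rint_ge0 => y; rewrite mulr_ge0 ?powR_ge0 ?kappa_ge0.
Qed.

(** The power of [2 ^ j] between the energy and the L^q size: for [q <= 2] the exponent of
    Bernstein's inequality at frequency [2 ^ j], for [q > 2] that of Hölder's inequality on a ball
    of radius [2 ^ (- rho j)]. *)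
Definition expo (q : \bar R) : R :=
  n%:R * (2 * qinv q - 1) * (if 2^-1 <= qinv q then 1 else rho).

Lemma continuous_kappa e p : continuous (kappa e p).
Proof. exact: continuous_omega_affine. Qed.

Lemma Kfun_kappa e p : Kfun (kappa e p).
Proof. exact: Kfun_omega_affine. Qed.

Lemma Kfun_kappaM e p (h : V -> R) : Kfun h -> Kfun (fun y => kappa e p y * h y).
Proof.
apply: (@KfunM _ _ _ _ 1); first exact: continuous_kappa.
by move=> y; rewrite ger0_norm ?kappa_ge0 ?kappa_le1.
Qed.

Lemma cmod_wmul0 p f y : cmod (wmul 0 p f y) = kappa rho p y * cmod (f y).
Proof. by rewrite cmodM cmodR wt0 ger0_norm// kappa_ge0. Qed.

Lemma NK_L2 : exists2 D, 0 <= D & forall p f (g : V -> R), Kc f -> Kfun g ->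
  (forall y, cmod (f y) ^+ 2 <= g y) ->
  NK p f <= D * rint (fun y => kappa rho p y * g y).
Proof.
have [D D0 hD] := NN_L2; exists D => // p f g Kf Kg fg.
rewrite (le_trans (hD p _ (Kc_wmul 0 p Kf)))//; apply: ler_wpM2l => //.
apply: le_rint; [exact: Kfun_sqr (Kfun_cmod (Kc_wmul 0 p Kf))|exact: Kfun_kappaM|] => y.
rewrite cmod_wmul0 exprMn; apply: ler_pM; [by nng|by nng| |exact: fg].
exact: (omega_exp_le _ 1).
Qed.

Lemma rint_kappa_le e p : rint (kappa e p) <= pi ^+ n / dyX e p ^+ n.
Proof. by rewrite -expr_div_n; exact: rint_omega_affine_le. Qed.

Lemma rint2D (h1 h2 : V -> V -> R) : K2 h1 -> K2 h2 ->
  rint (fun x => rint (fun y => h1 x y + h2 x y)) =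
  rint (fun x => rint (h1 x)) + rint (fun x => rint (h2 x)).
Proof.
move=> k1 k2; rewrite -(rintD (K2_rint k1) (K2_rint k2)).
by apply: eq_rint => x; rewrite (rintD (K2_l x k1) (K2_l x k2)).
Qed.

Lemma rint2Z (a : R) (h : V -> V -> R) : K2 h ->
  rint (fun x => rint (fun y => a * h x y)) = a * rint (fun x => rint (h x)).
Proof.
move=> k1; rewrite -(rintZ _ (K2_rint k1)).
by apply: eq_rint => x; rewrite (rintZ _ (K2_l x k1)).
Qed.

(** Hölder's inequality on a ball of volume about [1 / S], in threshold form: in units of [mu] a
    square is at most the q-th power plus 1, and [mu] is chosen so that both terms integrate to
    multiples of [mu ^+ 2 / S]. *)
Lemma NK_ge2 (q : R) : 2 <= q -> exists2 D, 0 <= D & forall p f tau, Kc f -> 0 < tau ->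
  NK p f <= D * ((Tq q%:E p f tau * dyX rho p ^+ n) `^ (2 * q^-1) / dyX rho p ^+ n).
Proof.
move=> q2; have q0 : 0 < q by exact: lt_le_trans q2. have q1 : 1 <= q by lra.
have [D D0 hD] := NN_L2; exists (D * (1 + pi ^+ n)); first by nng.
move=> p f tau Kf t0; set A := Tq _ _ _ _; set S := dyX rho p ^+ n.
have A0 : 0 < A by exact: Tq_gt0. have S0 : 0 < S by rewrite exprn_gt0.
have Q0 : 0 < A * S by exact: mulr_gt0.
set mu := (A * S) `^ q^-1; have mu0 : 0 < mu by rewrite powR_gt0.
have muE : (A * S) `^ (2 * q^-1) = mu ^+ 2.
  by rewrite -powR_mulrn ?powR_ge0// -powRrM (mulrC 2).
rewrite muE.
have Kk := Kfun_kappaM rho p (Kfun_powR q1 Kf).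
have K1 := KfunZ (mu ^+ 2 / (A * S)) Kk; have K2 := KfunZ (mu ^+ 2) (Kfun_kappa rho p).
rewrite (le_trans (hD p _ (Kc_wmul 0 p Kf)))// -mulrA; apply: ler_wpM2l => //.
apply: (@le_trans _ _ (rint (fun y => mu ^+ 2 / (A * S) * (kappa rho p y * cmod (f y) `^ q)
    + mu ^+ 2 * kappa rho p y))).
  apply: le_rint; [exact: Kfun_sqr (Kfun_cmod (Kc_wmul 0 p Kf))|exact: KfunD|] => y.
  rewrite cmod_wmul0 exprMn.
  have h := powR_split2 q2 (divr_ge0 (cmod_ge0 (f y)) (ltW mu0)).
  rewrite powR_div// ?cmod_ge0// in h.
  have h2 : cmod (f y) ^+ 2 <= mu ^+ 2 * (cmod (f y) `^ q / (A * S) + 1).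
    rewrite (_ : cmod (f y) = mu * (cmod (f y) / mu)) ; last by field; rewrite gt_eqF.
    rewrite exprMn (_ : mu * (cmod (f y) / mu) = cmod (f y)); last by field; rewrite gt_eqF.
    by apply: ler_wpM2l => //; exact: sqr_ge0.
  apply: (@le_trans _ _ (kappa rho p y * (mu ^+ 2 * (cmod (f y) `^ q / (A * S) + 1)))).
    by apply: ler_pM => //; [nng|nng|exact: (omega_exp_le _ 1)].
  by rewrite le_eqVlt; apply/orP; left; apply/eqP; ring.
rewrite rintD// !rintZ//; last exact: Kfun_kappa.
apply: (@le_trans _ _ (mu ^+ 2 / (A * S) * A + mu ^+ 2 * (pi ^+ n / S))).
  apply: lerD; apply: ler_wpM2l; [|by rewrite /A /Tq/= lerDl ltW|exact: sqr_ge0|exact: rint_kappa_le].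
  by rewrite divr_ge0 ?sqr_ge0// ltW.
rewrite le_eqVlt; apply/orP; left; apply/eqP; field.
by rewrite !gt_eqF.
Qed.

(** Bernstein's inequality in threshold form: [powR_split] is applied under the double integral of
    [NN_kernel], and with this [mu] its three terms all contribute multiples of [mu ^+ 2 / S]. *)
Lemma NK_le2 (q : R) : 1 <= q <= 2 -> exists2 D, 0 <= D & forall p f tau, Kc f -> 0 < tau ->
  NK p f <= D * ((Tq q%:E p f tau * dy p ^+ n) `^ (2 * q^-1) / dy p ^+ n).
Proof.
move=> q12; have /andP[q1 q2] := q12; have q0 : 0 < q by exact: lt_le_trans q1.
have [D D0 hD] := NN_kernel; exists (D * (2 * pi ^+ n + 1)); first by nng.
move=> p f tau Kf t0; set A := Tq _ _ _ _; set S := dy p ^+ n.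
have A0 : 0 < A by exact: Tq_gt0. have S0 : 0 < S by rewrite exprn_gt0.
have Q0 : 0 < A * S by exact: mulr_gt0.
set mu := (A * S) `^ q^-1; have mu0 : 0 < mu by rewrite powR_gt0.
have muE : (A * S) `^ (2 * q^-1) = mu ^+ 2.
  by rewrite -powR_mulrn ?powR_ge0// -powRrM (mulrC 2).
rewrite muE.
pose h y := kappa rho p y * cmod (f y) `^ q.
have Kh : Kfun h := Kfun_kappaM rho p (Kfun_powR q1 Kf).
have h0 y : 0 <= h y by rewrite mulr_ge0 ?powR_ge0 ?kappa_ge0.
have KF := Kc_wmul 0 p Kf.
have hA : rint h <= A by rewrite /A lerDl ltW.
have Ih : 0 <= rint h by exact: rint_ge0.
have K1 : K2 (fun y y' => h y * omega (dy p *: (y - y'))).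
  apply: K2_omega_sub => //; first by have [] := Kh.
  have [E E0 hE] := kappa_le_omega rho p; have [B B0 hB] := KfunE (Kfun_powR q1 Kf).
  exists (E * B) => y; rewrite ger0_norm// (_ : E * B * _ = (E * omega y) * (B * omega y)); last by ring.
  apply: ler_pM; [by nng|exact: powR_ge0|exact: hE|].
  exact: le_trans (ler_norm _) (hB y).
have K1' : K2 (fun y y' => h y' * omega (dy p *: (y - y'))).
  by have := K2_swap K1; under eq_fun do under eq_fun do rewrite omega_subC.
have K2h : K2 (fun y y' => h y * h y').
  have [ch _] := Kh; apply: (Kfun_K2 _ Kh Kh).
    by apply: continuous_mul; apply: (continuous_comp' _ ch); cont_proj.
  by move=> y y'; rewrite ger0_norm// mulr_ge0.
pose c := mu ^+ 2 / (A * S); pose d := mu ^+ 2 / (A * S) ^+ 2.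
have c0 : 0 <= c by rewrite divr_ge0 ?sqr_ge0// ltW.
have d0 : 0 <= d by rewrite divr_ge0 ?sqr_ge0// ltW.
have KR := K2D (K2D (K2Z c K1) (K2Z c K1')) (K2Z d K2h).
have KL : K2 (fun y y' => cmod (wmul 0 p f y) * cmod (wmul 0 p f y') * omega (dy p *: (y - y'))).
  have cF := Kc_cont KF.
  apply: (Kfun_K2 _ (Kfun_cmod KF) (Kfun_cmod KF)).
    apply: continuous_mul; last exact: continuous_omega_sub.
    by apply: continuous_mul; apply: (continuous_comp' _ (ccont_cmod cF)); cont_proj.
  move=> y y'; rewrite normrM [X in _ * X]ger0_norm ?omega_ge0// ger0_norm; last by nng.
  by rewrite ler_piMr ?omega_le1//; nng.
rewrite (le_trans (hD p _ KF))// -mulrA; apply: ler_wpM2l => //.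
have L := @le_rint2 _ _ _ _ _ KL KR.
have {}L : rint (fun y => rint (fun y' => cmod (wmul 0 p f y) * cmod (wmul 0 p f y') * omega (dy p *: (y - y'))))
    <= rint (fun y => rint (fun y' => c * (h y * omega (dy p *: (y - y'))) +
         c * (h y' * omega (dy p *: (y - y'))) + d * (h y * h y'))).
  apply: L => y y'; rewrite !cmod_wmul0.
  have := powR_split q12 (divr_ge0 (cmod_ge0 (f y)) (ltW mu0)) (divr_ge0 (cmod_ge0 (f y')) (ltW mu0)).
  rewrite !powR_div// ?cmod_ge0// => hs.
  set a := cmod (f y) in hs *; set b := cmod (f y') in hs *.
  set k := kappa rho p y; set k' := kappa rho p y'; set w := omega _.
  have k0 : 0 <= k by exact: kappa_ge0. have k0' : 0 <= k' by exact: kappa_ge0.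
  have w0 : 0 <= w by exact: omega_ge0. have mu0' := ltW mu0.
  have k1 : k <= 1 by exact: kappa_le1. have k1' : k' <= 1 by exact: kappa_le1.
  have w1 : w <= 1 by exact: omega_le1.
  have pa : 0 <= a `^ q by exact: powR_ge0. have pb : 0 <= b `^ q by exact: powR_ge0.
  apply: (@le_trans _ _ ((k * k' * w) * (mu ^+ 2 * (a `^ q / (A * S) + b `^ q / (A * S) + a `^ q / (A * S) * (b `^ q / (A * S)))))).
    rewrite (_ : k * a * (k' * b) * w = (k * k' * w) * (mu ^+ 2 * (a / mu * (b / mu)))); last first.
      by field; rewrite gt_eqF.
    by do 2 (apply: ler_wpM2l; first by nng).
  rewrite (_ : _ * (mu ^+ 2 * _) = c * (k * a `^ q * w) * k' + c * (k' * b `^ q * w) * k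
      + d * (k * a `^ q * (k' * b `^ q)) * w); last first.
    by rewrite /c /d; field; rewrite !gt_eqF.
  apply: lerD; first apply: lerD; rewrite ler_piMr//; by nng.
apply: (le_trans (ler_wpM2l (ltW S0) L)).
rewrite (_ : rint _ = c * rint (fun y => rint (fun y' => h y * omega (dy p *: (y - y')))) +
   c * rint (fun y => rint (fun y' => h y' * omega (dy p *: (y - y')))) + d * (rint h * rint h)); last first.
  rewrite (rint2D (K2D (K2Z c K1) (K2Z c K1')) (K2Z d K2h)) (rint2D (K2Z c K1) (K2Z c K1')).
  rewrite (rint2Z c K1) (rint2Z c K1') (rint2Z d K2h); congr (_ + _ * _).
  by rewrite -(rintZ _ Kh); apply: eq_rint => y; rewrite rintZ// mulrC.
have I1 : rint (fun y => rint (fun y' => h y * omega (dy p *: (y - y')))) <= pi ^+ n / S * A.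
  apply: (@le_trans _ _ (rint (fun y => pi ^+ n / S * h y))).
    apply: le_rint; [exact: K2_rint K1|exact: KfunZ|] => y.
    have Ko : Kfun (fun y' => omega (dy p *: (y - y'))).
      by under eq_fun do rewrite omega_subC; exact: Kfun_omega_affine.
    rewrite rintZ// mulrC; apply: ler_wpM2r => //.
    under eq_rint do rewrite omega_subC.
    by rewrite (le_trans (rint_omega_affine_le _ _))// expr_div_n.
  by rewrite rintZ//; apply: ler_wpM2l => //; apply: divr_ge0; [by nng|exact: ltW].
have I2 : rint (fun y => rint (fun y' => h y' * omega (dy p *: (y - y')))) <= pi ^+ n / S * A.
  rewrite (K2_Fubini K1'); apply: le_trans I1; rewrite le_eqVlt; apply/orP; left; apply/eqP.
  by apply: eq_rint => y; apply: eq_rint => y'; rewrite omega_subC.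
apply: (@le_trans _ _ (S * (c * (pi ^+ n / S * A) + c * (pi ^+ n / S * A) + d * (A * A)))).
  apply: ler_wpM2l; first exact: ltW.
  apply: lerD; first exact: (lerD (ler_wpM2l c0 I1) (ler_wpM2l c0 I2)).
  exact: (ler_wpM2l d0 (ler_pM Ih Ih hA hA)).
rewrite le_eqVlt; apply/orP; left; apply/eqP; rewrite /c /d; field.
by rewrite !gt_eqF.
Qed.

Lemma NK_le (q : \bar R) : (1%:E <= q)%E -> exists2 D, 0 <= D & forall p f tau,
  Kc f -> 0 < tau -> (q = +oo%E -> forall y, cmod (f y) <= 1) ->
  NK p f <= D * (dyX (expo q) p * Tq q p f tau `^ (2 * qinv q)).
Proof.
case: q => [q||//]; rewrite ?lee_fin => q1; last first.
  have [D D0 hD] := NN_L2; exists (D * pi ^+ n); first by nng.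
  move=> p f tau Kf t0 f1; have {}f1 := f1 erefl.
  rewrite (le_trans (hD p _ (Kc_wmul 0 p Kf)))// -mulrA; apply: ler_wpM2l => //.
  (* For [q = +oo] the quantity [Tq] appears to the power 0, and the bound is the volume of the
     ball. *)
  rewrite /qinv mulr0 powRr0 mulr1 /expo /qinv mulr0 sub0r mulrN1.
  rewrite ifF; last by apply/negbTE; rewrite -ltNge invr_gt0.
  rewrite mulNr dyXN mulrC (mulrC _ rho) -dyX_expn mulrC.
  apply: le_trans (rint_kappa_le _ _).
  apply: le_rint; [exact: Kfun_sqr (Kfun_cmod (Kc_wmul 0 p Kf))|exact: Kfun_kappa|] => y.
  rewrite cmod_wmul0 exprMn -[leRHS]mulr1; apply: ler_pM; [by nng|by nng| |].
    exact: (omega_exp_le _ 1).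
  by rewrite exprn_ile1// cmod_ge0.
have q0 : 0 < q by exact: lt_le_trans q1.
have key (S : P -> R) e D : 0 <= D -> (forall p, S p = dyX e p) ->
    (forall p f tau, Kc f -> 0 < tau -> NK p f <= D * ((Tq q%:E p f tau * S p) `^ (2 * q^-1) / S p)) ->
    forall p f tau, Kc f -> 0 < tau -> (q%:E = +oo%E -> forall y, cmod (f y) <= 1) ->
    NK p f <= D * (dyX (e * (2 * q^-1 - 1)) p * Tq q%:E p f tau `^ (2 * q^-1)).
  move=> D0 SE H p f tau Kf t0 _; rewrite (le_trans (H p f tau Kf t0))//; apply: ler_wpM2l => //.
  rewrite SE powRM ?(ltW (Tq_gt0 _ _ _ t0))//; last exact: ltW.
  by rewrite dyX_powR mulrBr mulr1 dyXD dyXN -mulrA mulrC.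
have [q2|q2] := leP q 2.
  have [|D D0 hD] := @NK_le2 q; first by rewrite q1.
  exists D => //; rewrite /expo/= ifT ?mulr1; last by rewrite lef_pV2 ?posrE.
  by apply: key hD => // p; exact: dy_expn.
have [D D0 hD] := NK_ge2 (ltW q2).
exists D => //; rewrite /expo/= ifF; last first.
  by apply/negbTE; rewrite -ltNge ltf_pV2 ?posrE.
rewrite mulrAC; apply: key hD => // p.
by rewrite dyX_expn (mulrC rho).
Qed.

(** * Local [L^r] estimates *)

(** A crude form of the weighted arithmetic-geometric mean inequality: both bases are at most
    [s + t]. *)
Lemma powR_convex_le (s t a b : R) : 0 < s -> 0 < t -> 0 <= a -> 0 <= b -> a + b = 1 ->
  s `^ a * t `^ b <= s + t.
Proof.
move=> s0 t0 a0 b0 ab; pose u := s + t.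
have u0 : 0 < u by exact: addr_gt0.
have -> : s + t = u `^ a * u `^ b by rewrite -powRD ?ab ?powRr1 ?ltW// (gt_eqF u0) implybT.
apply: ler_pM; rewrite ?powR_ge0//; apply: ge0_ler_powR; rewrite ?nnegrE// ?ltW///u.
  by rewrite ltrDl.
by rewrite ltrDr.
Qed.

Lemma powR_le_sqr (r t : R) : 0 < r <= 2 -> 0 <= t -> t `^ r <= t ^+ 2 + 1.
Proof.
move=> /andP[r0 r2] t0; have [t1|t1] := leP t 1.
  rewrite (@le_trans _ _ 1)//; last by rewrite lerDr sqr_ge0.
  apply: (@le_trans _ _ (1 `^ r)); last by rewrite powR1.
  by apply: ge0_ler_powR; rewrite ?nnegrE// ltW.
by rewrite ler_wpDr// -powR_mulrn// ler_powR// ltW.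
Qed.

Definition adm (q : \bar R) (f : V -> C) := q = +oo%E -> forall y, cmod (f y) <= 1.

(** The natural size of the operator on a ball is [nu = 2 ^ (alpha j) G], with [G] the size of the
    inputs. For [r <= 2], [nu ^+ 2] is the L^2 bound divided by the volume [2 ^ (- delta n j)]; for
    [r > 2], [nu] is the sup bound. In both cases the L^2 bound is [nu ^+ 2] times
    [2 ^ (- gamma j)], which determines [gamma_exp]. *)
Definition alpha_exp (r : R) q1 q2 : R :=
  if r <= 2 then m + n%:R / 2 + delta * n%:R / 2 + (expo q1 + expo q2) / 2
  else m + n%:R + (expo q1 + expo q2) / 2.

Definition gamma_exp (r : R) : R := if r <= 2 then delta * n%:R else n%:R.

Lemma powR_sqr (x a : R) : (x `^ a) ^+ 2 = x `^ (2 * a).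
Proof. by rewrite -powR_mulrn ?powR_ge0// -powRrM mulrC. Qed.

(** The relation [r / q1 + r / q2 = 1] turns a product of powers into the sum of the two [Tq]; the
    bound is linear in them, so it can be integrated over the centre. *)
Lemma local_est M b (r : R) q1 q2 :
  sclass vec3 sc3 (n.*2 + n.*2 + n.*2) (n + n + n) (W3 (n.*2 + n.*2).+1 M.+2) b ->
  0 < r -> (1%:E <= q1)%E -> (1%:E <= q2)%E -> r^-1 = qinv q1 + qinv q2 ->
  exists2 D, 0 <= D & forall p f g t1 t2, Kc f -> Kc g -> 0 < t1 -> 0 < t2 ->
    adm q1 f -> adm q2 g ->
    rint (fun x => kappa delta p x * cmod (Tbil b p (fourier f) (fourier g) x) `^ r) <=
    D * (dyX (r * alpha_exp r q1 q2 - gamma_exp r) p * (Tq q1 p f t1 + Tq q2 p g t2)).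
Proof.
move=> S r0 h1 h2 rq.
have [D D0 hD] := bilinear_core S.
have [D1 D10 hD1] := NK_le h1; have [D2 D20 hD2] := NK_le h2.
set e := expo q1 + expo q2; pose E := D * (D1 * D2).
have E0 : 0 <= E by rewrite /E; nng.
have th0 q : (1%:E <= q)%E -> 0 <= qinv q.
  by case: q => [q||]//; rewrite lee_fin => hq; rewrite /= invr_ge0; exact: le_trans hq.
have rr : r * qinv q1 + r * qinv q2 = 1 by rewrite -mulrDr -rq divff// gt_eqF.
exists (E + pi ^+ n + Num.sqrt E `^ (r - 2) * E).
  by rewrite !addr_ge0 ?mulr_ge0 ?powR_ge0//; nng.
move=> p f g t1 t2 Kf Kg t10 t20 a1 a2.
set T1 := Tq q1 p f t1; set T2 := Tq q2 p g t2.
have T10 : 0 < T1 by exact: Tq_gt0. have T20 : 0 < T2 by exact: Tq_gt0.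
set Z := Tbil b p (fourier f) (fourier g).
have [KZ L2 LS] := hD p f g Kf Kg.
pose G := T1 `^ qinv q1 * T2 `^ qinv q2.
have G0 : 0 < G by rewrite mulr_gt0// powR_gt0.
have Gr : G `^ r <= T1 + T2.
  rewrite powRM ?powR_ge0// -!powRrM; apply: powR_convex_le => //; first 2 last.
  - by rewrite mulrC (mulrC _ r).
  - by apply: mulr_ge0; [exact: th0|exact: ltW].
  - by apply: mulr_ge0; [exact: th0|exact: ltW].
have U : NK p f * NK p g <= D1 * D2 * (dyX e p * G ^+ 2).
  apply: (@le_trans _ _ ((D1 * (dyX (expo q1) p * T1 `^ (2 * qinv q1))) *
      (D2 * (dyX (expo q2) p * T2 `^ (2 * qinv q2))))).
    by apply: ler_pM; rewrite ?NK_ge0//; [exact: hD1|exact: hD2].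
  rewrite le_eqVlt; apply/orP; left; apply/eqP.
  by rewrite /G exprMn !powR_sqr /e dyXD; ring.
have U2 (c : R) : 0 <= c -> D * (c * (NK p f * NK p g)) <= E * (c * dyX e p * G ^+ 2).
  move=> c0; apply: (@le_trans _ _ (D * (c * (D1 * D2 * (dyX e p * G ^+ 2))))).
    by do 2 apply: ler_wpM2l => //.
  by rewrite le_eqVlt /E; apply/orP; left; apply/eqP; ring.
pose nu := dyX (alpha_exp r q1 q2) p * G.
have nu0 : 0 < nu by exact: mulr_gt0.
have nur : nu `^ r = dyX (r * alpha_exp r q1 q2) p * G `^ r.
  have -> : nu `^ r = dyX (alpha_exp r q1 q2) p `^ r * G `^ r by apply: powRM; exact: ltW.
  by rewrite dyX_powR (mulrC r).
have nu2 : nu ^+ 2 = dyX (2 * alpha_exp r q1 q2) p * G ^+ 2.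
  by rewrite /nu; move: (G) => g'; rewrite exprMn dyX_expn mulrC (mulrC 2) mulrC.
clearbody nu.
have L2' : rint (fun x => cmod (Z x) ^+ 2) <= E * (nu ^+ 2 * dyX (- gamma_exp r) p).
  rewrite (le_trans L2)// (le_trans (U2 _ _))//; first by nng.
  rewrite le_eqVlt; apply/orP; left; apply/eqP; congr (_ * _).
  rewrite nu2 [in RHS]mulrAC; congr (_ * _).
  rewrite dyX_expn dy_expn -!dyXD /alpha_exp /gamma_exp /e; congr (dyX _ _).
  by case: ifP => _; field.
have KZ2 : Kfun (fun x => cmod (Z x) ^+ 2) by exact: Kfun_sqr (Kfun_cmod KZ).
have [B B0 hB] := KcE KZ.
have KL : Kfun (fun x => kappa delta p x * cmod (Z x) `^ r).
  have : Kfun (fun x => cmod (Z x) `^ r * kappa delta p x).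
    apply: (@KfunM _ _ _ _ (B `^ r)); last exact: Kfun_kappa.
      by apply: continuous_cmod_powR => //; exact: Kc_cont.
    move=> x; rewrite ger0_norm ?powR_ge0//; apply: ge0_ler_powR; rewrite ?nnegrE ?cmod_ge0 ?(ltW r0)//.
    by rewrite (le_trans (hB x))// ler_piMr ?omega_le1.
  by under eq_fun do rewrite mulrC.
have fin (K : R) : 0 <= K -> rint (fun x => kappa delta p x * cmod (Z x) `^ r) <= K * (nu `^ r * dyX (- gamma_exp r) p) ->
    rint (fun x => kappa delta p x * cmod (Z x) `^ r) <=
    K * (dyX (r * alpha_exp r q1 q2 - gamma_exp r) p * (T1 + T2)).
  move=> K0 h; apply: (le_trans h); apply: ler_wpM2l => //.
  rewrite nur mulrAC -dyXD; apply: ler_wpM2l => //; exact: ltW.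
(* For [r <= 2] the threshold is [nu]: in this unit the r-th power is at most the square plus 1, and
   the constant is integrated against the weight of the ball. *)
have [r2|r2] := leP r 2.
  have hh : rint (fun x => kappa delta p x * cmod (Z x) `^ r) <= (E + pi ^+ n) * (nu `^ r * dyX (- gamma_exp r) p).
    have Ka := KfunZ (nu `^ r / nu ^+ 2) KZ2; have Kb := KfunZ (nu `^ r) (Kfun_kappa delta p).
    apply: (@le_trans _ _ (rint (fun x => nu `^ r / nu ^+ 2 * cmod (Z x) ^+ 2 + nu `^ r * kappa delta p x))).
      apply: le_rint => //; first exact: KfunD.
      move=> x; have k0 := kappa_ge0 delta p x; have k1 := kappa_le1 delta p x.
      have h := @powR_le_sqr r (cmod (Z x) / nu) _ (divr_ge0 (cmod_ge0 _) (ltW nu0)).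
      have {}h : cmod (Z x) `^ r <= nu `^ r * ((cmod (Z x) / nu) ^+ 2 + 1).
        rewrite [X in X `^ r](_ : _ = nu * (cmod (Z x) / nu)); last by field; rewrite gt_eqF.
        rewrite powRM ?divr_ge0 ?cmod_ge0 ?(ltW nu0)//; apply: ler_wpM2l; first exact: powR_ge0.
        by apply: h; rewrite r0.
      apply: (le_trans (ler_wpM2l k0 h)); rewrite expr_div_n.
      rewrite (_ : kappa delta p x * _ = (nu `^ r / nu ^+ 2 * cmod (Z x) ^+ 2) * kappa delta p x
         + nu `^ r * kappa delta p x); last by ring.
      by rewrite lerD2r ler_piMr// mulr_ge0 ?sqr_ge0// divr_ge0 ?powR_ge0 ?sqr_ge0.
    rewrite rintD// !rintZ//; last exact: Kfun_kappa.
    rewrite mulrDl; apply: lerD.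
      apply: (le_trans (ler_wpM2l _ L2')); first by rewrite divr_ge0 ?powR_ge0 ?sqr_ge0.
      by rewrite le_eqVlt; apply/orP; left; apply/eqP; field; rewrite gt_eqF.
    rewrite mulrCA; apply: ler_wpM2l; first exact: powR_ge0.
    by rewrite (le_trans (rint_kappa_le _ _))// /gamma_exp r2 dyXN -dyX_expn.
  apply: (le_trans (fin _ _ hh)); first by rewrite addr_ge0//; nng.
  apply: ler_wpM2r; first by apply: mulr_ge0; [exact: ltW|rewrite addr_ge0// ltW].
  by rewrite lerDl mulr_ge0 ?powR_ge0.
(* For [r > 2], all but two powers are estimated by the sup bound. *)
have sup x : cmod (Z x) <= Num.sqrt E * nu.
  have : cmod (Z x) ^+ 2 <= (Num.sqrt E * nu) ^+ 2.
    have -> : (Num.sqrt E * nu) ^+ 2 = E * nu ^+ 2.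
      by move: (nu) => v; rewrite exprMn sqr_sqrtr.
    apply: (le_trans (LS x)); apply: (le_trans (U2 _ _)); first by nng.
    rewrite le_eqVlt; apply/orP; left; apply/eqP; congr (_ * _).
    rewrite nu2; move: (G ^+ 2) => g2; congr (_ * _); rewrite !dyX_expn dy_expn dyX_expn -!dyXD.
    by rewrite /alpha_exp leNgt r2/= /e; congr (dyX _ _); field.
  have sn0 : 0 <= Num.sqrt E * nu by apply: mulr_ge0; [exact: sqrtr_ge0|exact: ltW].
  by rewrite ler_sqr ?nnegrE ?cmod_ge0.
have hh : rint (fun x => kappa delta p x * cmod (Z x) `^ r) <=
    (Num.sqrt E `^ (r - 2) * E) * (nu `^ r * dyX (- gamma_exp r) p).
  apply: (@le_trans _ _ (rint (fun x => (Num.sqrt E * nu) `^ (r - 2) * cmod (Z x) ^+ 2))).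
    apply: le_rint => //; first exact: KfunZ.
    move=> x; apply: (@le_trans _ _ (cmod (Z x) `^ r)).
      by rewrite ler_piMl ?powR_ge0 ?kappa_le1.
    have [->|z0] := eqVneq (cmod (Z x)) 0.
      by rewrite powR0 ?gt_eqF// expr0n/= mulr0.
    rewrite (_ : r = (r - 2) + 2%:R) ; last by ring.
    rewrite powRD ?z0 ?implybT// powR_mulrn ?cmod_ge0// (_ : r - 2 + 2 - 2 = r - 2); last by ring.
    apply: ler_wpM2r; first exact: sqr_ge0.
    apply: ge0_ler_powR; rewrite ?nnegrE ?cmod_ge0// ?mulr_ge0 ?sqrtr_ge0 ?(ltW nu0)//.
    by rewrite subr_ge0 ltW.
  rewrite rintZ// (le_trans (ler_wpM2l (powR_ge0 _ _) L2'))// powRM ?sqrtr_ge0 ?(ltW nu0)//.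
  rewrite le_eqVlt; apply/orP; left; apply/eqP.
  have -> : nu `^ r = nu `^ (r - 2) * nu ^+ 2.
    rewrite -(powR_mulrn _ (ltW nu0)) -powRD; first by congr (_ `^ _); ring.
    by rewrite (gt_eqF nu0) implybT.
  by ring.
apply: (le_trans (fin _ _ hh)); first by rewrite mulr_ge0 ?powR_ge0.
apply: ler_wpM2r; first by apply: mulr_ge0; [exact: ltW|rewrite addr_ge0// ltW].
by rewrite lerDr addr_ge0//; nng.
Qed.

(** * Averaging over the centre *)

Definition nrm (q : \bar R) (f : V -> C) : Prop :=
  match q with
  | EFin q' => rint (fun y => cmod (f y) `^ q') <= 1
  | _ => forall y, cmod (f y) <= 1
  end.

(** The second power of [omega] is consumed when a kernel in [y - u] has to be dominated in both
    variables. *)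
Definition Kc2 (f : V -> C) :=
  ccont f /\ exists B, forall y, cmod (f y) <= B * omega y ^+ 2.

Lemma Kc2_Kc f : Kc2 f -> Kc f.
Proof.
move=> [cf [B hB]].
have B0 : 0 <= B.
  by have := le_trans (cmod_ge0 _) (hB 0); rewrite pmulr_lge0// exprn_gt0// omega_gt0.
apply: (@KcI _ _ _ B) => // y; rewrite (le_trans (hB y))//; apply: ler_wpM2l => //.
exact: (omega_exp_le _ 1).
Qed.

Lemma rint_omega_le e j : rint (fun y : V => dyX e (j, 0) * omega y) <= pi ^+ n * dyX e (j, 0).
Proof.
rewrite rintZ; last exact: Kfun_omega.
rewrite mulrC; apply: ler_wpM2r; first exact: ltW.
have := rint_omega_affine_le (0 : V) (ltr01 : 0 < (1 : R)).
by under eq_rint do rewrite scale1r subr0; rewrite divr1.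
Qed.

(** Integration over [u] replaces [kappa] by its mass, of the order of the volume [2 ^ (- rho n j)].
    The free term [tau] decays in [u] and is given the same total size, so that it costs a factor
    2. *)
Lemma rint_Tq q j f : (1%:E <= q)%E -> Kc2 f -> nrm q f ->
  let tau u : R := dyX (- (rho * n%:R)) (j, 0) * omega u in
  Kfun (fun u => Tq q (j, u) f (tau u)) /\
  rint (fun u => Tq q (j, u) f (tau u)) <= 2 * pi ^+ n * dyX (- (rho * n%:R)) (j, 0).
Proof.
move=> h1 Kf nf tau; have Kt : Kfun tau by apply: KfunZ; exact: Kfun_omega.
have It : rint tau <= pi ^+ n * dyX (- (rho * n%:R)) (j, 0) by exact: rint_omega_le.
have I0 : 0 <= pi ^+ n * dyX (- (rho * n%:R)) (j, 0) by nng.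
case: q h1 nf => [q||] //; last first.
  move=> _ _; have E : (fun u => Tq +oo%E (j, u) f (tau u)) = tau.
    by apply/funext => u; rewrite /Tq add0r.
  by rewrite E; split => //; lra.
rewrite lee_fin /nrm => h1 nf; have q0 : 0 < q by exact: lt_le_trans h1.
have [cf [B hB]] := Kf.
have B0 : 0 <= B.
  by have := le_trans (cmod_ge0 _) (hB 0); rewrite pmulr_lge0// exprn_gt0// omega_gt0.
have Kfq := Kfun_powR h1 (Kc2_Kc Kf).
have KK : K2 (fun u y => cmod (f y) `^ q * omega (dyX rho (j, 0) *: (y - u))).
  apply: K2_swap; apply: K2_omega_sub => //; first by have [] := Kfq.
  exists (B `^ q) => y; rewrite ger0_norm ?powR_ge0//.
  apply: (@le_trans _ _ ((B * omega y ^+ 2) `^ q)).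
    by apply: ge0_ler_powR; rewrite ?nnegrE ?cmod_ge0 ?(ltW q0)//; nng.
  rewrite powRM//; last by nng.
  apply: ler_wpM2l; first exact: powR_ge0.
  apply: ge1r_powR => //; rewrite exprn_gt0 ?omega_gt0//=.
  by rewrite exprn_ile1 ?omega_le1 ?omega_ge0.
have KR := K2_rint KK.
have E u : rint (fun y => kappa rho (j, u) y * cmod (f y) `^ q) =
    rint (fun y => cmod (f y) `^ q * omega (dyX rho (j, 0) *: (y - u))).
  by apply: eq_rint => y; rewrite mulrC.
have -> : (fun u => Tq q%:E (j, u) f (tau u)) = (fun u =>
    rint (fun y => cmod (f y) `^ q * omega (dyX rho (j, 0) *: (y - u))) + tau u).
  by apply/funext => u; rewrite /Tq E.
split; first exact: KfunD.
rewrite rintD// (_ : 2 * pi ^+ n * _ = pi ^+ n * dyX (- (rho * n%:R)) (j, 0) + pi ^+ n * dyX (- (rho * n%:R)) (j, 0)); last by ring.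
apply: lerD => //; rewrite (K2_Fubini KK).
apply: (@le_trans _ _ (rint (fun y => pi ^+ n * dyX (- (rho * n%:R)) (j, 0) * cmod (f y) `^ q))).
  apply: le_rint; [exact: K2_rint (K2_swap KK)|exact: KfunZ|] => y.
  have Ko : Kfun (fun u : V => omega (dyX rho (j, 0) *: (y - u))).
    by under eq_fun do rewrite omega_subC; exact: Kfun_omega_affine.
  rewrite rintZ// mulrC; apply: ler_wpM2r; first exact: powR_ge0.
  under eq_rint do rewrite omega_subC.
  by rewrite (le_trans (rint_omega_affine_le _ _))// expr_div_n dyXN -dyX_expn.
by rewrite rintZ// ler_piMr.
Qed.

Section Averaging.
Variables (M : nat) (a : nat -> X3 -> R).
Let L := (n.*2 + n.*2).+1.
Let bL (p : P) (X : X3) : R := kappa delta p X.1.1 ^+ L * a p.1 X.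
Hypothesis SL : sclass vec3 sc3 (n.*2 + n.*2 + n.*2) (n + n + n) (W3 L M.+2) bL.

Definition TT (f g : V -> C) (j : nat) (x : V) : C :=
  Tbil (fun p => a p.1) (j, 0) (fourier f) (fourier g) x.

Let SL' : sclass vec3 sc3 n.*2 n (W3 L M.+2) bL.
Proof. by apply: (sclass_x _ _ SL); [exact: leq_addl|exact: leq_addl]. Qed.

(** The localisation depends on [x] alone, so it multiplies the output and can be divided out, for
    every centre [u]. *)
Lemma TT_localize f g j u x : Kc f -> Kc g ->
  TT f g j x = ((kappa delta (j, u) x ^+ L)^-1)%:C * Tbil bL (j, u) (fourier f) (fourier g) x.
Proof.
move=> Kf Kg; have K := K2c_Tbil (j, u) x SL' (fourier_bdc Kf) (fourier_bdc Kg).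
rewrite /Tbil -cintZ; last exact: K2c_cint.
apply: eq_cint => eta; rewrite -cintZ; last exact: (K2c_l eta K).
apply: eq_cint => xi; rewrite !mulrA -rmorphM/= mulKf//.
by rewrite expf_neq0// gt_eqF// kappa_gt0.
Qed.

Lemma ccont_TT f g j : Kc f -> Kc g -> ccont (TT f g j).
Proof.
move=> Kf Kg; have -> : TT f g j = fun x => ((kappa delta (j, 0) x ^+ L)^-1)%:C *
    Tbil bL (j, 0) (fourier f) (fourier g) x.
  by apply/funext => x; exact: TT_localize.
apply: ccontM; last exact: Kc_cont (Kc_Tbil SL' _ (fourier_bdc Kf) (fourier_bdc Kg)).
apply: ccontR; apply: (continuous_inv (f := fun x => kappa delta (j, 0) x ^+ L)).
  by move=> x; rewrite expf_neq0// gt_eqF// kappa_gt0.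
by apply: continuous_exprn; exact: continuous_kappa.
Qed.

Lemma NK_bounded : exists2 D, 0 <= D & forall p f, Kc f ->
  NK p f <= D * rint (fun y => cmod (f y) ^+ 2).
Proof.
have [D D0 hD] := NK_L2; exists D => // p f Kf.
have Kf2 := Kfun_sqr (Kfun_cmod Kf).
rewrite (le_trans (hD p f _ Kf Kf2 (fun y => lexx _)))//; apply: ler_wpM2l => //.
apply: le_rint => //; first exact: Kfun_kappaM.
by move=> y; rewrite ler_piMl ?kappa_le1//; nng.
Qed.

(** Each point is taken as its own centre, where [kappa] equals 1; the sup estimate is uniform in
    the centre. *)
Lemma TT_bounded f g j : Kc f -> Kc g -> exists2 B, 0 <= B & forall x, cmod (TT f g j x) <= B.
Proof.
move=> Kf Kg; have [D D0 hD] := bilinear_core SL; have [E E0 hE] := NK_bounded.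
set I := rint (fun y => cmod (f y) ^+ 2); set J := rint (fun y => cmod (g y) ^+ 2).
pose B := D * ((dyX m (j, 0) ^+ 2 * (dy (j, 0) ^+ n) ^+ 2) * ((E * I) * (E * J))).
exists (Num.sqrt B); first exact: sqrtr_ge0.
move=> u; rewrite (TT_localize j u u Kf Kg).
have -> : kappa delta (j, u) u = 1.
  rewrite /kappa subrr scaler0 /omega big1// => i _.
  by rewrite mxE /lweight expr0n/= addr0 invr1.
rewrite expr1n invr1 mul1r.
have [_ _ /(_ u) h] := hD (j, u) f g Kf Kg.
rewrite -[leLHS]ger0_norm ?cmod_ge0// -sqrtr_sqr ler_wsqrtr//.
apply: (le_trans h); apply: ler_wpM2l => //; apply: ler_wpM2l; first by nng.
by apply: ler_pM; rewrite ?NK_ge0//; exact: hE.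
Qed.

(** [TT] is only known to be bounded, so the weight [omega (c *: (x - 0)) ^+ 2] makes the integrals
    converge. [D] is independent of [c], which allows the weight to be removed in the limit. *)
Lemma dyadic_est (r : R) q1 q2 :
  0 < r -> (1%:E <= q1)%E -> (1%:E <= q2)%E -> r^-1 = qinv q1 + qinv q2 ->
  exists2 D, 0 <= D & forall f g j (c : R), Kc2 f -> Kc2 g -> nrm q1 f -> nrm q2 g -> 0 < c ->
    rint (fun x => omega (c *: (x - 0)) ^+ 2 * cmod (TT f g j x) `^ r) <=
    D * (2 ^+ j) `^ (r * alpha_exp r q1 q2 - gamma_exp r + delta * n%:R - rho * n%:R).
Proof.
move=> r0 h1 h2 rq; have [D D0 hD] := local_est SL r0 h1 h2 rq.
(* With this [K], the power [kappa ^+ K] is at most the r-th power of [kappa ^+ L], the factor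
   between [TT] and the localised operator. *)
have [K hK] : exists K : nat, L%:R * r <= K%:R.
  exists (Num.bound (L%:R * r)); apply: ltW; apply: archi_boundP.
  by rewrite mulr_ge0 ?ler0n ?(ltW r0).
pose k1 : R := (2 ^+ K.+1 / 2) ^+ n.
have k10 : 0 <= k1 by rewrite /k1 exprn_ge0// divr_ge0.
exists (k1 * (D * (4 * pi ^+ n))); first by nng.
move=> f g j c Kf2 Kg2 nf ng c0.
have Kf := Kc2_Kc Kf2; have Kg := Kc2_Kc Kg2.
have [B B0 hB] := TT_bounded j Kf Kg; have cT := ccont_TT j Kf Kg.
pose Phi (x : V) : R := omega (c *: (x - 0)) ^+ 2 * cmod (TT f g j x) `^ r.
have Phi0 x : 0 <= Phi x by rewrite mulr_ge0 ?powR_ge0 ?sqr_ge0.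
have cPhi : continuous Phi.
  apply: continuous_mul; last exact: continuous_cmod_powR.
  by apply: continuous_exprn; exact: continuous_omega_affine.
have [E E0 hE] := KfunE (Kfun_omega_affine (0 : V) c0).
have PhiB x : `|Phi x| <= E ^+ 2 * B `^ r * omega x ^+ 2.
  rewrite ger0_norm// /Phi (_ : _ * omega x ^+ 2 = (E * omega x) ^+ 2 * B `^ r); last by ring.
  apply: ler_pM; rewrite ?sqr_ge0 ?powR_ge0//.
    by rewrite lerXn2r ?nnegrE ?omega_ge0 ?mulr_ge0 ?omega_ge0// (le_trans (ler_norm _)).
  by apply: ge0_ler_powR; rewrite ?nnegrE ?cmod_ge0 ?(ltW r0).
pose d := dyX delta (j, 0).
have d0 : 0 < d by exact: dyX_gt0.
have KP : K2 (fun u x => Phi x * omega (d *: (x - u))).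
  by apply: K2_swap; apply: K2_omega_sub => //; exists (E ^+ 2 * B `^ r).
have KH : K2 (fun u x => Phi x * omega (d *: (x - u)) ^+ K.+1).
  apply: (K2_le _ KP).
    apply: continuous_mul; first by apply: (continuous_comp' _ cPhi); cont_proj.
    apply: continuous_exprn.
    apply: (continuous_comp' (f := fun z : V * V => (z.2, z.1)) (g := fun z : V * V => omega (d *: (z.1 - z.2)))).
      by cont_proj.
    exact: continuous_omega_sub.
  move=> u x; rewrite ger0_norm; last by apply: mulr_ge0 => //; nng.
  by apply: ler_wpM2l => //; exact: omega_exp_le.
pose e := r * alpha_exp r q1 q2 - gamma_exp r.
pose tau (u : V) : R := dyX (- (rho * n%:R)) (j, 0) * omega u.
have tau0 u : 0 < tau u by rewrite mulr_gt0 ?omega_gt0.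
have [KT1 IT1] := rint_Tq j h1 Kf2 nf; have [KT2 IT2] := rint_Tq j h2 Kg2 ng.
have adm1 : adm q1 f by move=> qq y; move: nf; rewrite qq; exact.
have adm2 : adm q2 g by move=> qq y; move: ng; rewrite qq; exact.
have KTs := KfunD KT1 KT2.
have up : rint (fun u => rint (fun x => Phi x * omega (d *: (x - u)) ^+ K.+1)) <=
    (D * dyX e (j, 0)) * (4 * pi ^+ n * dyX (- (rho * n%:R)) (j, 0)).
  apply: (@le_trans _ _ (rint (fun u => D * dyX e (j, 0) * (Tq q1 (j, u) f (tau u) + Tq q2 (j, u) g (tau u))))).
    apply: le_rint; [exact: K2_rint|exact: KfunZ|] => u.
    have := hD (j, u) f g _ _ Kf Kg (tau0 u) (tau0 u) adm1 adm2.
    rewrite mulrA; apply: le_trans.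
    have KZ := Kc_Tbil SL' (j, u) (fourier_bdc Kf) (fourier_bdc Kg).
    apply: le_rint; first exact: (K2_l u KH).
      have [Bz Bz0 hBz] := KcE KZ.
      have : Kfun (fun x => cmod (Tbil bL (j, u) (fourier f) (fourier g) x) `^ r * kappa delta (j, u) x).
        apply: (@KfunM _ _ _ _ (Bz `^ r)); last exact: Kfun_kappa.
          by apply: continuous_cmod_powR => //; exact: Kc_cont.
        move=> x; rewrite ger0_norm ?powR_ge0//; apply: ge0_ler_powR; rewrite ?nnegrE ?cmod_ge0 ?(ltW r0)//.
        by rewrite (le_trans (hBz x))// ler_piMr ?omega_le1.
      by under eq_fun do rewrite mulrC.
    move=> x; set k := kappa delta (j, u) x.
    have kk : 0 < k by exact: kappa_gt0. have kl : k <= 1 by exact: kappa_le1.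
    rewrite -[omega (d *: (x - u))]/k.
    have -> : cmod (Tbil bL (j, u) (fourier f) (fourier g) x) = k ^+ L * cmod (TT f g j x).
      rewrite (TT_localize j u x Kf Kg) cmodM cmodR gtr0_norm; last by rewrite invr_gt0 exprn_gt0.
      by rewrite mulrA divff ?mul1r// expf_neq0// gt_eqF.
    rewrite powRM ?cmod_ge0//; last by rewrite exprn_ge0// ltW.
    rewrite mulrA /Phi (exprS k).
    rewrite [leLHS](_ : _ = k * k ^+ K * cmod (TT f g j x) `^ r * omega (c *: (x - 0)) ^+ 2); last by ring.
    apply: (@le_trans _ _ (k * k ^+ K * cmod (TT f g j x) `^ r)).
      rewrite ler_piMr ?exprn_ile1 ?omega_le1 ?omega_ge0//.
      by rewrite !mulr_ge0 ?powR_ge0 ?exprn_ge0// ltW.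
    apply: ler_wpM2r; first exact: powR_ge0.
    apply: ler_wpM2l; first exact: ltW.
    rewrite -!powR_mulrn ?(ltW kk)// -powRrM; apply: ger_powR => //.
    by rewrite kk kl.
  rewrite rintZ//; apply: ler_wpM2l; first by nng.
  rewrite rintD//; move: IT1 IT2; rewrite -/tau; set I1 := rint _; set I2 := rint _; lra.
(* Over all centres the kernel has mass bounded below, so the left side is recovered up to the
   volume of a ball. *)
have low : rint Phi * (2 ^- K.+1 * (2 / d)) ^+ n <= rint (fun u => rint (fun x => Phi x * omega (d *: (x - u)) ^+ K.+1)).
  have KPhi : Kfun Phi.
    apply: Kfun_le cPhi (KfunZ (E ^+ 2 * B `^ r) (Kfun_omega n)) _ => x.
    rewrite (le_trans (PhiB x))//; apply: ler_wpM2l; first by rewrite mulr_ge0 ?powR_ge0 ?sqr_ge0.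
    exact: (omega_exp_le _ 1).
  rewrite (K2_Fubini KH) mulrC -rintZ//.
  apply: le_rint; [exact: KfunZ|exact: K2_rint (K2_swap KH)|] => x.
  have Ko : Kfun (fun u : V => omega (d *: (x - u)) ^+ K.+1).
    by under eq_fun do rewrite omega_subC; exact: Kfun_omega_exp.
  rewrite rintZ// mulrC; apply: ler_wpM2l => //.
  by under eq_rint do rewrite omega_subC; exact: rint_omega_exp_affine_ge.
have q0 : 0 < (2 ^- K.+1 * (2 / d)) ^+ n.
  by rewrite exprn_gt0// mulr_gt0 ?invr_gt0 ?exprn_gt0// divr_gt0.
rewrite -(ler_pM2r q0) (le_trans low)// (le_trans up)//.
rewrite le_eqVlt; apply/orP; left; apply/eqP.
rewrite -[(2 ^+ j) `^ _]/(dyX (e + delta * n%:R - rho * n%:R) (j, 0)) !dyXD -dyX_expn -/d.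
have kd : k1 * d ^+ n * (2 ^- K.+1 * (2 / d)) ^+ n = 1.
  rewrite /k1 -!exprMn (_ : _ * _ = 1) ?expr1n//.
  have n2 : (2 : R) ^+ K.+1 != 0 by rewrite expf_neq0.
  by field; rewrite n2 (gt_eqF d0).
have alg (D' A P4 B' k dn x : R) : k * dn * x = 1 ->
    D' * A * (P4 * B') = k * (D' * P4) * (A * dn * B') * x.
  move=> h; transitivity ((k * dn * x) * (D' * A * (P4 * B'))); first by rewrite h mul1r.
  by ring.
exact: alg kd.
Qed.

End Averaging.

(** * Dyadic decomposition of the symbol *)

Section Cutoffs.
Hypothesis rho_le1 : rho <= 1.
Hypothesis delta_le1 : delta <= 1.

(** A polynomial substitute for the square of [1 + |xi| + |eta|]; this is why the exponents in [sc1]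
    are halved. *)
Definition wz (X : X3) : R := 1 + (dotp X.1.2 X.1.2 + dotp X.2 X.2).

Lemma dotp_ge0 (x : V) : 0 <= dotp x x.
Proof. by apply: sumr_ge0 => i _; rewrite -expr2 sqr_ge0. Qed.

Lemma coord_sqr_le (x : V) i : x 0 i ^+ 2 <= dotp x x.
Proof.
rewrite /dotp (bigD1 i)//= -expr2 lerDl; apply: sumr_ge0 => j _.
by rewrite -expr2 sqr_ge0.
Qed.

Lemma wz_ge1 X : 1 <= wz X.
Proof. by rewrite lerDl addr_ge0 ?dotp_ge0. Qed.

Lemma wz_gt0 X : 0 < wz X. Proof. exact: lt_le_trans (wz_ge1 X). Qed.

Definition sc1 (j v : nat) (X : X3) : R :=
  if (v < n)%N then wz X `^ (delta / 2) else wz X `^ (- (rho / 2)).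

Lemma sc1_ge0 j v X : 0 <= sc1 j v X.
Proof. by rewrite /sc1; case: ifP => _; rewrite powR_ge0. Qed.

Lemma wz_powR_le e e' X : e <= e' -> wz X `^ e <= wz X `^ e'.
Proof. by move=> ee; rewrite ler_powR ?wz_ge1. Qed.

(** The slope 1 of a frequency coordinate is admissible because [rho <= 1] gives
    [1 <= wz^(1/2) wz^(-rho/2)]. *)
Lemma sclass_freq_coord k I (q : X3 -> R) (c : nat -> bool) :
  continuous q -> (forall X v, is_derive X (vec3 v) q (c v)%:R) ->
  (forall v, c v -> (n <= v)%N) -> (forall X, q X ^+ 2 <= wz X) ->
  sclass vec3 sc1 k I (fun _ => wz) (fun _ X => q X ^+ 2).
Proof.
move=> cq dq cn qw.
have S : sclass vec3 sc1 k I (fun _ X => wz X `^ 2^-1) (fun _ => q).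
  apply: (@sclass_affine _ _ _ _ _ _ _ _ _ (fun _ v => (c v)%:R) 1) => // [p X|p v X].
    rewrite mul1r powR12_sqrt ?(ltW (wz_gt0 X))// -sqrtr_sqr; apply: ler_wsqrtr.
    exact: qw.
  rewrite mul1r; case: (c v) (cn v) => cv; last by rewrite normr0 mulr_ge0 ?powR_ge0 ?sc1_ge0.
  rewrite normr1 /sc1 ltnNge cv//= -powRD ?(gt_eqF (wz_gt0 X)) ?implybT//.
  apply: (@le_trans _ _ (wz X `^ 0)); first by rewrite powRr0.
  by apply: wz_powR_le; have := rho_le1; lra.
apply: eq_sclassW (sclass_exp 2 S) => p X.
by rewrite powR_sqr divff// powRr1// ltW// wz_gt0.
Qed.

Lemma is_derive_affine_id (a : X3) v (q : X3 -> R) (w : R) :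
  (forall s, q (s *: vec3 v + a) = s *: w + q a) -> is_derive a (vec3 v) q w.
Proof.
move=> h; apply: (@is_derive_along _ _ _ q (fun t : R => t) _ _ w) => //.
Qed.

Lemma sclass_wz k I : sclass vec3 sc1 k I (fun _ => wz) (fun _ => wz).
Proof.
pose q1 (i : 'I_n) (X : X3) : R := X.1.2 0 i; pose q2 (i : 'I_n) (X : X3) : R := X.2 0 i.
have S1 i : sclass vec3 sc1 k I (fun _ => wz) (fun _ X => q1 i X ^+ 2).
  apply: (@sclass_freq_coord _ _ (q1 i) (fun v => v == n + i)%N).
  - by apply: continuous_coord; cont_proj.
  - move=> X v; apply: is_derive_affine_id => s; rewrite /q1 /vec3.
    case: ltnP => vn /=; first by rewrite scaler0 add0r ltn_eqF ?scaler0 ?add0r// ltn_addr.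
    case: ltnP => vn' /=.
      by rewrite rVD rVZ evec_coord eq_sym -(eqn_add2l n) subnKC// eq_sym.
    rewrite scaler0 add0r gtn_eqF ?scaler0 ?add0r//.
    by rewrite (leq_trans _ vn')// ltn_add2l.
  - by move=> v /eqP ->; rewrite leq_addr.
  - move=> X; rewrite (le_trans (coord_sqr_le _ _))//.
    by rewrite /wz; have := dotp_ge0 X.2; lra.
have S2 i : sclass vec3 sc1 k I (fun _ => wz) (fun _ X => q2 i X ^+ 2).
  apply: (@sclass_freq_coord _ _ (q2 i) (fun v => v == n + n + i)%N).
  - by apply: continuous_coord; cont_proj.
  - move=> X v; apply: is_derive_affine_id => s; rewrite /q2 /vec3.
    case: ltnP => vn /=; first by rewrite scaler0 add0r ltn_eqF ?scaler0 ?add0r// -addnA ltn_addr.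
    case: ltnP => vn' /=; first by rewrite scaler0 add0r ltn_eqF ?scaler0 ?add0r// ltn_addr.
    by rewrite rVD rVZ evec_coord eq_sym -(eqn_add2l (n + n)) subnKC// eq_sym.
  - by move=> v /eqP ->; rewrite -addnA leq_addr.
  - move=> X; rewrite (le_trans (coord_sqr_le _ _))//.
    by rewrite /wz; have := dotp_ge0 X.1.2; lra.
have S0 : sclass vec3 sc1 k I (fun _ => wz) (fun _ _ => 1).
  apply: (@sclass_cst _ _ _ _ _ _ _ _ (fun=> 1) 1) => p X.
  by rewrite normr1 mul1r wz_ge1.
apply: eq_sclass (sclassD S0 (sclassD (sclass_sum (index_enum 'I_n) S1) (sclass_sum (index_enum 'I_n) S2))).
by move=> p X; rewrite /wz /dotp /q1 /q2; congr (_ + (_ + _)); apply: eq_bigr => i _; rewrite expr2.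
Qed.

(* [sg j] is the size of the frequency squared, relative to [2 ^ j]; [yv] decays
   for high and [zv] for low relative frequencies, and [yv + zv = 1]. *)
Definition sg (j : nat) (X : X3) : R := 4 ^- j * wz X.

Lemma sg_gt0 j X : 0 < sg j X.
Proof. by rewrite mulr_gt0 ?wz_gt0// invr_gt0 exprn_gt0. Qed.

Lemma sclass_sgZ k I (c : R) : 0 < c ->
  sclass vec3 sc1 k I (fun j X => c * sg j X) (fun j X => c * sg j X).
Proof.
move=> c0.
have S0 : sclass vec3 sc1 k I (fun j _ => c * 4 ^- j) (fun j _ => c * 4 ^- j).
  apply: (@sclass_cst _ _ _ _ _ _ _ _ (fun j => c * 4 ^- j) 1) => j X.
  by rewrite mul1r gtr0_norm// mulr_gt0// invr_gt0 exprn_gt0.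
by apply: eq_sclassW (eq_sclass _ (sclassM S0 (sclass_wz k I))) => j X; rewrite /sg mulrA.
Qed.

Definition yv (c : R) j X : R := (1 + c * sg j X)^-1.
Definition zv (c : R) j X : R := c * sg j X * yv c j X.

Section Bump.
Variable c : R.
Hypothesis c_gt0 : 0 < c.

Lemma csg_gt0 j X : 0 < c * sg j X. Proof. by rewrite mulr_gt0// sg_gt0. Qed.
Lemma yv_gt0 j X : 0 < yv c j X.
Proof. by rewrite invr_gt0 addr_gt0// csg_gt0. Qed.
Lemma zv_gt0 j X : 0 < zv c j X.
Proof. by rewrite mulr_gt0 ?yv_gt0 ?csg_gt0. Qed.
Lemma yzE j X : yv c j X + zv c j X = 1.
Proof. by rewrite /zv /yv; field; rewrite gt_eqF// addr_gt0// csg_gt0. Qed.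
Lemma yv_le1 j X : yv c j X <= 1.
Proof. by rewrite -(yzE j X) lerDl ltW// zv_gt0. Qed.
Lemma zv_le1 j X : zv c j X <= 1.
Proof. by rewrite -(yzE j X) lerDr ltW// yv_gt0. Qed.

Lemma sclass_yv k I : sclass vec3 sc1 k I (yv c) (yv c).
Proof.
apply: (sclass_inv (phi := fun j X => c * sg j X)).
  by move=> j X; exact: ltW (csg_gt0 j X).
apply: (sclass_leW sc1_ge0 (D := 1) _ _ (sclass_sgZ k I c_gt0)) => j X.
  exact: ltW (csg_gt0 j X).
by rewrite mul1r lerDr.
Qed.

Lemma sclass_zv k I : sclass vec3 sc1 k I (zv c) (zv c).
Proof. exact: sclassM (sclass_sgZ k I c_gt0) (sclass_yv k I). Qed.

Variables M0 M1 : nat.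
(** Because [yv + zv = 1], this is [yv] times a polynomial in [zv]: it decays like [yv] at high
    frequencies and differs from 1 by [zv ^+ M0] at low ones. [Ebump] raises it to a power for
    faster decay. *)
Definition Abump j X : R := 1 - zv c j X ^+ M0.
Definition Ebump j X : R := Abump j X ^+ M1.

Lemma sclass_Abump k I : sclass vec3 sc1 k I (yv c) Abump.
Proof.
have Sz : sclass vec3 sc1 k I (fun _ _ => 1) (zv c).
  apply: (sclass_leW sc1_ge0 (D := 1) _ _ (sclass_zv k I)) => j X; first exact: ltW (zv_gt0 j X).
  by rewrite mul1r zv_le1.
have Sp : sclass vec3 sc1 k I (fun _ _ => 1) (fun j X => \sum_(i <- index_enum 'I_M0) zv c j X ^+ i).
  apply: sclass_sum => i.
  by apply: eq_sclassW (sclass_exp i Sz) => j X; rewrite expr1n.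
apply: eq_sclassW (eq_sclass _ (sclassM (sclass_yv k I) Sp)) => j X.
  by rewrite mulr1.
rewrite /Abump -[1 - _]opprB subrX1 -mulNr opprB; congr (_ * _).
by rewrite -(yzE j X) addrK.
Qed.

End Bump.

(* [4 * sg j] is [sg (j - 1)], so [ej j] is the difference of two consecutive
   cutoffs and the sum telescopes; [cj] drops the second one at [j = 0]. *)
Definition cj (j : nat) : R := (j != 0)%:R.

Definition ej M0 M1 j X : R := Ebump 1 M0 M1 j X - cj j * Ebump 4 M0 M1 j X.

Lemma sgS j X : 4 * sg j.+1 X = sg j X.
Proof. by rewrite /sg exprS invfM; field. Qed.

Lemma sum_ej M0 M1 J X : \sum_(j < J.+1) ej M0 M1 j X = Ebump 1 M0 M1 J X.
Proof.
elim: J => [|J IH]; first by rewrite big_ord1 /ej /cj/= mul0r subr0.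
rewrite big_ord_recr/= IH /ej /cj/= mul1r addrC -addrA.
have -> : Ebump 4 M0 M1 J.+1 X = Ebump 1 M0 M1 J X; last by rewrite addNr addr0.
by rewrite /Ebump /Abump /zv /yv sgS mul1r.
Qed.

Lemma yv4_le j X : yv 4 j X <= yv 1 j X.
Proof.
by have s0 := sg_gt0 j X; rewrite /yv lef_pV2 ?posrE; lra.
Qed.

Lemma zv4_le j X : zv 4 j X <= 4 * zv 1 j X.
Proof.
have s0 := sg_gt0 j X; rewrite /zv mul1r mulrA; apply: ler_wpM2l; last exact: yv4_le.
by rewrite mulr_ge0// ltW.
Qed.

(** At [j = 0] there are no low relative frequencies, since [wz >= 1]; the first piece, from which
    nothing is subtracted, therefore satisfies the same bound as the others. *)
Lemma zv0_ge X : 1 <= 2 * zv 1 0 X.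
Proof.
have s1 : 1 <= sg 0 X by rewrite /sg expr0 invr1 mul1r wz_ge1.
rewrite /zv /yv mul1r mulrA ler_pdivlMr; lra.
Qed.

(** The difference of two powers of order [M1.+1] factors: the difference of the bases gives the
    [M0] powers of [zv], the remaining sum the [M1] powers of [yv]. *)
Lemma sclass_ej M0 M1 k I :
  sclass vec3 sc1 k I (fun j X => zv 1 j X ^+ M0 * yv 1 j X ^+ M1) (ej M0 M1.+1).
Proof.
have y0 j X : 0 <= yv 1 j X by rewrite ltW// yv_gt0.
have z0 j X : 0 <= zv 1 j X by rewrite ltW// zv_gt0.
have y40 j X : 0 <= yv 4 j X by rewrite ltW// yv_gt0.
have z40 j X : 0 <= zv 4 j X by rewrite ltW// zv_gt0.
have SA : sclass vec3 sc1 k I (yv 1) (Abump 1 M0) by exact: sclass_Abump.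
have SA4 : sclass vec3 sc1 k I (yv 1) (Abump 4 M0).
  apply: (sclass_leW sc1_ge0 (D := 1) _ _ (sclass_Abump _ M0 k I)) => // j X.
  by rewrite mul1r yv4_le.
have Sc (c : nat -> R) : sclass vec3 sc1 k I (fun j _ => `|c j|) (fun j _ => c j).
  by apply: (@sclass_cst _ _ _ _ _ _ _ _ c 1) => j X; rewrite mul1r.
have S1 : sclass vec3 sc1 k I (fun j X => zv 1 j X ^+ M0 * yv 1 j X ^+ M1)
    (fun j X => (1 - cj j) * Ebump 1 M0 M1.+1 j X).
  apply: (sclass_leW sc1_ge0 (D := 2 ^+ M0) _ _ (sclassM (Sc (fun j => 1 - cj j)) (sclass_exp M1.+1 SA))) => j X.
    by rewrite mulr_ge0// exprn_ge0.
  (* [1 - cj j] vanishes except at [j = 0]. *)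
  rewrite /cj; case: j => [|j]; last by rewrite subrr normr0 mul0r !mulr_ge0 ?exprn_ge0.
  rewrite subr0 normr1 mul1r mulrA -exprMn exprS; apply: ler_pM; rewrite ?exprn_ge0//.
    by rewrite (le_trans (yv_le1 _ _ _))// exprn_ege1// zv0_ge.
have SD : sclass vec3 sc1 k I (fun j X => zv 1 j X ^+ M0) (fun j X => Abump 1 M0 j X - Abump 4 M0 j X).
  have Sz4 : sclass vec3 sc1 k I (fun j X => zv 1 j X ^+ M0) (fun j X => zv 4 j X ^+ M0).
    apply: (sclass_leW sc1_ge0 (D := 4 ^+ M0) _ _ (sclass_exp M0 (sclass_zv _ k I))) => // j X.
      exact: exprn_ge0.
    rewrite -exprMn; apply: lerXn2r; [by rewrite nnegrE|by rewrite nnegrE; exact: mulr_ge0|].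
    exact: zv4_le.
  have Sz1 := sclassN (sclass_exp M0 (sclass_zv ltr01 k I)).
  by apply: eq_sclass (sclassD Sz4 Sz1) => j X; rewrite /Abump; ring.
have SS : sclass vec3 sc1 k I (fun j X => yv 1 j X ^+ M1)
    (fun j X => \sum_(i <- index_enum 'I_M1.+1) Abump 1 M0 j X ^+ (M1 - i) * Abump 4 M0 j X ^+ i).
  apply: sclass_sum => i.
  apply: eq_sclassW (sclassM (sclass_exp (M1 - i) SA) (sclass_exp i SA4)) => j X.
  by rewrite -exprD subnK// -ltnS.
have S2 : sclass vec3 sc1 k I (fun j X => zv 1 j X ^+ M0 * yv 1 j X ^+ M1)
    (fun j X => cj j * (Ebump 1 M0 M1.+1 j X - Ebump 4 M0 M1.+1 j X)).
  apply: (sclass_leW sc1_ge0 (D := 1) _ _ (eq_sclass _ (sclassM (Sc cj) (sclassM SD SS)))).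
  - by move=> j X; rewrite !mulr_ge0 ?exprn_ge0.
  - move=> j X; apply: ler_wpM2r; first by rewrite mulr_ge0 ?exprn_ge0.
    by rewrite /cj; case: (j != 0); rewrite ?normr0 ?normr1.
  - by move=> j X; rewrite /Ebump subrXX.
by apply: eq_sclass (sclassD S1 S2) => j X; rewrite /ej; ring.
Qed.

Lemma powR_le_expn (t e : R) K : 0 < t -> `|e| <= K%:R -> t `^ e <= (1 + t) ^+ K * (1 + t^-1) ^+ K.
Proof.
move=> t0 eK; have ti0 : 0 < t^-1 by rewrite invr_gt0.
have h (u a : R) : 0 < u -> 0 <= a -> a <= K%:R -> u `^ a <= (1 + u) ^+ K.
  move=> u0 a0 aK; rewrite -powR_mulrn; last by rewrite addr_ge0// ltW.
  apply: (@le_trans _ _ ((1 + u) `^ a)).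
    by apply: ge0_ler_powR; rewrite ?nnegrE ?addr_ge0 ?(ltW u0)// lerDr.
  by rewrite ler_powR// lerDl ltW.
have p1 : 1 <= (1 + t) ^+ K by rewrite exprn_ege1// lerDl ltW.
have p2 : 1 <= (1 + t^-1) ^+ K by rewrite exprn_ege1// lerDl ltW.
have [e0|e0] := leP 0 e.
  rewrite ger0_norm// in eK; rewrite (le_trans (h t e t0 e0 eK))// ler_peMr//.
  exact: le_trans p1.
rewrite ltr0_norm// in eK.
have -> : t `^ e = t^-1 `^ (- e).
  by rewrite -(powR_inv1 (ltW t0)) -powRrM mulN1r opprK.
rewrite (le_trans (h _ _ ti0 _ eK)) ?oppr_ge0 ?(ltW e0)// ler_peMl//.
exact: le_trans p2.
Qed.

(** [yv * zv] is the inverse of [(1 + sg) * (1 + 1 / sg)], so [K] factors of it absorb every power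
    of [sg] with exponent at most [K] in absolute value. *)
Lemma sg_powR_le j X (e : R) K : `|e| <= K%:R ->
  sg j X `^ e * (yv 1 j X * zv 1 j X) ^+ K <= 1.
Proof.
move=> eK; have s0 := sg_gt0 j X.
have E : (yv 1 j X * zv 1 j X) ^+ K = ((1 + sg j X) ^+ K * (1 + (sg j X)^-1) ^+ K)^-1.
  rewrite -exprMn -exprVn; congr (_ ^+ _); rewrite /zv /yv mul1r.
  by field; rewrite !gt_eqF// addr_gt0.
rewrite E ler_pdivrMr ?mul1r; first exact: powR_le_expn.
by rewrite mulr_gt0// exprn_gt0// addr_gt0// invr_gt0.
Qed.

Lemma wzE j u X : wz X = dy (j, u) ^+ 2 * sg j X.
Proof.
rewrite /sg /dy/= -exprM mulnC exprM mulrA (_ : 2 ^+ 2 = 4 :> R); last by ring.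
by rewrite divff ?mul1r// expf_neq0.
Qed.

Lemma wz_powRE j u X e : wz X `^ e = dyX (2 * e) (j, u) * sg j X `^ e.
Proof.
rewrite (wzE j u) powRM ?(ltW (sg_gt0 _ _))//; last exact: sqr_ge0.
by rewrite dy_expn dyX_powR.
Qed.

(** As [wz = 4 ^ j * sg], the scale at the true frequency differs from the one at [2 ^ j] by a power
    of [sg], which a single factor [yv * zv] absorbs. *)
Lemma sc1_sc3 p v X : sc1 p.1 v X * (yv 1 p.1 X * zv 1 p.1 X) <= sc3 p v X.
Proof.
case: p => j u; have h e : `|e| <= 1 -> wz X `^ e * (yv 1 j X * zv 1 j X) <= dyX (2 * e) (j, u).
  move=> e1; rewrite (wz_powRE j u) -mulrA -[leRHS]mulr1; apply: ler_wpM2l; first exact: ltW.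
  by have := sg_powR_le j X (K := 1) e1; rewrite expr1.
have d0 : 0 <= delta by rewrite (le_trans _ rho_delta)// ltW.
have dl := delta_le1; have rl := rho_le1; have rg := rho_gt0.
rewrite /sc1 /sc3/=; case: ifP => _.
  have -> : delta = 2 * (delta / 2) by field.
  rewrite [2 * (delta / 2) / 2](_ : _ = delta / 2); last by field.
  by apply: h; rewrite ger0_norm; lra.
rewrite -dyXN (_ : - rho = 2 * - (rho / 2)); last by field.
by apply: h; rewrite normrN gtr0_norm; lra.
Qed.

(** Each of the [n] factors of [psi] is at least [yv], as a squared coordinate is at most [wz]. *)
Lemma yv_psi j u X : yv 1 j X ^+ n <= psi (j, u) X.1.2 /\ yv 1 j X ^+ n <= psi (j, u) X.2.
Proof.
have h (x : V) : dotp x x <= wz X -> yv 1 j X ^+ n <= psi (j, u) x.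
  move=> hx; have -> : yv 1 j X ^+ n = \prod_(i < n) yv 1 j X by rewrite prodr_const card_ord.
  apply: ler_prod => i _; rewrite ltW ?yv_gt0//=.
  have q1 (t : R) : 0 < 1 + t ^+ 2 by rewrite ltr_wpDr ?sqr_ge0.
  have q2 : 0 < 1 + 1 * sg j X by rewrite addr_gt0// csg_gt0.
  rewrite /yv /lweight lef_pV2 ?posrE//.
  rewrite lerD2l rVZ exprMn mul1r /sg exprVn /dy/= -exprM mulnC exprM (_ : 2 ^+ 2 = 4 :> R); last by ring.
  by apply: ler_wpM2l; [rewrite invr_ge0 exprn_ge0|exact: le_trans (coord_sqr_le _ _) hx].
by have a := dotp_ge0 X.1.2; have b := dotp_ge0 X.2; split; apply: h; rewrite /wz; lra.
Qed.

Lemma sclass_kappa k I :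
  sclass vec3 sc3 k I (fun p X => kappa delta p X.1.1) (fun p X => kappa delta p X.1.1).
Proof.
have E p (X : X3) : kappa delta p X.1.1 =
    \prod_(i <- index_enum 'I_n) lweight (dyX delta p * (X.1.1 0 i - p.2 0 i)).
  by rewrite /kappa omega_affineE.
apply: (@eq_sclassW _ _ _ _ _ _ _ _ _ _ (fun p x => esym (E p x))).
apply: (@eq_sclass _ _ _ _ _ _ _ _ _ _ (fun p x => esym (E p x))).
apply: sclass_prod => // i.
apply: (sclass_lweight sc3_ge0 k I (q := fun (p : P) (X : X3) => dyX delta p * (X.1.1 0 i - p.2 0 i))
  (c := fun (p : P) (v : nat) => if (i == v :> nat) then dyX delta p else 0) (D := 1)).
- move=> p; apply: continuous_mul; first exact: continuous_cst.
  apply: continuous_add; last exact: continuous_cst.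
  by apply: continuous_coord; cont_proj.
- move=> p X v; apply: is_derive_affine_id => s; rewrite /vec3; case: ifPn => vn /=.
    by rewrite rVD rVZ evec_coord; case: eqP => _; rewrite ?scaler0 ?add0r /GRing.scale/=; ring.
  rewrite [in RHS]ifF; last by apply/negbTE; apply: contra vn => /eqP <-.
  by case: ifP => _ /=; rewrite !scaler0 !add0r.
- move=> p v X; rewrite mul1r; case: ifPn => [/eqP <-|_]; last by rewrite normr0 sc3_ge0.
  by rewrite /sc3 ltn_ord gtr0_norm.
Qed.

(** Of the factors [yv * zv], [k] pay for the derivatives and [Km] for replacing [wz] by [4 ^ j] in
    the order of the symbol; the [4 * n] further powers of [yv] become the weight in [psi]. *)
Lemma sclass_dyadic (a : X3 -> R) k I L Km : `|m / 2| <= Km%:R ->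
  sclass vec3 sc1 k I (fun _ X => wz X `^ (m / 2)) (fun _ => a) ->
  sclass vec3 sc3 k I (W3 L 2)
    (fun p X => kappa delta p X.1.1 ^+ L * (a X * ej (k + Km) (k + Km + 4 * n).+1 p.1 X)).
Proof.
move=> hm Sa; have S1 := sclassM Sa (sclass_ej (k + Km) (k + Km + 4 * n) k I).
have {}S1 := sclass_reparam (fun p : P => p.1) S1.
have yz0 (p : P) X : 0 < yv 1 p.1 X * zv 1 p.1 X by rewrite mulr_gt0 ?yv_gt0 ?zv_gt0.
have yz1 (p : P) X : yv 1 p.1 X * zv 1 p.1 X <= 1.
  by rewrite mulr_ile1 ?yv_le1 ?zv_le1// ltW// ?yv_gt0 ?zv_gt0.
have W0 (p : P) X : 0 <= wz X `^ (m / 2) * (zv 1 p.1 X ^+ (k + Km) * yv 1 p.1 X ^+ (k + Km + 4 * n)).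
  by rewrite mulr_ge0 ?powR_ge0// mulr_ge0 ?exprn_ge0 ?ltW ?yv_gt0 ?zv_gt0.
have S2 := sclass_rescale yz0 W0 (fun p => sc1_ge0 p.1) sc1_sc3 yz1 S1.
apply: (sclass_leW sc3_ge0 (D := 1) _ _ (sclassM (sclass_exp L (sclass_kappa k I)) S2)) => p X.
  by rewrite mulr_ge0 ?exprn_ge0 ?kappa_ge0// divr_ge0 ?W0// exprn_ge0// ltW.
rewrite mul1r /W3 [leRHS](_ : _ = kappa delta p X.1.1 ^+ L * (dyX m p * (psi p X.1.2 * psi p X.2) ^+ 2)); last by ring.
apply: ler_wpM2l; first by nng.
case: p => j u; have := sg_powR_le j X hm; have := yz0 (j, u) X => /=.
have y0 := yv_gt0 (ltr01 : 0 < (1 : R)) j X; have z0 := zv_gt0 (ltr01 : 0 < (1 : R)) j X.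
have [p1 p2] := yv_psi j u X; move: p1 p2 y0 z0.
set y := yv 1 j X; set z := zv 1 j X => p1 p2 y0 z0 yz00 h.
rewrite (wz_powRE j u) (_ : 2 * (m / 2) = m); last by field.
rewrite [leLHS](_ : _ = dyX m (j, u) * (sg j X `^ (m / 2) * (y * z) ^+ Km * y ^+ (4 * n))).
  rewrite -[_ * _ * y ^+ (4 * n)]mulrA; apply: ler_wpM2l; first exact: ltW.
  rewrite mulrA -[leRHS]mul1r; apply: ler_pM => //.
  - by rewrite mulr_ge0 ?powR_ge0// exprn_ge0// ltW.
  - by rewrite exprn_ge0// ltW.
  rewrite (_ : y ^+ (4 * n) = (y ^+ n * y ^+ n) ^+ 2); last first.
    by rewrite -exprD -exprM; congr (_ ^+ _); rewrite addnn -muln2 -mulnA mulnC.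
  by rewrite lerXn2r ?nnegrE ?mulr_ge0 ?psi_ge0 ?exprn_ge0 ?(ltW y0)// ler_pM ?exprn_ge0 ?(ltW y0).
have -> : z ^+ (k + Km) * y ^+ (k + Km + 4 * n) = (y * z) ^+ k * ((y * z) ^+ Km * y ^+ (4 * n)).
  by rewrite !exprMn !exprD; ring.
have : (y * z) ^+ k != 0 by rewrite expf_neq0// gt_eqF.
move: ((y * z) ^+ k) ((y * z) ^+ Km) (y ^+ (4 * n)) (sg j X `^ _) (dyX m _) => t1 t2 t3 t4 t5 t10.
by field.
Qed.

End Cutoffs.

(** * Summation of the dyadic pieces *)

Definition Tr (b : X3 -> R) (Phi Gam : V -> C) (x : V) : C :=
  cint (fun eta => cint (fun xi =>
    (b (x, xi, eta))%:C * cexpi (dotp x (xi + eta)) * Phi xi * Gam eta)).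

Section BoundedSymbols.
Variables Phi Gam : V -> C.
Hypotheses (KPhi : Kc Phi) (KGam : Kc Gam).

Lemma ccont_Tr_integrand (T : topologicalType) (b : T -> X3 -> R) (x : V) :
  continuous (fun z : T * X3 => b z.1 z.2) ->
  ccont (fun z : T * V * V => (b z.1.1 (x, z.2, z.1.2))%:C * cexpi (dotp x (z.2 + z.1.2)) *
    Phi z.2 * Gam z.1.2).
Proof.
move=> cb; apply: ccontM; last by apply: (ccont_comp _ (Kc_cont KGam)); cont_proj.
apply: ccontM; last by apply: (ccont_comp _ (Kc_cont KPhi)); cont_proj.
apply: ccontM; last first.
  by apply: ccont_cexpi; apply: continuous_dotp; [cont_proj|apply: continuous_addV; cont_proj].
apply: ccontR.
apply: (continuous_comp' (f := fun z : T * V * V => (z.1.1, ((x, z.2, z.1.2) : X3))) _ cb).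
by cont_proj.
Qed.

Lemma Tr_param (T : pseudoMetricType R) (b : T -> X3 -> R) B (x : V) :
  continuous (fun z : T * X3 => b z.1 z.2) -> (forall t X, `|b t X| <= B) ->
  ccont (fun t => Tr (b t) Phi Gam x).
Proof.
move=> cb bB; have [C1 C10 hC1] := KcE KPhi; have [C2 C20 hC2] := KcE KGam.
(* [T] may be empty, in which case the hypothesis says nothing on the sign of [B]. *)
have B0 : 0 <= B \/ (forall t : T, False).
  have [[t]|nT] := pselect (inhabited T); last by right => t; apply: nT; exists.
  by left; rewrite (le_trans _ (bB t (0, 0, 0))).
case: B0 => [B0|nT]; last by split=> t; case: (nT t).
have h t eta xi : cmod ((b t (x, xi, eta))%:C * cexpi (dotp x (xi + eta)) * Phi xi * Gam eta) <=
    B * C1 * C2 * omega eta * omega xi.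
  rewrite !cmodM cmod_cexpi mulr1 cmodR.
  rewrite (_ : B * C1 * C2 * _ * _ = B * (C1 * omega xi) * (C2 * omega eta)); last by ring.
  by apply: ler_pM; [nng|nng|apply: ler_pM; [nng|nng|exact: bB|exact: hC1]|exact: hC2].
have c1 : ccont (fun z : T * V => cint (fun xi =>
    (b z.1 (x, xi, z.2))%:C * cexpi (dotp x (xi + z.2)) * Phi xi * Gam z.2)).
  apply: (@cint_param _ _ _ (fun z xi => (b z.1 (x, xi, z.2))%:C * cexpi (dotp x (xi + z.2)) *
    Phi xi * Gam z.2) (B * C1 * C2)); first exact: ccont_Tr_integrand.
  move=> z xi; rewrite (le_trans (h _ _ _))//; apply: ler_wpM2r; first by nng.
  by rewrite ler_piMr ?omega_le1//; nng.
apply: (@cint_param _ _ _ (fun t eta => cint (fun xi =>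
    (b t (x, xi, eta))%:C * cexpi (dotp x (xi + eta)) * Phi xi * Gam eta))
    (B * C1 * C2 * rint (@omega R n)) c1).
move=> t eta.
have K : Kc (fun xi => (b t (x, xi, eta))%:C * cexpi (dotp x (xi + eta)) * Phi xi * Gam eta).
  apply: (@KcI _ _ _ (B * C1 * C2 * omega eta)); last exact: h.
  apply: (ccont_comp (f := fun xi : V => (t, eta, xi)) _ (ccont_Tr_integrand x cb)).
  by apply: continuous_pair; [exact: continuous_cstT|exact: continuous_idT].
rewrite (le_trans (cmod_cint_le K))// mulrAC -rintZ; last exact: Kfun_omega.
by apply: le_rint; [exact: Kfun_cmod|exact: KfunZ (Kfun_omega n)|exact: h].
Qed.

Lemma K2c_Tr (b : X3 -> R) B x : continuous b -> (forall X, `|b X| <= B) ->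
  K2c (fun eta xi => (b (x, xi, eta))%:C * cexpi (dotp x (xi + eta)) * Phi xi * Gam eta).
Proof.
move=> cb bB; have B0 : 0 <= B by rewrite (le_trans _ (bB (0, 0, 0))).
have [C1 C10 hC1] := KcE KPhi; have [C2 C20 hC2] := KcE KGam.
split.
  apply: (ccont_comp (f := fun z : V * V => (0 : R, z.1, z.2)) (g := fun z : R * V * V =>
    (b (x, z.2, z.1.2))%:C * cexpi (dotp x (z.2 + z.1.2)) * Phi z.2 * Gam z.1.2)).
    by apply: continuous_pair; [apply: continuous_pair; [exact: continuous_cstT|cont_proj]|cont_proj].
  apply: (@ccont_Tr_integrand R (fun _ => b)).
  by apply: (continuous_comp' _ cb); cont_proj.
exists (B * C1 * C2) => eta xi; rewrite !cmodM cmod_cexpi mulr1 cmodR.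
rewrite (_ : B * C1 * C2 * _ * _ = B * (C1 * omega xi) * (C2 * omega eta)); last by ring.
by apply: ler_pM; [nng|nng|apply: ler_pM; [nng|nng|exact: bB|exact: hC1]|exact: hC2].
Qed.

Lemma TrD (b1 b2 : X3 -> R) B1 B2 x : continuous b1 -> (forall X, `|b1 X| <= B1) ->
  continuous b2 -> (forall X, `|b2 X| <= B2) ->
  Tr (fun X => b1 X + b2 X) Phi Gam x = Tr b1 Phi Gam x + Tr b2 Phi Gam x.
Proof.
move=> c1 h1 c2 h2; have K1 := K2c_Tr x c1 h1; have K2 := K2c_Tr x c2 h2.
rewrite /Tr -cintD; [|exact: K2c_cint K1|exact: K2c_cint K2].
apply: eq_cint => eta; rewrite -cintD; [|exact: (K2c_l eta K1)|exact: (K2c_l eta K2)].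
by apply: eq_cint => xi; rewrite rmorphD/=; ring.
Qed.

Lemma Tr_sum (b : nat -> X3 -> R) B J x : (forall j, continuous (b j)) ->
  (forall j X, `|b j X| <= B) ->
  Tr (fun X => \sum_(j < J) b j X) Phi Gam x = \sum_(j < J) Tr (b j) Phi Gam x.
Proof.
move=> cb bB; elim: J => [|J IH].
  rewrite big_ord0 /Tr -[RHS](@cint0 R n); apply: eq_cint => eta.
  by rewrite -[RHS](@cint0 R n); apply: eq_cint => xi; rewrite big_ord0 rmorph0 !mul0r.
rewrite big_ord_recr/= -IH; under [in LHS]eq_fun do rewrite big_ord_recr/=.
apply: (@TrD _ _ (J%:R * B) B) => //.
  by apply: continuous_sum => j; exact: cb.
move=> X; rewrite (le_trans (ler_norm_sum _ _ _))//.
rewrite (_ : J%:R * B = \sum_(j < J) B); first by apply: ler_sum.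
by rewrite sumr_const card_ord mulr_natl.
Qed.

Lemma Tr_scale (b : X3 -> R) B (c d : C) x : continuous b -> (forall X, `|b X| <= B) ->
  Tr b (fun xi => c * Phi xi) (fun eta => d * Gam eta) x = (c * d) * Tr b Phi Gam x.
Proof.
move=> cb bB; have K := K2c_Tr x cb bB.
rewrite /Tr -(cintZ _ (K2c_cint K)); apply: eq_cint => eta.
by rewrite -(cintZ _ (K2c_l eta K)); apply: eq_cint => xi; ring.
Qed.

End BoundedSymbols.

Lemma bipsido_Tr (a : X3 -> C) B1 B2 f g x : Kc (fourier f) -> Kc (fourier g) ->
  continuous (fun X => Re (a X)) -> (forall X, `|Re (a X)| <= B1) ->
  continuous (fun X => Im (a X)) -> (forall X, `|Im (a X)| <= B2) ->
  bipsido a f g x = Tr (fun X => Re (a X)) (fourier f) (fourier g) x +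
    'i * Tr (fun X => Im (a X)) (fourier f) (fourier g) x.
Proof.
move=> Kf Kg c1 h1 c2 h2; have K1 := K2c_Tr Kf Kg x c1 h1; have K2 := K2c_Tr Kf Kg x c2 h2.
have L1 := K2c_cint K1; have L2 := K2c_cint K2.
rewrite /Tr -(cintZ _ L2) -(cintD L1 (KcZ _ L2)); apply: eq_cint => eta.
have M1 := K2c_l eta K1; have M2 := K2c_l eta K2.
rewrite -(cintZ _ M2) -(cintD M1 (KcZ _ M2)); apply: eq_cint => xi.
have {1}-> : a (x, xi, eta) = (Re (a (x, xi, eta)))%:C + 'i * (Im (a (x, xi, eta)))%:C.
  by apply: complex_ext; rewrite ?(ReD, ImD, ReM, ImM)/=; ring.
by ring.
Qed.

Lemma bdcD (F G : V -> C) : bdc F -> bdc G -> bdc (fun x => F x + G x).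
Proof.
move=> [cF [B hB]] [cG [D hD]]; split; first exact: ccontD.
by exists (B + D) => x; rewrite (le_trans (cmodD _ _))// lerD.
Qed.

Lemma bdcZ (c : C) (F : V -> C) : bdc F -> bdc (fun x => c * F x).
Proof.
move=> [cF [B hB]]; split; first by apply: ccontM => //; exact: ccont_cst.
by exists (cmod c * B) => x; rewrite cmodM ler_wpM2l ?cmod_ge0.
Qed.

Lemma bdc_sum J (F : nat -> V -> C) : (forall j, bdc (F j)) ->
  bdc (fun x => \sum_(j < J) F j x).
Proof.
move=> bF; elim: J => [|J IH].
  under eq_fun do rewrite big_ord0; split; first exact: ccont_cst.
  by exists (cmod (0 : C)).
by under eq_fun do rewrite big_ord_recr/=; exact: bdcD.
Qed.

Lemma cmod_sum J (F : nat -> C) : cmod (\sum_(j < J) F j) <= \sum_(j < J) cmod (F j).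
Proof.
elim: J => [|J IH]; last by rewrite !big_ord_recr/= (le_trans (cmodD _ _))// lerD2r.
by rewrite !big_ord0 /cmod/= expr0n/= addr0 sqrtr0.
Qed.

Lemma Kfun_omega_powR (F : V -> C) (c r : R) : 0 < c -> 0 < r -> bdc F ->
  Kfun (fun x => omega (c *: (x - 0)) ^+ 2 * cmod (F x) `^ r).
Proof.
move=> c0 r0 bF; have [cF _] := bF; have [B B0 hB] := bdc_ge0 bF.
under eq_fun do rewrite mulrC; apply: (@KfunM _ _ _ _ (B `^ r)).
- exact: continuous_cmod_powR.
- move=> x; rewrite ger0_norm ?powR_ge0//.
  by apply: ge0_ler_powR; rewrite ?nnegrE ?cmod_ge0 ?(ltW r0).
- exact: (Kfun_omega_exp 0 1 c0).
Qed.

Lemma powR_addr_le (r u v : R) : 0 < r -> 0 <= u -> 0 <= v ->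
  (u + v) `^ r <= 2 `^ r * (u `^ r + v `^ r).
Proof.
move=> r0; wlog uv : u v / u <= v => [hw u0 v0|u0 v0].
  have [uv|vu] := leP u v; first exact: hw.
  by rewrite addrC [X in _ * X]addrC; apply: hw => //; exact: ltW.
apply: (@le_trans _ _ ((2 * v) `^ r)).
  apply: ge0_ler_powR; rewrite ?nnegrE ?(ltW r0)//; [exact: addr_ge0|exact: mulr_ge0|lra].
by rewrite powRM//; apply: ler_wpM2l; rewrite ?powR_ge0// lerDr powR_ge0.
Qed.

Lemma geometric_sum_le (x : R) J : 0 <= x < 1 -> \sum_(j < J) x ^+ j <= (1 - x)^-1.
Proof.
move=> /andP[x0 x1]; have d : 0 < 1 - x by rewrite subr_gt0.
rewrite -[leRHS]mul1r ler_pdivlMr//.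
have := subrX1 x J; have := exprn_ge0 J x0; set S := \sum_(i < J) _ => h1 h2.
nra.
Qed.

(** Minkowski's inequality fails for [r < 1]. Here each [t j] is at most [x ^+ j] times the r-th
    root of the sum on the right, and a geometric series is summed; this works for every [r > 0]. *)
Lemma sum_powR_le (r x : R) J (t : nat -> R) : 0 < r -> 0 < x < 1 -> (forall j, 0 <= t j) ->
  (\sum_(j < J) t j) `^ r <= (1 - x)^-1 `^ r * \sum_(j < J) (x ^- j * t j) `^ r.
Proof.
move=> r0 /andP[x0 x1] t0; set S := \sum_(j < J) (x ^- j * t j) `^ r.
have S0 : 0 <= S by apply: sumr_ge0 => j _; exact: powR_ge0.
have d : 0 < 1 - x by rewrite subr_gt0.
have tj (j : 'I_J) : t j <= x ^+ j * S `^ r^-1.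
  have xj : 0 < x ^+ j by exact: exprn_gt0.
  rewrite -ler_pdivrMl// -[leLHS]powRr1; last by rewrite mulr_ge0// invr_ge0 ltW.
  rewrite -(mulfV (lt0r_neq0 r0)) powRrM; apply: ge0_ler_powR; rewrite ?nnegrE ?powR_ge0 ?invr_ge0 ?(ltW r0)//.
  rewrite /S (bigD1 j)//= lerDl; apply: sumr_ge0 => k _; exact: powR_ge0.
apply: (@le_trans _ _ (((1 - x)^-1 * S `^ r^-1) `^ r)).
  apply: ge0_ler_powR; rewrite ?nnegrE ?(ltW r0) ?sumr_ge0 ?mulr_ge0 ?powR_ge0 ?invr_ge0 ?(ltW d)//.
  apply: (@le_trans _ _ (\sum_(j < J) x ^+ j * S `^ r^-1)); first by apply: ler_sum.
  rewrite -mulr_suml; apply: ler_wpM2r; first exact: powR_ge0.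
  by apply: geometric_sum_le; rewrite ltW.
by rewrite powRM ?powR_ge0 ?invr_ge0 ?(ltW d)// -powRrM mulVf ?gt_eqF// powRr1.
Qed.

Section Summation.
Hypotheses (n_gt0 : (0 < n)%N) (rho_le1 : rho <= 1) (delta_le1 : delta <= 1) (m_le0 : m <= 0).
Variables (Km : nat) (r : R) (q1 q2 : \bar R) (a : X3 -> C).
Hypothesis Km_ge : `|m / 2| <= Km%:R.
Hypotheses (r_gt0 : 0 < r) (q1_ge1 : (1%:E <= q1)%E) (q2_ge1 : (1%:E <= q2)%E).
Hypothesis r_inv : r^-1 = qinv q1 + qinv q2.
Let E : R := r * alpha_exp r q1 q2 - gamma_exp r + delta * n%:R - rho * n%:R.
Hypothesis E_lt0 : E < 0.
Let k := (n.*2 + n.*2 + n.*2)%N.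
Let M0 := (k + Km)%N.
Let M1 := (k + Km + 4 * n)%N.

Definition dpiece (b : X3 -> R) (j : nat) (X : X3) : R := b X * ej M0 M1.+1 j X.

(** At [t = 2 ^ (- J)] this is the sum of the first [J + 1] bumps. A real parameter [t] turns the
    limit of the partial sums into continuity at [t = 0]. *)
Definition cutoff (t : R) (X : X3) : R :=
  (1 - (t ^+ 2 * wz X * (1 + t ^+ 2 * wz X)^-1) ^+ M0) ^+ M1.+1.

Lemma cutoff_den_gt0 t X : 0 < 1 + t ^+ 2 * wz X.
Proof. by rewrite ltr_wpDr// mulr_ge0 ?sqr_ge0// ltW// wz_gt0. Qed.

Lemma continuous_wz : continuous wz.
Proof.
apply: continuous_add; first exact: continuous_cst.
by apply: continuous_add; apply: continuous_dotp; cont_proj.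
Qed.

Lemma continuous_cutoff : continuous (fun z : R * X3 => cutoff z.1 z.2).
Proof.
have cq : continuous (fun z : R * X3 => z.1 ^+ 2 * wz z.2).
  apply: continuous_mul; first by apply: continuous_exprn; cont_proj.
  by apply: (continuous_comp' _ continuous_wz); cont_proj.
apply: continuous_exprn; apply: continuous_add; first exact: continuous_cst.
apply: continuous_opp; apply: continuous_exprn; apply: continuous_mul => //.
apply: (continuous_inv (f := fun z : R * X3 => 1 + z.1 ^+ 2 * wz z.2)).
  by move=> z; rewrite gt_eqF// cutoff_den_gt0.
by apply: continuous_add => //; exact: continuous_cst.
Qed.

Lemma cutoff_bound t X : `|cutoff t X| <= 1.
Proof.
have d := cutoff_den_gt0 t X; have s0 : 0 <= t ^+ 2 * wz X.
  by rewrite mulr_ge0 ?sqr_ge0// ltW// wz_gt0.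
have z0 : 0 <= t ^+ 2 * wz X * (1 + t ^+ 2 * wz X)^-1 by rewrite mulr_ge0// invr_ge0 ltW.
have z1 : t ^+ 2 * wz X * (1 + t ^+ 2 * wz X)^-1 <= 1 by rewrite ler_pdivrMr// mul1r lerDr.
rewrite normrX exprn_ile1 ?normr_ge0// ler_norml.
have := exprn_ge0 M0 z0; have := exprn_ile1 M0 z0 z1; set e := _ ^+ M0; lra.
Qed.

Lemma cutoff0 X : cutoff 0 X = 1.
Proof.
(* With [M0 = 0] the cutoff would vanish identically; [M0] is positive because [n] is. *)
have M0_gt0 : (0 < M0)%N by rewrite /M0 /k -!addnA addn_gt0 double_gt0 n_gt0.
by rewrite /cutoff expr0n/= !mul0r expr0n (gtn_eqF M0_gt0)/= subr0 expr1n.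
Qed.

Lemma sum_dpiece b J X : \sum_(j < J.+1) dpiece b j X = b X * cutoff (2^-1 ^+ J) X.
Proof.
rewrite /dpiece -mulr_sumr sum_ej.
have sE : 4 ^- J = (2^-1 ^+ J) ^+ 2 :> R.
  by rewrite -exprM mulnC exprM -exprVn; congr (_ ^+ _); field.
by rewrite /Ebump /Abump /zv /yv /sg sE mul1r.
Qed.

Section RealSymbol.
Variable b : X3 -> R.
Hypothesis Sb : sclass vec3 sc1 k (n + n + n) (fun _ X => wz X `^ (m / 2)) (fun _ : nat => b).

Lemma real_symbol_bounded : exists2 B, 0 <= B & forall X, `|b X| <= B.
Proof.
have [B hB] := sclass_bound Sb; exists `|B| => // X.
rewrite (le_trans (hB 0%N X))// (le_trans (ler_norm _))// normrM ler_piMr//.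
rewrite ger0_norm ?powR_ge0//; apply: (@le_trans _ _ (wz X `^ 0)); last by rewrite powRr0.
by apply: wz_powR_le; have := m_le0; lra.
Qed.

Lemma dpiece_bounded : exists2 B, 0 <= B & forall j X, `|dpiece b j X| <= B.
Proof.
have [B B0 hB] := real_symbol_bounded.
have [D hD] := sclass_bound (sclass_ej rho_le1 M0 M1 0 0).
exists (B * `|D|); first by nng.
move=> j X; rewrite normrM; apply: ler_pM => //.
rewrite (le_trans (hD j X))// (le_trans (ler_norm _))// normrM ler_piMr//.
have y0 := ltW (yv_gt0 (ltr01 : 0 < (1 : R)) j X); have z0 := ltW (zv_gt0 (ltr01 : 0 < (1 : R)) j X).
rewrite ger0_norm; last by rewrite mulr_ge0// exprn_ge0.
by rewrite mulr_ile1 ?exprn_ge0// exprn_ile1// ?yv_le1 ?zv_le1.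
Qed.

Lemma continuous_dpiece j : continuous (dpiece b j).
Proof.
apply: continuous_mul; first exact: (sclass_cont Sb 0%N).
exact: (sclass_cont (sclass_ej rho_le1 M0 M1 0 0) j).
Qed.

Lemma dpiece_class : sclass vec3 sc3 k (n + n + n) (W3 (n.*2 + n.*2).+1 2)
  (fun p X => kappa delta p X.1.1 ^+ (n.*2 + n.*2).+1 * dpiece b p.1 X).
Proof. exact: (sclass_dyadic rho_le1 delta_le1 _ Km_ge Sb). Qed.

Lemma bdc_dpiece f g j : Kc f -> Kc g -> bdc (Tr (dpiece b j) (fourier f) (fourier g)).
Proof.
move=> Kf Kg; split; first exact: (ccont_TT dpiece_class).
by have [B B0 hB] := TT_bounded dpiece_class j Kf Kg; exists B.
Qed.

Lemma Tr_cutoff f g J x : Kc (fourier f) -> Kc (fourier g) ->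
  Tr (fun X => b X * cutoff (2^-1 ^+ J) X) (fourier f) (fourier g) x =
  \sum_(j < J.+1) Tr (dpiece b j) (fourier f) (fourier g) x.
Proof.
move=> Kf Kg; have [B B0 hB] := dpiece_bounded.
have -> : (fun X => b X * cutoff (2^-1 ^+ J) X) = (fun X => \sum_(j < J.+1) dpiece b j X).
  by apply/funext => X; rewrite sum_dpiece.
exact: (Tr_sum Kf Kg J.+1 x continuous_dpiece hB).
Qed.

Lemma Tr_cutoff_cont f g x : Kc (fourier f) -> Kc (fourier g) ->
  ccont (fun t : R => Tr (fun X => b X * cutoff t X) (fourier f) (fourier g) x).
Proof.
move=> Kf Kg; have [B B0 hB] := real_symbol_bounded.
apply: (@Tr_param _ _ Kf Kg R (fun t X => b X * cutoff t X) B).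
  apply: continuous_mul; last exact: continuous_cutoff.
  by apply: (continuous_comp' _ (sclass_cont Sb 0%N)); cont_proj.
by move=> t X; rewrite normrM -[leRHS]mulr1 ler_pM ?cutoff_bound.
Qed.

End RealSymbol.

Hypothesis SRe : sclass vec3 sc1 k (n + n + n) (fun _ X => wz X `^ (m / 2)) (fun (_ : nat) X => Re (a X)).
Hypothesis SIm : sclass vec3 sc1 k (n + n + n) (fun _ X => wz X `^ (m / 2)) (fun (_ : nat) X => Im (a X)).

(** The factor [c] is carried inside the limit, where every approximant lies in [Kfun] and scales;
    homogeneity is thus obtained for a limit function that may lie outside the class. *)
Lemma bilinear_normalized : exists2 B, 0 <= B & forall f g, Kc2 f -> Kc2 g ->
  Kc (fourier f) -> Kc (fourier g) -> nrm q1 f -> nrm q2 g ->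
  forall c : R, 0 <= c ->
  (iint (fun x => (c * (cmod (bipsido a f g x)) `^ r)%:E) <= (c * B)%:E)%E.
Proof.
have [D1 D10 hD1] := dyadic_est (dpiece_class SRe) r_gt0 q1_ge1 q2_ge1 r_inv.
have [D2 D20 hD2] := dyadic_est (dpiece_class SIm) r_gt0 q1_ge1 q2_ge1 r_inv.
(* The decay [2 ^ (E j)] is split in two halves: the weights [xq ^- j], once raised to the power
   [r], use one, and [yq] keeps the other for the final series. *)
pose xq : R := 2 `^ (E / (2 * r)); pose yq : R := 2 `^ (E / 2).
have lt1 (e : R) : e < 0 -> 0 < (2 : R) `^ e < 1.
  move=> e0; rewrite powR_gt0//= /powR pnatr_eq0/=.
  by rewrite expR_lt1 pmulr_llt0// ln_gt0// ltr1n.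
have xq01 : 0 < xq < 1 by apply: lt1; rewrite pmulr_llt0 ?invr_gt0 ?mulr_gt0.
have yq01 : 0 < yq < 1 by apply: lt1; rewrite pmulr_llt0.
pose c1 := (1 - xq)^-1 `^ r * (2 `^ r * (D1 + D2)).
have c10 : 0 <= c1 by rewrite !mulr_ge0 ?powR_ge0// addr_ge0.
have [yq0 yq1] := andP yq01.
exists (c1 * (1 - yq)^-1); first by rewrite mulr_ge0// invr_ge0 subr_ge0 ltW.
move=> f g Kf2 Kg2 Kff Kfg nf ng c c_ge0; have Kf := Kc2_Kc Kf2; have Kg := Kc2_Kc Kg2.
pose u j x := Tr (dpiece (fun X => Re (a X)) j) (fourier f) (fourier g) x.
pose v j x := Tr (dpiece (fun X => Im (a X)) j) (fourier f) (fourier g) x.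
have bu j : bdc (u j) by exact: bdc_dpiece.
have bv j : bdc (v j) by exact: bdc_dpiece.
pose Z (J : nat) x : C := \sum_(j < J.+1) u j x + 'i * \sum_(j < J.+1) v j x.
have bZ J : bdc (Z J) by apply: bdcD; [exact: bdc_sum|apply: bdcZ; exact: bdc_sum].
(* One sequence drives both limits: the frequency cutoff and the spatial weight are removed
   together. *)
pose t (J : nat) : R := 2^-1 ^+ J.
have t0 J : 0 < t J by rewrite exprn_gt0.
pose h (J : nat) (x : V) : R := omega (t J *: (x - 0)) ^+ 2 * cmod (Z J x) `^ r.
have Kh J : Kfun (h J) by exact: Kfun_omega_powR.
apply: (@iint_le_of_cvg _ _ (fun J x => c * h J x)).
- by move=> J; exact: KfunZ.
- move=> J x; apply: mulr_ge0 => //.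
  by apply: mulr_ge0; [exact: sqr_ge0|exact: powR_ge0].
- move=> x; apply: cvgMr.
  pose Tt (s : R) : C := Tr (fun X => Re (a X) * cutoff s X) (fourier f) (fourier g) x +
     'i * Tr (fun X => Im (a X) * cutoff s X) (fourier f) (fourier g) x.
  pose phi (s : R) : R := omega (s *: (x - 0)) ^+ 2 * cmod (Tt s) `^ r.
  have cphi : continuous phi.
    apply: continuous_mul.
      apply: continuous_exprn; apply: (continuous_comp' _ (@continuous_omega R n)).
      by apply: continuous_scale; [cont_proj|exact: continuous_cstT].
    apply: continuous_cmod_powR => //; apply: ccontD; first exact: Tr_cutoff_cont.
    by apply: ccontM; [exact: ccont_cst|exact: Tr_cutoff_cont].
  have -> : (fun J => h J x) = (fun J => phi (t J)).
    by apply/funext => J; rewrite /h /phi /Tt /Z (Tr_cutoff SRe)// (Tr_cutoff SIm).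
  have -> : cmod (bipsido a f g x) `^ r = phi 0.
    have [B1 B10 hB1] := real_symbol_bounded SRe; have [B2 B20 hB2] := real_symbol_bounded SIm.
    rewrite (bipsido_Tr x Kff Kfg (sclass_cont SRe 0%N) hB1 (sclass_cont SIm 0%N) hB2).
    rewrite /phi /Tt scale0r.
    have -> : omega (0 : V) = 1 by rewrite /omega big1// => i _; rewrite mxE /lweight expr0n/= addr0 invr1.
    have c0 (b : X3 -> R) : (fun X => b X * cutoff 0 X) = b.
      by apply/funext => X; rewrite cutoff0 mulr1.
    by rewrite expr1n mul1r (c0 (fun X => Re (a X))) (c0 (fun X => Im (a X))).
  have ct : t J @[J --> \oo] --> (0 : R).
    by apply: cvg_expr; rewrite gtr0_norm// invf_lt1// ltr1n.
  exact: (cvg_comp _ _ ct (cphi 0)).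
move=> J; rewrite rintZ//; apply: ler_wpM2l => //.
pose w j : R := (xq ^- j) `^ r.
have K1 j : Kfun (fun x => omega (t J *: (x - 0)) ^+ 2 * cmod (u j x) `^ r) by exact: Kfun_omega_powR.
have K2 j : Kfun (fun x => omega (t J *: (x - 0)) ^+ 2 * cmod (v j x) `^ r) by exact: Kfun_omega_powR.
pose cc := (1 - xq)^-1 `^ r * 2 `^ r.
have K3 j : Kfun (fun x => cc * w j * (omega (t J *: (x - 0)) ^+ 2 * cmod (u j x) `^ r +
   omega (t J *: (x - 0)) ^+ 2 * cmod (v j x) `^ r)) by apply: KfunZ; exact: KfunD.
apply: (@le_trans _ _ (rint (fun x => \sum_(j <- index_enum 'I_J.+1)
    cc * w j * (omega (t J *: (x - 0)) ^+ 2 * cmod (u j x) `^ r +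
   omega (t J *: (x - 0)) ^+ 2 * cmod (v j x) `^ r)))).
  apply: le_rint; [exact: Kfun_omega_powR|by apply: Kfun_sum => j; exact: K3|] => x.
  have hZ : cmod (Z J x) <= \sum_(j < J.+1) (cmod (u j x) + cmod (v j x)).
    rewrite (le_trans (cmodD _ _))// cmodM (_ : cmod 'i = 1) ?mul1r; last first.
      by rewrite /cmod/= expr0n/= expr1n add0r sqrtr1.
    rewrite big_split/=; apply: lerD; first exact: (cmod_sum J.+1 (fun j => u j x)).
    exact: (cmod_sum J.+1 (fun j => v j x)).
  have hp : cmod (Z J x) `^ r <= (1 - xq)^-1 `^ r *
      \sum_(j < J.+1) (xq ^- j * (cmod (u j x) + cmod (v j x))) `^ r.
    apply: (le_trans _ (sum_powR_le J.+1 r_gt0 xq01 (t := fun j => cmod (u j x) + cmod (v j x)) _)).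
      apply: ge0_ler_powR; rewrite ?nnegrE ?cmod_ge0 ?(ltW r_gt0)//.
      by apply: sumr_ge0 => j _; rewrite addr_ge0 ?cmod_ge0.
    by move=> j; rewrite addr_ge0 ?cmod_ge0.
  apply: (le_trans (ler_wpM2l (sqr_ge0 _) hp)).
  rewrite !mulr_sumr; apply: ler_sum => j _.
  rewrite powRM ?addr_ge0 ?cmod_ge0//; last by rewrite invr_ge0 exprn_ge0// ltW//; case/andP: xq01.
  have := powR_addr_le r_gt0 (cmod_ge0 (u j x)) (cmod_ge0 (v j x)).
  rewrite -/(w j); set A := (_ + _) `^ r; set A1 := cmod (u j x) `^ r; set A2 := cmod (v j x) `^ r.
  set o := omega _ ^+ 2 => hA; rewrite -mulrDr /cc.
  rewrite [leRHS](_ : _ = o * ((1 - xq)^-1 `^ r * (w j * (2 `^ r * (A1 + A2))))); last by ring.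
  apply: ler_wpM2l; first exact: sqr_ge0.
  by apply: ler_wpM2l; [exact: powR_ge0|apply: ler_wpM2l => //; exact: powR_ge0].
rewrite rint_sum//.
apply: (@le_trans _ _ (\sum_(j < J.+1) c1 * yq ^+ j)).
  apply: ler_sum => j _; rewrite rintZ; last exact: KfunD.
  rewrite rintD//.
  have e1 := hD1 f g j (t J) Kf2 Kg2 nf ng (t0 J); have e2 := hD2 f g j (t J) Kf2 Kg2 nf ng (t0 J).
  have ww : w j * (2 ^+ j) `^ E = yq ^+ j.
    have xn0 : xq ^- j = 2 `^ (- (E / (2 * r)) * j%:R).
      by rewrite mulNr powRN powRrM powR_mulrn ?powR_ge0.
    rewrite /w xn0 -powRrM -(powR_mulrn j (ler0n _ 2)) -powRrM -powRD; last by rewrite pnatr_eq0 implybT.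
    rewrite -powR_mulrn ?powR_ge0// -powRrM; congr (_ `^ _).
    by field; rewrite gt_eqF.
  apply: (@le_trans _ _ (cc * w j * (D1 * (2 ^+ j) `^ E + D2 * (2 ^+ j) `^ E))).
    by apply: ler_wpM2l; [rewrite !mulr_ge0 ?powR_ge0|exact: lerD].
  by rewrite -ww /c1 /cc le_eqVlt; apply/orP; left; apply/eqP; ring.
rewrite -mulr_sumr; apply: ler_wpM2l => //.
by apply: geometric_sum_le; rewrite ltW.
Qed.

End Summation.

End CoreEstimate.

(** * Normalisation of the inputs *)

Section Normalization.
Context {R : realType}.
Local Notation C := (R[i]).
Local Notation mu := (@lebesgue_measure R).

Lemma integral_gt0_of_point (g : R -> R) (t0 : R) : continuous g -> (forall t, 0 <= g t) ->
  0 < g t0 -> (0 < \int[mu]_t (g t)%:E)%E.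
Proof.
move=> cg g0 gt0.
have [e /= e0 he] : nbhs_ball (t0 : R) [set t : R | g t0 / 2 < g t].
  have := cg t0 => /cvgrPdist_lt /(_ (g t0 / 2)); rewrite divr_gt0// => /(_ isT) h.
  have [e e0 he] := h; exists e => // t /he /=; rewrite ltr_norml => /andP[_]; lra.
have c0 : 0 < g t0 / 2 by rewrite divr_gt0.
apply: (@lt_le_trans _ _ (\int[mu]_t ((g t0 / 2)%:E * (\1_(`[t0, t0 + e / 2]) t)%:E))%E).
  rewrite ge0_integralZl//.
  - rewrite integral_indic//= setIT lebesgue_measure_itv/= lte_fin ltrDl divr_gt0//.
    by rewrite -EFinD addrAC subrr add0r mule_gt0// lte_fin ?divr_gt0.
  - exact/measurable_EFinP.
  - by rewrite lee_fin ltW.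
apply: integral_ge0_mono => t.
  by rewrite mule_ge0// lee_fin// ltW.
rewrite -EFinM lee_fin indicE.
have [|] := boolP (t \in `[t0, t0 + e / 2]%classic); rewrite ?mulr1 ?mulr0 ?g0//.
rewrite inE/= in_itv/= => /andP[t1 t2]; apply/ltW; apply: he => /=.
by rewrite -ball_normE/= distrC ger0_norm ?subr_ge0// ltrBlDl (le_lt_trans t2)// ltrD2l ltr_pdivrMr// mulr_natr mulr2n ltrDl.
Qed.

Lemma rint_gt0 n (h : 'rV[R]_n -> R) x0 : Kfun h -> (forall x, 0 <= h x) -> 0 < h x0 ->
  0 < rint h.
Proof.
elim: n h x0 => [|n IH] h x0 Kh h0 hx.
  rewrite /rint/=; suff -> : (0 : 'rV[R]_0) = x0 by [].
  by apply: rV_ext => -[].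
have [K1 E c [B hB]] := Kfun_slices Kh; rewrite E.
have g0 t : 0 <= rint (fun v => h (rcons_mx t v)) by apply: rint_ge0 => v.
have x0E : x0 = rcons_mx (x0 0 ord0) (\row_i x0 0 (lift ord0 i)).
  apply: rV_ext => k; case: (unliftP ord0 k) => [j|] ->; first by rewrite rcons_mxS mxE.
  by rewrite rcons_mx0.
have gx : 0 < rint (fun v => h (rcons_mx (x0 0 ord0) v)).
  by apply: (IH _ (\row_i x0 0 (lift ord0 i))) => //; rewrite -x0E.
have := integral_gt0_of_point c g0 gx.
by rewrite (integral_dom_EFin c hB) lte_fin.
Qed.

Lemma iint_mono n (f g : 'rV[R]_n -> \bar R) : (forall x, (0 <= f x)%E) ->
  (forall x, (f x <= g x)%E) -> (iint f <= iint g)%E.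
Proof.
elim: n f g => [|n IH] f g f0 fg; first exact: fg.
apply: integral_ge0_mono => t; first by apply: iint_ge0 => v.
by apply: IH => v.
Qed.

Lemma iint0 n : iint (fun _ : 'rV[R]_n => 0%E) = 0%E :> \bar R.
Proof. by elim: n => [//|n IH] /=; under eq_integral do rewrite IH; rewrite integral0. Qed.

(** [lebn] is an iterated integral of an indicator, so the measure of the set where the bound fails
    is estimated from below by the integral of a continuous minorant [h] of this indicator, taken in
    [Kfun] and positive at [x0]. *)
Lemma essential_bound n (f : 'rV[R]_n -> C) (M : R) : ccont f ->
  lebn [set x | (M%:E < (cmod (f x))%:E)%E] = 0%E -> forall x, cmod (f x) <= M.
Proof.
move=> cf l0 x0; rewrite leNgt; apply/negP => Mx.
pose h x := Num.max (cmod (f x) - M) 0 / (1 + Num.max (cmod (f x) - M) 0) * omega x.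
have m0 x : 0 <= Num.max (cmod (f x) - M) 0 by rewrite le_max lexx orbT.
have d0 x : 0 < 1 + Num.max (cmod (f x) - M) 0 by rewrite ltr_wpDr.
have hle x : 0 <= Num.max (cmod (f x) - M) 0 / (1 + Num.max (cmod (f x) - M) 0) <= 1.
  by rewrite divr_ge0 ?(ltW (d0 x))//= ler_pdivrMr// mul1r lerDr.
have h0 x : 0 <= h x by have /andP[a _] := hle x; rewrite mulr_ge0// omega_ge0.
have cm : continuous (fun x => Num.max (cmod (f x) - M) 0).
  have -> : (fun x => Num.max (cmod (f x) - M) 0) = (fun x => (cmod (f x) - M + `|cmod (f x) - M|) / 2).
    by apply/funext => x; case: (lerP (cmod (f x) - M) 0) => hx; [rewrite ler0_norm//|rewrite gtr0_norm//]; lra.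
  have cd : continuous (fun x => cmod (f x) - M).
    by apply: continuous_add; [exact: ccont_cmod|exact: continuous_cst].
  apply: continuous_mul; last exact: continuous_cst.
  by apply: continuous_add => //; exact: continuous_normr.
have Kh : Kfun h.
  apply: (@KfunM _ _ _ _ 1); last exact: Kfun_omega.
    apply: continuous_mul => //; apply: continuous_inv; first by move=> x; rewrite gt_eqF.
    by apply: continuous_add => //; exact: continuous_cst.
  by move=> x; have /andP[a b] := hle x; rewrite ger0_norm.
have hx0 : 0 < h x0.
  rewrite /h mulr_gt0 ?omega_gt0// divr_gt0//.
  by rewrite lt_max subr_gt0 Mx.
have H : (iint (fun x => (h x)%:E) <= lebn [set x | (M%:E < (cmod (f x))%:E)%E])%E.
  rewrite /lebn; apply: iint_mono => x; first by rewrite lee_fin.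
  rewrite indicE; case: (boolP (x \in _)) => [_|]; rewrite lee_fin.
    have /andP[a b] := hle x; rewrite -[leRHS]mulr1; apply: ler_pM => //; first exact: omega_ge0.
    exact: omega_le1.
  rewrite notin_setE/= lte_fin => /negP; rewrite -leNgt => hx.
  by rewrite /h (max_idPr _) ?mul0r// subr_le0.
by move: H; rewrite l0 (iint_EFin Kh) lee_fin leNgt (rint_gt0 Kh h0 hx0).
Qed.

(** The strict inequality [A < t] covers the case [A = 0], and it yields an essential bound below
    [t] when the norm is an infimum of such bounds. *)
Lemma Lpnorm_normalize n (q : \bar R) (f : 'rV[R]_n -> C) : (1%:E <= q)%E -> Kc2 f ->
  exists2 A, 0 <= A & Lpnorm q f = A%:E /\
    forall t, A < t -> nrm q (fun x => (t^-1)%:C * f x)%C.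
Proof.
move=> + Kf; have KKf := Kc2_Kc Kf; have cf := Kc_cont KKf; have [B B0 hB] := KcE KKf.
case: q => [q|_|//]; last first.
  have bd x : cmod (f x) <= B by rewrite (le_trans (hB x))// ler_piMr ?omega_le1.
  have SB : [set M : \bar R | (0 <= M)%E /\ lebn [set x | (M < (cmod (f x))%:E)%E] = 0%E] B%:E.
    split; first by rewrite lee_fin.
    rewrite (_ : [set x | _] = set0); last first.
      by apply/seteqP; split => x//=; rewrite lte_fin ltNge bd.
    by rewrite /lebn; under eq_fun do rewrite indicE in_set0; exact: iint0.
  have lb : (0 <= esssup_norm f)%E by apply: le_ereal_inf_tmp => M [].
  have ub : (esssup_norm f <= B%:E)%E by apply: ereal_inf_lbound.
  have fin : esssup_norm f \is a fin_num.
    by rewrite ge0_fin_numE// (le_lt_trans ub)// ltry.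
  exists (fine (esssup_norm f)); first exact: fine_ge0.
  split; first by rewrite /= fineK.
  move=> t At y; have t0 : 0 < t by rewrite (le_lt_trans _ At)// fine_ge0.
  have : (ereal_inf [set M : \bar R | (0 <= M)%E /\ lebn [set x | (M < (cmod (f x))%:E)%E] = 0%E] < t%:E)%E.
    by rewrite -/(esssup_norm f) -(fineK fin) lte_fin.
  move=> /ereal_inf_lt[M [M0 lM] Mt].
  have Mfin : M \is a fin_num by rewrite ge0_fin_numE// (lt_trans Mt)// ltry.
  rewrite -(fineK Mfin) in lM Mt; rewrite lte_fin in Mt.
  have := essential_bound cf lM y => hy.
  rewrite cmodM cmodR gtr0_norm ?invr_gt0// ler_pdivrMl// mulr1.
  exact: le_trans hy (ltW Mt).
rewrite lee_fin => q1; have q0 : 0 < q by exact: lt_le_trans q1.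
have Kq := Kfun_powR q1 KKf.
have I0 : 0 <= rint (fun x => cmod (f x) `^ q) by apply: rint_ge0 => x; exact: powR_ge0.
exists ((rint (fun x => cmod (f x) `^ q)) `^ q^-1); first exact: powR_ge0.
split; first by rewrite /Lpnorm iint_EFin// poweR_EFin.
move=> t At; have t0 : 0 < t by rewrite (le_lt_trans _ At)// powR_ge0.
rewrite /nrm (_ : (fun y => _) = (fun y => t^-1 `^ q * cmod (f y) `^ q)); last first.
  apply/funext => y; rewrite cmodM cmodR gtr0_norm ?invr_gt0// powRM ?cmod_ge0//.
  by rewrite invr_ge0 ltW.
rewrite rintZ//.
have tq : t^-1 `^ q = (t `^ q)^-1 by rewrite -(powR_inv1 (ltW t0)) -powRrM mulN1r powRN.
rewrite tq mulrC ler_pdivrMr ?powR_gt0// mul1r.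
have -> : rint (fun x => cmod (f x) `^ q) = (rint (fun x => cmod (f x) `^ q) `^ q^-1) `^ q.
  by rewrite -powRrM mulVf ?gt_eqF// powRr1.
by apply: ge0_ler_powR; rewrite ?nnegrE ?powR_ge0 ?(ltW q0) ?(ltW t0) ?(ltW At).
Qed.

End Normalization.

(** * Sorted lists of directions and multi-indices *)

Section OrderedDirections.

Lemma path_flatten_nseq N a x (c : nat -> nat) : (x <= a)%N ->
  path leq x (flatten [seq nseq (c v) v | v <- iota a N]).
Proof.
elim: N a x => [//|N IH] a x xa /=; rewrite cat_path.
have h k y : (y <= a)%N -> path leq y (nseq k a) && (last y (nseq k a) <= a)%N.
  by elim: k y => [|k IHk] y ya /=; [exact: ya|rewrite ya IHk].
have /andP[-> l] := h (c a) x xa; apply: IH; exact: leq_trans l (leqnSn a).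
Qed.

(** A sorted list is determined by its multiplicities; this translates the ordered directions of
    [sclass] into the multi-indices of the symbol estimates. *)
Lemma sorted_flatten_count N (s : seq nat) : sorted leq s -> all (fun v => v < N)%N s ->
  s = flatten [seq nseq (count_mem v s) v | v <- iota 0 N].
Proof.
move=> ss sN; apply: (sorted_eq leq_trans anti_leq ss).
  exact: path_sorted (path_flatten_nseq N (fun v => count_mem v s) (leqnn 0)).
apply/allP => x _ /=; apply/eqP; rewrite count_flatten -map_comp sumnE big_map.
rewrite (eq_bigr (fun v => if v == x then count_mem x s else 0%N)); last first.
  by move=> v _ /=; rewrite count_nseq /=; case: eqP => [->|]; rewrite ?mul1n ?mul0n.
rewrite -big_mkcond/=.
have [xN|xN] := ltnP x N.
  rewrite -big_filter (_ : [seq v <- iota 0 N | v == x] = [:: x]) ?big_seq1//.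
  have := @filter_pred1_uniq _ (iota 0 N) x (iota_uniq 0 N).
  by rewrite mem_iota xN; exact.
rewrite big1_seq; last first.
  by move=> v /andP[/eqP ->]; rewrite mem_iota ltnNge xN.
by apply/count_memPn; apply: contraL (xN) => xs; rewrite -ltnNge (allP sN).
Qed.

Lemma mdirs_segment (W : Type) n (vec : nat -> W) (emb : 'I_n -> W) o (c : nat -> nat) :
  (forall i : 'I_n, vec (o + i)%N = emb i) ->
  [seq vec v | v <- flatten [seq nseq (c v) v | v <- iota o n]] = mdirs emb (fun i => c (o + i)%N).
Proof.
move=> ve; rewrite /mdirs map_flatten -map_comp; congr flatten.
have -> : iota o n = [seq (o + i)%N | i <- iota 0 n] by rewrite -iotaDl addn0.
rewrite -val_enum_ord -!map_comp; apply: eq_map => i /=.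
by rewrite map_nseq ve.
Qed.

Lemma sum_count_mem n o (s : seq nat) :
  (\sum_(i < n) count_mem (o + i)%N s)%N = count (fun v => o <= v < o + n)%N s.
Proof.
elim: s => [|x s IH]; first by rewrite big1.
rewrite /= big_split/= IH; congr addn.
have [ox|xo] /= := leqP o x; last first.
  by rewrite big1// => i _; rewrite ltn_eqF// ltn_addr.
have [xn|nx] := ltnP x (o + n); last first.
  by rewrite big1// => i _; rewrite gtn_eqF// (leq_trans _ nx)// ltn_add2l.
have xi : (x - o < n)%N by rewrite ltn_subLR.
rewrite (bigD1 (Ordinal xi))//= subnKC// eqxx big1// => i ii.
apply/eqP; rewrite eqb0; apply: contra ii => /eqP xoi; apply/eqP; apply: val_inj.
by rewrite /= xoi addKn.
Qed.

End OrderedDirections.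

(** * Symbols and Schwartz functions *)

Section SmoothToClass.
Context {R : realType}.
Local Notation C := (R[i]).
Local Notation V n := ('rV[R]_n).
Local Notation Re := (@complex.Re R).
Local Notation Im := (@complex.Im R).
Local Open Scope complex_scope.

Lemma sclass_smooth_part {X : normedModType R} {P : Type} (vec : nat -> X) (sc : nat -> X -> R)
    (f : X -> C) (W : X -> R) K I (pr : C -> R) :
  (forall (v : X) (g : X -> C) (x : X), pr (cD v g x) = 'D_v (fun y => pr (g y)) x) ->
  (forall z, `|pr z| <= cmod z) ->
  (forall vs, continuous (fun y => pr (cDs vs f y))) ->
  (forall vs v x, derivable (fun y => pr (cDs vs f y)) x v) ->
  (forall s, sorted leq s -> all (fun v => v < I)%N s -> (size s <= K)%N ->
    exists D, forall x, cmod (cDs (map vec s) f x) <= D * (W x * \prod_(v <- s) sc v x)) ->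
  sclass vec (fun _ : P => sc) K I (fun _ => W) (fun _ x => pr (f x)).
Proof.
move=> prD prle prc prd H.
(* [s] lists the directions already taken, the most recent first; a new one is at most the head, so
   the list stays sorted. *)
have G k s i : (k + size s <= K)%N -> sorted leq s -> all (fun v => v < I)%N s ->
    (forall v, v < i -> v < I /\ sorted leq (v :: s))%N ->
    sclass vec (fun _ : P => sc) k i (fun _ x => W x * \prod_(v <- s) sc v x)
      (fun _ x => pr (cDs (map vec s) f x)).
  elim: k s i => [|k IH] s i ks ss sI hi.
    have [D hD] := H s ss sI (leq_trans (leq_addl _ _) ks).
    split; [by move=> _; exact: prc|split => //].
    by exists D => _ x; rewrite (le_trans (prle _)).
  have [D hD] := H s ss sI (leq_trans (leq_addl _ _) ks).
  split; [by move=> _; exact: prc|split].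
    by exists D => _ x; rewrite (le_trans (prle _)).
  move=> v vi; split; first by move=> _ x; exact: prd.
  have [vI sv] := hi v vi.
  have S : sclass vec (fun _ : P => sc) k v.+1 (fun _ x => W x * \prod_(u <- v :: s) sc u x)
      (fun _ x => pr (cDs (map vec (v :: s)) f x)).
    apply: IH => //; first by rewrite /= addnS.
      by rewrite /= vI.
    move=> u; rewrite ltnS => uv; split; first exact: leq_ltn_trans uv vI.
    by rewrite /= uv.
  apply: eq_sclassW (eq_sclass _ S) => p x; first by rewrite big_cons; ring.
  by rewrite /= prD.
have := G K [::] I; rewrite addn0 => /(_ (leqnn _) isT isT) S.
apply: eq_sclassW (S _) => [p x|v vI]; last by split.
by rewrite big_nil mulr1.
Qed.

Lemma sclass_smooth {X : normedModType R} {P : Type} (vec : nat -> X) (sc : nat -> X -> R)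
    (f : X -> C) (W : X -> R) K I :
  smooth f ->
  (forall s, sorted leq s -> all (fun v => v < I)%N s -> (size s <= K)%N ->
    exists D, forall x, cmod (cDs (map vec s) f x) <= D * (W x * \prod_(v <- s) sc v x)) ->
  sclass vec (fun _ : P => sc) K I (fun _ => W) (fun _ x => Re (f x)) /\
  sclass vec (fun _ : P => sc) K I (fun _ => W) (fun _ x => Im (f x)).
Proof.
move=> sf H; split; apply: sclass_smooth_part => //.
- exact: Re_le_cmod.
- by move=> vs; have [] := sf vs.
- by move=> vs v x; have [_ [_ /(_ v x)[]]] := sf vs.
- exact: Im_le_cmod.
- by move=> vs; have [_ []] := sf vs.
- by move=> vs v x; have [_ [_ /(_ v x)[]]] := sf vs.
Qed.

Lemma map_vec3 n (s : seq nat) : sorted leq s -> all (fun v => v < n + n + n)%N s ->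
  map (@vec3 R n) s = mdirs (@Wx R n) (fun i => count_mem (0 + i)%N s) ++
    mdirs (@Wxi R n) (fun i => count_mem (n + i)%N s) ++
    mdirs (@Weta R n) (fun i => count_mem (n + n + i)%N s).
Proof.
move=> ss sN; rewrite {1}(sorted_flatten_count ss sN) -addnA iotaD add0n iotaD.
rewrite !map_cat !flatten_cat !map_cat; congr (_ ++ (_ ++ _)).
- apply: (@mdirs_segment _ n (@vec3 R n) (@Wx R n) 0 (fun v => count_mem v s)) => i.
  by rewrite /vec3 add0n ltn_ord evecE.
- apply: (@mdirs_segment _ n (@vec3 R n) (@Wxi R n) n (fun v => count_mem v s)) => i.
  by rewrite /vec3 ltnNge leq_addr/= ltn_add2l ltn_ord addKn evecE.
- apply: (@mdirs_segment _ n (@vec3 R n) (@Weta R n) (n + n) (fun v => count_mem v s)) => i.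
  by rewrite /vec3 ltnNge -addnA leq_addr/= ltn_add2l ltnNge leq_addr/= addnA addKn evecE.
Qed.

Lemma map_evec n (s : seq nat) : sorted leq s -> all (fun v => v < n)%N s ->
  map (@evec R n) s = mdirs (@ebasis R n) (fun i => count_mem (0 + i)%N s).
Proof.
move=> ss sN; rewrite {1}(sorted_flatten_count ss sN).
apply: (@mdirs_segment _ n (@evec R n) (@ebasis R n) 0 (fun v => count_mem v s)) => i.
by rewrite add0n evecE.
Qed.

Lemma prod_sc1 n (rho d : R) s (X : V n * V n * V n) :
  \prod_(v <- s) sc1 rho d 0 v X =
  wz X `^ (d / 2 * (count (fun v => v < n)%N s)%:R - rho / 2 * (count (fun v => ~~ (v < n))%N s)%:R).
Proof.
have w0 := wz_gt0 X.
elim: s => [|v s IH]; first by rewrite big_nil /= !mulr0 subrr powRr0.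
rewrite big_cons IH /sc1 /=; case: (v < n)%N; rewrite -powRD ?(gt_eqF w0) ?implybT//;
  congr (_ `^ _); rewrite ?natrD/=; ring.
Qed.

(** For negative [e] the inequality [w <= h ^+ 2] gives the bound with constant 1; the factor
    accounts for positive exponents. *)
Lemma powR_comparable (h w e : R) : 1 <= w -> 0 < h -> w <= h ^+ 2 -> h ^+ 2 <= 3 * w ->
  h `^ e <= 3 `^ `|e| * w `^ (e / 2).
Proof.
move=> w1 h0 wh hw; have w0 : 0 < w by exact: lt_le_trans w1.
have -> : h `^ e = (h ^+ 2) `^ (e / 2).
  by rewrite -(powR_mulrn 2 (ltW h0)) -powRrM; congr (_ `^ _); field.
have h20 : 0 < h ^+ 2 by exact: exprn_gt0.
have [e0|e0] := leP 0 e.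
  apply: (@le_trans _ _ ((3 * w) `^ (e / 2))).
    by apply: ge0_ler_powR; rewrite ?nnegrE ?divr_ge0 ?(ltW h20) ?mulr_ge0 ?(ltW w0).
  rewrite powRM ?(ltW w0)//; apply: ler_wpM2r; first exact: powR_ge0.
  rewrite ger0_norm//; apply: ler_powR; [by rewrite ler1n|lra].
apply: (@le_trans _ _ (w `^ (e / 2))); last first.
  rewrite ler_peMl ?powR_ge0//; apply: (@le_trans _ _ (3 `^ 0)); first by rewrite powRr0.
  by apply: ler_powR; rewrite ?ler1n.
have -> : e / 2 = - (- e / 2) by ring.
rewrite !(powRN _ (- e / 2)) lef_pV2 ?posrE ?powR_gt0//.
apply: ge0_ler_powR; rewrite ?nnegrE ?(ltW h20) ?(ltW w0)//.
by rewrite divr_ge0// oppr_ge0 ltW.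
Qed.

Lemma enorm_ge0 n (x : V n) : 0 <= enorm x. Proof. exact: sqrtr_ge0. Qed.

Lemma sqr_enorm n (x : V n) : enorm x ^+ 2 = dotp x x.
Proof. by rewrite sqr_sqrtr// dotp_ge0. Qed.

Lemma symbol_sorted_bound n (m rho delta d : R) (a : V n * V n * V n -> C) s :
  bilinear_symbol m rho delta a -> delta <= d ->
  sorted leq s -> all (fun v => v < n + n + n)%N s ->
  exists D, forall X, cmod (cDs (map (@vec3 R n) s) a X) <=
    D * (wz X `^ (m / 2) * \prod_(v <- s) sc1 rho d 0 v X).
Proof.
move=> [_ H] dd ss sN; rewrite (map_vec3 ss sN).
set be : mindex n := fun i => _; set al1 : mindex n := fun i => _; set al2 : mindex n := fun i => _.
have [D hD] := H al1 al2 be.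
set e := m - rho * (mabs al1 + mabs al2)%:R + delta * (mabs be)%:R in hD.
exists (`|D| * 3 `^ `|e|) => -[[x xi] eta].
have := hD x xi eta; set X := (x, xi, eta); set h := 1 + enorm xi + enorm eta => hX.
have w1 := wz_ge1 X; have h1 : 1 <= h.
  by rewrite /h; have := enorm_ge0 xi; have := enorm_ge0 eta; lra.
have h0 : 0 < h by exact: lt_le_trans h1.
have p1 := enorm_ge0 xi; have p2 := enorm_ge0 eta.
have p3 := sqr_enorm xi; have p4 := sqr_enorm eta.
have wh : wz X <= h ^+ 2 by rewrite /wz /h/= -p3 -p4; nra.
(* The 3 comes from Cauchy-Schwarz for the three terms of [h]. *)
have hw : h ^+ 2 <= 3 * wz X.
  rewrite /wz /h/= -p3 -p4.
  have := sqr_ge0 (1 - enorm xi); have := sqr_ge0 (1 - enorm eta); have := sqr_ge0 (enorm xi - enorm eta).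
  nra.
apply: (le_trans hX); apply: (@le_trans _ _ (`|D| * h `^ e)).
  by apply: ler_wpM2r; [exact: powR_ge0|exact: ler_norm].
rewrite -mulrA; apply: ler_wpM2l => //.
rewrite (le_trans (powR_comparable e w1 h0 wh hw))//; apply: ler_wpM2l; first exact: powR_ge0.
rewrite prod_sc1 -powRD ?(gt_eqF (wz_gt0 X)) ?implybT//; apply: ler_powR => //.
have c1 : mabs be = count (fun v => v < n)%N s.
  by rewrite /mabs /be sum_count_mem; apply: eq_count => v.
have c2 : (mabs al1 + mabs al2 = count (fun v => ~~ (v < n)) s)%N.
  rewrite /mabs /al1 /al2 !sum_count_mem.
  elim: s sN {ss be al1 al2 hD H e hX c1} => [//|v s IH] /= /andP[vN sN].
  rewrite addnACA IH//; congr addn; rewrite -leqNgt vN andbT ltnNge.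
  have [nv|vn] /= := leqP n v; last by rewrite leqNgt (leq_trans vn (leq_addr _ _)).
  by case: leqP.
rewrite /e c1 c2; have n1 : 0 <= (count (fun v => v < n)%N s)%:R :> R by exact: ler0n.
nra.
Qed.

(** Expanding the product of the [1 + x_i^4] over subsets of coordinates leaves monomials, each
    controlled by a Schwartz seminorm; [(1 + x^2)^2 <= 2 (1 + x^4)] accounts for [2 ^+ n]. *)
Lemma schwartz_decay n (f : V n -> C) s : schwartz f -> sorted leq s ->
  all (fun v => v < n)%N s ->
  exists D, forall x, cmod (cDs (map (@evec R n) s) f x) <= D * omega x ^+ 2.
Proof.
move=> [_ H] ss sN; rewrite (map_evec ss sN); set be : mindex n := fun i => _.
pose al (J : {set 'I_n}) : mindex n := fun i => if i \in J then 4%N else 0%N.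
have [K hK] := choice (fun J => H (al J) be).
exists ((\sum_(J : {set 'I_n}) K J) * 2 ^+ n) => x.
set t := cmod (cDs _ f x).
have t0 : 0 <= t by exact: cmod_ge0.
have p0 (i : 'I_n) : 0 < x 0 i ^+ 4 + 1 by rewrite ltr_wpDl// exprn_even_ge0.
have hP : t * \prod_(i < n) (x 0 i ^+ 4 + 1) <= \sum_(J : {set 'I_n}) K J.
  rewrite bigA_distr mulr_sumr; apply: ler_sum => J _.
  have := hK J x; rewrite cmodM cmodR mulrC -/t.
  have -> : mpow x (al J) = \prod_i (if i \in J then x 0 i ^+ 4 else 1).
    by apply: eq_bigr => i _; rewrite /al; case: ifP => _; rewrite ?expr0.
  rewrite ger0_norm//; apply: prodr_ge0 => i _; case: ifP => _ //.
  exact: exprn_even_ge0.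
have P0 : 0 < \prod_(i < n) (x 0 i ^+ 4 + 1) by apply: prodr_gt0 => i _.
have S0 : 0 <= \sum_(J : {set 'I_n}) K J by apply: le_trans hP; rewrite mulr_ge0// ltW.
apply: (@le_trans _ _ ((\sum_(J : {set 'I_n}) K J) / \prod_(i < n) (x 0 i ^+ 4 + 1))).
  by rewrite ler_pdivlMr.
rewrite -mulrA; apply: ler_wpM2l => //.
rewrite /omega -prodrXl -[X in X ^+ n]/(2 : R).
have -> : (2 : R) ^+ n = \prod_(i < n) 2 by rewrite prodr_const card_ord.
rewrite -big_split/= -prodfV; apply: ler_prod => i _.
rewrite invr_ge0 ltW//= /lweight exprVn -ler_pdivrMl ?invr_gt0//.
have q0 : 0 < 1 + x 0 i ^+ 2 by rewrite ltr_wpDr ?sqr_ge0.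
rewrite -invfM lef_pV2 ?posrE ?mulr_gt0 ?exprn_gt0//.
have := sqr_ge0 (1 - x 0 i ^+ 2); rewrite (_ : x 0 i ^+ 4 = (x 0 i ^+ 2) ^+ 2); last by rewrite -exprM.
nra.
Qed.

Lemma Kc2_schwartz n (f : V n -> C) : schwartz f -> Kc2 f.
Proof.
move=> sf; have [D hD] := @schwartz_decay n f [::] sf isT isT.
have [sm _] := sf; have [c1 [c2 _]] := sm [::].
by split; [split|exists D].
Qed.

(** Two integrations by parts per coordinate: [cint_omega_decay] is used at unit scale over a
    one-point parameter space, separately for the real and imaginary parts. *)
Lemma Kc_fourier_schwartz n (f : V n -> C) : schwartz f -> Kc (fourier f).
Proof.
move=> sf; have [sm _] := sf; have Kf := Kc2_Kc (Kc2_schwartz sf).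
have [cF _] := fourier_bdc Kf.
have [S1 S2] : sclass (@evec R n) (fun (_ : unit) (_ : nat) (_ : V n) => 1) n.*2 n
      (fun _ => @omega R n) (fun _ x => Re (f x)) /\
    sclass (@evec R n) (fun (_ : unit) (_ : nat) (_ : V n) => 1) n.*2 n
      (fun _ => @omega R n) (fun _ x => Im (f x)).
  apply: (@sclass_smooth _ unit (@evec R n) (fun _ _ => 1) f (@omega R n)) => // s ss sN _.
  have [D hD] := schwartz_decay sf ss sN; exists `|D| => x.
  rewrite big1 ?mulr1//; apply: (le_trans (hD x)).
  apply: (@le_trans _ _ (`|D| * omega x ^+ 2)).
    by apply: ler_wpM2r; [exact: sqr_ge0|exact: ler_norm].
  by apply: ler_wpM2l => //; exact: (omega_exp_le _ 1).
have [D1 hD1] := cint_omega_decay (fun _ => ltr01) (fun _ => Kfun_omega n) S1.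
have [D2 hD2] := cint_omega_decay (fun _ => ltr01) (fun _ => Kfun_omega n) S2.
have [K1 K2] := Kf.
apply: (@KcI _ _ _ ((D1 + D2) * rint (@omega R n))) => // xi.
have -> : fourier f xi = cint (fun x => (Re (f x))%:C * cexpi (dotp x (- xi))) +
    'i * cint (fun x => (Im (f x))%:C * cexpi (dotp x (- xi))).
  have k1 := KcM_cexpi (- xi) K1; have k2 := KcM_cexpi (- xi) K2.
  rewrite -(cintZ _ k2) -(cintD k1 (KcZ _ k2)); apply: eq_cint => x.
  have {1}-> : f x = (Re (f x))%:C + 'i * (Im (f x))%:C.
    by apply: complex_ext; rewrite ?(ReD, ImD, ReM, ImM)/=; ring.
  by rewrite dotpNr; ring.
rewrite (le_trans (cmodD _ _))// cmodM (_ : cmod 'i = 1) ?mul1r; last first.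
  by rewrite /cmod/= expr0n/= expr1n add0r sqrtr1.
rewrite 2!mulrDl; have := hD1 tt (- xi); have := hD2 tt (- xi).
by rewrite invr1 scale1r omegaN => h2 h1; exact: lerD.
Qed.

End SmoothToClass.

(** * Arithmetic of the exponents *)

Section Exponents.
Context {R : realType}.

Lemma qinv_bounds (q : \bar R) : (1%:E <= q)%E -> 0 <= qinv q <= 1.
Proof.
case: q => [q||]//; rewrite ?lee_fin /= => q1; last by rewrite lexx ler01.
have q0 : 0 < q by exact: lt_le_trans q1.
by rewrite invr_ge0 ltW//= invf_le1.
Qed.

Lemma qinv_anti (q q' : \bar R) : (1%:E <= q)%E -> (q <= q')%E -> qinv q' <= qinv q.
Proof.
case: q => [q||]//; case: q' => [q'||]//; rewrite ?lee_fin/= => q1 qq.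
  have q0 : 0 < q by exact: lt_le_trans q1.
  by rewrite lef_pV2 ?posrE// (lt_le_trans q0).
by rewrite invr_ge0 (le_trans _ q1).
Qed.

(** Put [A = n (1 - rho)], [B = n (d - rho)] with [d] the larger of [rho] and [delta], and let [s_i]
    be the positive part of [1 / q_i - 1 / 2]. The exponent is [r] times
    [m + A (1/2 + s1 + s2) + B / 2] if [r <= 2], and [r] times [m + A (1 - 1 / r) + B / r]
    otherwise; the hypothesis on [m] majorises the coefficients of [A] and [B] in both. *)
Lemma exponent_lt0 n (m rho delta r : R) (q1 q2 : \bar R) :
  (0 < n)%N -> (1%:E <= q1)%E -> (1%:E <= q2)%E -> 0 < r -> r^-1 = qinv q1 + qinv q2 ->
  0 < rho <= 1 -> 0 < delta < 1 ->
  m < n%:R * (rho - 1) *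
        (Num.max `|2^-1 - qinv q1| `|2^-1 - qinv q2|
         + qinv (Order.min 2%:E (Order.min q1 q2)))
      + n%:R * Num.min (rho - delta) 0 / 2 ->
  m <= 0 /\
  r * alpha_exp n m rho (Num.max rho delta) r q1 q2 - gamma_exp n (Num.max rho delta) r
    + Num.max rho delta * n%:R - rho * n%:R < 0.
Proof.
move=> n0 h1 h2 r0 rq /andP[rho0 rho1] /andP[del0 del1].
set d := Num.max rho delta; set Mx := Num.max _ _; set mx := qinv (Order.min _ _).
have /andP[t10 t11] := qinv_bounds h1; have /andP[t20 t21] := qinv_bounds h2.
have dmin : Num.min (rho - delta) 0 = rho - d.
  by rewrite /d; case: (leP rho delta) => hd; [rewrite min_l ?subr_le0|rewrite min_r ?subr_ge0 ?(ltW hd)// subrr].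
rewrite dmin => hm.
have d1 : d <= 1 by rewrite /d ge_max rho1 ltW.
have rd : rho <= d by rewrite /d le_max lexx.
have N0 : 0 < n%:R :> R by rewrite ltr0n.
have h12 : (1%:E <= Order.min 2%:E (Order.min q1 q2))%E.
  by rewrite !le_min h1 h2 lee_fin ler1n.
have mx1 : 2^-1 <= mx by apply: (qinv_anti (q' := 2%:E) h12); rewrite ge_min lexx.
have mx2 : qinv q1 <= mx by apply: (qinv_anti h12); rewrite !ge_min lexx/= orbT.
have mx3 : qinv q2 <= mx by apply: (qinv_anti h12); rewrite !ge_min lexx/= !orbT.
have Mx1 : `|2^-1 - qinv q1| <= Mx by rewrite le_max lexx.
have Mx2 : `|2^-1 - qinv q2| <= Mx by rewrite le_max lexx orbT.
have {Mx1}[Mx1 Mx1'] : 2^-1 - qinv q1 <= Mx /\ qinv q1 - 2^-1 <= Mx.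
  by move: Mx1; rewrite ler_norml => /andP[]; split; lra.
have {Mx2}[Mx2 Mx2'] : 2^-1 - qinv q2 <= Mx /\ qinv q2 - 2^-1 <= Mx.
  by move: Mx2; rewrite ler_norml => /andP[]; split; lra.
move: Mx1 Mx1' Mx2 Mx2' mx1 mx2 mx3 hm; move: Mx mx => Mx mx Mx1 Mx1' Mx2 Mx2' mx1 mx2 mx3 hm.
pose A := n%:R * (1 - rho); pose B := n%:R * (d - rho).
have A0 : 0 <= A by apply: mulr_ge0; [exact: ltW|rewrite subr_ge0].
have B0 : 0 <= B by apply: mulr_ge0; [exact: ltW|rewrite subr_ge0].
have hm' : m + A * (Mx + mx) + B / 2 < 0.
  by move: hm; rewrite /A /B -subr_lt0; congr (_ < _); field.
have Amx : 0 <= A * (Mx + mx) by rewrite mulr_ge0//; lra.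
split; first by lra.
pose s1 := if 2^-1 <= qinv q1 then qinv q1 - 2^-1 else 0.
pose s2 := if 2^-1 <= qinv q2 then qinv q2 - 2^-1 else 0.
have ex q : expo n rho q / 2 = n%:R * rho * (qinv q - 2^-1) + A * (if 2^-1 <= qinv q then qinv q - 2^-1 else 0).
  by rewrite /expo /A; case: ifP => _; field.
have e12 : (expo n rho q1 + expo n rho q2) / 2 = n%:R * rho * (qinv q1 + qinv q2 - 1) + A * (s1 + s2).
  by rewrite mulrDl !ex -/s1 -/s2; field.
(* If both [s_i] are positive, [Mx] bounds one of them and [mx] the other plus one half; if at most
   one is, [mx] alone suffices. *)
have s12 : 2^-1 + s1 + s2 <= Mx + mx.
  by rewrite /s1 /s2; case: (leP 2^-1 (qinv q1)) => c1; case: (leP 2^-1 (qinv q2)) => c2; lra.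
rewrite /alpha_exp /gamma_exp e12 -rq; have rr : r * r^-1 = 1 by rewrite divff// gt_eqF.
have [r2|r2] := leP r 2.
  rewrite (_ : _ - _ = r * (m + A / 2 + B / 2 + A * (s1 + s2)) + (r * r^-1 - 1) * (n%:R * rho)); last first.
    by rewrite /A /B; field; rewrite gt_eqF.
  rewrite rr subrr mul0r addr0 pmulr_rlt0//.
  have := ler_wpM2l A0 s12; lra.
(* For [r > 2] both [q_i] exceed 2, so [s1] and [s2] vanish. *)
have ri : r^-1 < 2^-1 by rewrite ltf_pV2 ?posrE.
have z1 : s1 = 0 by rewrite /s1 ifF//; apply/negbTE; rewrite -ltNge; lra.
have z2 : s2 = 0 by rewrite /s2 ifF//; apply/negbTE; rewrite -ltNge; lra.
rewrite z1 z2 addr0 mulr0 addr0.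
rewrite (_ : _ - _ = r * (m + A - A * r^-1 + B * r^-1) + (r * r^-1 - 1) * (n%:R * rho - n%:R * d + n%:R)); last first.
  by rewrite /A /B; field; rewrite gt_eqF.
rewrite rr subrr mul0r addr0 pmulr_rlt0//.
have : 1 - r^-1 <= Mx + mx by lra.
move=> /(ler_wpM2l A0); have := ler_wpM2l B0 (ltW ri); lra.
Qed.

End Exponents.

(** * Homogeneity and the passage to arbitrary inputs *)

Section Scaling.
Context {R : realType} (n : nat).
Local Notation C := (R[i]).
Local Notation V := ('rV[R]_n).
Local Open Scope complex_scope.

Lemma fourierZ (c : C) (f : V -> C) : Kc f -> fourier (fun x => c * f x) = fun xi => c * fourier f xi.
Proof.
move=> Kf; apply/funext => xi; rewrite /fourier -cintZ.
  by apply: eq_cint => x; ring.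
apply: (@KcM _ _ _ _ 1) => //; last by move=> y; rewrite cmod_cexpi.
by apply: ccont_cexpi; apply: continuous_opp; apply: continuous_dotp; cont_proj.
Qed.

Lemma Kc2Z (c : C) (f : V -> C) : Kc2 f -> Kc2 (fun x => c * f x).
Proof.
move=> [cf [B hB]]; split; first by apply: ccontM => //; exact: ccont_cst.
by exists (cmod c * B) => x; rewrite cmodM -mulrA ler_wpM2l ?cmod_ge0.
Qed.

End Scaling.

Theorem theorem5p18 (R : realType) (n : nat) (q1 q2 : \bar R) (r : R)
    (m rho delta : R) (a : 'rV[R]_n * 'rV[R]_n * 'rV[R]_n -> R[i]) :
  (0 < n)%N ->
  (1%:E <= q1)%E -> (1%:E <= q2)%E ->
  0 < r -> r^-1 = qinv q1 + qinv q2 ->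
  0 < rho <= 1 -> 0 < delta < 1 ->
  bilinear_symbol m rho delta a ->
  m < n%:R * (rho - 1) *
        (Num.max `|2^-1 - qinv q1| `|2^-1 - qinv q2|
         + qinv (Order.min 2%:E (Order.min q1 q2)))
      + n%:R * Num.min (rho - delta) 0 / 2 ->
  exists Cst : R, forall f g : 'rV[R]_n -> R[i],
    schwartz f -> schwartz g ->
    (Lpnorm r%:E (bipsido a f g) <= Cst%:E * Lpnorm q1 f * Lpnorm q2 g)%E.
Proof.
move=> n_gt0 q1_ge1 q2_ge1 r_gt0 rq hrho hdelta ha hm.
have [m_le0 E_lt0] := exponent_lt0 n_gt0 q1_ge1 q2_ge1 r_gt0 rq hrho hdelta hm.
have /andP[rho_gt0 rho_le1] := hrho; have /andP[delta_gt0 delta_lt1] := hdelta.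
set d := Num.max rho delta in E_lt0.
have rho_d : rho <= d by rewrite /d le_max lexx.
have delta_d : delta <= d by rewrite /d le_max lexx orbT.
have d_le1 : d <= 1 by rewrite /d ge_max rho_le1 ltW.
have [Sre Sim] := @sclass_smooth _ _ nat (@vec3 R n) (sc1 rho d 0%N) a (fun X => wz X `^ (m / 2))
  (n.*2 + n.*2 + n.*2) (n + n + n) (proj1 ha)
  (fun s ss sN _ => symbol_sorted_bound ha delta_d ss sN).
have Km_ge : `|m / 2| <= (Num.bound `|m / 2|)%:R by apply: ltW; exact: archi_boundP.
have [B B0 hB] := bilinear_normalized rho_gt0 rho_d n_gt0 rho_le1 d_le1 m_le0 Km_ge r_gt0
  q1_ge1 q2_ge1 rq E_lt0 Sre Sim.
have [B1 B10 hB1] := real_symbol_bounded m_le0 Sre.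
have [B2 B20 hB2] := real_symbol_bounded m_le0 Sim.
have cre := sclass_cont Sre 0%N; have cim := sclass_cont Sim 0%N.
exists (B `^ r^-1) => f g sf sg.
have Kf := Kc2_schwartz sf; have Kg := Kc2_schwartz sg.
have Ff := Kc_fourier_schwartz sf; have Fg := Kc_fourier_schwartz sg.
have [A1 A10 [-> N1]] := Lpnorm_normalize q1_ge1 Kf.
have [A2 A20 [-> N2]] := Lpnorm_normalize q2_ge1 Kg.
(* The inputs divided by [t1] and [t2] are normalised, and bilinearity returns the factor [t1 * t2],
   whose r-th power is carried through [iint]. *)
have key t1 t2 : A1 < t1 -> A2 < t2 ->
    (Lpnorm r%:E (bipsido a f g) <= (t1 * t2 * B `^ r^-1)%:E)%E.
  move=> At1 At2; have t10 : 0 < t1 by exact: le_lt_trans At1.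
  have t20 : 0 < t2 by exact: le_lt_trans At2.
  pose f1 := (fun x => (t1^-1)%:C * f x)%C; pose g1 := (fun x => (t2^-1)%:C * g x)%C.
  have Ff1 : Kc (fourier f1) by rewrite /f1 (fourierZ _ (Kc2_Kc Kf)); exact: KcZ.
  have Fg1 : Kc (fourier g1) by rewrite /g1 (fourierZ _ (Kc2_Kc Kg)); exact: KcZ.
  have cV t : 0 < t -> (t%:C * (t^-1)%:C = 1 :> R[i])%C.
    by move=> t0; rewrite -rmorphM/= divff ?rmorph1// gt_eqF.
  have Ef : fourier f = (fun xi => t1%:C%C * fourier f1 xi).
    by rewrite /f1 (fourierZ _ (Kc2_Kc Kf)); apply/funext => xi; rewrite mulrA cV// mul1r.
  have Eg : fourier g = (fun xi => t2%:C%C * fourier g1 xi).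
    by rewrite /g1 (fourierZ _ (Kc2_Kc Kg)); apply/funext => xi; rewrite mulrA cV// mul1r.
  have TE x : bipsido a f g x = t1%:C%C * t2%:C%C * bipsido a f1 g1 x.
    rewrite (bipsido_Tr x Ff Fg cre hB1 cim hB2) (bipsido_Tr x Ff1 Fg1 cre hB1 cim hB2).
    by rewrite Ef Eg (Tr_scale Ff1 Fg1 _ _ x cre hB1) (Tr_scale Ff1 Fg1 _ _ x cim hB2); ring.
  have c0 : 0 <= (t1 * t2) `^ r by exact: powR_ge0.
  have := hB f1 g1 (Kc2Z _ Kf) (Kc2Z _ Kg) Ff1 Fg1 (N1 _ At1) (N2 _ At2) _ c0.
  have -> : (fun x => ((t1 * t2) `^ r * cmod (bipsido a f1 g1 x) `^ r)%:E) =
      (fun x => (cmod (bipsido a f g x) `^ r)%:E).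
    apply/funext => x; rewrite TE !cmodM !cmodR !gtr0_norm// powRM ?cmod_ge0//.
    by rewrite mulr_ge0// ltW.
  move=> hI; have I0 : (0 <= iint (fun x => (cmod (bipsido a f g x) `^ r)%:E))%E.
    by apply: iint_ge0 => x; rewrite lee_fin powR_ge0.
  have r0' : 0 <= r^-1 by rewrite invr_ge0 ltW.
  have := gt0_ler_poweR r0' _ _ hI; rewrite !in_itv/= !leey !andbT I0 lee_fin.
  rewrite mulr_ge0// => /(_ isT isT); rewrite /Lpnorm; move/le_trans; apply.
  rewrite lee_fin powRM// -powRrM divff ?gt_eqF// powRr1//.
  by rewrite mulr_ge0// ltW.
set L := Lpnorm _ _ in key *; set Q := B `^ r^-1 in key *.
have Q0 : 0 <= Q by exact: powR_ge0.
apply/lee_addgt0Pr => e e0.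
(* For [eta <= 1], replacing both norms by [A_i + eta] raises the product by at most [eta * c];
   dividing by [c + 1] instead of [c] below allows [c = 0]. *)
pose c := Q * (A1 + A2 + 1); have c0 : 0 <= c by rewrite mulr_ge0 ?addr_ge0.
pose eta := Num.min 1 (e / (c + 1)).
have eta0 : 0 < eta by rewrite lt_min ltr01 divr_gt0// ltr_wpDl.
have eta1 : eta <= 1 by rewrite ge_min lexx.
have etae : eta * (c + 1) <= e by rewrite -ler_pdivlMr ?ltr_wpDl// ge_min lexx orbT.
apply: (le_trans (key (A1 + eta) (A2 + eta) _ _)); rewrite ?ltrDl//.
rewrite -!EFinM -EFinD lee_fin.
rewrite (_ : (A1 + eta) * (A2 + eta) * Q = Q * A1 * A2 + eta * (Q * (A1 + A2 + eta))); last by ring.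
rewrite lerD2l; apply: le_trans etae; apply: ler_wpM2l; first exact: ltW.
apply: (@le_trans _ _ c); last by rewrite lerDl.
by apply: ler_wpM2l => //; rewrite lerD2l.
Qed.
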